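(* Assume the generalized Riemann hypothesis. Let $1<a_1<a_2$ be integers with $\gcd(a_1,a_2)=1$. For a positive integer $m$ let $0\le r_m<a_1$ be the unique integer with $a_2r_m\equiv m\pmod{a_1}$, and for a positive integer $n$ define $$E(n)=\sum_{d\mid n}\mu\!\left(\frac{n}{d}\right)\left(1-\frac{r_d}{a_1}-\left\{\frac{d-a_2r_d}{a_1a_2}\right\}\right).$$ Then for every $\varepsilon>0$, $$\sum_{n\le N}E(n)\ll a_1a_2N^{\frac12+\varepsilon},$$ where the implied constant depends only on $\varepsilon$.
   Context: $\mu$ is the Möbius function and $\{t\}=t-\lfloor t\rfloor$ is the fractional part. ($E(n)$ is the error term in $f(n)=\varphi(n)/(a_1a_2)+E(n)$, where $f(n)$ counts pairs $(x_1,x_2)\in\mathbb{Z}_{\ge0}^2$ with $a_1x_1+a_2x_2=n$ and $\gcd(x_1,x_2)=1$.) *)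

(* Defs.v *)
From HB Require Import structures.
From mathcomp Require Import all_boot all_order all_algebra.
From mathcomp Require Import all_classical all_reals all_analysis.
From mathcomp Require Import complex.
Set Implicit Arguments.
Unset Strict Implicit.
Unset Printing Implicit Defensive.
Import Order.TTheory GRing.Theory Num.Theory.
Import numFieldNormedType.Exports.
Local Open Scope classical_set_scope.
Local Open Scope ring_scope.
Local Open Scope complex_scope.

Definition mobius (n : nat) : int :=
  if (0 < n)%N && all (fun p => logn p n == 1%N) (primes n)
  then (-1) ^+ size (primes n) else 0.

Definition fracpart (R : realType) (x : R) : R := x - (Num.floor x)%:~R.

(* The default value 0 is never used when a1 > 0 and gcd(a1, a2) = 1:
   see lin_resP and lin_res_unique. *)
Definition lin_res (a1 a2 m : nat) : nat :=
  if [pick r : 'I_a1 | a2 * r == m %[mod a1]] is Some r then val r else 0%N.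

Lemma lin_resP (a1 a2 m : nat) : (0 < a1)%N -> coprime a1 a2 ->
  (lin_res a1 a2 m < a1)%N /\ a2 * lin_res a1 a2 m = m %[mod a1].
Proof.
move=> a1_gt0 cop; rewrite /lin_res; case: pickP => [r /eqP rP|no_r] //=.
have [r lt_r rE] : exists2 r, (r < a1)%N & a2 * r = m %[mod a1].
  case: (posnP a2) cop {no_r} => [-> |a2_gt0 cop].
    by rewrite /coprime gcdn0 => /eqP ->; exists 0%N; rewrite // !modn1.
  case: (egcdnP a1 a2_gt0) => u v uE _.
  move: uE; rewrite gcdnC (eqP cop) => uE.
  exists (u * m %% a1)%N; first exact: ltn_pmod.
  by rewrite modnMmr mulnA (mulnC a2) uE mulnDl mul1n -mulnA (mulnC a1) mulnA modnMDl.
by have /= := no_r (Ordinal lt_r); rewrite rE eqxx.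
Qed.

Lemma lin_res_unique (a1 a2 m r : nat) : coprime a1 a2 ->
  (r < a1)%N -> a2 * r = m %[mod a1] -> r = lin_res a1 a2 m.
Proof.
move=> cop lt_r rE.
have [lt_s sE] := lin_resP m (leq_ltn_trans (leq0n r) lt_r) cop.
suff W x y : (x <= y)%N -> a2 * x = a2 * y %[mod a1] -> x = y %[mod a1].
  rewrite -(modn_small lt_r) -[RHS](modn_small lt_s).
  by have [/W->|/ltnW/W->] := leqP r (lin_res a1 a2 m); rewrite ?rE ?sE.
move=> le_xy /esym/eqP; rewrite eqn_mod_dvd ?leq_mul2l ?le_xy ?orbT//.
by rewrite -mulnBr Gauss_dvdr// -eqn_mod_dvd// => /eqP.
Qed.

Definition Eerr (R : realType) (a1 a2 n : nat) : R :=
  \sum_(d <- divisors n) (mobius (n %/ d))%:~R *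
    (1 - (lin_res a1 a2 d)%:R / a1%:R
       - fracpart ((d%:R - a2%:R * (lin_res a1 a2 d)%:R) / (a1%:R * a2%:R))).

Definition dirichlet_character (R : realType) (q : nat) (chi : nat -> R[i]) :=
  [/\ forall m n, chi (m * n)%N = chi m * chi n,
      forall n, chi (n + q)%N = chi n
    & forall n, (chi n != 0) = coprime n q].

(* n ^ (-s) = exp (- s ln n), for n > 0 *)
Definition nat_cpow_opp (R : realType) (n : nat) (s : R[i]) : R[i] :=
  (n%:R `^ (- complex.Re s))%:C *
  (cos (complex.Im s * ln n%:R) -i* sin (complex.Im s * ln n%:R)).

(* L is the L-function of chi on the half-plane Re s > 0, which contains the
   critical strip: L is holomorphic there except possibly at s = 1 (its only
   possible pole, arising when chi is principal) and is given by the Dirichlet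
   series for Re s > 1; by the identity theorem this determines L on
   Re s > 0, s != 1.  Since the field of scalars is R[i], derivability at s in
   the direction 1 is complex differentiability at s. *)
Definition dirichlet_L (R : realType) (chi : nat -> R[i]) (L : R[i] -> R[i]) :=
  (forall s : R[i], 0 < complex.Re s -> s != 1 ->
     derivable (L : R[i]^o -> R[i]^o) s 1) /\
  (forall s : R[i], 1 < complex.Re s ->
     (fun N => \sum_(1 <= n < N.+1) chi n * nat_cpow_opp n s : R[i]^o) @ \oo
       --> (L s : R[i]^o)).

(* q = 1 gives the Riemann zeta function.  A character need not be primitive:
   passing to the inducing primitive character only removes zeros with
   Re s = 0, outside the open strip. *)
Definition GRH (R : realType) : Prop :=
  forall (q : nat) (chi : nat -> R[i]) (L : R[i] -> R[i]),
    (0 < q)%N -> dirichlet_character q chi -> dirichlet_L chi L ->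
    forall s : R[i], 0 < complex.Re s -> complex.Re s < 1 -> L s = 0 ->
      complex.Re s = 2^-1.

(* Main.v *)
(** Let g(d) be the bracket in the definition of E(n). It is periodic modulo
q = a1 a2 and |g| <= 1, so g0 = g - mean has partial sums O(q). Since
sum_(d | n) mu(d) = [n = 1], the sum of E(n) over n <= N is O(1) plus the sum
over d <= N of g0(d) M(N / d), with M the summatory function of mu. The
hyperbola method gives O(q N^(1/2)) for d > D = N^(1/2), and for d <= D one may
replace M(N / d) by a sum of mu with a linear cut-off on [N, N + D].

Perron's formula then gives the integral of kappa(s) P(s) / zeta(s), where
P(s) = sum_(d <= D) g0(d) d^(-s) and |kappa(s)| is at most about
N^sigma min(1 / |s|, (N / D) / |s|^2). Only the Riemann hypothesis is needed: it
gives 1 / zeta(s) = O(|t|^eta) for Re s >= 1/2 + 2 delta, by Borel-Caratheodory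
and the three circles theorem for log ((s - 1) zeta(s)), and the contour moves
to Re s = 1/2 + 2 delta. A pointwise bound for P would lose a power of N;
instead the mean of |P| over [-T, T] is O(q T^eta): expand the square for
d <= q T, and sum by parts before doing so for d > q T. *)
Require Import Defs.
From mathcomp Require Import all_boot all_order all_algebra.
From mathcomp Require Import all_classical all_reals all_analysis.
From mathcomp Require Import complex ring lra zify.
Set Implicit Arguments.
Unset Strict Implicit.
Unset Printing Implicit Defensive.
Import Order.TTheory GRing.Theory Num.Theory.
Import numFieldNormedType.Exports.
Local Open Scope ring_scope.
Local Open Scope complex_scope.

(** The cut-off is linear because a sharp one would give a kernel of size 1 / |s|, for which the
    estimate diverges: on a dyadic block at height T the mean value of P costs T^(1 + eta) and 1 /
    zeta costs another T^eta. With the linear cut-off, min (1, y) <= y^(3 eta) merges the two bounds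
    for the kernel into one of order |s|^(-1 - 3 eta), so that the blocks sum, at the price of a
    factor (N / D)^(3 eta) only. The length D of the cut-off is small enough for the replacement of
    M(N / d), whose error D / d + 1 adds up to D^(1 + e) over d <= D.

    The hypothesis concerns the open critical strip alone, so the absence of zeros for Re s >= 1 is
    proved separately, by sieved Dirichlet series and the 3-4-1 inequality.

    Throughout, holomorphy is a quadratic error estimate, integrals are limits of dyadic Riemann
    sums of Lipschitz functions, and contours are moved by differentiating an integral with respect
    to a parameter. Logarithms from harmonic sums are avoided by exponents such as 1 + e, whose
    series converge. *)

Ltac pos := repeat first [ done | apply: sqr_ge0 | apply: expR_ge0 | apply: sqrtr_ge0
  | apply: ler0n | apply: normr_ge0 | solve [apply: ltW; assumption] | apply: exprn_ge0 | apply: mulr_ge0 | apply: addr_ge0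
  | apply: divr_ge0 | rewrite invr_ge0 | lra ].

(** * Complex modulus and exponential *)

Section ComplexBasics.
Variable R : realType.
Local Notation C := R[i].
Implicit Types (z w : C) (x y : R).

(** The norm of [R[i]] takes values in [R[i]]; this modulus is real, so that real inequalities apply
    to it directly. [normE] links the two. *)
Definition cabs (z : C) : R := Num.sqrt (complex.Re z ^+ 2 + complex.Im z ^+ 2).

Lemma cabsE z : cabs z = Normc.normc z. Proof. by case: z. Qed.
Lemma cabs_ge0 z : 0 <= cabs z. Proof. exact: sqrtr_ge0. Qed.
Lemma cabs0 : cabs 0 = 0. Proof. by rewrite cabsE Normc.normc0. Qed.
Lemma cabs1 : cabs 1 = 1. Proof. by rewrite cabsE Normc.normc1. Qed.
Lemma cabsM z w : cabs (z * w) = cabs z * cabs w.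
Proof. by rewrite !cabsE Normc.normcM. Qed.
Lemma cabsV z : cabs z^-1 = (cabs z)^-1.
Proof. by rewrite !cabsE Normc.normcV. Qed.
Lemma cabsN z : cabs (- z) = cabs z.
Proof. by rewrite !cabsE normcN. Qed.
Lemma cabsD z w : cabs (z + w) <= cabs z + cabs w.
Proof. by rewrite !cabsE le_normcD. Qed.
Lemma cabsB z w : cabs (z - w) <= cabs z + cabs w.
Proof. by rewrite -(cabsN w) cabsD. Qed.
Lemma cabsC z w : cabs (z - w) = cabs (w - z).
Proof. by rewrite -cabsN opprB. Qed.
Lemma cabs_eq0 z : cabs z = 0 -> z = 0.
Proof. by rewrite cabsE => /Normc.eq0_normc. Qed.
Lemma cabs_gt0 z : z != 0 -> 0 < cabs z.
Proof. by move=> z0; rewrite lt_def cabs_ge0 andbT; apply: contra z0 => /eqP/cabs_eq0 ->. Qed.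
Lemma cabs_gt0_neq0 z : 0 < cabs z -> z != 0.
Proof. by apply: contraTneq => ->; rewrite cabs0 ltxx. Qed.
Lemma cabs_real x : cabs x%:C = `|x|.
Proof. by rewrite /cabs /= expr0n addr0 sqrtr_sqr. Qed.
Lemma cabs_pos x : 0 <= x -> cabs x%:C = x.
Proof. by move=> x0; rewrite cabs_real ger0_norm. Qed.
Lemma cabsX z n : cabs (z ^+ n) = cabs z ^+ n.
Proof. by elim: n => [|n IH]; rewrite ?expr0 ?cabs1 // !exprS cabsM IH. Qed.
Lemma cabs_nat n : cabs n%:R = n%:R.
Proof. by rewrite -(rmorph_nat (real_complex R)) cabs_pos. Qed.
Lemma cabs_conj z : cabs (conjc z) = cabs z.
Proof. by case: z => a b; rewrite /cabs /= sqrrN. Qed.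
Lemma sqr_cabs z : cabs z ^+ 2 = complex.Re z ^+ 2 + complex.Im z ^+ 2.
Proof. by rewrite sqr_sqrtr // addr_ge0 ?sqr_ge0. Qed.
Lemma cabs_Re z : `|complex.Re z| <= cabs z.
Proof. rewrite -sqrtr_sqr; apply: ler_wsqrtr; by rewrite lerDl sqr_ge0. Qed.
Lemma cabs_Im z : `|complex.Im z| <= cabs z.
Proof. rewrite -sqrtr_sqr; apply: ler_wsqrtr; by rewrite lerDr sqr_ge0. Qed.
Lemma Re_le z : complex.Re z <= cabs z.
Proof. exact: le_trans (ler_norm _) (cabs_Re z). Qed.
Lemma cabs_le_ReIm z : cabs z <= `|complex.Re z| + `|complex.Im z|.
Proof.
rewrite -[leRHS]ger0_norm ?addr_ge0 // -sqrtr_sqr; apply: ler_wsqrtr.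
rewrite -(real_normK (num_real (complex.Re z))) -(real_normK (num_real (complex.Im z))).
by have := mulr_ge0 (normr_ge0 (complex.Re z)) (normr_ge0 (complex.Im z)); nra.
Qed.
Lemma cabs_sum (I : Type) (s : seq I) (P : pred I) (F : I -> C) :
  cabs (\sum_(i <- s | P i) F i) <= \sum_(i <- s | P i) cabs (F i).
Proof.
elim/big_rec2: _ => [|i y z _ le_zy]; first by rewrite cabs0.
by rewrite (le_trans (cabsD _ _)) // lerD2l.
Qed.
Lemma cabs_prod (I : Type) (s : seq I) (P : pred I) (F : I -> C) :
  cabs (\prod_(i <- s | P i) F i) = \prod_(i <- s | P i) cabs (F i).
Proof. by elim/big_rec2: _ => [|i y z _ <-]; rewrite ?cabs1 ?cabsM. Qed.
Lemma cabs_lower z w : cabs z - cabs w <= cabs (z + w).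
Proof. by have := cabsD (z + w) (- w); rewrite addrK cabsN; lra. Qed.

Lemma cabs_dist z w : `|cabs z - cabs w| <= cabs (z - w).
Proof.
have h1 := cabs_lower z (w - z); have h2 := cabs_lower w (z - w).
move: h1 h2; rewrite !subrKC (cabsC w z) => h1 h2.
by rewrite ler_norml; apply/andP; split; move: h1 h2; lra.
Qed.

Lemma cabs_leD z w x y : cabs z <= x -> cabs w <= y -> cabs (z + w) <= x + y.
Proof. by move=> h1 h2; apply: le_trans (cabsD _ _) _; exact: lerD. Qed.

Lemma ReD z w : complex.Re (z + w) = complex.Re z + complex.Re w. Proof. by case: z w => [? ?] []. Qed.
Lemma ImD z w : complex.Im (z + w) = complex.Im z + complex.Im w. Proof. by case: z w => [? ?] []. Qed.
Lemma ReN z : complex.Re (- z) = - complex.Re z. Proof. by case: z. Qed.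
Lemma ImN z : complex.Im (- z) = - complex.Im z. Proof. by case: z. Qed.
Lemma ReB z w : complex.Re (z - w) = complex.Re z - complex.Re w. Proof. by rewrite ReD ReN. Qed.
Lemma ImB z w : complex.Im (z - w) = complex.Im z - complex.Im w. Proof. by rewrite ImD ImN. Qed.
Lemma ReM z w : complex.Re (z * w) = complex.Re z * complex.Re w - complex.Im z * complex.Im w.
Proof. by case: z w => [? ?] []. Qed.
Lemma ImM z w : complex.Im (z * w) = complex.Re z * complex.Im w + complex.Im z * complex.Re w.
Proof. by case: z w => [? ?] []. Qed.
Lemma ReZ x z : complex.Re (x%:C * z) = x * complex.Re z. Proof. by rewrite ReM /= mul0r subr0. Qed.
Lemma ImZ x z : complex.Im (x%:C * z) = x * complex.Im z. Proof. by rewrite ImM /= mul0r addr0. Qed.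
Lemma Re_sum (I : Type) (s : seq I) (P : pred I) (F : I -> C) :
  complex.Re (\sum_(i <- s | P i) F i) = \sum_(i <- s | P i) complex.Re (F i).
Proof. by elim/big_rec2: _ => [|i y z _ <-] //; rewrite ReD. Qed.
Lemma Im_sum (I : Type) (s : seq I) (P : pred I) (F : I -> C) :
  complex.Im (\sum_(i <- s | P i) F i) = \sum_(i <- s | P i) complex.Im (F i).
Proof. by elim/big_rec2: _ => [|i y z _ <-] //; rewrite ImD. Qed.
Lemma complexP z w : complex.Re z = complex.Re w -> complex.Im z = complex.Im w -> z = w.
Proof. by case: z w => [? ?] [? ?] /= -> ->. Qed.

Lemma conjM z w : conjc (z * w) = conjc z * conjc w.
Proof. by case: z w => [a b] [c d]; apply: complexP => /=; ring. Qed.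

Definition ii : C := 0 +i* 1.
Lemma cabs_ii : cabs ii = 1. Proof. by rewrite /cabs /= expr0n expr1n add0r sqrtr1. Qed.
Lemma ii_sqr : ii * ii = -1. Proof. by apply: complexP => /=; rewrite ?ReM ?ImM /=; ring. Qed.
Lemma ii_neq0 : ii != 0.
Proof. by apply: cabs_gt0_neq0; rewrite cabs_ii. Qed.
Lemma complexii z : z = (complex.Re z)%:C + ii * (complex.Im z)%:C.
Proof. by apply: complexP; rewrite ?ReD ?ImD ?ReM ?ImM /=; ring. Qed.

Lemma le_eqr x y : x = y -> x <= y. Proof. by move=> ->. Qed.

(** Passages to the limit take this form: an approximation with explicit error [c / n.+1], which the
    Archimedean property then removes. [le_add_geo] and [le_add_pow] are the variants with geometric
    errors. *)
Lemma le_add_eps x y (c : R) : (forall n : nat, x <= y + c / n.+1%:R) -> x <= y.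
Proof.
move=> H; rewrite leNgt; apply/negP => yx.
have d0 : 0 < x - y by lra.
have [c0|c0] := leP c 0.
  by have := H 0%N; rewrite divr1; lra.
have := archi_boundP (ltW (divr_gt0 c0 d0)).
set n := Num.bound _ => hn.
have := H n; rewrite -lerBlDl => h.
have n0 : (0 : R) < n.+1%:R by rewrite ltr0n.
move: h; rewrite ler_pdivlMr // => h.
move: hn; rewrite ltr_pdivrMr // => hn.
have : n%:R * (x - y) <= n.+1%:R * (x - y) by apply: ler_wpM2r; [exact: ltW | rewrite ler_nat].
lra.
Qed.

(* [cabs (Phi y - Phi x)] is bounded to first order by [M * (y - x)] at every
   scale, so that subdividing removes the quadratic term. *)
Lemma quad_lip (Phi : R -> C) (a b M K d : R) : a <= b -> 0 < d -> 0 <= K ->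
  (forall x y, a <= x -> x <= y -> y <= b -> y - x <= d ->
     cabs (Phi y - Phi x) <= M * (y - x) + K * (y - x) ^+ 2) ->
  cabs (Phi b - Phi a) <= M * (b - a).
Proof.
move=> ab d0 K0 H.
pose m := Num.bound ((b - a) / d).
have hm : (b - a) / d < m%:R by apply: archi_boundP; apply: divr_ge0; [rewrite subr_ge0|exact: ltW].
apply: (@le_add_eps _ _ (K * (b - a) ^+ 2)) => n'.
have [n [n_gt0 hn mn]] : exists n : nat, [/\ (0 < n)%N, (b - a) / n%:R <= d & (n'.+1 <= n)%N].
  exists (n'.+1 + m)%N; split; rewrite ?addn_gt0 //; last by rewrite leq_addr.
  rewrite ler_pdivrMr ?ltr0n ?addn_gt0 //.
  move: hm; rewrite ltr_pdivrMr // => /ltW/le_trans -> //.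
  by rewrite mulrC ler_pM2l // ler_nat leq_addl.
pose h := (b - a) / n%:R.
have n0 : (0 : R) < n%:R by rewrite ltr0n.
have h0 : 0 <= h by rewrite divr_ge0 ?subr_ge0 ?ler0n.
have hnb : n%:R * h = b - a by rewrite /h mulrC divfK // gt_eqF.
have step (k : nat) : (k <= n)%N -> cabs (Phi (a + k%:R * h) - Phi a) <= k%:R * (M * h + K * h ^+ 2).
  elim: k => [|k IH] kn; first by rewrite !mul0r addr0 subrr cabs0.
  have -> : Phi (a + k.+1%:R * h) - Phi a =
    (Phi (a + k.+1%:R * h) - Phi (a + k%:R * h)) + (Phi (a + k%:R * h) - Phi a) by ring.
  apply: le_trans (cabsD _ _) _.
  have E : a + k.+1%:R * h - (a + k%:R * h) = h by rewrite -natr1; ring.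
  have := H (a + k%:R * h) (a + k.+1%:R * h); rewrite E => /(_ _ _ _ _)/le_trans H'.
  have kh : k.+1%:R * h <= n%:R * h by apply: ler_wpM2r; rewrite // ler_nat.
  have kh0 : 0 <= k%:R * h by rewrite mulr_ge0.
  rewrite -[in leRHS]natr1 mulrDl mul1r [leRHS]addrC; apply: lerD; last exact/IH/ltnW.
  by apply: H' => //; lra.
have := step n (leqnn n).
rewrite hnb (_ : a + (b - a) = b); last by ring.
move=> /le_trans; apply.
have -> : n%:R * (M * h + K * h ^+ 2) = M * (b - a) + (n%:R * h) * (K * h) by rewrite -hnb; ring.
rewrite hnb lerD2l.
have -> : (b - a) * (K * h) = (K * (b - a) ^+ 2) / n%:R by rewrite /h; field; rewrite gt_eqF.
by apply: ler_wpM2l; [rewrite mulr_ge0 ?sqr_ge0 | rewrite lef_pV2 ?posrE ?ltr0n // ler_nat].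
Qed.

Lemma le_expR_quad x : `|x| <= 1/2 -> `|expR x - 1 - x| <= 2 * x ^+ 2.
Proof.
move=> hx; have [h1 h2] : - (1/2) <= x /\ x <= 1/2 by apply/andP; rewrite -ler_norml.
have l := expR_ge1Dx x; have l' := expR_ge1Dx (- x).
have e0 := expR_gt0 x.
have : expR x * (1 - x) <= 1.
  by rewrite -[leRHS](expRxMexpNx_1 x) ler_pM2l.
rewrite ger0_norm => [h|]; last lra.
nra.
Qed.

Lemma le_sin_abs x : `|sin x| <= `|x|.
Proof.
wlog x0 : x / 0 <= x => [H|].
  have [|/ltW xn] := leP 0 x; first exact: H.
  by rewrite -normrN -sinN -[leRHS]normrN; apply: H; rewrite oppr_ge0.
move: x0; rewrite le_eqVlt => /orP[/eqP <-|x0]; first by rewrite sin0.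
have [|c _] := @MVT R sin cos 0 x x0 (fun t _ => is_derive_sin t).
  by apply: continuous_subspaceT; exact: continuous_sin.
rewrite sin0 !subr0 => ->.
by rewrite normrM ler_piMl // cos_max.
Qed.

Lemma le_cos_quad x : `|cos x - 1| <= x ^+ 2.
Proof.
have -> : x = (x / 2) *+ 2 by rewrite -mulr_natr; field.
move: (x / 2) => y.
have h : sin y ^+ 2 <= y ^+ 2.
  rewrite -(real_normK (num_real (sin y))) -(real_normK (num_real y)).
  by apply: lerXn2r; rewrite ?nnegrE ?normr_ge0 // le_sin_abs.
rewrite cos_mulr2n cos2sin2 !mulr2n.
have -> : (1 - sin y ^+ 2) + (1 - sin y ^+ 2) - 1 - 1 = - (2 * sin y ^+ 2) by ring.
have := sqr_ge0 (sin y); rewrite normrN => s0; rewrite ger0_norm; last by lra.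
by have := sqr_ge0 y; nra.
Qed.

Lemma le_sin_quad x : `|x| <= 1 -> `|sin x - x| <= x ^+ 2.
Proof.
wlog x0 : x / 0 <= x => [H|].
  have [|/ltW xn] := leP 0 x; first exact: H.
  rewrite -normrN => hx; have := H (- x); rewrite oppr_ge0 xn sqrrN => /(_ isT hx).
  by rewrite sinN -opprD normrN.
move: x0; rewrite le_eqVlt => /orP[/eqP <-|x0 x1]; first by rewrite sin0 subrr normr0 sqr_ge0.
have [|c] := @MVT R sin cos 0 x x0 (fun t _ => is_derive_sin t).
  by apply: continuous_subspaceT; exact: continuous_sin.
rewrite in_itv /= => /andP[c0 cx]; rewrite sin0 !subr0 => ->.
have -> : cos c * x - x = (cos c - 1) * x by ring.
rewrite normrM (ger0_norm (ltW x0)) expr2 ler_pM2r //.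
apply: le_trans (le_cos_quad c) _.
move: x1; rewrite ger0_norm; last exact: ltW.
nra.
Qed.

Definition cexp z : C := (expR (complex.Re z))%:C * (cos (complex.Im z) +i* sin (complex.Im z)).

Lemma cexpD z w : cexp (z + w) = cexp z * cexp w.
Proof.
rewrite /cexp ReD ImD expRD cosD sinD.
by apply: complexP; rewrite !(ReM, ImM) /=; ring.
Qed.
Lemma cexp0 : cexp 0 = 1.
Proof. by rewrite /cexp /= expR0 cos0 sin0 mul1r. Qed.
Lemma cabs_cexp z : cabs (cexp z) = expR (complex.Re z).
Proof.
rewrite /cexp cabsM cabs_pos ?expR_ge0 //.
by rewrite /cabs /= cos2Dsin2 sqrtr1 mulr1.
Qed.
Lemma cexp_neq0 z : cexp z != 0.
Proof. by apply: cabs_gt0_neq0; rewrite cabs_cexp expR_gt0. Qed.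
Lemma cexpN z : cexp (- z) = (cexp z)^-1.
Proof. by apply: (mulfI (cexp_neq0 z)); rewrite -cexpD subrr cexp0 divff // cexp_neq0. Qed.
Lemma cexpB z w : cexp (z - w) = cexp z / cexp w.
Proof. by rewrite cexpD cexpN. Qed.
Lemma cexp_natM n z : cexp (n%:R * z) = cexp z ^+ n.
Proof.
elim: n => [|n IH]; first by rewrite mul0r cexp0.
by rewrite -natr1 mulrDl mul1r cexpD IH exprSr.
Qed.

(** A crude bound near 0, from the real expansions of exp, cos and sin. It only feeds the quadratic
    term of [quad_lip], so the constant 16 disappears from [cexp_lip] and [cexp_quad]. *)
Lemma cexp_quad0 w : cabs w <= 1/2 -> cabs (cexp w - 1 - w) <= 16 * cabs w ^+ 2.
Proof.
move=> hw; set a := complex.Re w; set b := complex.Im w.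
have ha := le_trans (cabs_Re w) hw; have hb := le_trans (cabs_Im w) hw.
have E := le_expR_quad ha; have Cq := le_cos_quad b.
have Sq : `|sin b - b| <= b ^+ 2 by apply: le_sin_quad; apply: le_trans hb _; lra.
have eB : expR a <= 2.
  by move: E ha; rewrite !ler_norml -/a => /andP[e1 e2] /andP[h1 h2]; nra.
have e0 := expR_gt0 a.
have w2 := sqr_cabs w; rewrite -/a -/b in w2.
have a2 := sqr_ge0 a; have b2 := sqr_ge0 b.
apply: le_trans (cabs_le_ReIm _) _.
rewrite !(ReB, ImB) /cexp ReZ ImZ /= -/a -/b subr0.
have h1 : `|expR a * cos b - 1 - a| <= 2 * a ^+ 2 + 2 * b ^+ 2.
  have -> : expR a * cos b - 1 - a = (expR a - 1 - a) + expR a * (cos b - 1) by ring.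
  apply: le_trans (ler_normD _ _) _; apply: lerD => //.
  rewrite normrM (ger0_norm (ltW e0)); apply: ler_pM => //; exact: ltW.
have h2 : `|expR a * sin b - b| <= 2 * b ^+ 2 + 4 * (a ^+ 2 + b ^+ 2).
  have -> : expR a * sin b - b = expR a * (sin b - b) + (expR a - 1) * b by ring.
  apply: le_trans (ler_normD _ _) _; apply: lerD.
    by rewrite normrM (ger0_norm (ltW e0)); apply: ler_pM => //; exact: ltW.
  rewrite normrM.
  have h3 : `|expR a - 1| <= 2 * `|a|.
    have -> : expR a - 1 = (expR a - 1 - a) + a by ring.
    apply: le_trans (ler_normD _ _) _; apply: le_trans (lerD E (lexx _)) _.
    rewrite -(real_normK (num_real a)); have := normr_ge0 a; have := ha; rewrite -/a; nra.
  apply: le_trans (ler_wpM2r (normr_ge0 _) h3) _.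
  rewrite -(real_normK (num_real a)) -(real_normK (num_real b)).
  have := sqr_ge0 (`|a| - `|b|); have := sqr_ge0 `|a|; have := sqr_ge0 `|b|; nra.
by rewrite w2; apply: le_trans (lerD h1 h2) _; lra.
Qed.

(** The maximum of |exp| on the segment from 0 to [w]. It equals 1 when [Re w <= 0], so that later
    bounds in a half-plane carry no exponential loss. *)
Definition emax w : R := Num.max 1 (expR (complex.Re w)).
Lemma emax_ge1 w : 1 <= emax w. Proof. by rewrite le_max lexx. Qed.
Lemma emax_seg w x : 0 <= x -> x <= 1 -> expR (complex.Re (x%:C * w)) <= emax w.
Proof.
move=> x0 x1; rewrite ReZ le_max.
have [h|h] := leP (complex.Re w) 0.
  by rewrite expR_le1; apply/orP; left; nra.
by rewrite ler_expR; apply/orP; right; nra.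
Qed.
Lemma emax_seg2 w x : 0 <= x -> x <= 1 -> emax (x%:C * w) <= emax w.
Proof. by move=> x0 x1; rewrite ge_max emax_ge1 emax_seg. Qed.

(** Mean value inequality along the segment from 0 to [w], by [quad_lip]. The step [d] keeps every
    increment within modulus 1/2, where [cexp_quad0] applies. *)
Lemma cexp_lip w : cabs (cexp w - 1) <= cabs w * emax w.
Proof.
pose d := (1/2) / (1 + cabs w).
have w1 : 0 < 1 + cabs w by have := cabs_ge0 w; lra.
have m1 := emax_ge1 w.
have d0 : 0 < d by rewrite divr_gt0 //; lra.
have := @quad_lip (fun x => cexp (x%:C * w)) 0 1 (cabs w * emax w) (16 * cabs w ^+ 2 * emax w) d ler01 d0.
rewrite mul0r mul1r cexp0 subr0 mulr1; apply.
  by pos.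
move=> x y x0 xy y1 yd.
have -> : cexp (y%:C * w) - cexp (x%:C * w) = cexp (x%:C * w) * (cexp ((y-x)%:C * w) - 1).
  by rewrite mulrBr mulr1 -cexpD; congr (cexp _ - _); ring.
set v := (y - x)%:C * w.
have vE : cabs v = (y - x) * cabs w by rewrite cabsM cabs_pos // subr_ge0.
have hv : cabs v <= 1/2.
  rewrite vE; apply: le_trans (_ : d * (1 + cabs w) <= _); last by rewrite /d divfK // gt_eqF.
  by apply: ler_pM => //; [rewrite subr_ge0 | exact: cabs_ge0 | lra].
have q := cexp_quad0 hv.
have hl : cabs (cexp v - 1) <= cabs v + 16 * cabs v ^+ 2.
  have -> : cexp v - 1 = v + (cexp v - 1 - v) by ring.
  by apply: le_trans (cabsD _ _) _; rewrite lerD2l.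
rewrite cabsM cabs_cexp.
have es : expR (complex.Re (x%:C * w)) <= emax w by apply: emax_seg => //; lra.
apply: le_trans (ler_pM (expR_ge0 _) (cabs_ge0 _) es hl) _.
by rewrite vE; apply: le_eqr; ring.
Qed.

(** The argument of [cexp_lip] applied to exp (x w) - x w, whose first-order variation is w (exp (x
    w) - 1) and is bounded by [cexp_lip] itself. *)
Lemma cexp_quad w : cabs (cexp w - 1 - w) <= cabs w ^+ 2 * emax w.
Proof.
pose d := (1/2) / (1 + cabs w).
have w0 := cabs_ge0 w.
have w1 : 0 < 1 + cabs w by lra.
have m1 := emax_ge1 w.
have d0 : 0 < d by rewrite divr_gt0 //; lra.
have := @quad_lip (fun x => cexp (x%:C * w) - x%:C * w) 0 1 (cabs w ^+ 2 * emax w) (16 * cabs w ^+ 2 * emax w) d ler01 d0.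
rewrite mul0r mul1r cexp0 !subr0 mulr1.
have -> : cexp w - w - 1 = cexp w - 1 - w by ring.
apply.
  by pos.
move=> x y x0 xy y1 yd.
set v := (y - x)%:C * w.
have -> : cexp (y%:C * w) - y%:C * w - (cexp (x%:C * w) - x%:C * w) =
   v * (cexp (x%:C * w) - 1) + cexp (x%:C * w) * (cexp v - 1 - v).
  have -> : y%:C * w = x%:C * w + v by rewrite /v; ring.
  by rewrite cexpD; ring.
have vE : cabs v = (y - x) * cabs w by rewrite cabsM cabs_pos // subr_ge0.
have hv : cabs v <= 1/2.
  rewrite vE; apply: le_trans (_ : d * (1 + cabs w) <= _); last by rewrite /d divfK // gt_eqF.
  by apply: ler_pM => //; [rewrite subr_ge0 | lra].
have q := cexp_quad0 hv.
have es : expR (complex.Re (x%:C * w)) <= emax w by apply: emax_seg => //; lra.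
apply: le_trans (cabsD _ _) _; apply: lerD.
  rewrite cabsM vE.
  have -> : cabs w ^+ 2 * emax w * (y - x) = ((y - x) * cabs w) * (cabs w * emax w) by ring.
  apply: ler_wpM2l; first by rewrite mulr_ge0 // subr_ge0.
  apply: le_trans (cexp_lip _) _.
  apply: ler_pM; rewrite ?cabs_ge0 //; [by have := emax_ge1 (x%:C * w); lra| |apply: emax_seg2; lra].
  by rewrite cabsM cabs_pos //; nra.
rewrite cabsM cabs_cexp.
apply: le_trans (ler_pM (expR_ge0 _) (cabs_ge0 _) es q) _.
by rewrite vE; apply: le_eqr; ring.
Qed.

End ComplexBasics.
Global Opaque cabs.

(** * Lipschitz and differentiable functions *)

Section LipInt.
Variable R : realType.
Local Notation C := R[i].
Implicit Types (z w : C) (x y a b : R) (F G f g : C -> C) (U V : C -> Prop).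

(** A real interval seen inside the complex plane, so that [lipon] and [qhol] also serve for
    integrands of a real variable. *)
Definition seg a b z := complex.Im z = 0 /\ a <= complex.Re z <= b.
Lemma seg_real a b x : seg a b x%:C <-> a <= x <= b.
Proof. by split=> [[]//|h]; split. Qed.
Lemma segP a b z : seg a b z -> exists2 x, a <= x <= b & z = x%:C.
Proof. by case: z => x y [/= -> h]; exists x. Qed.

Definition bdd U := exists B, forall z, U z -> cabs z <= B.
(* [qhol U F F'] replaces holomorphy: [F'] is the derivative of [F] with a
   quadratic error, uniformly on [U]. It is stable under the usual operations
   and makes both [F] and [F'] Lipschitz on bounded sets. *)
Definition lipon U F := exists2 L : R, 0 <= L & forall z w, U z -> U w -> cabs (F w - F z) <= L * cabs (w - z).
Definition qhol U F F' := exists2 K : R, 0 <= K & forall z w, U z -> U w ->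
  cabs (F w - F z - (w - z) * F' z) <= K * cabs (w - z) ^+ 2.

Lemma bdd_seg a b : bdd (seg a b).
Proof.
exists (`|a| + `|b|) => z /segP[x /andP[ax xb] ->]; rewrite cabs_real.
rewrite ler_norml; have := ler_norm b; have := ler_norm (- a); rewrite normrN.
have := normr_ge0 a; have := normr_ge0 b; lra.
Qed.

Lemma bdd_diam U : bdd U -> exists2 B, 0 <= B & forall z w, U z -> U w -> cabs (w - z) <= B.
Proof.
move=> [B HB]; exists (`|B| + `|B|); first by rewrite addr_ge0.
move=> z w Uz Uw; apply: le_trans (cabsB _ _) _.
by apply: lerD; apply: le_trans (HB _ _) (ler_norm _).
Qed.

Lemma lip_bd U F : bdd U -> lipon U F -> exists2 M : R, 0 <= M & forall z, U z -> cabs (F z) <= M.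
Proof.
move=> /bdd_diam[B B0 HB] [L L0 HL].
have [[z0 Uz0]|no] := pselect (exists z, U z); last first.
  by exists 0 => // z Uz; case: no; exists z.
exists (L * B + cabs (F z0)); first by pos; exact: cabs_ge0.
move=> z Uz; have -> : F z = (F z - F z0) + F z0 by ring.
apply: le_trans (cabsD _ _) _; rewrite lerD2r.
apply: le_trans (HL _ _ Uz0 Uz) _; apply: ler_wpM2l => //; exact: HB.
Qed.

Lemma lip_sub U V F : (forall z, V z -> U z) -> lipon U F -> lipon V F.
Proof. by move=> VU [L L0 H]; exists L => // z w /VU ? /VU; apply: H. Qed.
Lemma lip_ext U F G : (forall z, U z -> F z = G z) -> lipon U F -> lipon U G.
Proof. by move=> E [L L0 H]; exists L => // z w Uz Uw; rewrite -!E //; apply: H. Qed.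
Lemma lip_cst U c : lipon U (fun=> c).
Proof. by exists 0 => // z w _ _; rewrite subrr cabs0 mul0r. Qed.
Lemma lip_id U : lipon U id.
Proof. by exists 1 => // z w _ _; rewrite mul1r. Qed.
Lemma lipD U F G : lipon U F -> lipon U G -> lipon U (fun z => F z + G z).
Proof.
move=> [L L0 H] [M M0 K]; exists (L + M); first exact: addr_ge0.
move=> z w Uz Uw; have -> : F w + G w - (F z + G z) = (F w - F z) + (G w - G z) by ring.
by rewrite [leRHS]mulrDl; apply: cabs_leD; [apply: H|apply: K].
Qed.
Lemma lipM U F G : bdd U -> lipon U F -> lipon U G -> lipon U (fun z => F z * G z).
Proof.
move=> bU LF LG; have [A A0 HA] := lip_bd bU LF; have [B B0 HB] := lip_bd bU LG.
case: LF LG => [L L0 H] [M M0 K]; exists (A * M + L * B); first by pos.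
move=> z w Uz Uw; have -> : F w * G w - F z * G z = F w * (G w - G z) + (F w - F z) * G z by ring.
rewrite [leRHS]mulrDl; apply: cabs_leD; rewrite cabsM.
  by rewrite -mulrA; apply: ler_pM; rewrite ?cabs_ge0 ?HA // K.
by rewrite mulrAC; apply: ler_pM; rewrite ?cabs_ge0 ?HB // H.
Qed.
Lemma lipZ U c F : bdd U -> lipon U F -> lipon U (fun z => c * F z).
Proof. by move=> bU; apply: lipM => //; exact: lip_cst. Qed.
Lemma lip_abs U F : lipon U F -> lipon U (fun z => (cabs (F z))%:C).
Proof.
move=> [L L0 H]; exists L => // z w Uz Uw.
rewrite -rmorphB cabs_real; apply: le_trans (H _ _ Uz Uw).
rewrite ler_norml; have := cabs_lower (F z) (F w - F z); have := cabs_lower (F w) (F z - F w).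
rewrite !subrKC; rewrite !(cabsC (F z) (F w)); lra.
Qed.
Lemma lip_Re U F : lipon U F -> lipon U (fun z => (complex.Re (F z))%:C).
Proof.
move=> [L L0 H]; exists L => // z w Uz Uw.
rewrite -rmorphB cabs_real -ReB; apply: le_trans (cabs_Re _) (H _ _ Uz Uw).
Qed.
Lemma lip_conj U F : lipon U F -> lipon U (fun z => conjc (F z)).
Proof. by move=> [L L0 H]; exists L => // z w Uz Uw; rewrite -rmorphB cabs_conj; exact: H. Qed.
Lemma lip_comp U V f g : (forall z, U z -> V (g z)) -> lipon V f -> lipon U g -> lipon U (fun z => f (g z)).
Proof.
move=> gV [L L0 H] [M M0 K]; exists (L * M); first by pos.
move=> z w Uz Uw; apply: le_trans (H _ _ (gV _ Uz) (gV _ Uw)) _.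
by rewrite -mulrA; apply: ler_wpM2l => //; apply: K.
Qed.
Lemma lip_sum U (I : Type) (s : seq I) (F : I -> C -> C) : (forall i, lipon U (F i)) ->
  lipon U (fun z => \sum_(i <- s) F i z).
Proof.
move=> H; elim: s => [|i s IH].
  by apply: lip_ext (lip_cst U 0) => z _; rewrite big_nil.
by apply: lip_ext (lipD (H i) IH) => z _; rewrite big_cons.
Qed.

Lemma qhol_sub U V F F' : (forall z, V z -> U z) -> qhol U F F' -> qhol V F F'.
Proof. by move=> VU [L L0 H]; exists L => // z w /VU ? /VU; apply: H. Qed.
Lemma qhol_ext U F F' G G' : (forall z, U z -> F z = G z) -> (forall z, U z -> F' z = G' z) ->
  qhol U F F' -> qhol U G G'.
Proof. by move=> E E' [L L0 H]; exists L => // z w Uz Uw; rewrite -!E // -E' //; apply: H. Qed.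
(** Adding the expansion from [z] to [w] to the one from [w] to [z] cancels the values of [F] and
    leaves (F' w - F' z)(w - z), of quadratic size. *)
Lemma qhol_lip' U F F' : qhol U F F' -> lipon U F'.
Proof.
move=> [K K0 H]; exists (K + K); first by pos.
move=> z w Uz Uw; have [->|zw] := eqVneq w z; first by rewrite !subrr cabs0 mulr0.
have p : 0 < cabs (w - z) by apply: cabs_gt0; rewrite subr_eq0.
rewrite -(ler_pM2r p) -cabsM.
have -> : (F' w - F' z) * (w - z) = (F w - F z - (w - z) * F' z) + (F z - F w - (z - w) * F' w) by ring.
apply: le_trans (cabsD _ _) _; have := H _ _ Uz Uw; have := H _ _ Uw Uz.
by rewrite (cabsC z w); lra.
Qed.
Lemma qhol_lip U F F' : bdd U -> qhol U F F' -> lipon U F.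
Proof.
move=> bU q; have [M M0 HM] := lip_bd bU (qhol_lip' q); case: q => K K0 H.
have [B B0 HB] := bdd_diam bU; exists (K * B + M); first by pos.
move=> z w Uz Uw; have -> : F w - F z = (F w - F z - (w - z) * F' z) + (w - z) * F' z by ring.
rewrite [leRHS]mulrDl; apply: cabs_leD.
  apply: le_trans (H _ _ Uz Uw) _; rewrite expr2 mulrA.
  by apply: ler_wpM2r; rewrite ?cabs_ge0 //; apply: ler_wpM2l => //; apply: HB.
by rewrite cabsM mulrC; apply: ler_wpM2r; rewrite ?cabs_ge0 // HM.
Qed.
Lemma qhol_cst U c : qhol U (fun=> c) (fun=> 0).
Proof. by exists 0 => // z w _ _; rewrite subrr mulr0 subrr cabs0 mul0r. Qed.
Lemma qhol_id U : qhol U id (fun=> 1).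
Proof. by exists 0 => // z w _ _; rewrite mulr1 subrr cabs0 mul0r. Qed.
Lemma qholD U F F' G G' : qhol U F F' -> qhol U G G' ->
  qhol U (fun z => F z + G z) (fun z => F' z + G' z).
Proof.
move=> [L L0 H] [M M0 K]; exists (L + M); first by pos.
move=> z w Uz Uw.
have -> : F w + G w - (F z + G z) - (w - z) * (F' z + G' z) =
  (F w - F z - (w - z) * F' z) + (G w - G z - (w - z) * G' z) by ring.
by rewrite [leRHS]mulrDl; apply: cabs_leD; [apply: H|apply: K].
Qed.
Lemma qholM U F F' G G' : bdd U -> qhol U F F' -> qhol U G G' ->
  qhol U (fun z => F z * G z) (fun z => F' z * G z + F z * G' z).
Proof.
move=> bU qF qG.
have [A A0 HA] := lip_bd bU (qhol_lip bU qF).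
have [A' A'0 HA'] := lip_bd bU (qhol_lip' qF).
have [B B0 HB] := lip_bd bU (qhol_lip bU qG).
have [D D0 HD] := qhol_lip bU qG.
case: qF qG => [L L0 H] [M M0 K].
exists (L * B + A' * D + A * M); first by pos.
move=> z w Uz Uw.
have -> : F w * G w - F z * G z - (w - z) * (F' z * G z + F z * G' z) =
  (F w - F z - (w - z) * F' z) * G w + (w - z) * F' z * (G w - G z)
  + F z * (G w - G z - (w - z) * G' z) by ring.
rewrite [leRHS]mulrDl; apply: cabs_leD.
  rewrite [leRHS]mulrDl; apply: cabs_leD.
    by rewrite cabsM mulrAC; apply: ler_pM; rewrite ?cabs_ge0 ?HB // H.
  rewrite !cabsM mulrAC.
  have -> : A' * D * cabs (w - z) ^+ 2 = cabs (w - z) * (D * cabs (w - z)) * A' by ring.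
  apply: ler_pM; rewrite ?mulr_ge0 ?cabs_ge0 ?HA' //.
  by apply: ler_wpM2l; rewrite ?cabs_ge0 // HD.
by rewrite cabsM -mulrA; apply: ler_pM; rewrite ?cabs_ge0 ?HA // K.
Qed.
Lemma qholZ U c F F' : bdd U -> qhol U F F' -> qhol U (fun z => c * F z) (fun z => c * F' z).
Proof.
move=> bU q; apply: qhol_ext (qholM bU (qhol_cst U c) q) => z _ //.
by rewrite mul0r add0r.
Qed.
Lemma qhol_sum U (I : Type) (s : seq I) (F F' : I -> C -> C) : (forall i, qhol U (F i) (F' i)) ->
  qhol U (fun z => \sum_(i <- s) F i z) (fun z => \sum_(i <- s) F' i z).
Proof.
move=> H; elim: s => [|i s IH].
  by apply: qhol_ext (qhol_cst U 0) => z _; rewrite big_nil.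
by apply: qhol_ext (qholD (H i) IH) => z _; rewrite big_cons.
Qed.
Lemma qhol_comp U V f f' g g' : bdd U -> (forall z, U z -> V (g z)) -> lipon V f' ->
  qhol V f f' -> bdd V -> qhol U g g' -> qhol U (fun z => f (g z)) (fun z => f' (g z) * g' z).
Proof.
move=> bU gV lf' [L L0 H] bV qg.
have [D D0 HD] := qhol_lip bU qg.
have [A A0 HA] := lip_bd bV lf'.
case: qg => M M0 K; exists (L * D ^+ 2 + A * M); first by pos.
move=> z w Uz Uw.
have -> : f (g w) - f (g z) - (w - z) * (f' (g z) * g' z) =
  (f (g w) - f (g z) - (g w - g z) * f' (g z)) + f' (g z) * (g w - g z - (w - z) * g' z) by ring.
rewrite [leRHS]mulrDl; apply: cabs_leD.
  apply: le_trans (H _ _ (gV _ Uz) (gV _ Uw)) _; rewrite -mulrA -exprMn.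
  apply: ler_wpM2l => //; apply: lerXn2r; rewrite ?nnegrE ?mulr_ge0 ?cabs_ge0 //; exact: HD.
rewrite cabsM -mulrA; apply: ler_pM; rewrite ?cabs_ge0 ?HA //; [exact: gV|exact: K].
Qed.
Lemma qholV U F F' m : bdd U -> 0 < m -> (forall z, U z -> m <= cabs (F z)) -> qhol U F F' ->
  qhol U (fun z => (F z)^-1) (fun z => - F' z / F z ^+ 2).
Proof.
move=> bU m0 hm q.
have [D D0 HD] := qhol_lip bU q.
have [A A0 HA] := lip_bd bU (qhol_lip' q).
case: q => K K0 H.
exists (K * (m^-1) ^+ 2 + D ^+ 2 * (m^-1) ^+ 3).
  have mi : 0 <= m^-1 by rewrite invr_ge0 ltW.
  by pos.
have iv z : U z -> cabs (F z)^-1 <= m^-1.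
  by move=> Uz; rewrite cabsV lef_pV2 ?posrE // ?hm //; apply: lt_le_trans (hm _ Uz).
have nz z : U z -> F z != 0.
  by move=> Uz; apply: cabs_gt0_neq0; apply: lt_le_trans (hm _ Uz).
have mi : 0 <= m^-1 by rewrite invr_ge0 ltW.
move=> z w Uz Uw.
have -> : (F w)^-1 - (F z)^-1 - (w - z) * (- F' z / F z ^+ 2) =
   - (F w - F z - (w - z) * F' z) * ((F z)^-1 * (F z)^-1) + (F w - F z) * (F w - F z) * ((F z)^-1 * (F z)^-1 * (F w)^-1).
  by field; rewrite !nz.
rewrite [leRHS]mulrDl; apply: cabs_leD.
  rewrite !cabsM cabsN mulrAC; apply: ler_pM; rewrite ?mulr_ge0 ?cabs_ge0 //; first exact: H.
  by rewrite expr2; apply: ler_pM; rewrite ?cabs_ge0 ?iv.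
rewrite !cabsM.
have -> : D ^+ 2 * m^-1 ^+ 3 * cabs (w - z) ^+ 2 = (D * cabs (w - z)) * (D * cabs (w - z)) * (m^-1 * m^-1 * m^-1) by ring.
apply: ler_pM; rewrite ?mulr_ge0 ?cabs_ge0 //.
  by apply: ler_pM; rewrite ?cabs_ge0 ?HD.
apply: ler_pM; rewrite ?mulr_ge0 ?cabs_ge0 ?iv //.
by apply: ler_pM; rewrite ?cabs_ge0 ?iv.
Qed.
Lemma emax_bound w : emax w <= expR (cabs w).
Proof. by rewrite ge_max -expR0 !ler_expR cabs_ge0 Re_le. Qed.
Lemma qhol_cexp U : bdd U -> qhol U (@cexp R) (@cexp R).
Proof.
move=> bU; case: (bU) => B HB; have [D D0 HD] := bdd_diam bU.
exists (expR B * expR D); first by pos.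
move=> z w Uz Uw.
have -> : cexp w - cexp z - (w - z) * cexp z = cexp z * (cexp (w - z) - 1 - (w - z)).
  by rewrite cexpB; field; exact: cexp_neq0.
rewrite cabsM -mulrA cabs_cexp; apply: ler_pM; rewrite ?expR_ge0 ?cabs_ge0 //.
  by rewrite ler_expR (le_trans (Re_le _)) // HB.
rewrite mulrC; apply: le_trans (cexp_quad _) _; apply: ler_wpM2l; first by pos.
by apply: le_trans (emax_bound _) _; rewrite ler_expR HD.
Qed.
Lemma bdd_img U g : bdd U -> lipon U g -> bdd (fun w => exists2 z, U z & w = g z).
Proof. by move=> bU /(lip_bd bU)[M M0 H]; exists M => _ [z Uz ->]; apply: H. Qed.
Lemma qhol_cexpc U g g' : bdd U -> qhol U g g' -> qhol U (fun z => cexp (g z)) (fun z => cexp (g z) * g' z).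
Proof.
move=> bU qg.
have bV := bdd_img bU (qhol_lip bU qg).
apply: (qhol_comp (V := fun w => exists2 z, U z & w = g z)) => //.
- by move=> z Uz; exists z.
- exact: qhol_lip bV (qhol_cexp bV).
- exact: qhol_cexp.
Qed.
Lemma qhol_X U n : bdd U -> qhol U (fun z => z ^+ n.+1) (fun z => n.+1%:R * z ^+ n).
Proof.
move=> bU; elim: n => [|n IH].
  by apply: qhol_ext (qhol_id U) => z _ //; rewrite expr0 mulr1.
apply: qhol_ext (qholM bU (qhol_id U) IH) => z _; first by rewrite [RHS]exprS.
by rewrite /= -[n.+2%:R]natr1 exprS; ring.
Qed.
End LipInt.

(** * Integrals of Lipschitz functions *)

Section Integral.
Variable R : realType.
Local Notation C := R[i].
Implicit Types (z w : C) (x y a b : R) (F G f g : C -> C) (U V : C -> Prop).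

Lemma le_add_geo x y (c : R) : (forall n : nat, x <= y + c / 2 ^+ n) -> x <= y.
Proof.
move=> H; apply: (@le_add_eps _ _ _ `|c|) => n; apply: le_trans (H n) _.
rewrite lerD2l; apply: le_trans (_ : `|c| / 2 ^+ n <= _).
  by apply: ler_wpM2r; rewrite ?ler_norm // invr_ge0; apply: exprn_ge0.
apply: ler_wpM2l => //; rewrite lef_pV2 ?posrE ?ltr0n ?exprn_gt0 //.
by rewrite -natrX ler_nat; exact: ltn_expl.
Qed.

(** The intervals of centre [u n] and radius 2 c / 2^n, the geometric tail of the steps, are nested;
    the supremum of their left ends lies in all of them. *)
Lemma geo_lim_real (u : nat -> R) (c : R) : (forall n, `|u n.+1 - u n| <= c / 2 ^+ n) ->
  exists l, forall n, `|u n - l| <= (2 * c) / 2 ^+ n.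
Proof.
move=> H.
pose v n := u n - (2 * c) / 2 ^+ n; pose w n := u n + (2 * c) / 2 ^+ n.
have p n : (0 : R) < 2 ^+ n by apply: exprn_gt0.
have E n : (2 * c) / 2 ^+ n.+1 = c / 2 ^+ n by rewrite exprS; field; rewrite gt_eqF.
have E2 n : (2 * c) / 2 ^+ n = 2 * (c / 2 ^+ n) by ring.
have Hn n := H n.
have c0 : 0 <= c by have := le_trans (normr_ge0 _) (H 0%N); rewrite expr0 divr1.
have v1 n : v n <= v n.+1 by rewrite /v E E2; have := Hn n; rewrite ler_norml => /andP[]; lra.
have w1 n : w n.+1 <= w n by rewrite /w E E2; have := Hn n; rewrite ler_norml => /andP[]; lra.
have vw n : v n <= w n.
  have : 0 <= c / 2 ^+ n by apply: divr_ge0; [exact: c0 | exact: ltW].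
  by rewrite /v /w E2; lra.
have vm n m : (n <= m)%N -> v n <= v m.
  move=> /subnK <-; elim: (m - n)%N => [|k IH]; first by rewrite add0n.
  by rewrite addSn; exact: le_trans IH (v1 _).
have wm n m : (n <= m)%N -> w m <= w n.
  move=> /subnK <-; elim: (m - n)%N => [|k IH]; first by rewrite add0n.
  by rewrite addSn; exact: le_trans (w1 _) IH.
have vwnm n m : v n <= w m.
  by apply: le_trans (vm _ _ (leq_maxl n m)) _; apply: le_trans (vw _) _; apply: wm; exact: leq_maxr.
have hs : has_sup (range v).
  by split; [exists (v 0%N); exists 0%N | exists (w 0%N) => _ [n _ <-]; exact: vwnm].
exists (sup (range v)) => n.
have l1 : v n <= sup (range v) by apply: sup_upper_bound => //; exists n.
have l2 : sup (range v) <= w n.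
  by apply: ge_sup; [exists (v 0%N); exists 0%N | move=> _ [m _ <-]; exact: vwnm].
by rewrite ler_norml; move: l1 l2; rewrite /v /w; lra.
Qed.

(* Dyadic Riemann sums of a Lipschitz function converge at the rate [2 ^- n];
   [cint] is their limit, and [F] is only sampled on the real segment. *)
Definition capx (u : nat -> C) (I : C) := exists c : R, forall n, cabs (u n - I) <= c / 2 ^+ n.

Lemma geo_lim (u : nat -> C) (c : R) : (forall n, cabs (u n.+1 - u n) <= c / 2 ^+ n) -> exists I, capx u I.
Proof.
move=> H.
have [|l hl] := @geo_lim_real (fun n => complex.Re (u n)) c.
  by move=> n; rewrite -ReB; apply: le_trans (cabs_Re _) (H n).
have [|k hk] := @geo_lim_real (fun n => complex.Im (u n)) c.
  by move=> n; rewrite -ImB; apply: le_trans (cabs_Im _) (H n).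
exists (l +i* k), (4 * c) => n; apply: le_trans (cabs_le_ReIm _) _.
rewrite ReB ImB /=; apply: le_trans (lerD (hl n) (hk n)) _.
by apply: le_eqr; ring.
Qed.

Lemma capx_uniq (u : nat -> C) I J : capx u I -> capx u J -> I = J.
Proof.
move=> [c H] [d K]; apply/eqP; rewrite -subr_eq0; apply/eqP/cabs_eq0/le_anti; rewrite cabs_ge0 andbT.
apply: (@le_add_geo _ _ (c + d)) => n; rewrite add0r.
have -> : I - J = (u n - J) - (u n - I) by ring.
by rewrite [(c + d)]addrC mulrDl; apply: le_trans (cabsB _ _) _; apply: lerD.
Qed.
Lemma capxD (u v : nat -> C) I J : capx u I -> capx v J -> capx (fun n => u n + v n) (I + J).
Proof.
move=> [c H] [d K]; exists (c + d) => n; have -> : u n + v n - (I + J) = (u n - I) + (v n - J) by ring.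
by rewrite mulrDl; apply: cabs_leD.
Qed.
Lemma capxZ (u : nat -> C) k I : capx u I -> capx (fun n => k * u n) (k * I).
Proof.
move=> [c H]; exists (cabs k * c) => n; rewrite -mulrBr cabsM -mulrA.
by apply: ler_wpM2l; rewrite ?cabs_ge0.
Qed.
Lemma capx_ext (u v : nat -> C) I : u =1 v -> capx u I -> capx v I.
Proof. by move=> E [c H]; exists c => n; rewrite -E. Qed.

Definition pt a b n j : R := a + (b - a) * (j%:R / 2 ^+ n).
Definition rs F a b n : C := ((b - a) / 2 ^+ n)%:C * \sum_(0 <= j < 2 ^ n) F (pt a b n j)%:C.
Definition cint F a b : C := xget 0 [set I | capx (rs F a b) I]%classic.

Lemma cintE F a b I : capx (rs F a b) I -> cint F a b = I.
Proof.
by move=> h; rewrite /cint; case: xgetP => [y _ /= hy|/(_ I)//]; apply: capx_uniq hy h.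
Qed.

Lemma pt_in a b n j : a <= b -> (j <= 2 ^ n)%N -> a <= pt a b n j <= b.
Proof.
move=> ab jn; have p : (0 : R) < 2 ^+ n by apply: exprn_gt0.
have q0 : 0 <= j%:R / 2 ^+ n :> R by apply: divr_ge0; rewrite ?ler0n ?ltW.
have q1 : j%:R / 2 ^+ n <= 1 :> R.
  by rewrite ler_pdivrMr // mul1r -natrX ler_nat.
rewrite /pt; have ab' : 0 <= b - a by lra.
have := mulr_ge0 ab' q0; have := ler_wpM2l ab' q1; lra.
Qed.

Lemma sum_pair (f : nat -> C) m :
  \sum_(0 <= j < 2 * m) f j = \sum_(0 <= j < m) (f (2 * j)%N + f (2 * j).+1).
Proof.
elim: m => [|m IH]; first by rewrite muln0 !big_nil.
by rewrite mulnS !big_nat_recr //= IH addrA.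
Qed.

Lemma sum_le_const (f : nat -> C) m B : (forall j, (j < m)%N -> cabs (f j) <= B) ->
  cabs (\sum_(0 <= j < m) f j) <= m%:R * B.
Proof.
move=> H; apply: le_trans (cabs_sum _ _ _) _.
rewrite big_nat; apply: le_trans (ler_sum _ (G := fun=> B) _) _.
  by move=> j /andP[_ jm]; exact: H.
by rewrite -big_nat sumr_const_nat subn0 mulr_natl.
Qed.

(** Halving the mesh adds the midpoints; each sample there differs from its left neighbour by at
    most L times the new mesh. *)
Lemma rs_step F a b L : a <= b -> 0 <= L ->
  (forall z w, seg a b z -> seg a b w -> cabs (F w - F z) <= L * cabs (w - z)) ->
  forall n, cabs (rs F a b n.+1 - rs F a b n) <= (L * (b - a) ^+ 2) / 2 ^+ n.
Proof.
move=> ab L0 H n.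
have p : (0 : R) < 2 ^+ n by apply: exprn_gt0.
have E j : pt a b n.+1 (2 * j) = pt a b n j.
  by rewrite /pt exprS natrM; field; rewrite gt_eqF.
have -> : rs F a b n.+1 - rs F a b n = ((b - a) / 2 ^+ n.+1)%:C *
   \sum_(0 <= j < 2 ^ n) (F (pt a b n.+1 (2 * j).+1)%:C - F (pt a b n j)%:C).
  rewrite /rs expnS sum_pair sumrB.
  under [X in _ * X - _]eq_bigr => j _ do rewrite E.
  rewrite big_split /= exprS; set S1 := \sum_(_ <= _ < _) _; set S2 := \sum_(_ <= _ < _) _.
  have -> : ((b - a) / 2 ^+ n)%:C = 2 * ((b - a) / (2 * 2 ^+ n))%:C :> C.
    by rewrite -(rmorph_nat (real_complex R)) -rmorphM; congr (_%:C); field; rewrite gt_eqF.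
  by ring.
rewrite cabsM cabs_pos; last by apply: divr_ge0; [lra|exact: exprn_ge0].
have S : cabs (\sum_(0 <= j < 2 ^ n) (F (pt a b n.+1 (2 * j).+1)%:C - F (pt a b n j)%:C)) <=
   (2 ^ n)%:R * (L * ((b - a) / 2 ^+ n.+1)).
  apply: sum_le_const => j jn.
  have j2 : ((2 * j).+1 <= 2 ^ n.+1)%N by rewrite expnS; lia.
  apply: le_trans (H _ _ _ _) _; try (apply/seg_real/pt_in => //; lia).
  apply: ler_wpM2l => //; rewrite -rmorphB -E.
  have -> : pt a b n.+1 (2 * j).+1 - pt a b n.+1 (2 * j) = (b - a) / 2 ^+ n.+1.
    by rewrite /pt -natr1; ring.
  by rewrite cabs_pos //; apply: divr_ge0; [lra|exact: exprn_ge0].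
apply: le_trans (ler_wpM2l _ S) _; first by apply: divr_ge0; [lra|exact: exprn_ge0].
rewrite natrX exprS.
have -> : (b - a) / (2 * 2 ^+ n) * (2 ^+ n * (L * ((b - a) / (2 * 2 ^+ n)))) = ((L * (b - a) ^+ 2) / 2 ^+ n) / 4.
  by field; rewrite gt_eqF.
have : 0 <= L * (b - a) ^+ 2 / 2 ^+ n by pos; exact: exprn_ge0.
lra.
Qed.

Lemma cint_capx F a b : a <= b -> lipon (seg a b) F -> capx (rs F a b) (cint F a b).
Proof.
move=> ab [L L0 H]; have [I hI] := geo_lim (rs_step ab L0 H).
by rewrite (cintE hI).
Qed.

Lemma rs_eq F G a b n : a <= b -> (forall z, seg a b z -> F z = G z) -> rs F a b n = rs G a b n.
Proof.
move=> ab E; rewrite /rs; congr (_ * _); rewrite !big_nat; apply: eq_bigr => j /andP[_ jn].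
by apply: E; apply/seg_real/pt_in => //; exact: ltnW.
Qed.

Lemma cint_eq F G a b : a <= b -> (forall z, seg a b z -> F z = G z) -> cint F a b = cint G a b.
Proof.
move=> ab E; rewrite /cint; congr (xget _ _); apply/funext => I; apply/propext.
by split; apply: capx_ext => n; rewrite (rs_eq _ ab E).
Qed.

Lemma cintD F G a b : a <= b -> lipon (seg a b) F -> lipon (seg a b) G ->
  cint (fun z => F z + G z) a b = cint F a b + cint G a b.
Proof.
move=> ab lF lG; apply: cintE.
apply: capx_ext (capxD (cint_capx ab lF) (cint_capx ab lG)) => n.
by rewrite /rs big_split mulrDr.
Qed.

Lemma cintZ k F a b : a <= b -> lipon (seg a b) F ->
  cint (fun z => k * F z) a b = k * cint F a b.
Proof.
move=> ab lF; apply: cintE; apply: capx_ext (capxZ k (cint_capx ab lF)) => n.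
by rewrite /rs -mulr_sumr; ring.
Qed.

Lemma cint_cst k a b : a <= b -> cint (fun=> k) a b = (b - a)%:C * k.
Proof.
move=> ab; apply: cintE; exists 0 => n; rewrite mul0r /rs sumr_const_nat subn0.
have p : (2 ^+ n : R) != 0 by rewrite expf_neq0.
have -> : ((b - a) / 2 ^+ n)%:C * (k *+ 2 ^ n) - (b - a)%:C * k = 0; last by rewrite cabs0.
have -> : k *+ 2 ^ n = k * (2 ^+ n)%:C.
  by rewrite -[LHS]mulr_natr natrX rmorphXn /= rmorph_nat.
by field; rewrite fmorph_eq0.
Qed.

Lemma cint_sum (I : Type) (s : seq I) (F : I -> C -> C) a b : a <= b ->
  (forall i, lipon (seg a b) (F i)) ->
  cint (fun z => \sum_(i <- s) F i z) a b = \sum_(i <- s) cint (F i) a b.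
Proof.
move=> ab H; elim: s => [|i s IH].
  rewrite big_nil -[RHS](mulr0 (b - a)%:C) -cint_cst //.
  by apply: cint_eq => // z _; rewrite big_nil.
rewrite big_cons -IH -cintD //; last exact: lip_sum.
by apply: cint_eq => // z _; rewrite big_cons.
Qed.

Lemma cint_dom F G a b : a <= b -> lipon (seg a b) F -> lipon (seg a b) G ->
  (forall x, a <= x <= b -> cabs (F x%:C) <= complex.Re (G x%:C)) ->
  cabs (cint F a b) <= complex.Re (cint G a b).
Proof.
move=> ab lF lG H.
have [c hc] := cint_capx ab lF; have [d hd] := cint_capx ab lG.
apply: (@le_add_geo _ _ (c + d)) => n.
have h1 : cabs (rs F a b n) <= complex.Re (rs G a b n).
  have q : 0 <= (b - a) / 2 ^+ n by apply: divr_ge0; [lra|exact: exprn_ge0].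
  rewrite /rs cabsM ReZ cabs_pos //; apply: ler_wpM2l => //.
  apply: le_trans (cabs_sum _ _ _) _; rewrite Re_sum !big_nat; apply: ler_sum => j /andP[_ jn].
  by apply: H; apply: pt_in => //; exact: ltnW.
have -> : cint F a b = rs F a b n - (rs F a b n - cint F a b) by ring.
have -> : complex.Re (cint G a b) = complex.Re (rs G a b n) - complex.Re (rs G a b n - cint G a b).
  by rewrite ReB; ring.
apply: le_trans (cabsB _ _) _; have := hc n; have := hd n; have := Re_le (rs G a b n - cint G a b).
by rewrite mulrDl; lra.
Qed.

Lemma cint_bound F a b M : a <= b -> lipon (seg a b) F ->
  (forall x, a <= x <= b -> cabs (F x%:C) <= M) -> cabs (cint F a b) <= M * (b - a).
Proof.
move=> ab lF H; apply: le_trans (cint_dom (G := fun=> M%:C) ab lF _ _) _ => //.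
  exact: lip_cst.
by rewrite cint_cst // -rmorphM /= mulrC.
Qed.

Lemma le_cint_Re F G a b : a <= b -> lipon (seg a b) F -> lipon (seg a b) G ->
  (forall x, a <= x <= b -> complex.Re (F x%:C) <= complex.Re (G x%:C)) ->
  complex.Re (cint F a b) <= complex.Re (cint G a b).
Proof.
move=> ab lF lG H.
have E : complex.Re (cint (fun z => G z + (-1) * F z) a b) = complex.Re (cint G a b) - complex.Re (cint F a b).
  have lF' : lipon (seg a b) (fun z => -1 * F z) by apply: lipZ => //; exact: bdd_seg.
  by rewrite cintD // cintZ // mulN1r ReD ReN.
rewrite -subr_ge0 -E.
have l := lipD lG (lipZ (-1) (bdd_seg a b) lF).
have := cint_dom (F := fun=> 0) (G := fun z => G z + (-1) * F z) ab (lip_cst _ _) l.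
move=> hh; apply: le_trans (cabs_ge0 _) (hh _) => x hx.
by rewrite cabs0 ReD mulN1r ReN; have := H x hx; lra.
Qed.

Lemma cint_conj F a b : a <= b -> lipon (seg a b) F ->
  cint (fun z => conjc (F z)) a b = conjc (cint F a b).
Proof.
move=> ab lF; have [c hc] := cint_capx ab lF; apply: cintE; exists c => n.
rewrite /rs -(rmorph_sum (@conjc R)).
have -> : ((b - a) / 2 ^+ n)%:C = conjc ((b - a) / 2 ^+ n)%:C :> C by rewrite conjc_real.
by rewrite -rmorphM -rmorphB cabs_conj; exact: hc.
Qed.

Lemma cint_Re F a b : a <= b -> lipon (seg a b) F ->
  cint (fun z => (complex.Re (F z))%:C) a b = (complex.Re (cint F a b))%:C.
Proof.
move=> ab lF; have [c hc] := cint_capx ab lF; apply: cintE; exists c => n.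
have -> : rs (fun z => (complex.Re (F z))%:C) a b n = (complex.Re (rs F a b n))%:C.
  apply: complexP; first by rewrite /rs /= !ReZ !Re_sum.
  by rewrite /rs ImZ Im_sum big1 ?mulr0.
by rewrite -rmorphB cabs_real -ReB; apply: le_trans (cabs_Re _) (hc n).
Qed.

(** The increments of [F] over the dyadic partition telescope; each differs from its Riemann term by
    K times the square of the mesh, and there are 2^n of them. *)
Lemma cint_FTC F F' a b : a <= b -> qhol (seg a b) F F' -> cint F' a b = F b%:C - F a%:C.
Proof.
move=> ab [K K0 H]; apply: cintE; exists (K * (b - a) ^+ 2) => n.
have p : (0 : R) < 2 ^+ n by apply: exprn_gt0.
have tel m : F (pt a b n m)%:C - F a%:C = \sum_(0 <= j < m) (F (pt a b n j.+1)%:C - F (pt a b n j)%:C).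
  by rewrite telescope_sumr // /pt mul0r mulr0 addr0.
have Eb : pt a b n (2 ^ n) = b by rewrite /pt natrX divff ?gt_eqF // mulr1; ring.
rewrite -[in F b%:C]Eb tel cabsC /rs mulr_sumr -sumrB.
apply: le_trans (sum_le_const (B := K * ((b - a) / 2 ^+ n) ^+ 2) _) _.
  move=> j jn.
  have D : pt a b n j.+1 - pt a b n j = (b - a) / 2 ^+ n by rewrite /pt -natr1; ring.
  have := H (pt a b n j)%:C (pt a b n j.+1)%:C; rewrite -rmorphB D.
  rewrite [cabs _%:C]cabs_pos; last by apply: divr_ge0; [lra|exact: ltW].
  by apply; apply/seg_real/pt_in => //; exact: ltnW.
by rewrite natrX; apply: le_eqr; field; rewrite gt_eqF.
Qed.

(** At the midpoint the dyadic sums match exactly, which is why intervals are only ever cut in the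
    middle; the decomposition into blocks [2^k, 2^(k + 1)] fits this. *)
Lemma rs_split F a b n : let m := (a + b) / 2 in rs F a b n.+1 = rs F a m n + rs F m b n.
Proof.
move=> m; rewrite /rs.
have p : (0 : R) < 2 ^+ n by apply: exprn_gt0.
have -> : (b - a) / 2 ^+ n.+1 = (m - a) / 2 ^+ n by rewrite /m exprS; field; rewrite gt_eqF.
have -> : (b - m) / 2 ^+ n = (m - a) / 2 ^+ n by rewrite /m; field; rewrite gt_eqF.
rewrite -mulrDr; congr (_ * _).
rewrite expnS mul2n -addnn (@big_cat_nat _ _ _ (2 ^ n)%N) ?leq_addr //=; congr (_ + _).
  by apply: eq_bigr => j _; congr (F _%:C); rewrite /pt /m exprS; field; rewrite gt_eqF.
rewrite -{1}[(2 ^ n)%N]add0n big_addn addnK; apply: eq_bigr => j _; congr (F _%:C).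
by rewrite /pt /m exprS natrD natrX; field; rewrite gt_eqF.
Qed.

Lemma cint_split F a b : a <= b -> lipon (seg a b) F -> let m := (a + b) / 2 in
  cint F a b = cint F a m + cint F m b.
Proof.
move=> ab lF m.
have am : a <= m by rewrite /m; lra.
have mb : m <= b by rewrite /m; lra.
have l1 : lipon (seg a m) F by apply: lip_sub lF => z /segP[x hx ->]; apply/seg_real; lra.
have l2 : lipon (seg m b) F by apply: lip_sub lF => z /segP[x hx ->]; apply/seg_real; lra.
have [c hc] := cint_capx ab lF.
have h : capx (fun n => rs F a b n.+1) (cint F a b).
  exists `|c| => n; apply: le_trans (hc _) _; have p : (0 : R) < 2 ^+ n by apply: exprn_gt0.
  rewrite exprS ler_pdivrMr ?mulr_gt0 //.
  have -> : `|c| / 2 ^+ n * (2 * 2 ^+ n) = 2 * `|c| by field; rewrite gt_eqF.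
  by have := ler_norm c; have := normr_ge0 c; lra.
apply: capx_uniq h _.
apply: capx_ext (capxD (cint_capx am l1) (cint_capx mb l2)) => n; by rewrite rs_split.
Qed.
End Integral.
Global Opaque cint.

(** * Contour shift and Cauchy formula *)

Section Cauchy.
Variable R : realType.
Local Notation C := R[i].
Local Notation ii := (@ii R).
Implicit Types (z w : C) (x y a b r T M B t : R) (F G f g : C -> C) (U V : C -> Prop).

Lemma cintB F G a b : a <= b -> lipon (seg a b) F -> lipon (seg a b) G ->
  cint (fun z => F z - G z) a b = cint F a b - cint G a b.
Proof.
move=> ab lF lG; rewrite -[- cint G a b]mulN1r -cintZ // -cintD //; last by apply: lipZ => //; exact: bdd_seg.
by apply: cint_eq => // z _; rewrite mulN1r.
Qed.

Lemma lipB U F G : bdd U -> lipon U F -> lipon U G -> lipon U (fun z => F z - G z).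
Proof.
move=> bU lF lG; apply: lip_ext (lipD lF (lipZ (-1) bU lG)) => z _; by rewrite mulN1r.
Qed.

Definition rect a b T z := a <= complex.Re z <= b /\ `|complex.Im z| <= T.

Lemma bdd_rect a b T : bdd (rect a b T).
Proof.
exists (`|a| + `|b| + T) => z [/andP[ha hb] hT]; apply: le_trans (cabs_le_ReIm _) _.
apply: lerD => //; rewrite ler_norml; have := ler_norm b; have := ler_norm (- a); rewrite normrN.
have := normr_ge0 a; have := normr_ge0 b; lra.
Qed.

Lemma Re_line x t : complex.Re (x%:C + ii * t%:C) = x.
Proof. by rewrite ReD ReM /=; ring. Qed.
Lemma Im_line x t : complex.Im (x%:C + ii * t%:C) = t.
Proof. by rewrite ImD ImM /=; ring. Qed.

Lemma rect_line a b T x t : a <= x <= b -> - T <= t <= T -> rect a b T (x%:C + ii * t%:C).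
Proof.
by move=> hx ht; rewrite /rect Re_line Im_line; split => //; rewrite ler_norml.
Qed.

Lemma qhol_line U x : bdd U -> qhol U (fun z => x%:C + ii * z) (fun=> ii).
Proof.
move=> bU; apply: qhol_ext (qholD (qhol_cst U x%:C) (qholZ ii bU (qhol_id U))) => z _ //.
by rewrite mulr1 add0r.
Qed.

(** Moving the vertical line differentiates the integral: its derivative in [x] is the integral of
    [F'], which by the fundamental theorem along the line is [- ii] times the difference of [F] at
    the two ends. [quad_lip] integrates this bound, and only the horizontal sides enter. *)
Lemma contour_shift F F' a b T M : a <= b -> 0 <= T -> qhol (rect a b T) F F' ->
  (forall x, a <= x <= b -> cabs (F (x%:C + ii * T%:C) - F (x%:C + ii * (- T)%:C)) <= M) ->
  cabs (cint (fun t : C => F (b%:C + ii * t)) (- T) T - cint (fun t : C => F (a%:C + ii * t)) (- T) T) <= M * (b - a).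
Proof.
move=> ab T0 qF HM; have TT : - T <= T by lra.
have bR := bdd_rect a b T; have bS := bdd_seg (- T) T.
have lF := qhol_lip bR qF; have lF' := qhol_lip' qF.
have gU x z : a <= x <= b -> seg (- T) T z -> rect a b T (x%:C + ii * z).
  by move=> hx /segP[t ht ->]; exact: rect_line.
have lline x := qhol_lip bS (qhol_line x bS).
have lFx x : a <= x <= b -> lipon (seg (- T) T) (fun t : C => F (x%:C + ii * t)).
  by move=> hx; apply: lip_comp lF (lline x) => z; exact: gU.
have lFx' x : a <= x <= b -> lipon (seg (- T) T) (fun t : C => F' (x%:C + ii * t)).
  by move=> hx; apply: lip_comp lF' (lline x) => z; exact: gU.
case: (qF) => K K0 H.
apply: (@quad_lip _ (fun x => cint (fun t : C => F (x%:C + ii * t)) (- T) T) a b M (K * (T + T)) 1 ab ltr01).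
  by pos.
move=> x y ax xy yb _.
have hx : a <= x <= b by lra.
have hy : a <= y <= b by lra.
have E : cint (fun t : C => F' (x%:C + ii * t)) (- T) T = - ii * (F (x%:C + ii * T%:C) - F (x%:C + ii * (- T)%:C)).
  rewrite -(@cint_FTC _ (fun t : C => F (x%:C + ii * t)) (fun t : C => F' (x%:C + ii * t) * ii)) //.
    rewrite -cintZ //; last by apply: lipM => //; [exact: lFx'|exact: lip_cst].
    apply: cint_eq => // z _; rewrite mulNr mulrCA ii_sqr; ring.
  by apply: qhol_comp bS (gU x ^~ hx) lF' qF bR (qhol_line x bS).
(* First-order expansion in [x]: the first integral is known exactly by [E], the second is of size
   (y - x)^2. *)
have E2 : cint (fun t : C => F (y%:C + ii * t)) (- T) T - cint (fun t : C => F (x%:C + ii * t)) (- T) T =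
  (y - x)%:C * cint (fun t : C => F' (x%:C + ii * t)) (- T) T +
  cint (fun t : C => F (y%:C + ii * t) - F (x%:C + ii * t) - (y - x)%:C * F' (x%:C + ii * t)) (- T) T.
  rewrite (cintB TT (lipB bS (lFx y hy) (lFx x hx)) (lipZ (y-x)%:C bS (lFx' x hx))).
  by rewrite (cintB TT (lFx y hy) (lFx x hx)) (cintZ (y-x)%:C TT (lFx' x hx)); ring.
rewrite E2; apply: cabs_leD.
  rewrite E cabsM cabs_pos ?subr_ge0 // mulNr cabsN cabsM cabs_ii mul1r mulrC.
  by apply: ler_wpM2r; rewrite ?subr_ge0 // HM.
apply: le_trans (cint_bound (M := K * (y - x) ^+ 2) _ _ _) _ => //.
- by apply: lipB => //; [apply: lipB => //; exact: lFx|apply: lipZ => //; exact: lFx'].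
- move=> t ht; have := H _ _ (rect_line hx ht) (rect_line hy ht).
  have -> : y%:C + ii * t%:C - (x%:C + ii * t%:C) = (y - x)%:C by ring.
  by rewrite cabs_pos ?subr_ge0.
- by apply: le_eqr; ring.
Qed.

Local Notation tpi := (pi *+ 2 : R).
Lemma tpi_gt0 : 0 < tpi. Proof. by rewrite pmulrn_lgt0 // pi_gt0. Qed.
Lemma tpi_ge0 : 0 <= tpi. Proof. exact/ltW/tpi_gt0. Qed.

Lemma cexp_tpi : cexp (ii * tpi%:C) = 1.
Proof.
rewrite /cexp (_ : complex.Re _ = 0); last by rewrite ReM /=; ring.
rewrite (_ : complex.Im _ = tpi); last by rewrite ImM /=; ring.
by rewrite expR0 cos2pi sin2pi mul1r; apply: complexP.
Qed.

Definition circ r z : C := r%:C * cexp (ii * z).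

Lemma cabs_circ r x : 0 <= r -> cabs (circ r x%:C) = r.
Proof. by move=> r0; rewrite cabsM cabs_cexp ReM /= mul0r mul1r subrr expR0 mulr1 cabs_pos. Qed.
Lemma circ_neq0 r z : 0 < r -> circ r z != 0.
Proof. by move=> r0; rewrite mulf_neq0 ?cexp_neq0 // fmorph_eq0 gt_eqF. Qed.
Lemma circ_per r : circ r tpi%:C = circ r 0%:C.
Proof. by rewrite /circ cexp_tpi mulr0 cexp0. Qed.

Let bS := bdd_seg 0 tpi.
Let S := seg 0 tpi.

Lemma qhol_circ r : qhol S (circ r) (fun z => ii * circ r z).
Proof.
have q := qholZ r%:C bS (qhol_cexpc bS (qholZ ii bS (qhol_id S))).
by apply: qhol_ext q => z _ //; rewrite /circ; ring.
Qed.
Lemma lip_circ r : lipon S (circ r). Proof. exact: qhol_lip bS (qhol_circ r). Qed.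

Lemma qhol_cexpl (k : C) : qhol S (fun z => cexp (k * z)) (fun z => k * cexp (k * z)).
Proof.
apply: qhol_ext (qhol_cexpc bS (qholZ k bS (qhol_id S))) => z _ //.
by rewrite mulr1 mulrC.
Qed.
Lemma lip_cexpl (k : C) : lipon S (fun z => cexp (k * z)).
Proof. exact: qhol_lip bS (qhol_cexpl k). Qed.

Lemma cint_cexp0 (k : C) : k != 0 -> cexp (k * tpi%:C) = 1 -> cint (fun z => cexp (k * z)) 0 tpi = 0.
Proof.
move=> k0 hk; apply: (mulfI k0); rewrite mulr0 -cintZ ?tpi_ge0 //; last exact: lip_cexpl.
rewrite (cint_FTC tpi_ge0 (qhol_cexpl k)) hk.
have -> : (0%:C : C) = 0 by [].
by rewrite mulr0 cexp0 subrr.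
Qed.

Lemma circX r z n : circ r z ^+ n = (r ^+ n)%:C * cexp ((n%:R * ii) * z).
Proof. by rewrite /circ exprMn rmorphXn -cexp_natM mulrA. Qed.
Lemma circXV r z n : circ r z ^- n = (r ^- n)%:C * cexp (- (n%:R * ii) * z).
Proof. by rewrite circX invfM -cexpN mulNr fmorphV. Qed.
Lemma lip_circX r n : lipon S (fun z => circ r z ^+ n).
Proof. by apply: lip_ext (lipZ (r ^+ n)%:C bS (lip_cexpl (n%:R * ii))) => z _; rewrite circX. Qed.
Lemma lip_circXV r n : lipon S (fun z => circ r z ^- n).
Proof. by apply: lip_ext (lipZ (r ^- n)%:C bS (lip_cexpl (- (n%:R * ii)))) => z _; rewrite circXV. Qed.

Lemma cexp_nat_tpi n : cexp ((n%:R * ii) * tpi%:C) = 1.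
Proof. by rewrite -mulrA cexp_natM cexp_tpi expr1n. Qed.

Lemma cint_circX r n : (0 < n)%N -> cint (fun z => circ r z ^+ n) 0 tpi = 0.
Proof.
move=> n0; rewrite (cint_eq (G := fun z => (r ^+ n)%:C * cexp ((n%:R * ii) * z))) ?tpi_ge0 //.
  rewrite cintZ ?tpi_ge0 ?cint_cexp0 ?mulr0 ?cexp_nat_tpi //; last exact: lip_cexpl.
  by rewrite mulf_neq0 ?ii_neq0 // pnatr_eq0 -lt0n.
by move=> z _; rewrite circX.
Qed.
Lemma cint_circXV r n : (0 < n)%N -> cint (fun z => circ r z ^- n) 0 tpi = 0.
Proof.
move=> n0; rewrite (cint_eq (G := fun z => (r ^- n)%:C * cexp (- (n%:R * ii) * z))) ?tpi_ge0 //.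
  rewrite cintZ ?tpi_ge0 ?cint_cexp0 ?mulr0 //; last exact: lip_cexpl.
    by rewrite oppr_eq0 mulf_neq0 ?ii_neq0 // pnatr_eq0 -lt0n.
  by rewrite mulNr cexpN cexp_nat_tpi invr1.
by move=> z _; rewrite circXV.
Qed.

Definition disc r z := cabs z <= r.
Lemma bdd_disc r : bdd (disc r). Proof. by exists r. Qed.
Lemma disc_circ r z : 0 <= r -> S z -> disc r (circ r z).
Proof. by move=> r0 /segP[x _ ->]; rewrite /disc cabs_circ. Qed.

Lemma circ_sub_ge r w x : 0 <= r -> r - cabs w <= cabs (circ r x%:C - w).
Proof. by move=> r0; rewrite -{1}(cabs_circ x r0) -(cabsN w) cabs_lower. Qed.

Lemma lip_ker r w : 0 < r -> cabs w < r -> lipon S (fun z => circ r z / (circ r z - w)).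
Proof.
move=> r0 wr; apply: lipM => //; first exact: lip_circ.
have q := qholD (qhol_circ r) (qhol_cst S (- w)).
apply: qhol_lip (qholV (m := r - cabs w) bS _ _ q) => //; first by rewrite subr_gt0.
by move=> z /segP[x _ ->]; apply: circ_sub_ge; exact: ltW.
Qed.

Lemma cabs_ker r w x : 0 < r -> cabs w < r -> cabs (circ r x%:C / (circ r x%:C - w)) <= r / (r - cabs w).
Proof.
move=> r0 wr; rewrite cabsM cabsV (cabs_circ x (ltW r0)); apply: ler_wpM2l; first exact: ltW.
have p : 0 < r - cabs w by rewrite subr_gt0.
have := circ_sub_ge w x (ltW r0) => h.
by rewrite lef_pV2 ?posrE //; exact: lt_le_trans h.
Qed.

(** The geometric series for 1 / (1 - w / c) truncated at [N], with its exact remainder (w / c)^N c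
    / (c - w). With [g = 1] it evaluates the kernel; with [g] the boundary values of a function it
    yields the Taylor expansion. *)
Lemma ker_expand g r w N B : 0 < r -> cabs w < r -> 0 <= B -> lipon S g ->
  (forall x, 0 <= x <= tpi -> cabs (g x%:C) <= B) ->
  cabs (cint (fun z => g z * (circ r z / (circ r z - w))) 0 tpi -
     \sum_(n < N) w ^+ n * cint (fun z => g z * circ r z ^- n) 0 tpi)
  <= (B * (r / (r - cabs w)) * tpi) * (cabs w / r) ^+ N.
Proof.
move=> r0 wr B0 lg gB.
have p : 0 < r - cabs w by rewrite subr_gt0.
have lgn n : lipon S (fun z => g z * circ r z ^- n) by apply: lipM => //; exact: lip_circXV.
have lk := lip_ker r0 wr.
have E : cint (fun z => g z * (circ r z / (circ r z - w))) 0 tpi -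
     \sum_(n < N) w ^+ n * cint (fun z => g z * circ r z ^- n) 0 tpi =
  cint (fun z => w ^+ N * (g z * circ r z ^- N * (circ r z / (circ r z - w)))) 0 tpi.
  have -> : \sum_(n < N) w ^+ n * cint (fun z => g z * circ r z ^- n) 0 tpi =
    cint (fun z => \sum_(n < N) w ^+ n * (g z * circ r z ^- n)) 0 tpi.
    rewrite (cint_sum _ (F := fun (n : 'I_N) z => w ^+ n * (g z * circ r z ^- n))) ?tpi_ge0 //.
      by apply: eq_bigr => n _; rewrite cintZ ?tpi_ge0 //; exact: lgn.
    by move=> n; apply: lipZ => //; exact: lgn.
  rewrite -cintB ?tpi_ge0 //.
  - apply: cint_eq; first exact: tpi_ge0.
    move=> z /segP[x _ ->]; set c := circ r x%:C.
    have c0 : c != 0 by apply: circ_neq0.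
    have cw : c - w != 0.
      by apply: cabs_gt0_neq0; apply: lt_le_trans (circ_sub_ge w x (ltW r0)).
    apply/(mulIf cw).
    have -> : \sum_(i < N) w ^+ i * (g x%:C * c ^- i) = g x%:C * \sum_(i < N) (w / c) ^+ i.
      by rewrite mulr_sumr; apply: eq_bigr => i _; rewrite expr_div_n; ring.
    have := subrX1 (w / c) N => h.
    have h2 : (c - w) * \sum_(i < N) (w / c) ^+ i = c - c * (w / c) ^+ N.
      have -> : c - w = - c * (w / c - 1) by field.
      by rewrite -mulrA -h; ring.
        have -> : (g x%:C * (c / (c - w)) - g x%:C * \sum_(i < N) (w / c) ^+ i) * (c - w) =
      g x%:C * (c - (c - w) * \sum_(i < N) (w / c) ^+ i) by field.
    rewrite h2.
    by rewrite expr_div_n; field; rewrite cw expf_neq0.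
  - by apply: lipM.
  - by apply: lip_sum => n; apply: lipZ => //; exact: lgn.
rewrite E; apply: le_trans (cint_bound (M := cabs w ^+ N * (B * r ^- N * (r / (r - cabs w)))) _ _ _) _.
- exact: tpi_ge0.
- by apply: lipZ => //; apply: lipM.
- move=> x hx; rewrite cabsM cabsX.
  apply: ler_wpM2l; first by apply: exprn_ge0; exact: cabs_ge0.
  have ir : 0 <= r ^- N by rewrite invr_ge0; apply: exprn_ge0; exact: ltW.
  rewrite cabsM [cabs (g _ / _)]cabsM cabsV cabsX (cabs_circ x (ltW r0)).
  apply: ler_pM; rewrite ?mulr_ge0 ?cabs_ge0 //.
    by apply: ler_wpM2r => //; exact: gB.
  exact: cabs_ker.
- by apply: le_eqr; rewrite expr_div_n subr0; ring.
Qed.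

Lemma le_add_pow x y (c q : R) : 0 <= q -> q < 1 -> (forall n : nat, x <= y + c * q ^+ n) -> x <= y.
Proof.
move=> q0 q1 H; apply: (@le_add_eps _ _ _ (`|c| / (1 - q))) => n.
apply: le_trans (H n) _; rewrite lerD2l.
have p : 0 < 1 - q by lra.
(* The geometric sum 1 + ... + q^n has n + 1 terms, each at least q^n, so that (n + 1) q^n (1 - q)
   <= 1 - q^(n + 1); this stronger form carries the induction. *)
have h : q ^+ n * (n.+1%:R * (1 - q)) <= 1.
  apply: le_trans (_ : 1 - q * q ^+ n <= 1); last first.
    by rewrite gerBl -exprS; exact: exprn_ge0.
  elim: n => [|n IH]; first by rewrite expr0 mul1r mul1r mulr1.
  have qn : 0 <= q ^+ n by apply: exprn_ge0.
  have qn1 : q ^+ n <= 1 by apply: exprn_ile1 => //; exact: ltW.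
  have q2 : q * q ^+ n <= 1 by rewrite -exprS; apply: exprn_ile1 => //; exact: ltW.
  have := ler_wpM2l q0 IH; have := mulr_ge0 (ltW p) (_ : 0 <= 1 - q * q ^+ n).
  by rewrite subr_ge0 => /(_ q2); rewrite [q ^+ n.+1]exprS -[n.+2%:R]natr1; lra.
have h2 : q ^+ n <= (1 - q)^-1 / n.+1%:R.
  by rewrite -invfM -[leRHS]mul1r ler_pdivlMr ?mulr_gt0 ?ltr0n // [(1 - q) * _]mulrC.
apply: le_trans (_ : `|c| * q ^+ n <= _).
  by apply: ler_wpM2r; [exact: exprn_ge0|exact: ler_norm].
by rewrite -mulrA; apply: ler_wpM2l.
Qed.

Lemma cabs_eq_pow z w (c q : R) : 0 <= q -> q < 1 -> (forall n : nat, cabs (z - w) <= c * q ^+ n) -> z = w.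
Proof.
move=> q0 q1 H; apply/eqP; rewrite -subr_eq0; apply/eqP/cabs_eq0/le_anti; rewrite cabs_ge0 andbT.
by apply: (@le_add_pow _ _ c q) => // n; rewrite add0r.
Qed.

(** In the expansion with [g = 1] every negative power of [circ] integrates to 0; only the constant
    term survives. Truncating at [n.+1] makes sure that this term is present. *)
Lemma cint_ker r w : 0 < r -> cabs w < r -> cint (fun z => circ r z / (circ r z - w)) 0 tpi = tpi%:C.
Proof.
move=> r0 wr.
have q1 : cabs w / r < 1 by rewrite ltr_pdivrMr // mul1r.
have q0 : 0 <= cabs w / r by apply: divr_ge0; [exact: cabs_ge0|exact: ltW].
apply: (@cabs_eq_pow _ _ (1 * (r / (r - cabs w)) * tpi * (cabs w / r)) _ q0 q1) => n.
have := @ker_expand (fun=> 1) r w n.+1 1 r0 wr ler01 (lip_cst _ _) (fun x _ => le_eqr (cabs1 R)).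
rewrite big_ord_recl expr0 mul1r big1 ?addr0; last first.
  move=> i _; rewrite (cint_eq (G := fun z => circ r z ^- (bump 0 i))) ?tpi_ge0 //; last by move=> z _; rewrite mul1r.
  by rewrite cint_circXV ?mulr0.
rewrite (cint_eq (G := fun z => circ r z / (circ r z - w)) tpi_ge0); last by move=> z _; rewrite mul1r.
rewrite (cint_eq (G := fun=> 1) (a := 0) (b := tpi) tpi_ge0); last by move=> z _; rewrite expr0 invr1 mulr1.
by rewrite cint_cst ?tpi_ge0 // subr0 mulr1 exprS mulrA.
Qed.

Section CauchyFormula.
Variables (r : R) (f f' : C -> C).
Hypothesis r0 : 0 < r.
Hypothesis qf : qhol (disc r) f f'.
Let r0' : 0 <= r := ltW r0.

Lemma lip_fcirc : lipon S (fun z => f (circ r z)).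
Proof.
apply: lip_comp (qhol_lip (@bdd_disc r) qf) (lip_circ r) => z; exact: disc_circ.
Qed.

(* The homotopy [w + l (circ - w)], [l] from 1 to 0, contracts the circle to [w];
   its derivative in [l] is an exact derivative along the circle. *)
Lemma cauchy w : cabs w < r -> cint (fun z => f (circ r z) * (circ r z / (circ r z - w))) 0 tpi = tpi%:C * f w.
Proof.
move=> wr.
pose p (l : R) z := w + l%:C * (circ r z - w).
have bD := bdd_disc r.
have lf := qhol_lip bD qf; have lf' := qhol_lip' qf.
have lk := lip_ker r0 wr.
have qp l : qhol S (p l) (fun z => l%:C * (ii * circ r z)).
  have q := qholD (qhol_cst S w) (qholZ l%:C bS (qholD (qhol_circ r) (qhol_cst S (- w)))).
  by apply: qhol_ext q => z _; rewrite /p; ring.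
have pD l z : 0 <= l <= 1 -> S z -> disc r (p l z).
  move=> /andP[l0 l1] Sz; have := disc_circ r0' Sz; rewrite /disc => hc.
  have -> : p l z = (1 - l)%:C * w + l%:C * circ r z by rewrite /p; ring.
  apply: le_trans (cabsD _ _) _; rewrite cabsM [cabs (l%:C * _)]cabsM !cabs_pos ?subr_ge0 //.
  by have := cabs_ge0 w; nra.
have lp l : lipon S (p l) by apply: qhol_lip (qp l).
have lfp l : 0 <= l <= 1 -> lipon S (fun z => f (p l z)).
  by move=> hl; apply: lip_comp lf (lp l) => z; exact: pD.
have lfp' l : 0 <= l <= 1 -> lipon S (fun z => f' (p l z)).
  by move=> hl; apply: lip_comp lf' (lp l) => z; exact: pD.
pose Phi (l : R) := cint (fun z => f (p l z) * (circ r z / (circ r z - w))) 0 tpi.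
have lPhi l : 0 <= l <= 1 -> lipon S (fun z => f (p l z) * (circ r z / (circ r z - w))).
  by move=> hl; apply: lipM => //; exact: lfp.
have c0 := lip_circ r.
have Z l : 0 <= l <= 1 -> cint (fun z => f' (p l z) * circ r z) 0 tpi = 0.
  (* The exact-derivative argument divides by [l]. At [l = 0] the integrand is a multiple of [circ],
     whose integral vanishes. *)
  move=> hl; have [l0|l0] := eqVneq l 0.
    rewrite (cint_eq (G := fun z => f' w * circ r z ^+ 1)) ?tpi_ge0 //; last first.
      by move=> z _; rewrite /p l0 mul0r addr0 expr1.
    by rewrite cintZ ?tpi_ge0 ?cint_circX ?mulr0 //; exact: lip_circX.
  have li : l%:C * ii != 0 by rewrite mulf_neq0 ?ii_neq0 // fmorph_eq0.
  apply: (mulfI li); rewrite mulr0 -cintZ ?tpi_ge0 //; last by apply: lipM => //; exact: lfp'.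
  have q : qhol S (fun z => f (p l z)) (fun z => f' (p l z) * (l%:C * (ii * circ r z))).
    by apply: qhol_comp bS (fun z => pD l z hl) lf' qf bD (qp l).
  rewrite (cint_eq (G := fun z => f' (p l z) * (l%:C * (ii * circ r z)))) ?tpi_ge0 //; last by move=> z _; ring.
  by rewrite (cint_FTC tpi_ge0 q) /p circ_per subrr.
(* By [Z] the first-order variation of [Phi] is 0, so [quad_lip] applies with [M = 0] and forces
   [Phi] to be constant. *)
have H01 : Phi 1 = Phi 0.
  case: qf => K K0 H.
  apply/eqP; rewrite -subr_eq0; apply/eqP/cabs_eq0/le_anti; rewrite cabs_ge0 andbT.
  rewrite -[leRHS](mul0r (1 - 0)).
  apply: (@quad_lip _ Phi 0 1 0 (K * ((r + r) * r) * tpi) 1 ler01 ltr01); first by apply: mulr_ge0; [pos|exact: tpi_ge0].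
  move=> x y x0 xy y1 _.
  have hx : 0 <= x <= 1 by lra.
  have hy : 0 <= y <= 1 by lra.
  have lgap : lipon S (fun z => (f (p y z) - f (p x z) - (y - x)%:C * (circ r z - w) * f' (p x z)) * (circ r z / (circ r z - w))).
    apply: lipM => //; apply: lipB => //; first by apply: lipB => //; [exact: lfp|exact: lfp].
    apply: lipM => //; last exact: lfp'.
    by apply: lipZ => //; apply: lipB => //; exact: lip_cst.
  have -> : Phi y - Phi x = cint (fun z => (f (p y z) - f (p x z) - (y - x)%:C * (circ r z - w) * f' (p x z)) * (circ r z / (circ r z - w))) 0 tpi.
    have -> : Phi y - Phi x = Phi y - Phi x - (y - x)%:C * cint (fun z => f' (p x z) * circ r z) 0 tpi.
      by rewrite Z // mulr0 subr0.
    have lc : lipon S (fun z => f' (p x z) * circ r z) by apply: lipM => //; exact: lfp'.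
    rewrite -(cintZ _ tpi_ge0 lc) -(cintB tpi_ge0 (lPhi y hy) (lPhi x hx)).
    rewrite -(cintB tpi_ge0 (lipB bS (lPhi y hy) (lPhi x hx)) (lipZ _ bS lc)).
    apply: cint_eq; first exact: tpi_ge0.
    move=> z /segP[t _ ->]; field.
    apply: cabs_gt0_neq0; apply: lt_le_trans (circ_sub_ge w t r0'); by rewrite subr_gt0.
  rewrite mul0r add0r.
  apply: le_trans (cint_bound (M := K * ((r + r) * r) * (y - x) ^+ 2) _ lgap _) _.
  - exact: tpi_ge0.
  - move=> t ht; have St : S t%:C by apply/seg_real.
    have := H _ _ (pD _ _ hx St) (pD _ _ hy St).
    have -> : p y t%:C - p x t%:C = (y - x)%:C * (circ r t%:C - w) by rewrite /p; ring.
    set E := f _ - _ - _ => hE.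
    have cw : 0 < cabs (circ r t%:C - w) by apply: lt_le_trans (circ_sub_ge w t r0'); rewrite subr_gt0.
    rewrite cabsM; apply: le_trans (ler_wpM2r (cabs_ge0 _) hE) _.
    rewrite [cabs ((y - x)%:C * _)]cabsM [cabs (_ / _)]cabsM cabsV (cabs_circ _ r0') cabs_pos ?subr_ge0 //.
    set d := cabs (circ _ _ - w) in cw *.
    have -> : K * ((y - x) * d) ^+ 2 * (r / d) = K * (d * r) * (y - x) ^+ 2 by field; rewrite gt_eqF.
    apply: ler_wpM2r; first exact: sqr_ge0.
    apply: ler_wpM2l => //; apply: ler_wpM2r => //.
    by apply: le_trans (cabsB _ _) _; rewrite (cabs_circ _ r0') lerD2l ltW.
  - by rewrite subr0; apply: le_eqr; ring.
have E1 : Phi 1 = cint (fun z => f (circ r z) * (circ r z / (circ r z - w))) 0 tpi.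
  by apply: cint_eq; [exact: tpi_ge0|move=> z _; rewrite /p mul1r subrKC].
rewrite -E1 H01 /Phi (cint_eq (G := fun z => f w * (circ r z / (circ r z - w)))) ?tpi_ge0 //; last first.
  by move=> z _; rewrite /p mul0r addr0.
by rewrite cintZ ?tpi_ge0 // cint_ker // mulrC.
Qed.
End CauchyFormula.
End Cauchy.

(** * Borel-Caratheodory and three circles *)

Section Taylor.
Variable R : realType.
Local Notation C := R[i].
Local Notation ii := (@ii R).
Implicit Types (z w : C) (x y a b r T M B t A : R) (F G f g : C -> C) (U V : C -> Prop).
Local Notation tpi := (pi *+ 2 : R).
Local Notation circ := (@circ R).
Local Notation disc := (@disc R).
Let bS := bdd_seg 0 tpi.
Let S := seg 0 tpi.
Let tp0 := tpi_ge0 R.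

Definition coef f r n : C := tpi^-1%:C * cint (fun z => f (circ r z) * circ r z ^- n) 0 tpi.

Lemma tpi_coef f r n : cint (fun z => f (circ r z) * circ r z ^- n) 0 tpi = tpi%:C * coef f r n.
Proof. by rewrite /coef mulrA -rmorphM mulfV ?mul1r // gt_eqF // tpi_gt0. Qed.

Lemma taylor_err f f' r B w N : 0 < r -> qhol (disc r) f f' -> 0 <= B ->
  (forall x, cabs (f (circ r x%:C)) <= B) -> cabs w < r ->
  cabs (f w - \sum_(n < N) w ^+ n * coef f r n) <= (B * (r / (r - cabs w))) * (cabs w / r) ^+ N.
Proof.
move=> r0 qf B0 hB wr.
have := @ker_expand _ (fun z => f (circ r z)) r w N B r0 wr B0 (lip_fcirc r0 qf) (fun x _ => hB x).
rewrite (cauchy r0 qf wr).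
have -> : \sum_(n < N) w ^+ n * cint (fun z => f (circ r z) / circ r z ^+ n) 0 tpi = 
   tpi%:C * \sum_(n < N) w ^+ n * coef f r n.
  by rewrite mulr_sumr; apply: eq_bigr => n _; rewrite tpi_coef; ring.
rewrite -mulrBr cabsM cabs_pos //.
have -> : B * (r / (r - cabs w)) * tpi * (cabs w / r) ^+ N = tpi * (B * (r / (r - cabs w)) * (cabs w / r) ^+ N) by ring.
by rewrite ler_pM2l // tpi_gt0.
Qed.

Lemma mean_value f f' r : 0 < r -> qhol (disc r) f f' -> cint (fun z => f (circ r z)) 0 tpi = tpi%:C * f 0.
Proof.
move=> r0 qf; rewrite -(cauchy r0 qf); last by rewrite cabs0.
apply: cint_eq => // z _; rewrite subr0 divff ?mulr1 //; exact: circ_neq0.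
Qed.

Lemma circ_ort r n k : 0 < r ->
  cint (fun z => circ r z ^+ n * circ r z ^- k) 0 tpi = if n == k then tpi%:C else 0.
Proof.
move=> r0; have c0 z : circ r z != 0 by exact: circ_neq0.
have [nk|kn|->] := ltngtP n k.
- rewrite (cint_eq (G := fun z => circ r z ^- (k - n))) ?cint_circXV ?subn_gt0 // => z _.
  rewrite -[in LHS](subnK (ltnW nk)) exprD; field; rewrite !expf_neq0 //.
- rewrite (cint_eq (G := fun z => circ r z ^+ (n - k))) ?cint_circX ?subn_gt0 // => z _.
  rewrite -[in LHS](subnK (ltnW kn)) exprD; field; rewrite !expf_neq0 //.
- rewrite (cint_eq (G := fun=> 1)) //; first by rewrite cint_cst // subr0 mulr1.
  by move=> z _; rewrite divff // expf_neq0.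
Qed.

Lemma circ_bd f f' r : 0 < r -> qhol (disc r) f f' -> exists2 B : R, 0 <= B & forall x, cabs (f (circ r x%:C)) <= B.
Proof.
move=> r0 qf; have [B B0 HB] := lip_bd (@bdd_disc R r) (qhol_lip (@bdd_disc R r) qf).
by exists B => // x; apply: HB; rewrite /disc cabs_circ // ltW.
Qed.

Lemma qhol_disc_sub f f' r r' : r' <= r -> qhol (disc r) f f' -> qhol (disc r') f f'.
Proof. by move=> h; apply: qhol_sub => z hz; exact: le_trans h. Qed.

(** The Taylor polynomial with coefficients from the outer circle is integrated over the inner one:
    orthogonality isolates the coefficient [k], and the remainder tends to 0 geometrically. *)
Lemma coef_indep f f' r r' k : 0 < r' -> r' < r -> qhol (disc r) f f' -> coef f r' k = coef f r k.
Proof.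
move=> r'0 rr qf; have r0 : 0 < r by exact: lt_trans rr.
have [B B0 HB] := circ_bd r0 qf.
have q' := qhol_disc_sub (ltW rr) qf.
have lf := lip_fcirc r'0 q'.
have q0 : 0 <= r' / r by apply: divr_ge0; exact: ltW.
have q1 : r' / r < 1 by rewrite ltr_pdivrMr // mul1r.
pose D := B * (r / (r - r')).
apply: (@cabs_eq_pow _ _ _ (r' ^- k * D * (r' / r) ^+ k.+1) _ q0 q1) => M.
pose N := (k.+1 + M)%N.
pose P z := \sum_(n < N) circ r' z ^+ n * coef f r n.
have lP : lipon S P.
  apply: lip_sum => n; apply: lipM => //; [exact: lip_circX|exact: lip_cst].
have lk : lipon S (fun z => circ r' z ^- k) := lip_circXV r' k.
have E : cint (fun z => (f (circ r' z) - P z) * circ r' z ^- k) 0 tpi = tpi%:C * (coef f r' k - coef f r k).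
  rewrite (cint_eq (G := fun z => f (circ r' z) * circ r' z ^- k - P z * circ r' z ^- k)) //; last by move=> z _; rewrite mulrBl.
  rewrite cintB // ?tpi_coef; [|exact: lipM|exact: lipM].
  rewrite mulrBr; congr (_ - _).
  rewrite (cint_eq (G := fun z => \sum_(n < N) coef f r n * (circ r' z ^+ n * circ r' z ^- k))) //; last first.
    by move=> z _; rewrite mulr_suml; apply: eq_bigr => n _; ring.
  have ll (n : 'I_N) : lipon S (fun z => circ r' z ^+ n * circ r' z ^- k) by apply: lipM => //; exact: lip_circX.
  rewrite (@cint_sum _ _ _ (fun (n : 'I_N) z => coef f r n * (circ r' z ^+ n * circ r' z ^- k))) //; last first.
    by move=> n; apply: lipZ.
  have kN : (k < N)%N by rewrite /N addSn ltnS leq_addr.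
  rewrite (bigD1 (Ordinal kN)) //= cintZ //; last exact: (ll (Ordinal kN)).
  rewrite circ_ort // eqxx big1 ?addr0 1?mulrC // => n hn.
  rewrite cintZ // circ_ort // ifN ?mulr0 //.
rewrite -(ler_pM2l (tpi_gt0 R)) -{1}(cabs_pos tp0) -cabsM -E.
apply: le_trans (cint_bound (M := r' ^- k * D * (r' / r) ^+ N) _ _ _) _ => //.
- by apply: lipM => //; apply: lipB.
- move=> x hx; rewrite cabsM cabsV cabsX (cabs_circ _ (ltW r'0)) mulrC -mulrA.
  have ir : 0 <= r' ^- k by rewrite invr_ge0; apply: exprn_ge0; exact: ltW.
  apply: ler_wpM2l => //.
  have := @taylor_err f f' r B (circ r' x%:C) N r0 qf B0 HB; rewrite (cabs_circ _ (ltW r'0)); exact.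
- by apply: le_eqr; rewrite subr0 /N exprD; ring.
Qed.

(** For n > 0 the conjugate of [f] integrates to 0 against [circ ^- n] ([Z2]), and so does a
    constant; hence [f] may be replaced by -2 (A - Re f). As A - Re f >= 0, its modulus integrates
    to its mean value, which is [A] because [f 0 = 0]. *)
Lemma borel_car f f' r A n : 0 < r -> qhol (disc r) f f' -> f 0 = 0 -> (0 < n)%N ->
  (forall x, 0 <= x <= tpi -> complex.Re (f (circ r x%:C)) <= A) -> cabs (coef f r n) * r ^+ n <= 2 * A.
Proof.
move=> r0 qf f0 n0 HA.
have lf := lip_fcirc r0 qf.
have lk : lipon S (fun z => circ r z ^- n) := lip_circXV r n.
have lr := lip_Re lf.
have bD := @bdd_disc R r.
have Z1 : cint (fun z => f (circ r z) * circ r z ^+ n) 0 tpi = 0.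
  have qX : qhol (disc r) (fun z => z ^+ n) (fun z => n%:R * z ^+ n.-1).
    by case: n n0 {lk} => // n _; exact: qhol_X.
  by have := mean_value r0 (qholM bD qf qX); rewrite f0 mul0r mulr0.
have rn : 0 < r ^+ n by apply: exprn_gt0.
have cc z : S z -> conjc (circ r z ^+ n) = (r ^+ n)%:C * ((r ^+ n)%:C * circ r z ^- n).
  move=> /segP[x _ ->]; set c := circ r x%:C ^+ n.
  have c0 : c != 0 by rewrite expf_neq0 // circ_neq0.
  have h : c * conjc c = (r ^+ n)%:C * (r ^+ n)%:C.
    have -> : c * conjc c = (cabs c ^+ 2)%:C.
      by rewrite sqr_cabs; case: (c) => u v; apply: complexP; rewrite ?ReM ?ImM /=; ring.
    by rewrite /c cabsX (cabs_circ _ (ltW r0)) expr2 rmorphM.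
  by apply: (mulfI c0); rewrite h; field.
have Z2 : cint (fun z => conjc (f (circ r z)) * circ r z ^- n) 0 tpi = 0.
  have : cint (fun z => conjc (f (circ r z) * circ r z ^+ n)) 0 tpi = 0.
    rewrite cint_conj ?Z1 ?conjc0 //; apply: lipM => //; exact: lip_circX.
  rewrite (cint_eq (G := fun z => ((r ^+ n)%:C * (r ^+ n)%:C) * (conjc (f (circ r z)) * circ r z ^- n))) //; last first.
    by move=> z Sz; rewrite conjM cc //; ring.
  rewrite cintZ //; last by apply: lipM => //; exact: lip_conj.
  have nz : (r ^+ n)%:C * (r ^+ n)%:C != 0 :> C by rewrite mulf_neq0 // fmorph_eq0 gt_eqF.
  by move=> h; apply: (mulfI nz); rewrite h mulr0.
pose u z : C := A%:C - (complex.Re (f (circ r z)))%:C.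
have lu : lipon S u by apply: lipB => //; exact: lip_cst.
have E : tpi%:C * coef f r n = - 2 * cint (fun z => u z * circ r z ^- n) 0 tpi.
  have e1 : cint (fun z => u z * circ r z ^- n) 0 tpi = - cint (fun z => (complex.Re (f (circ r z)))%:C * circ r z ^- n) 0 tpi.
    rewrite (cint_eq (G := fun z => A%:C * circ r z ^- n - (complex.Re (f (circ r z)))%:C * circ r z ^- n)) //; last by move=> z _; rewrite mulrBl.
    rewrite cintB ?cintZ // ?cint_circXV ?mulr0 ?sub0r //; [exact: lipZ|exact: lipM].
  rewrite e1 mulrNN -cintZ //; last exact: lipM.
  rewrite -tpi_coef -[LHS]addr0 -Z2 -cintD //; [|exact: lipM|by apply: lipM => //; exact: lip_conj].
  apply: cint_eq => // z _; rewrite -mulrDl mulrA; congr (_ * _).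
  by case: (f _) => p q; apply: complexP; rewrite ?ReM ?ImM /=; ring.
have h1 : cabs (cint (fun z => u z * circ r z ^- n) 0 tpi) <= complex.Re (cint (fun z => (r ^- n)%:C * u z) 0 tpi).
  apply: cint_dom => //; [exact: lipM|exact: lipZ|].
  move=> x hx; have := HA _ hx => hA.
  rewrite cabsM cabsV cabsX (cabs_circ _ (ltW r0)) ReZ /u -rmorphB cabs_pos ?subr_ge0 //= mulrC //.
have h2 : cint (fun z => (r ^- n)%:C * u z) 0 tpi = (r ^- n * tpi)%:C * (A%:C - (complex.Re (cint (fun z => f (circ r z)) 0 tpi))%:C * tpi^-1%:C).
  rewrite cintZ // cintB // ?cint_cst //; last exact: lip_cst.
  rewrite subr0.
  rewrite cint_Re // rmorphM -[RHS]mulrA; congr (_ * _).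
  have hh : (tpi%:C : C) * tpi^-1%:C = 1 by rewrite -rmorphM mulfV // gt_eqF // tpi_gt0.
  have key (J : C) : tpi%:C * A%:C - J = tpi%:C * (A%:C - J * tpi^-1%:C).
    by rewrite -[J in LHS]mul1r -hh; ring.
  exact: key.
rewrite (mean_value r0 qf) f0 mulr0 /= mul0r subr0 in h2.
rewrite h2 -rmorphM /= in h1.
have e : tpi * cabs (coef f r n) = 2 * cabs (cint (fun z => u z * circ r z ^- n) 0 tpi).
  by rewrite -{1}(cabs_pos tp0) -cabsM E cabsM cabsN cabs_nat.
rewrite -(ler_pM2l (tpi_gt0 R)) mulrA e.
apply: le_trans (_ : 2 * (r ^- n * tpi * A) * r ^+ n <= _).
  apply: ler_wpM2r; [exact: ltW|exact: ler_wpM2l].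
by apply: le_eqr; field; rewrite gt_eqF.
Qed.

(** A substitute for Hadamard's convexity: the Taylor coefficients below [n0] are bounded on the
    inner circle, the others on the outer one. Large [n0] multiplies [A] by an arbitrarily small
    factor, while the coefficient of [m] stays fixed. *)
Lemma three_circles f f' r1 r2 rho m A w n0 : 0 < r1 -> r1 < r2 -> 0 <= rho -> rho < r2 -> qhol (disc r2) f f' -> f 0 = 0 ->
  (forall z, cabs z = r1 -> complex.Re (f z) <= m) ->
  (forall z, cabs z = r2 -> complex.Re (f z) <= A) -> 0 <= A -> 0 <= m ->
  cabs w <= rho ->
  cabs (f w) <= (2 * m) * \sum_(n < n0) (rho / r1) ^+ n + (2 * A) * ((rho / r2) ^+ n0 / (1 - rho / r2)).
Proof.
move=> r10 r12 rho0 rho2 qf f0 Hm HA A0 m0 wrho.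
have r20 : 0 < r2 by exact: lt_trans r12.
have [B B0 HB] := circ_bd r20 qf.
have c0 : coef f r2 0 = 0.
  rewrite /coef (cint_eq (G := fun z => f (circ r2 z))) //; last by move=> z _; rewrite expr0 invr1 mulr1.
  by rewrite (mean_value r20 qf) f0 !mulr0.
have q0 : 0 <= rho / r2 by apply: divr_ge0 => //; exact: ltW.
have q1 : rho / r2 < 1 by rewrite ltr_pdivrMr // mul1r.
have ci n : cabs (coef f r2 n) * r1 ^+ n <= 2 * m.
  case: n => [|n]; first by rewrite c0 cabs0 mul0r mulr_ge0.
  rewrite -(coef_indep n.+1 r10 r12 qf).
  apply: (borel_car r10 (qhol_disc_sub (ltW r12) qf) f0) => // x _.
  by apply: Hm; rewrite cabs_circ // ltW.
have co n : cabs (coef f r2 n) * r2 ^+ n <= 2 * A.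
  case: n => [|n]; first by rewrite c0 cabs0 mul0r mulr_ge0.
  apply: (borel_car r20 qf f0) => // x _.
  by apply: HA; rewrite cabs_circ // ltW.
have w2 : cabs w < r2 by exact: le_lt_trans rho2.
apply: (@le_add_pow _ _ _ (B * (r2 / (r2 - cabs w))) _ q0 q1) => M.
have := @taylor_err f f' r2 B w (n0 + M) r20 qf B0 HB w2 => te.
set P := \sum_(n < n0 + M) _ in te.
have -> : f w = P + (f w - P) by ring.
apply: cabs_leD; last first.
  apply: le_trans te _; apply: ler_wpM2l.
    by apply: mulr_ge0 => //; apply: divr_ge0; [exact: ltW|rewrite subr_ge0 ltW].
  apply: le_trans (_ : (rho / r2) ^+ (n0 + M) <= _).
    apply: lerXn2r; rewrite ?nnegrE //; first by apply: divr_ge0; [exact: cabs_ge0|exact: ltW].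
    by apply: ler_wpM2r => //; rewrite invr_ge0 ltW.
  rewrite exprD ler_piMl ?exprn_ge0 //; apply: exprn_ile1 => //; exact: ltW.
rewrite /P big_split_ord /=; apply: cabs_leD.
  apply: le_trans (cabs_sum _ _ _) _; rewrite mulr_sumr; apply: ler_sum => n _.
  rewrite cabsM cabsX.
  apply: le_trans (_ : rho ^+ n * cabs (coef f r2 n) <= _).
    by apply: ler_wpM2r; [exact: cabs_ge0|apply: lerXn2r; rewrite ?nnegrE ?cabs_ge0].
  have p1 : 0 < r1 ^+ n by apply: exprn_gt0.
  rewrite expr_div_n; have -> : rho ^+ n * cabs (coef f r2 n) = (cabs (coef f r2 n) * r1 ^+ n) * (rho ^+ n / r1 ^+ n).
    by field; rewrite gt_eqF.
  by apply: ler_wpM2r => //; apply: divr_ge0; [exact: exprn_ge0|exact: ltW].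
apply: le_trans (cabs_sum _ _ _) _.
apply: le_trans (_ : \sum_(n < M) (2 * A) * ((rho / r2) ^+ n0 * (rho / r2) ^+ n) <= _).
  apply: ler_sum => n _; rewrite cabsM cabsX -exprD.
  apply: le_trans (_ : rho ^+ (n0 + n) * cabs (coef f r2 (n0 + n)) <= _).
    by apply: ler_wpM2r; [exact: cabs_ge0|apply: lerXn2r; rewrite ?nnegrE ?cabs_ge0].
  have p1 : 0 < r2 ^+ (n0 + n) by apply: exprn_gt0.
  rewrite expr_div_n; have -> : rho ^+ (n0 + n) * cabs (coef f r2 (n0 + n)) = (cabs (coef f r2 (n0 + n)) * r2 ^+ (n0 + n)) * (rho ^+ (n0 + n) / r2 ^+ (n0 + n)).
    by field; rewrite gt_eqF.
  by apply: ler_wpM2r => //; apply: divr_ge0; [exact: exprn_ge0|exact: ltW].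
rewrite -!mulr_sumr; apply: ler_wpM2l; first by rewrite mulr_ge0.
apply: ler_wpM2l; first exact: exprn_ge0.
have p : 0 < 1 - rho / r2 by lra.
rewrite -[leRHS]mul1r ler_pdivlMr // mulrC.
have := subrX1 (rho / r2) M => h.
have -> : (1 - rho / r2) * \sum_(n < M) (rho / r2) ^+ n = 1 - (rho / r2) ^+ M.
  by rewrite -[1 - rho / r2]opprB mulNr -h; ring.
by rewrite gerBl exprn_ge0.
Qed.

(** The logarithm is the integral of the logarithmic derivative along the ray from 0 to [z]. As that
    derivative is only known to be Lipschitz, both f = f(0) exp l and the expansion of [l] are
    obtained from [f] itself. *)
Lemma disc_log f f' r m0 : 0 < r -> qhol (disc r) f f' -> 0 < m0 -> (forall z, disc r z -> m0 <= cabs (f z)) ->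
  exists l l', [/\ qhol (disc r) l l', l 0 = 0 & forall z, disc r z -> f z = f 0 * cexp (l z)].
Proof.
move=> r0 qf m00 Hm; have r0' := ltW r0.
have bD := @bdd_disc R r.
have fnz z : disc r z -> f z != 0 by move=> hz; apply: cabs_gt0_neq0; exact: lt_le_trans (Hm _ hz).
have qV := qholV bD m00 Hm qf.
pose h z := f' z * (f z)^-1.
have lh : lipon (disc r) h by apply: lipM => //; [exact: qhol_lip' qf|exact: qhol_lip bD qV].
have [H H0 HH] := lip_bd bD lh.
have [Fb F0 HF] := lip_bd bD (qhol_lip bD qf).
have sD z u : disc r z -> seg 0 1 u -> disc r (u * z).
  move=> hz /segP[x /andP[x0 x1] ->]; rewrite /disc cabsM cabs_pos //.
  by apply: le_trans hz; rewrite ler_piMl // cabs_ge0.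
have bs := bdd_seg (0 : R) 1.
have lhz z : disc r z -> lipon (seg 0 1) (fun u => h (u * z)).
  move=> hz; apply: lip_comp lh _; first by move=> u; exact: sD.
  by apply: lipM => //; [exact: lip_id|exact: lip_cst].
pose I z := cint (fun u => h (u * z)) 0 1.
have lI : lipon (disc r) I.
  case: (lh) => L L0 HL; exists L => // z w hz hw.
  rewrite -cintB ?ler01 //; [|exact: lhz|exact: lhz].
  apply: le_trans (cint_bound (M := L * cabs (w - z)) _ _ _) _ => //.
  - by apply: lipB => //; exact: lhz.
  - move=> x hx; have Sx : seg 0 1 x%:C by apply/seg_real.
    apply: le_trans (HL _ _ (sD _ _ hz Sx) (sD _ _ hw Sx)) _.
    rewrite -mulrBr cabsM; apply: ler_wpM2l => //; rewrite cabs_real ger0_norm; last by case/andP: hx.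
    by rewrite ler_piMl ?cabs_ge0 //; case/andP: hx.
  - by rewrite subr0 mulr1.
pose l z := z * I z.
have ll : lipon (disc r) l by apply: lipM => //; exact: lip_id.
have D0 : disc r 0 by rewrite /disc cabs0.
have E z : disc r z -> f z = f 0 * cexp (l z).
  move=> hz; have [K K0 HK] := qf.
  have [c hc] := cint_capx ler01 (lhz z hz).
  pose Sm n j := \sum_(0 <= i < j) h ((pt 0 1 n i)%:C * z).
  (* [f] along the ray times exp of minus the partial Riemann sum of its logarithmic derivative.
     Each step changes it by O(4^-n), so after 2^n steps it is within O(2^-n) of [f 0]; the same
     sequence tends to [f z * cexp (- l z)]. *)
  pose X n j := f ((pt 0 1 n j)%:C * z) * cexp (- (z * ((2 ^- n)%:C * Sm n j))).
  have zr : cabs z <= r by exact: hz.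
  have z0 := cabs_ge0 z.
  pose D := expR (r * H) * (K * r ^+ 2 + Fb * ((r * H) ^+ 2 * expR (r * H))).
  have step n j : (j < 2 ^ n)%N -> cabs (X n j.+1 - X n j) <= D * (2 ^- n) ^+ 2.
    move=> jn; have p : (0 : R) < 2 ^+ n by apply: exprn_gt0.
    have ip : 0 < (2 : R) ^- n by rewrite invr_gt0.
    have ip1 : (2 : R) ^- n <= 1 by rewrite invf_le1 // exprn_ege1 // ler1n.
    have Sj : seg (0 : R) 1 (pt 0 1 n j)%:C by apply/seg_real/pt_in; rewrite ?ler01 // ltnW.
    have Sj1 : seg (0 : R) 1 (pt 0 1 n j.+1)%:C by apply/seg_real/pt_in; rewrite ?ler01.
    have Dj := sD _ _ hz Sj; have Dj1 := sD _ _ hz Sj1.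
    set u := (pt 0 1 n j)%:C * z in Dj; set u1 := (pt 0 1 n j.+1)%:C * z in Dj1.
    have du : u1 - u = (2 ^- n)%:C * z.
      by rewrite /u /u1 -mulrBl -rmorphB; congr (_%:C * _); rewrite /pt -natr1; ring.
    set v := z * ((2 ^- n)%:C * h u).
    have -> : X n j.+1 - X n j = cexp (- (z * ((2 ^- n)%:C * Sm n j.+1))) *
       ((f u1 - f u - (u1 - u) * f' u) - f u * (cexp v - 1 - v)).
      rewrite /X -/u -/u1.
      have -> : Sm n j.+1 = Sm n j + h u by rewrite /Sm big_nat_recr.
      have -> : cexp (- (z * ((2 ^- n)%:C * Sm n j))) = cexp (- (z * ((2 ^- n)%:C * (Sm n j + h u)))) * cexp v.
        by rewrite -cexpD; congr (cexp _); rewrite /v; ring.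
      have -> : (u1 - u) * f' u = f u * v.
        have hE : f u * h u = f' u by rewrite /h mulrC divfK // fnz.
        by rewrite du /v -hE; ring.
      by ring.
    have hu : cabs (h u) <= H by exact: HH.
    have bS' : cabs (Sm n j.+1) <= (2 ^+ n) * H.
      apply: le_trans (sum_le_const (B := H) _) _.
        by move=> i ij; apply: HH; apply: sD => //; apply/seg_real/pt_in; rewrite ?ler01 //; exact: leq_trans (ltnW ij) jn.
      by apply: ler_wpM2r => //; rewrite -natrX ler_nat.
    have be : cabs (cexp (- (z * ((2 ^- n)%:C * Sm n j.+1)))) <= expR (r * H).
      rewrite cabs_cexp ler_expR; apply: le_trans (Re_le _) _; rewrite cabsN !cabsM cabs_pos ?(ltW ip) //.
      apply: ler_pM => //; first by rewrite mulr_ge0 ?cabs_ge0 // ltW.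
      by rewrite mulrC ler_pdivrMr // mulrC.
    have bv : cabs v <= (r * H) * 2 ^- n.
      rewrite /v cabsM [cabs (_ * h u)]cabsM cabs_pos ?(ltW ip) // mulrCA [leRHS]mulrC; apply: ler_wpM2l; first exact: ltW.
      by apply: ler_pM; rewrite ?cabs_ge0.
    have bv2 : cabs (cexp v - 1 - v) <= (r * H) ^+ 2 * expR (r * H) * (2 ^- n) ^+ 2.
      apply: le_trans (cexp_quad _) _.
      have -> : (r * H) ^+ 2 * expR (r * H) * (2 ^- n) ^+ 2 = ((r * H) * 2 ^- n) ^+ 2 * expR (r * H) by ring.
      apply: ler_pM; rewrite ?exprn_ge0 ?cabs_ge0 //.
      - by have := emax_ge1 v; lra.
      - by apply: lerXn2r; rewrite ?nnegrE ?cabs_ge0 // ?mulr_ge0 // ltW.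
      - apply: le_trans (emax_bound _) _; rewrite ler_expR; apply: le_trans bv _.
        by rewrite ler_piMr // mulr_ge0.
    have b1 := HK _ _ Dj Dj1.
    rewrite cabsM /D -mulrA; apply: ler_pM; rewrite ?cabs_ge0 //.
    apply: le_trans (cabsB _ _) _; rewrite [leRHS]mulrDl; apply: lerD.
      apply: le_trans b1 _; rewrite du cabsM cabs_pos ?(ltW ip) // -mulrA exprMn [X in K * X <= _]mulrC.
      apply: ler_wpM2l => //; apply: ler_wpM2r; first exact: sqr_ge0.
      by apply: lerXn2r; rewrite ?nnegrE.
    by rewrite cabsM -mulrA; apply: ler_pM; rewrite ?cabs_ge0 ?HF.
  have tot n : cabs (f z * cexp (- (z * rs (fun u => h (u * z)) 0 1 n)) - f 0) <= D / 2 ^+ n.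
    have p : (0 : R) < 2 ^+ n by apply: exprn_gt0.
    have -> : f z * cexp (- (z * rs (fun u => h (u * z)) 0 1 n)) - f 0 = X n (2 ^ n)%N - X n 0%N.
      rewrite /X /Sm big_nil !mulr0 oppr0 cexp0 mulr1 /rs subr0 mul1r.
      rewrite (_ : pt 0 1 n (2 ^ n) = 1); last by rewrite /pt natrX divff ?gt_eqF // mulr1; ring.
      by rewrite (_ : pt 0 1 n 0 = 0) ?mul1r ?mul0r //; rewrite /pt mul0r mulr0 addr0.
    rewrite -telescope_sumr //.
    apply: le_trans (sum_le_const (B := D * (2 ^- n) ^+ 2) _) _; first by move=> j; exact: step.
    by rewrite natrX; apply: le_eqr; field; rewrite gt_eqF.
  have Dpos : 0 <= D by apply: mulr_ge0; [exact: expR_ge0|]; pos.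
  have capz : capx (fun n => f z * cexp (- (z * rs (fun u => h (u * z)) 0 1 n))) (f 0) by exists D.
  have cape : capx (fun n => f z * cexp (- (z * rs (fun u => h (u * z)) 0 1 n))) (f z * cexp (- l z)).
    apply: capxZ.
    have c0 : 0 <= c by have := le_trans (cabs_ge0 _) (hc 0%N); rewrite expr0 divr1.
    exists (expR (cabs (l z)) * (r * c * expR (r * c))) => n.
    set q := rs _ _ _ _.
    have hq : cabs (q - I z) <= c / 2 ^+ n by exact: hc.
    have -> : cexp (- (z * q)) - cexp (- l z) = cexp (- l z) * (cexp (- (z * (q - I z))) - 1).
      by rewrite mulrBr mulr1 -cexpD; congr (cexp _ - _); rewrite /l; ring.
    have p : (0 : R) < 2 ^+ n by apply: exprn_gt0.
    have hq2 : cabs (- (z * (q - I z))) <= r * c / 2 ^+ n.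
      by rewrite cabsN cabsM -mulrA; apply: ler_pM; rewrite ?cabs_ge0.
    rewrite cabsM cabs_cexp -!mulrA; apply: ler_pM; rewrite ?expR_ge0 ?cabs_ge0 //.
      by rewrite ler_expR; apply: le_trans (Re_le _) _; rewrite cabsN.
    apply: le_trans (cexp_lip _) _.
    have -> : r * (c * (expR (r * c) / 2 ^+ n)) = r * c / 2 ^+ n * expR (r * c) by ring.
    apply: ler_pM; rewrite ?cabs_ge0 //; first by have := emax_ge1 (- (z * (q - I z))); lra.
    apply: le_trans (emax_bound _) _; rewrite ler_expR; apply: le_trans hq2 _.
    rewrite ler_pdivrMr //; apply: ler_peMr; first by rewrite mulr_ge0.
    by rewrite exprn_ege1 // ler1n.
  by rewrite -(capx_uniq cape capz) -mulrA -cexpD addNr cexp0 mulr1.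
exists l, h; split => //; last by rewrite /l mul0r.
have [L L0 HL] := ll.
have [K K0 HK] := qf.
pose W := (L ^+ 2 * expR (L * (r + r)) + K / m0).
exists W; first by rewrite /W; apply: addr_ge0; [pos|apply: divr_ge0 => //; exact: ltW].
move=> z w hz hw.
set d := l w - l z.
have hd : cabs d <= L * cabs (w - z) by exact: HL.
have wz : cabs (w - z) <= r + r by apply: le_trans (cabsB _ _) _; exact: lerD.
(* The quotient of values of [f] is exp of the increment [d]; the expansion of [l] thus follows from
   those of [f] and of exp at 0. *)
have ed : cexp d = f w / f z.
  rewrite /d cexpB (E w) // (E z) //; field; rewrite cexp_neq0 /=.
  exact: fnz.
have -> : d - (w - z) * h z = (f w - f z - (w - z) * f' z) * (f z)^-1 - (cexp d - 1 - d).
  by rewrite ed /h; field; exact: fnz.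
apply: le_trans (cabsB _ _) _; rewrite [leLHS]addrC /W [leRHS]mulrDl; apply: lerD.
  apply: le_trans (cexp_quad _) _; rewrite [leRHS]mulrAC; apply: ler_pM.
  - by apply: exprn_ge0; exact: cabs_ge0.
  - by have := emax_ge1 d; lra.
  - by rewrite -exprMn; apply: lerXn2r; rewrite ?nnegrE ?mulr_ge0 ?cabs_ge0.
  - apply: le_trans (emax_bound _) _; rewrite ler_expR; apply: le_trans hd _.
    exact: ler_wpM2l.
rewrite cabsM [leRHS]mulrAC; apply: ler_pM; rewrite ?cabs_ge0 //; first exact: HK.
by rewrite cabsV lef_pV2 ?posrE ?Hm //; exact: lt_le_trans (Hm _ hz).
Qed.
End Taylor.

(** * The zeta function in the half-plane Re s > 0 *)

Section Zeta.
Variable R : realType.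
Local Notation C := R[i].
Local Notation ii := (@ii R).
Implicit Types (s z w : C) (x y a b r T M B t A : R) (F G f g : C -> C) (U V : C -> Prop).

(* [rp x a] is [x ^ a] and [xp x s] is [x ^ (- s)], meaningful for [0 < x] only. *)
Definition rp x a : R := expR (a * ln x).
Definition xp x s : C := cexp (- (s * (ln x)%:C)).

Lemma rp_gt0 x a : 0 < rp x a. Proof. exact: expR_gt0. Qed.
Lemma rp_ge0 x a : 0 <= rp x a. Proof. exact: expR_ge0. Qed.
Lemma rpD x a b : rp x (a + b) = rp x a * rp x b.
Proof. by rewrite /rp mulrDl expRD. Qed.
Lemma rpN x a : rp x (- a) = (rp x a)^-1.
Proof. by rewrite /rp mulNr expRN. Qed.
Lemma rp0 x : rp x 0 = 1. Proof. by rewrite /rp mul0r expR0. Qed.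
Lemma rp1 x : 0 < x -> rp x 1 = x. Proof. by move=> x0; rewrite /rp mul1r lnK ?posrE. Qed.
Lemma rpN1 x : 0 < x -> rp x (-1) = x^-1. Proof. by move=> x0; rewrite rpN rp1. Qed.
Lemma rp_1 a : rp 1 a = 1. Proof. by rewrite /rp ln1 mulr0 expR0. Qed.
Lemma rpM x y a : 0 < x -> 0 < y -> rp (x * y) a = rp x a * rp y a.
Proof. by move=> x0 y0; rewrite /rp lnM ?posrE // mulrDr expRD. Qed.
Lemma rpX x a n : rp x (a * n%:R) = rp x a ^+ n.
Proof. by rewrite /rp -expRM_natr mulrAC. Qed.
Lemma rprp x a b : rp (rp x a) b = rp x (a * b).
Proof. by rewrite /rp expRK mulrA (mulrC b). Qed.
Lemma rp_monoe x a b : 1 <= x -> a <= b -> rp x a <= rp x b.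
Proof. by move=> x1 ab; rewrite ler_expR; apply: ler_wpM2r => //; exact: ln_ge0. Qed.
Lemma rp_monob x y a : 0 < x -> x <= y -> 0 <= a -> rp x a <= rp y a.
Proof.
move=> x0 xy a0; rewrite ler_expR; apply: ler_wpM2l => //.
by rewrite ler_ln ?posrE //; exact: lt_le_trans xy.
Qed.
Lemma rp_antib x y a : 0 < x -> x <= y -> a <= 0 -> rp y a <= rp x a.
Proof.
move=> x0 xy a0; rewrite ler_expR -subr_ge0 -mulrBr; apply: mulr_le0 => //.
by rewrite subr_le0 ler_ln ?posrE //; exact: lt_le_trans xy.
Qed.
Lemma rp_ge1 x a : 1 <= x -> 0 <= a -> 1 <= rp x a.
Proof. by move=> x1 a0; rewrite -(rp0 x); exact: rp_monoe. Qed.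
Lemma rp_le1 x a : 1 <= x -> a <= 0 -> rp x a <= 1.
Proof. by move=> x1 a0; rewrite -(rp0 x); exact: rp_monoe. Qed.

Lemma cabs_xp x s : cabs (xp x s) = rp x (- complex.Re s).
Proof. by rewrite cabs_cexp ReN ReM /= mulr0 subr0 /rp mulNr. Qed.
Lemma xpM x y s : 0 < x -> 0 < y -> xp (x * y) s = xp x s * xp y s.
Proof.
by move=> x0 y0; rewrite /xp lnM ?posrE // -cexpD rmorphD; congr cexp; ring.
Qed.
Lemma xpD x s w : xp x (s + w) = xp x s * xp x w.
Proof. by rewrite /xp -cexpD; congr cexp; ring. Qed.
Lemma xp1 s : xp 1 s = 1.
Proof. by rewrite /xp ln1 mulr0 oppr0 cexp0. Qed.
Lemma xpN1 x : 0 < x -> xp x (-1) = x%:C.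
Proof.
move=> x0; rewrite /xp mulN1r opprK /cexp /= lnK ?posrE // cos0 sin0.
by apply: complexP; rewrite ?ReM ?ImM /=; ring.
Qed.
Lemma xpp1 x : 0 < x -> xp x 1 = x^-1%:C.
Proof.
move=> x0; have := xpN1 x0; rewrite /xp mulN1r opprK mul1r cexpN => ->.
by rewrite fmorphV.
Qed.
Lemma xpB1 x s : 0 < x -> xp x (s - 1) = x%:C * xp x s.
Proof. by move=> x0; rewrite xpD xpN1 // mulrC. Qed.

Lemma nat_cpow_oppE n s : (0 < n)%N -> nat_cpow_opp n s = xp n%:R s.
Proof.
move=> n0; have n0' : (0 : R) < n%:R by rewrite ltr0n.
rewrite /nat_cpow_opp /xp /cexp /powR gt_eqF // !(ReN, ImN, ReM, ImM) /= !(mulr0, subr0, add0r) cosN sinN.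
by rewrite mulNr.
Qed.

Lemma nested_lim (u : nat -> R) (tau : nat -> R) m0 :
  (forall m k, (m0 <= m)%N -> (m <= k)%N -> `|u k - u m| <= tau m) ->
  exists l, forall m, (m0 <= m)%N -> `|u m - l| <= tau m.
Proof.
move=> H.
have lr m k : (m0 <= m)%N -> (m0 <= k)%N -> u m - tau m <= u k + tau k.
  move=> hm hk; have [mk|km] := leqP m k.
    by have := H _ _ hm mk; have := le_trans (normr_ge0 _) (H _ _ hk (leqnn k)); rewrite ler_norml => ? /andP[]; lra.
  by have := H _ _ hk (ltnW km); have := le_trans (normr_ge0 _) (H _ _ hm (leqnn m)); rewrite ler_norml => ? /andP[]; lra.
pose E := [set x | exists2 m, (m0 <= m)%N & x = u m - tau m]%classic.
have hs : has_sup E.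
  split; first by exists (u m0 - tau m0); exists m0.
  by exists (u m0 + tau m0) => _ [m hm ->]; exact: lr.
exists (sup E) => m hm.
have l1 : u m - tau m <= sup E by apply: sup_upper_bound => //; exists m.
have l2 : sup E <= u m + tau m.
  by apply: ge_sup; [case: hs|move=> _ [k hk ->]; exact: lr].
by rewrite ler_norml; lra.
Qed.

Lemma nested_limC (u : nat -> C) (tau : nat -> R) m0 :
  (forall m k, (m0 <= m)%N -> (m <= k)%N -> cabs (u k - u m) <= tau m) ->
  exists l, forall m, (m0 <= m)%N -> cabs (u m - l) <= 2 * tau m.
Proof.
move=> H.
have [|l hl] := @nested_lim (fun n => complex.Re (u n)) tau m0.
  by move=> m k hm mk; rewrite -ReB; apply: le_trans (cabs_Re _) (H _ _ hm mk).
have [|k hk] := @nested_lim (fun n => complex.Im (u n)) tau m0.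
  by move=> m k hm mk; rewrite -ImB; apply: le_trans (cabs_Im _) (H _ _ hm mk).
exists (l +i* k) => m hm; apply: le_trans (cabs_le_ReIm _) _.
by rewrite ReB ImB /=; have := hl m hm; have := hk m hm; lra.
Qed.

Lemma ln_quad x y : 1 <= x -> 1 <= y -> `|ln y - ln x - (y - x) / x| <= (y - x) ^+ 2.
Proof.
move=> x1 y1; have x0 : 0 < x by lra. have y0 : 0 < y by lra.
have up (u v : R) : 0 < u -> 0 < v -> ln u - ln v <= (u - v) / v.
  move=> u0 v0; rewrite -ln_div ?posrE //.
  have -> : u / v = 1 + (u - v) / v by field; rewrite gt_eqF.
  apply: le_ln1Dx; rewrite ltr_pdivlMr //; lra.
have h1 := up y x y0 x0; have h2 := up x y x0 y0.
have e : (x - y) / y = - (y - x) / x + (y - x) ^+ 2 / (x * y) by field; rewrite !gt_eqF.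
have h3 : (y - x) ^+ 2 / (x * y) <= (y - x) ^+ 2.
  rewrite ler_pdivrMr ?mulr_gt0 //; apply: ler_peMr; first exact: sqr_ge0.
  by nra.
have := divr_ge0 (sqr_ge0 (y - x)) (ltW (mulr_gt0 x0 y0)).
by rewrite ler_norml; move: h1 h2 h3; rewrite e mulNr; lra.
Qed.

(** Discrete form of the comparison with the integral of x^(-1 - al); it telescopes in [tail_rp]. *)
Lemma le_rp_succ (n : nat) (al : R) : (0 < n)%N -> 0 < al ->
  al * rp n.+1%:R (- (1 + al)) <= rp n%:R (- al) - rp n.+1%:R (- al).
Proof.
move=> n0 al0; have n0' : (0 : R) < n%:R by rewrite ltr0n.
have n1 : (0 : R) < n.+1%:R by rewrite ltr0n.
have E : rp n%:R (- al) = rp n.+1%:R (- al) * expR (al * (ln n.+1%:R - ln n%:R)).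
  by rewrite /rp -expRD; congr expR; ring.
rewrite E opprD rpD rpN1 //.
have h : n.+1%:R^-1 <= ln n.+1%:R - ln n%:R :> R.
  rewrite -ln_div ?posrE // -[X in _ <= X]opprK -lnV ?posrE ?divr_gt0 // invf_div.
  have -> : n%:R / n.+1%:R = 1 + (- n.+1%:R^-1) :> R.
    by rewrite -[in RHS]natr1 -natr1; field; rewrite natr1 gt_eqF.
  rewrite lerNr; apply: le_ln1Dx; rewrite ltrN2 invf_lt1 // ltr1n; lia.
have := expR_ge1Dx (al * (ln n.+1%:R - ln n%:R)).
have := ler_wpM2l (ltW al0) h.
move=> h1 h2.
have h3 : al / n.+1%:R <= expR (al * (ln n.+1%:R - ln n%:R)) - 1.
  by apply: le_trans h1 _; rewrite lerBrDl.
have := ler_wpM2l (rp_ge0 n.+1%:R (- al)) h3; rewrite [X in _ <= X -> _]mulrBr mulr1.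
by apply: le_trans; apply: le_eqr; ring.
Qed.

Lemma tail_rp (al : R) (m k : nat) : 0 < al -> (0 < m)%N -> (m <= k)%N ->
  \sum_(m <= n < k) rp n.+1%:R (- (1 + al)) <= al^-1 * rp m%:R (- al).
Proof.
move=> al0 m0 mk.
apply: le_trans (_ : al^-1 * (rp m%:R (- al) - rp k%:R (- al)) <= _); last first.
  apply: ler_wpM2l; first by rewrite invr_ge0 ltW.
  by have := rp_ge0 k%:R (- al); lra.
have -> : rp m%:R (- al) - rp k%:R (- al) = \sum_(m <= n < k) (rp n%:R (- al) - rp n.+1%:R (- al)).
  by under eq_bigr do rewrite -opprB; rewrite sumrN telescope_sumr // opprB.
rewrite mulr_sumr !big_nat; apply: ler_sum => n /andP[mn _].
rewrite ler_pdivlMl //; apply: le_rp_succ => //; exact: leq_trans mn.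
Qed.

Lemma sum_rp (al : R) (k : nat) : 0 < al -> \sum_(0 <= n < k) rp n.+1%:R (- (1 + al)) <= 1 + al^-1.
Proof.
move=> al0; have ai : 0 <= al^-1 by rewrite invr_ge0 ltW.
case: k => [|k]; first by rewrite big_nil; lra.
rewrite big_ltn // rp_1 lerD2l; have := @tail_rp al 1 k.+1 al0 isT isT.
by rewrite rp_1 mulr1.
Qed.

(* Euler-Maclaurin on [[n, n + 1]]: zeta(s) (s - 1) = 1 + s (s - 1) sum_n phi n s
   for Re s > 0. *)
Definition phi (n : nat) s : C := cint (fun z => (1 - z) * xp (n%:R + complex.Re z) (s + 1)) 0 1.
Definition phi' (n : nat) s : C :=
  cint (fun z => - (ln (n%:R + complex.Re z))%:C * ((1 - z) * xp (n%:R + complex.Re z) (s + 1))) 0 1.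

Let bs := bdd_seg (0 : R) 1.
Local Notation S01 := (seg (0 : R) 1).

Lemma qhol_ln (n : nat) : (0 < n)%N -> qhol S01 (fun z => (ln (n%:R + complex.Re z))%:C) (fun z => (n%:R + complex.Re z)^-1%:C).
Proof.
move=> n0; have n1 : (1 : R) <= n%:R by rewrite ler1n.
exists 1 => // _ _ /segP[x /andP[x0 x1] ->] /segP[y /andP[y0 y1] ->] /=.
have h := @ln_quad (n%:R + x) (n%:R + y).
rewrite -!rmorphB -rmorphM -rmorphB !cabs_real mul1r real_normK ?num_real //.
have -> : y - x = (n%:R + y) - (n%:R + x) by ring.
by apply: h; lra.
Qed.
Lemma qhol_xp (n : nat) s : (0 < n)%N ->
  qhol S01 (fun z => xp (n%:R + complex.Re z) s) (fun z => - s * xp (n%:R + complex.Re z) (s + 1)).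
Proof.
move=> n0; have n1 : (1 : R) <= n%:R by rewrite ler1n.
apply: qhol_ext (qhol_cexpc bs (qholZ (- s) bs (qhol_ln n0))).
  by move=> z _; rewrite /xp mulNr.
move=> _ /segP[x /andP[x0 x1] ->] /=.
have p : 0 < n%:R + x by lra.
by rewrite xpD xpp1 // /xp mulNr; ring.
Qed.
Lemma lip_ln (n : nat) : (0 < n)%N -> lipon S01 (fun z => (ln (n%:R + complex.Re z))%:C).
Proof. by move=> n0; exact: qhol_lip bs (qhol_ln n0). Qed.
Lemma lip_xp (n : nat) s : (0 < n)%N -> lipon S01 (fun z => (1 - z) * xp (n%:R + complex.Re z) s).
Proof.
move=> n0; apply: lipM => //; last exact: qhol_lip bs (qhol_xp s n0).
by apply: lipB => //; [exact: lip_cst|exact: lip_id].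
Qed.
Lemma lip_xp' (n : nat) s : (0 < n)%N ->
  lipon S01 (fun z => - (ln (n%:R + complex.Re z))%:C * ((1 - z) * xp (n%:R + complex.Re z) s)).
Proof.
move=> n0; apply: lipM => //; last exact: lip_xp.
by apply: lip_ext (lipZ (-1) bs (lip_ln n0)) => z _; rewrite mulN1r.
Qed.

Lemma phiE (n : nat) s : (0 < n)%N ->
  (s - 1) * xp n%:R s + xp n.+1%:R (s - 1) - xp n%:R (s - 1) = s * (s - 1) * phi n s.
Proof.
move=> n0.
have q1 := qhol_xp s n0; have q2 := qhol_xp (s - 1) n0.
have q3 := qholD (qhol_cst S01 1) (qholZ (-1) bs (qhol_id S01)).
(* With x = n + z, the function (1 - s)(1 - z) x^(-s) + x^(1 - s) has derivative s (s - 1)(1 - z)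
   x^(-s - 1): an integration by parts in closed form. *)
have q := qholD (qholZ (- (s - 1)) bs (qholM bs q3 q1)) q2.
rewrite -cintZ ?ler01 //; last exact: lip_xp.
have := cint_FTC ler01 q; rewrite /= addr0 mulr0 addr0 !mulr1 subrr mul0r mulr0 add0r natr1 mul1r => h.
have -> : (s - 1) * xp n%:R s + xp n.+1%:R (s - 1) - xp n%:R (s - 1) =
  xp n.+1%:R (s - 1) - (- (s - 1) * xp n%:R s + xp n%:R (s - 1)) by ring.
rewrite add0r in h; rewrite -h; apply: cint_eq; first exact: ler01.
by move=> z _; rewrite subrK; ring.
Qed.

Lemma partial_Z (N : nat) s :
  (s - 1) * (\sum_(1 <= n < N.+1) xp n%:R s) + xp N.+1%:R (s - 1) =
  1 + s * (s - 1) * \sum_(1 <= n < N.+1) phi n s.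
Proof.
elim: N => [|N IH]; first by rewrite !big_nil !mulr0 xp1 add0r addr0.
rewrite big_nat_recr //= [X in 1 + s * (s - 1) * X]big_nat_recr //=.
have p := phiE s (ltn0Sn N).
have -> : 1 + s * (s - 1) * (\sum_(1 <= n < N.+1) phi n s + phi N.+1 s) =
  (1 + s * (s - 1) * \sum_(1 <= n < N.+1) phi n s) + s * (s - 1) * phi N.+1 s by ring.
by rewrite -IH -p; ring.
Qed.

Lemma xp_le (n : nat) s x : (0 < n)%N -> 0 <= x -> 0 <= complex.Re s -> cabs (xp (n%:R + x) s) <= rp n%:R (- complex.Re s).
Proof.
move=> n0 x0 s0; rewrite cabs_xp; apply: rp_antib; rewrite ?ltr0n //; lra.
Qed.

Lemma phi_le (n : nat) s : (0 < n)%N -> 0 <= complex.Re s -> cabs (phi n s) <= rp n%:R (- (1 + complex.Re s)).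
Proof.
move=> n0 s0; have n1 : (1 : R) <= n%:R by rewrite ler1n.
apply: le_trans (cint_bound (M := rp n%:R (- (1 + complex.Re s))) _ _ _) _; rewrite ?ler01 //.
- exact: lip_xp.
- move=> x /andP[x0 x1]; rewrite cabsM -[leRHS]mul1r; apply: ler_pM; rewrite ?cabs_ge0 //.
    by rewrite -rmorphB cabs_pos; lra.
  have := @xp_le n (s + 1) x n0 x0; rewrite ReD /= addrC; apply; lra.
- by rewrite subr0 mulr1.
Qed.

Lemma ln_le_rp x d : 0 < d -> ln x <= d^-1 * rp x d.
Proof.
move=> d0; rewrite ler_pdivlMl //; have := expR_ge1Dx (d * ln x); rewrite /rp; lra.
Qed.

Lemma sqln_le_rp x d : 1 <= x -> 0 < d -> (ln x) ^+ 2 <= (2 / d) ^+ 2 * rp x d.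
Proof.
move=> x1 d0; have -> : rp x d = rp x (d / 2) ^+ 2 by rewrite -rpX; congr rp; field.
rewrite -exprMn; apply: lerXn2r; rewrite ?nnegrE ?ln_ge0 //.
  by rewrite mulr_ge0 ?rp_ge0 // divr_ge0 // ltW.
apply: le_trans (ln_le_rp x (_ : 0 < d / 2)) _; first by lra.
by rewrite invf_div.
Qed.

(** On the segment from [b] to [b + a] the modulus of exp is largest at an end, so a bound at both
    ends replaces [emax]. *)
Lemma cexp_quad_at (b a : C) m : expR (complex.Re b) <= m -> expR (complex.Re (b + a)) <= m ->
  cabs (cexp b * (cexp a - 1 - a)) <= cabs a ^+ 2 * m.
Proof.
move=> h1 h2; rewrite cabsM cabs_cexp; apply: le_trans (ler_wpM2l (expR_ge0 _) (cexp_quad _)) _.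
rewrite mulrCA; apply: ler_wpM2l; first by apply: exprn_ge0; exact: cabs_ge0.
rewrite /emax; have [h|h] := leP 1 (expR (complex.Re a)); last by rewrite mulr1.
by rewrite -expRD -ReD.
Qed.

(** Two derivatives in [s] produce the square of ln (n + x). Half of [sg] is spent on absorbing it
    by (n + x)^(sg / 2), and n^(-1 - sg / 2) remains summable. *)
Lemma phi_quad (n : nat) sg z w : (0 < n)%N -> 0 < sg -> sg <= complex.Re z -> sg <= complex.Re w ->
  cabs (phi n w - phi n z - (w - z) * phi' n z) <=
   ((4 / sg) ^+ 2 * rp n%:R (- (1 + sg / 2))) * cabs (w - z) ^+ 2.
Proof.
move=> n0 sg0 hz hw; have n1 : (1 : R) <= n%:R by rewrite ler1n.
have l1 := lip_xp (w + 1) n0; have l2 := lip_xp (z + 1) n0; have l3 := lip_xp' (z + 1) n0.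
rewrite /phi /phi' -(cintB ler01 l1 l2) -(cintZ (w - z) ler01 l3).
rewrite -(cintB ler01 (lipB bs l1 l2) (lipZ (w - z) bs l3)).
apply: le_trans (cint_bound (M := (4 / sg) ^+ 2 * rp n%:R (- (1 + sg / 2)) * cabs (w - z) ^+ 2) ler01 _ _) _.
- exact: lipB bs (lipB bs l1 l2) (lipZ (w - z) bs l3).
- move=> x /andP[x0 x1]; have E : complex.Re x%:C = x by [].
  rewrite !E; set l := ln (n%:R + x).
  have nx : 1 <= n%:R + x by lra.
  have l0 : 0 <= l by exact: ln_ge0.
  have -> : (1 - x%:C) * xp (n%:R + x) (w + 1) - (1 - x%:C) * xp (n%:R + x) (z + 1) - (w - z) * (- l%:C * ((1 - x%:C) * xp (n%:R + x) (z + 1))) =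
     (1 - x)%:C * (cexp (- ((z + 1) * l%:C)) * (cexp (- ((w - z) * l%:C)) - 1 - - ((w - z) * l%:C))).
    have -> : xp (n%:R + x) (w + 1) = cexp (- ((z + 1) * l%:C)) * cexp (- ((w - z) * l%:C)).
      by rewrite /xp -cexpD; congr cexp; rewrite -/l; ring.
    by rewrite /xp -/l rmorphB; ring.
  have nm s : sg <= complex.Re s -> expR (complex.Re (- ((s + 1) * l%:C))) <= expR (- (1 + sg) * l).
    by move=> hs; rewrite ler_expR ReN ReM ReD /=; nra.
  rewrite cabsM -[leRHS]mul1r; apply: ler_pM; rewrite ?cabs_ge0 //; first by rewrite cabs_pos; lra.
  apply: le_trans (cexp_quad_at (nm z hz) _) _.
    have -> : - ((z + 1) * l%:C) + - ((w - z) * l%:C) = - ((w + 1) * l%:C) by ring.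
    exact: nm.
  rewrite cabsN cabsM cabs_pos // exprMn [leRHS]mulrC -mulrA; apply: ler_wpM2l.
    by apply: exprn_ge0; exact: cabs_ge0.
  have h := sqln_le_rp nx (_ : 0 < sg / 2); rewrite -/l in h.
  have {h} : l ^+ 2 <= (4 / sg) ^+ 2 * rp (n%:R + x) (sg / 2).
    have -> : 4 / sg = 2 / (sg / 2) by field; rewrite gt_eqF.
    by apply: h; lra.
  move=> h; apply: le_trans (ler_wpM2r (expR_ge0 _) h) _.
  rewrite -mulrA; apply: ler_wpM2l; first exact: sqr_ge0.
  rewrite /rp -/l -expRD; have -> : sg / 2 * l + - (1 + sg) * l = (- (1 + sg / 2)) * l by field.
  apply: rp_antib; lra.
- by rewrite subr0 mulr1.
Qed.

Lemma phi'_le (n : nat) s sg : (0 < n)%N -> 0 < sg -> sg <= complex.Re s -> cabs (phi' n s) <= (2 / sg) * rp n%:R (- (1 + sg / 2)).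
Proof.
move=> n0 sg0 hs; have n1 : (1 : R) <= n%:R by rewrite ler1n.
apply: le_trans (cint_bound (M := (2 / sg) * rp n%:R (- (1 + sg / 2))) ler01 (lip_xp' _ n0) _) _; last by rewrite subr0 mulr1.
move=> x /andP[x0 x1]; have E : complex.Re x%:C = x by [].
have nx : 1 <= n%:R + x by lra.
have l0 := ln_ge0 nx.
rewrite !E cabsM cabsN cabs_pos // cabsM -rmorphB cabs_pos ?subr_ge0 // cabs_xp ReD /=.
have h1 : ln (n%:R + x) <= 2 / sg * rp (n%:R + x) (sg / 2).
  have := @ln_le_rp (n%:R + x) (sg / 2) _; rewrite invf_div; apply; lra.
have h2 : rp (n%:R + x) (- (complex.Re s + 1)) <= rp (n%:R + x) (- (1 + sg)) by apply: rp_monoe; lra.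
have h3 : rp (n%:R + x) (- (1 + sg / 2)) <= rp n%:R (- (1 + sg / 2)) by apply: rp_antib; lra.
apply: le_trans (_ : (2 / sg * rp (n%:R + x) (sg / 2)) * rp (n%:R + x) (- (1 + sg)) <= _).
  apply: ler_pM => //; first by rewrite mulr_ge0 ?rp_ge0 // subr_ge0.
  rewrite -[leRHS]mul1r; apply: ler_pM; rewrite ?rp_ge0 ?subr_ge0 //; lra.
rewrite -mulrA -rpD; apply: ler_wpM2l; first by rewrite divr_ge0 // ltW.
by have -> : sg / 2 + - (1 + sg) = - (1 + sg / 2) by field.
Qed.

Definition clim (u : nat -> C) l := forall e : R, 0 < e -> exists N, forall n, (N <= n)%N -> cabs (u n - l) <= e.

Lemma clim_uniq u l l' : clim u l -> clim u l' -> l = l'.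
Proof.
move=> h h'; apply/eqP; rewrite -subr_eq0; apply/eqP/cabs_eq0/le_anti; rewrite cabs_ge0 andbT leNgt; apply/negP => p.
have e0 : 0 < cabs (l - l') / 3 by lra.
have [N hN] := h _ e0; have [M hM] := h' _ e0.
have := hN _ (leq_maxl N M); have := hM _ (leq_maxr N M).
set v := u _; have : cabs (l - l') <= cabs (v - l') + cabs (v - l).
  have -> : l - l' = (v - l') - (v - l) by ring.
  exact: cabsB.
lra.
Qed.

Lemma rp_small al e : 0 < al -> 0 < e -> exists N : nat, forall n : nat, (N <= n)%N -> rp n%:R (- al) <= e.
Proof.
move=> al0 e0.
have [N hN] : exists N : nat, expR (- (ln e) / al) <= N%:R.
  by exists (Num.bound (expR (- ln e / al))); apply/ltW/archi_boundP/expR_ge0.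
exists N => n Nn.
have nn : expR (- (ln e) / al) <= n%:R by apply: le_trans hN _; rewrite ler_nat.
have n0 : (0 : R) < n%:R by apply: lt_le_trans nn; exact: expR_gt0.
rewrite -[leRHS]lnK ?posrE // /rp ler_expR mulNr lerNl.
have : ln (expR (- ln e / al)) <= ln (n%:R : R) by rewrite ler_ln ?posrE // expR_gt0.
by rewrite expRK ler_pdivrMr // mulrC.
Qed.

Lemma clim_tail u l (c al : R) m0 : 0 < al -> 0 <= c ->
  (forall m, (m0 <= m)%N -> cabs (u m - l) <= c * rp m%:R (- al)) -> clim u l.
Proof.
move=> al0 c0 H e e0; have [|N hN] := @rp_small al (e / (c + 1)) al0; first by apply: divr_gt0 => //; lra.
exists (maxn m0 N) => n; rewrite geq_max => /andP[h1 h2]; apply: le_trans (H _ h1) _.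
apply: le_trans (ler_wpM2l c0 (hN _ h2)) _.
have c1 : 0 < c + 1 by lra.
by rewrite mulrA ler_pdivrMr //; nra.
Qed.

Lemma dir_sum (f : nat -> C) (c al : R) : 0 < al -> 0 <= c -> 
  (forall n, (0 < n)%N -> cabs (f n) <= c * rp n%:R (- (1 + al))) ->
  exists l, forall m, (0 < m)%N -> cabs (\sum_(1 <= n < m.+1) f n - l) <= (2 * c / al) * rp m%:R (- al).
Proof.
move=> al0 c0 H.
have [|l hl] := @nested_limC (fun m => \sum_(1 <= n < m.+1) f n) (fun m => c * (al^-1 * rp m%:R (- al))) 1%N.
  move=> m k m0 mk; rewrite (@big_cat_nat _ _ _ m.+1 1 k.+1) //= addrAC subrr add0r.
  apply: le_trans (cabs_sum _ _ _) _.
  apply: le_trans (_ : \sum_(m <= n < k) c * rp n.+1%:R (- (1 + al)) <= _).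
    by rewrite big_add1 /= !big_nat; apply: ler_sum => n _; exact: H.
  by rewrite -mulr_sumr; apply: ler_wpM2l => //; exact: tail_rp.
by exists l => m hm; apply: le_trans (hl m hm) _; apply: le_eqr; field; rewrite gt_eqF.
Qed.

(** For [0 < Re s] both this series and that of [Psi'] converge ([Psi_clim], [Psi'_clim]), so the
    default value 0 does not enter there. *)
Definition Psi s : C := xget 0 [set l | clim (fun m => \sum_(1 <= n < m.+1) phi n s) l]%classic.
Definition Psi' s : C := xget 0 [set l | clim (fun m => \sum_(1 <= n < m.+1) phi' n s) l]%classic.

Lemma xget_clim u l : clim u l -> xget 0 [set l | clim u l]%classic = l.
Proof. by move=> h; case: xgetP => [y _ /= hy|/(_ l)//]; exact: clim_uniq hy h. Qed.

Lemma Psi_tail s m : 0 < complex.Re s -> (0 < m)%N ->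
  cabs (\sum_(1 <= n < m.+1) phi n s - Psi s) <= (2 / complex.Re s) * rp m%:R (- complex.Re s).
Proof.
move=> s0 m0.
have [|l hl] := @dir_sum (phi^~ s) 1 _ s0 ler01.
  by move=> n n0; rewrite mul1r; apply: phi_le => //; exact: ltW.
have hl' k : (0 < k)%N -> cabs (\sum_(1 <= n < k.+1) phi n s - l) <= (2 / complex.Re s) * rp k%:R (- complex.Re s).
  by move=> k0; have := hl k k0; rewrite mulr1.
have -> : Psi s = l; last exact: hl'.
apply: xget_clim; apply: clim_tail hl' => //; by rewrite divr_ge0 // ltW.
Qed.

Lemma Psi'_clim s : 0 < complex.Re s -> clim (fun m => \sum_(1 <= n < m.+1) phi' n s) (Psi' s).
Proof.
move=> s0; have s2 : 0 < complex.Re s / 2 by lra.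
have c0 : 0 <= 2 / complex.Re s by rewrite divr_ge0 // ltW.
have [|l hl] := @dir_sum (phi'^~ s) (2 / complex.Re s) _ s2 c0.
  by move=> n n0; apply: phi'_le.
have h : clim (fun m => \sum_(1 <= n < m.+1) phi' n s) l.
  by apply: clim_tail hl => //; rewrite !mulr_ge0 // ?invr_ge0 ltW.
by rewrite /Psi' (xget_clim h).
Qed.
Lemma Psi_clim s : 0 < complex.Re s -> clim (fun m => \sum_(1 <= n < m.+1) phi n s) (Psi s).
Proof.
move=> s0; apply: (@clim_tail _ _ (2 / complex.Re s) _ 1%N s0); first by rewrite divr_ge0 // ltW.
by move=> m; exact: Psi_tail.
Qed.

#[local] Opaque Psi Psi' phi phi'.

Lemma qhol_Psi (sg : R) : 0 < sg -> qhol (fun z => sg <= complex.Re z) Psi Psi'.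
Proof.
move=> sg0; pose K := (4 / sg) ^+ 2 * (1 + (sg / 2)^-1).
have s2 : 0 < sg / 2 by lra.
exists K; first by rewrite mulr_ge0 ?sqr_ge0 // addr_ge0 // invr_ge0 ltW.
move=> z w hz hw.
have z0 : 0 < complex.Re z by lra. have w0 : 0 < complex.Re w by lra.
(* The three series are approximated at one common index within 1 / (n + 1); 2 + |w - z| is the
   total weight with which these errors occur. *)
apply: (@le_add_eps _ _ _ (2 + cabs (w - z))) => n.
have e0 : (0 : R) < n.+1%:R^-1 by rewrite invr_gt0 ltr0n.
have [N1 h1] := Psi_clim z0 e0; have [N2 h2] := Psi_clim w0 e0; have [N3 h3] := Psi'_clim z0 e0.
set N := maxn N1 (maxn N2 N3).
have {}h1 := h1 N (leq_maxl _ _).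
have {}h2 := h2 N (leq_trans (leq_maxl _ _) (leq_maxr _ _)).
have {}h3 := h3 N (leq_trans (leq_maxr _ _) (leq_maxr _ _)).
set A1 := \sum_(1 <= n < N.+1) _ in h1; set A2 := \sum_(1 <= n < N.+1) _ in h2; set A3 := \sum_(1 <= n < N.+1) _ in h3.
have hA : cabs (A2 - A1 - (w - z) * A3) <= K * cabs (w - z) ^+ 2.
  rewrite /A1 /A2 /A3 mulr_sumr -!sumrB.
  apply: le_trans (cabs_sum _ _ _) _.
  apply: le_trans (_ : \sum_(0 <= i < N) ((4 / sg) ^+ 2 * rp i.+1%:R (- (1 + sg / 2))) * cabs (w - z) ^+ 2 <= _).
    by rewrite big_add1 /= !big_nat; apply: ler_sum => i _; exact: phi_quad.
  rewrite -mulr_suml -mulr_sumr; apply: ler_wpM2r; first by apply: exprn_ge0; exact: cabs_ge0.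
  by apply: ler_wpM2l; [exact: sqr_ge0|exact: sum_rp].
clearbody A1 A2 A3.
move: (Psi w) (Psi z) (Psi' z) h1 h2 h3 => pw pz pz' h1 h2 h3.
have -> : pw - pz - (w - z) * pz' = (A2 - A1 - (w - z) * A3) + ((A1 - pz) - (A2 - pw) + (w - z) * (A3 - pz')) by ring.
apply: cabs_leD => //; apply: le_trans (cabsD _ _) _; rewrite [leRHS]mulrDl; apply: lerD.
  by apply: le_trans (cabsB _ _) (le_trans (lerD h1 h2) _); apply: le_eqr; ring.
by rewrite cabsM; apply: ler_wpM2l => //; exact: cabs_ge0.
Qed.

(* [zetaX s] is [(s - 1) * zeta(s)], continued to Re s > 0. *)
Definition zetaX s : C := 1 + s * (s - 1) * Psi s.
Definition zetaX' s : C := (2 * s - 1) * Psi s + s * (s - 1) * Psi' s.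

Lemma qhol_zetaX U (sg : R) : bdd U -> 0 < sg -> (forall z, U z -> sg <= complex.Re z) -> qhol U zetaX zetaX'.
Proof.
move=> bU sg0 hU; have qP := qhol_sub hU (qhol_Psi sg0).
have q1 := qholM bU (qhol_id U) (qholD (qhol_id U) (qhol_cst U (-1))).
apply: qhol_ext (qholD (qhol_cst U 1) (qholM bU q1 qP)) => z _; rewrite /zetaX /zetaX' //.
by ring.
Qed.

Lemma zetaX_partial s N : 0 < complex.Re s -> (0 < N)%N ->
  cabs ((s - 1) * (\sum_(1 <= n < N.+1) xp n%:R s) + xp N.+1%:R (s - 1) - zetaX s) <=
   cabs s * cabs (s - 1) * ((2 / complex.Re s) * rp N%:R (- complex.Re s)).
Proof.
move=> s0 N0; rewrite partial_Z /zetaX.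
have -> : 1 + s * (s - 1) * (\sum_(1 <= n < N.+1) phi n s) - (1 + s * (s - 1) * Psi s) =
  s * (s - 1) * (\sum_(1 <= n < N.+1) phi n s - Psi s) by ring.
rewrite !cabsM; apply: ler_wpM2l; first by rewrite mulr_ge0 ?cabs_ge0.
exact: Psi_tail.
Qed.

Lemma zetaX1 : zetaX 1 = 1. Proof. by rewrite /zetaX subrr mulr0 mul0r addr0. Qed.

Lemma Psi_le (sg : R) s : 0 < sg -> sg <= complex.Re s -> cabs (Psi s) <= 1 + sg^-1.
Proof.
move=> sg0 hs; have s0 : 0 < complex.Re s by lra.
apply: (@le_add_eps _ _ _ 1) => n.
have e0 : (0 : R) < n.+1%:R^-1 by rewrite invr_gt0 ltr0n.
have [N h] := Psi_clim s0 e0; have {}h := h N (leqnn N).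
rewrite div1r; set A := \sum_(1 <= n < N.+1) _ in h.
have -> : Psi s = A - (A - Psi s) by ring.
apply: le_trans (cabsB _ _) _; apply: lerD => //.
apply: le_trans (cabs_sum _ _ _) _.
apply: le_trans (sum_rp N sg0); rewrite big_add1 /= !big_nat; apply: ler_sum => i _.
apply: le_trans (phi_le _ _) _ => //; first exact: ltW.
apply: rp_monoe; [by rewrite ler1n|lra].
Qed.

Lemma zetaX_le (sg : R) s : 0 < sg -> sg <= complex.Re s -> cabs (zetaX s) <= (2 + sg^-1) * (1 + cabs s) ^+ 2.
Proof.
move=> sg0 hs; have p := Psi_le sg0 hs; have s0 := cabs_ge0 s.
have i0 : 0 < sg^-1 by rewrite invr_gt0.
have h : cabs (s - 1) <= 1 + cabs s by apply: le_trans (cabsB _ _) _; rewrite cabs1 addrC.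
apply: le_trans (cabsD _ _) _; rewrite cabs1 !cabsM.
have h2 : cabs s * cabs (s - 1) * cabs (Psi s) <= (cabs s * (1 + cabs s)) * (1 + sg^-1).
  by apply: ler_pM; rewrite ?mulr_ge0 ?cabs_ge0 //; apply: ler_wpM2l.
have := mulr_ge0 s0 (ltW i0); nra.
Qed.

(** For Re s > 1 the boundary term (N + 1)^(1 - s) of [zetaX_partial] tends to 0, which identifies
    the sum of the Dirichlet series. *)
Lemma zeta_sum s N : 1 < complex.Re s -> (0 < N)%N ->
  cabs (\sum_(1 <= n < N.+1) xp n%:R s - zetaX s / (s - 1)) <= (2 / (complex.Re s - 1)) * rp N%:R (- (complex.Re s - 1)).
Proof.
move=> s1 N0; have a0 : 0 < complex.Re s - 1 by lra.
have s0 : 0 < complex.Re s by lra.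
have sm : s - 1 != 0.
  by apply: contraTneq a0 => h; have := congr1 (@complex.Re R) h; rewrite ReB /= => ->; rewrite ltxx.
have [|l hl] := @dir_sum (fun n => xp n%:R s) 1 _ a0 ler01.
  move=> n n0; rewrite mul1r cabs_xp; apply: rp_monoe; [by rewrite ler1n|lra].
have cl : clim (fun m => \sum_(1 <= n < m.+1) xp n%:R s) l.
  by apply: clim_tail hl => //; rewrite mulr1 divr_ge0 // ltW.
have -> : zetaX s / (s - 1) = l; last by have := hl N N0; rewrite mulr1.
apply: clim_uniq cl.
pose cc := cabs s * (2 / complex.Re s) + cabs (s - 1)^-1.
apply: (@clim_tail _ _ cc _ 1%N a0).
  by apply: addr_ge0; [apply: mulr_ge0|]; rewrite ?cabs_ge0 //; apply: divr_ge0 => //; exact: ltW.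
move=> m m0; have h := zetaX_partial s0 m0.
set A := \sum_(1 <= n < m.+1) _ in h *.
have -> : A - zetaX s / (s - 1) = ((s - 1) * A + xp m.+1%:R (s - 1) - zetaX s) / (s - 1) - xp m.+1%:R (s - 1) / (s - 1).
  by field.
apply: le_trans (cabsB _ _) _; rewrite /cc [leRHS]mulrDl; apply: lerD; rewrite cabsM.
  rewrite cabsV ler_pdivrMr ?cabs_gt0 //; apply: le_trans h _.
  have m1 : (1 : R) <= m%:R by rewrite ler1n.
  have : rp m%:R (- complex.Re s) <= rp m%:R (- (complex.Re s - 1)) by apply: rp_monoe; lra.
  move=> hr; apply: le_trans (_ : cabs s * cabs (s - 1) * (2 / complex.Re s * rp m%:R (- (complex.Re s - 1))) <= _); last by apply: le_eqr; ring.
  apply: ler_wpM2l; first by rewrite mulr_ge0 ?cabs_ge0.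
  by apply: ler_wpM2l => //; rewrite divr_ge0 // ltW.
rewrite mulrC; apply: ler_wpM2l; first exact: cabs_ge0.
rewrite cabs_xp ReB /=; apply: rp_antib; rewrite ?ltr0n ?ler_nat //; lra.
Qed.
End Zeta.
Global Opaque Psi Psi' phi phi' zetaX zetaX'.

Lemma sum_dvd_reindex (V : nmodType) (F : nat -> V) (k N : nat) : (0 < k)%N ->
  \sum_(1 <= n < N.+1 | (k %| n)%N) F n = \sum_(1 <= m < (N %/ k).+1) F (k * m)%N.
Proof.
move=> k0; elim: N => [|N IH]; first by rewrite div0n !big_nil.
rewrite big_mkcond big_nat_recr //= -big_mkcond IH divnS //.
case: (boolP (k %| N.+1)%N) => kN; last by rewrite addr0.
rewrite add1n [in RHS]big_nat_recr //=; congr (_ + F _).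
by rewrite -(divnK kN) divnS // kN add1n mulnC.
Qed.

(** * Zero-free half-plane *)

Section NonVanishing.
Variable R : realType.
Local Notation C := R[i].
Local Notation ii := (@ii R).
Implicit Types (s z w : C) (x y a b r T M B t A : R) (F G f g : C -> C) (U V : C -> Prop).

Lemma normE z : `|z| = (cabs z)%:C.
Proof. by rewrite normc_def. Qed.

Lemma gt0_complex (e : C) : 0 < e -> exists2 r : R, 0 < r & e = r%:C.
Proof. by case: e => a b; rewrite ltcE /= => /andP[/eqP -> ?]; exists a. Qed.

(** Passage from the quadratic error notion to [derivable], in which the hypothesis [GRH] is
    expressed. *)
Lemma quad_derivable f s d K rho : 0 < rho -> 0 <= K ->
  (forall h, cabs h <= rho -> cabs (f (s + h) - f s - h * d) <= K * cabs h ^+ 2) ->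
  derivable (f : C^o -> C^o) s 1.
Proof.
move=> rho0 K0 H; apply/cvg_ex; exists (d : C^o); apply/cvgrPdist_le => e /gt0_complex[r r0 ->].
have q0 : 0 < Num.min rho (r / (K + 1)).
  by rewrite lt_min rho0 divr_gt0 //; lra.
near=> h.
have h0 : h != 0 by near: h; exact: nbhs_dnbhs_neq.
have hq : `|h| < (Num.min rho (r / (K + 1)))%:C.
  by near: h; apply: dnbhs0_lt; rewrite ltcR.
move: hq; rewrite normE ltcR lt_min => /andP[h1 h2].
have := H h (ltW h1); rewrite normE lecR /=.
have -> : (d : C) - h^-1 *: (f (h *: (1 : C) + s) - f s) = - (f (s + h) - f s - h * d) / h.
  have -> : (h *: (1 : C) + s : C) = s + h by rewrite addrC; congr (_ + _); exact: mulr1.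
  have -> : h^-1 *: (f (s + h) - f s) = h^-1 * (f (s + h) - f s) :> C by [].
  by field.
rewrite cabsM cabsN cabsV ler_pdivrMr ?cabs_gt0 // => /le_trans; apply.
rewrite expr2 mulrA; apply: ler_wpM2r; first exact: cabs_ge0.
have K1 : 0 < K + 1 by lra.
move: h2; rewrite ltr_pdivlMr //; have := cabs_ge0 h; nra.
Unshelve. all: by end_near. Qed.

Lemma clim_cvg (u : nat -> C) l : clim u l -> ((u : nat -> C^o) n @[n --> \oo] --> (l : C^o))%classic.
Proof.
move=> H; apply/cvgrPdist_le => e /gt0_complex[r r0 ->].
have [N hN] := H r r0; near=> n; rewrite normE lecR -cabsC; apply: hN; near: n; exact: nbhs_infty_ge.
Unshelve. all: by end_near. Qed.

Lemma zeta_clim s : 1 < complex.Re s -> clim (fun N => \sum_(1 <= n < N.+1) xp n%:R s) (zetaX s / (s - 1)).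
Proof.
move=> s1; have a0 : 0 < complex.Re s - 1 by lra.
apply: (@clim_tail _ _ _ (2 / (complex.Re s - 1)) _ 1%N a0); first by rewrite divr_ge0 // ltW.
by move=> m m0; exact: zeta_sum.
Qed.

Lemma trivial_character : dirichlet_character 1 (fun=> 1 : C).
Proof. by split=> [m n|n|n]; rewrite ?mulr1 // oner_neq0 coprimen1. Qed.

(** The instance of [GRH] that is used: modulus 1 and the trivial character. Around each [s != 1] a
    disc is taken that stays away from 1 and from the imaginary axis. *)
Lemma zeta_dirichlet_L : dirichlet_L (fun=> 1 : C) (fun s => zetaX s / (s - 1)).
Proof.
split=> s s0.
  move=> s1; have sm : 0 < cabs (s - 1) by apply: cabs_gt0; rewrite subr_eq0.
  pose rho := Num.min (complex.Re s / 2) (cabs (s - 1) / 2).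
  have r0 : 0 < rho by rewrite lt_min !divr_gt0.
  have [r1 r2] : rho <= complex.Re s / 2 /\ rho <= cabs (s - 1) / 2.
    by split; rewrite ge_min lexx ?orbT.
  pose U z := cabs (z - s) <= rho.
  have bU : bdd U.
    exists (rho + cabs s) => z hz; have -> : z = (z - s) + s by ring.
    by apply: cabs_leD.
  have sg0 : 0 < complex.Re s / 2 by lra.
  have hU z : U z -> complex.Re s / 2 <= complex.Re z.
    move=> hz; have := le_trans (cabs_Re (z - s)) hz; rewrite ReB ler_norml => /andP[]; lra.
  have hm z : U z -> cabs (s - 1) / 2 <= cabs (z - 1).
    move=> hz; have -> : z - 1 = (s - 1) + (z - s) by ring.
    apply: le_trans (cabs_lower _ _); move: hz; rewrite /U; lra.
  have q1 := qhol_zetaX bU sg0 hU.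
  have q2 := qholV bU (_ : 0 < cabs (s - 1) / 2) hm (qholD (qhol_id U) (qhol_cst U (-1))).
  have := qholM bU q1 (q2 _); case=> [|K K0 HK]; first by lra.
  apply: (quad_derivable r0 K0) => h hr.
  have := HK s (s + h); rewrite /U subrr cabs0 addrAC subrr add0r; apply => //; exact: ltW.
apply: clim_cvg => e e0; have [N hN] := zeta_clim s0 e0; exists N => n /hN.
congr (cabs (_ - _) <= _); rewrite !big_nat; apply: eq_bigr => i /andP[i0 _].
by rewrite mul1r nat_cpow_oppE.
Qed.

(* Sieving the primes below [k] out of the Dirichlet series gives the partial
   Euler product without any infinite product. *)
Definition rough (k n : nat) := [forall p : 'I_k, prime p ==> ~~ (p %| n)%N].

Lemma roughP k n : reflect (forall p, (p < k)%N -> prime p -> ~~ (p %| n)%N) (rough k n).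
Proof.
apply: (iffP forallP) => [H p pk pp|H p]; first by have := H (Ordinal pk); rewrite pp.
by apply/implyP; exact: H.
Qed.
Lemma rough0 n : rough 0 n. Proof. by apply/roughP. Qed.
Lemma rough1 k : rough k 1.
Proof. by apply/roughP => p _ pp; rewrite dvdn1; case: p pp => [|[]]. Qed.
Lemma roughS k n : rough k.+1 n = rough k n && (prime k ==> ~~ (k %| n)%N).
Proof.
apply/roughP/andP => [H|[/roughP H /implyP K] p].
  by split; [apply/roughP => p pk; apply: H; exact: ltnW|apply/implyP; exact: H].
by rewrite ltnS leq_eqVlt => /orP[/eqP ->|]; [exact: K|exact: H].
Qed.
Lemma rough_mul k n : prime k -> rough k (k * n) = rough k n.
Proof.
move=> pk; apply/roughP/roughP => H p hp pp; have := H p hp pp; rewrite Euclid_dvdM //.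
  by rewrite negb_or => /andP[].
move=> h; rewrite negb_or h andbT dvdn_prime2 //; by rewrite ltn_eqF.
Qed.
Lemma rough_lt k n : (1 < n)%N -> (n < k)%N -> rough k n = false.
Proof.
move=> n1 nk; apply/negP => /roughP H.
have lt : (pdiv n < k)%N by apply: leq_ltn_trans nk; apply: pdiv_leq; exact: ltnW.
by have := H _ lt (pdiv_prime n1); rewrite pdiv_dvd.
Qed.

Definition rough_sum k s (N : nat) : C := \sum_(1 <= n < N.+1) (rough k n)%:R * xp n%:R s.
Definition rough_prod k s : C := \prod_(p < k | prime p) (1 - xp p%:R s).

Lemma ePS k s : rough_prod k.+1 s = rough_prod k s * (if prime k then 1 - xp k%:R s else 1).
Proof. by rewrite /rough_prod big_mkcond big_ord_recr /= -big_mkcond. Qed.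

(** Among the integers without prime factor below [k], the multiples of the prime [k] are exactly
    [k] times such integers ([rough_mul]); removing them multiplies the series by 1 - k^(-s). *)
Lemma T_S k s N : prime k -> rough_sum k.+1 s N = rough_sum k s N - xp k%:R s * rough_sum k s (N %/ k).
Proof.
move=> pk; have k0 := prime_gt0 pk.
have -> : xp k%:R s * rough_sum k s (N %/ k) = \sum_(1 <= n < N.+1 | (k %| n)%N) (rough k n)%:R * xp n%:R s.
  rewrite sum_dvd_reindex // /rough_sum mulr_sumr !big_nat; apply: eq_bigr => m /andP[m0 _].
  by rewrite rough_mul // natrM xpM ?ltr0n //; ring.
rewrite [X in _ - X]big_mkcond -sumrB; apply: eq_bigr => n _.
rewrite roughS pk /=; case: (k %| n)%N; first by rewrite andbF mul0r subrr.
by rewrite andbT subr0.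
Qed.

Lemma T_clim k s : 1 < complex.Re s -> clim (rough_sum k s) (rough_prod k s * (zetaX s / (s - 1))).
Proof.
move=> s1; elim: k => [|k IH].
  rewrite /rough_prod big_ord0 mul1r => e e0; have [N hN] := zeta_clim s1 e0; exists N => n /hN.
  by congr (cabs (_ - _) <= _); apply: eq_bigr => i _; rewrite rough0 mul1r.
rewrite ePS; case: ifP => pk; last first.
  rewrite mulr1 => e e0; have [N hN] := IH e e0; exists N => n /hN.
  by congr (cabs (_ - _) <= _); apply: eq_bigr => i _; rewrite roughS pk andbT.
have k0 := prime_gt0 pk.
move=> e e0; have e2 : 0 < e / 2 by lra.
(* Beyond [N * k] both [n] and [n %/ k] are at least [N]. *)
have [N hN] := IH _ e2; exists (N * k)%N => n hn.
rewrite T_S //; set l := rough_prod k s * _ in hN; set x := xp k%:R s.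
have -> : rough_prod k s * (1 - x) * (zetaX s / (s - 1)) = l - x * l by rewrite /l; ring.
have -> : rough_sum k s n - x * rough_sum k s (n %/ k) - (l - x * l) = (rough_sum k s n - l) - x * (rough_sum k s (n %/ k) - l) by ring.
have h1 : cabs (rough_sum k s n - l) <= e / 2 by apply: hN; apply: leq_trans hn; rewrite leq_pmulr.
have h2 : cabs (rough_sum k s (n %/ k) - l) <= e / 2 by apply: hN; rewrite leq_divRL.
have h3 : cabs x <= 1 by rewrite cabs_xp; apply: rp_le1; rewrite ?ler1n //; lra.
apply: le_trans (cabsB _ _) _; rewrite cabsM.
have := cabs_ge0 x; have := cabs_ge0 (rough_sum k s (n %/ k) - l); nra.
Qed.

(** After the primes below [k] are sieved out, the integers that remain are 1 and some that are at
    least [k], so the sum is 1 up to the tail of a convergent series. *)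
Lemma euler k s : 1 < complex.Re s -> (1 < k)%N ->
  cabs (rough_prod k s * (zetaX s / (s - 1)) - 1) <= (complex.Re s - 1)^-1 * rp k.-1%:R (- (complex.Re s - 1)).
Proof.
move=> s1 k1; have a0 : 0 < complex.Re s - 1 by lra.
apply: (@le_add_eps _ _ _ 1) => n.
have e0 : (0 : R) < n.+1%:R^-1 by rewrite invr_gt0 ltr0n.
have [N hN] := T_clim k s1 e0.
set M := maxn N k; have := hN M (leq_maxl _ _) => h.
set l := rough_prod k s * _ in h *.
have -> : l - 1 = (rough_sum k s M - 1) - (rough_sum k s M - l) by ring.
rewrite div1r; apply: le_trans (cabsB _ _) _; apply: lerD => //.
have kM : (k <= M)%N := leq_maxr _ _.
have k0 : (0 < k.-1)%N by case: (k) k1 => [|[]].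
rewrite /rough_sum big_ltn ?ltnS ?(leq_trans (ltnW k1)) // rough1 mul1r xp1 [1 + _]addrC addrK.
rewrite (@big_cat_nat _ _ _ k) //=; last exact: leq_trans kM _.
rewrite big_nat big1 ?add0r; last by move=> i /andP[i1 ik]; rewrite rough_lt // mul0r.
apply: le_trans (cabs_sum _ _ _) _.
apply: le_trans (_ : \sum_(k.-1 <= i < M) rp i.+1%:R (- (1 + (complex.Re s - 1))) <= _); last first.
  by apply: tail_rp => //; apply: leq_trans kM; exact: leq_pred.
rewrite -{1}(prednK (ltnW k1)) big_add1 /= !big_nat; apply: ler_sum => i _.
rewrite cabsM cabs_nat cabs_xp addrC subrK.
by case: (rough _ _); rewrite ?mul1r // mul0r rp_ge0.
Qed.

Lemma euler_ev s : 1 < complex.Re s -> exists K : nat, forall k, (K <= k)%N -> 1 / 2 <= cabs (rough_prod k s * (zetaX s / (s - 1))).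
Proof.
move=> s1; have a0 : 0 < complex.Re s - 1 by lra.
have [|N hN] := @rp_small R (complex.Re s - 1) ((complex.Re s - 1) / 2) a0; first by lra.
exists (N + 2)%N => k hk; have k1 : (1 < k)%N by apply: leq_trans hk; rewrite addn2.
have h := euler s1 k1.
have h2 : (complex.Re s - 1)^-1 * rp k.-1%:R (- (complex.Re s - 1)) <= 1 / 2.
  rewrite ler_pdivrMl //; have := hN k.-1 _; rewrite div1r; apply.
  by rewrite -ltnS (ltn_predK k1); apply: leq_trans hk; rewrite addn2.
have := cabs_lower 1 (rough_prod k s * (zetaX s / (s - 1)) - 1); rewrite subrKC cabs1; lra.
Qed.

Lemma zetaX_neq0_gt1 s : 1 < complex.Re s -> zetaX s != 0.
Proof.
move=> s1; have [K hK] := euler_ev s1; have := hK K (leqnn K).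
by apply: contraTneq => ->; rewrite mul0r mulr0 cabs0; lra.
Qed.

(* [1 + x <= exp x] on each factor turns the 3-4-1 product into
   exp (- 4 r (1 + cos)^2 + 8 r^2). *)
Lemma three_four_one r x : 0 <= r ->
  ((1 - r) ^+ 2) ^+ 3 * (1 - 2 * r * cos x + r ^+ 2) ^+ 4 * (1 - 2 * r * cos (2 * x) + r ^+ 2) <= expR (8 * r ^+ 2).
Proof.
move=> r0; set c := cos x.
have c2 : cos (2 * x) = 2 * c ^+ 2 - 1 by rewrite mulr_natl cos_mulr2n /c; ring.
have nn y : `|cos y| <= 1 -> 0 <= 1 - 2 * r * cos y + r ^+ 2.
  by rewrite ler_norml => /andP[h1 h2]; have := sqr_ge0 (1 - r); nra.
have n1 := nn _ (cos_max x); have n2 := nn _ (cos_max (2 * x)); rewrite -/c in n1.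
have e1 : (1 - r) ^+ 2 <= expR (- 2 * r + r ^+ 2).
  by apply: le_trans (expR_ge1Dx _); apply: le_eqr; ring.
have e2 : 1 - 2 * r * c + r ^+ 2 <= expR (- 2 * r * c + r ^+ 2).
  by apply: le_trans (expR_ge1Dx _); apply: le_eqr; ring.
have e3 : 1 - 2 * r * cos (2 * x) + r ^+ 2 <= expR (- 2 * r * (2 * c ^+ 2 - 1) + r ^+ 2).
  by apply: le_trans (expR_ge1Dx _); rewrite c2; apply: le_eqr; ring.
apply: le_trans (_ : expR (- 2 * r + r ^+ 2) ^+ 3 * expR (- 2 * r * c + r ^+ 2) ^+ 4 * expR (- 2 * r * (2 * c ^+ 2 - 1) + r ^+ 2) <= _).
    have n0 : 0 <= ((1 - r) ^+ 2) ^+ 3 by apply: exprn_ge0; exact: sqr_ge0.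
  have n4 : 0 <= (1 - 2 * r * c + r ^+ 2) ^+ 4 by exact: exprn_ge0.
  apply: ler_pM => //; first exact: mulr_ge0.
  by apply: ler_pM => //; apply: lerXn2r; rewrite ?nnegrE ?sqr_ge0 ?expR_ge0.
rewrite -!expRM_natl -!expRD ler_expR.
have := mulr_ge0 r0 (sqr_ge0 (1 + c)); nra.
Qed.

Lemma Re_xp x sg t : complex.Re (xp x (sg%:C + ii * t%:C)) = rp x (- sg) * cos (t * ln x) /\
  complex.Im (xp x (sg%:C + ii * t%:C)) = - (rp x (- sg) * sin (t * ln x)).
Proof.
rewrite /xp; set w := - _.
have e1 : complex.Re w = - sg * ln x by rewrite /w ReN ReM Re_line Im_line /=; ring.
have e2 : complex.Im w = - (t * ln x) by rewrite /w ImN ImM Re_line Im_line /=; ring.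
by rewrite /cexp ReZ ImZ e1 e2 /= cosN sinN mulrN.
Qed.

Lemma cabs_1xp (p : nat) sg t :
  cabs (1 - xp p%:R (sg%:C + ii * t%:C)) ^+ 2 = 1 - 2 * rp p%:R (- sg) * cos (t * ln p%:R) + rp p%:R (- sg) ^+ 2.
Proof.
have [e1 e2] := Re_xp p%:R sg t.
rewrite sqr_cabs ReB ImB e1 e2 /=; set c := cos _; set s := sin _; set r := rp _ _.
have h : c ^+ 2 + s ^+ 2 = 1 := cos2Dsin2 _.
have -> : (1 - r * c) ^+ 2 + (0 - - (r * s)) ^+ 2 = 1 - 2 * r * c + r ^+ 2 * (c ^+ 2 + s ^+ 2) by ring.
by rewrite h mulr1.
Qed.

Lemma eP_341 k sg t : 1 < sg ->
  cabs (rough_prod k sg%:C) ^+ 3 * cabs (rough_prod k (sg%:C + ii * t%:C)) ^+ 4 * cabs (rough_prod k (sg%:C + ii * (2 * t)%:C)) <= expR 8.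
Proof.
move=> s1.
(* After squaring, [three_four_one] bounds each factor by exp (8 p^(-2 sg)), and the sum of p^(-2
   sg) is at most 2: hence 16 = 8 * 2. *)
have e16 : expR 8 ^+ 2 = expR 16 :> R by rewrite -expRM_natl; congr expR; ring.
rewrite -ler_sqr ?nnegrE ?expR_ge0 ?mulr_ge0 ?exprn_ge0 ?cabs_ge0 // e16.
have E : (cabs (rough_prod k sg%:C) ^+ 3 * cabs (rough_prod k (sg%:C + ii * t%:C)) ^+ 4 * cabs (rough_prod k (sg%:C + ii * (2 * t)%:C))) ^+ 2 =
  \prod_(p < k | prime p) (((1 - rp p%:R (- sg)) ^+ 2) ^+ 3 * (1 - 2 * rp p%:R (- sg) * cos (t * ln p%:R) + rp p%:R (- sg) ^+ 2) ^+ 4 * (1 - 2 * rp p%:R (- sg) * cos (2 * (t * ln p%:R)) + rp p%:R (- sg) ^+ 2)).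
  rewrite /rough_prod !cabs_prod -!prodrXl -!big_split /= -prodrXl; apply: eq_bigr => p _.
  have c0 := cabs_1xp p sg 0; have c1 := cabs_1xp p sg t; have c2 := cabs_1xp p sg (2 * t).
  rewrite mul0r cos0 mulr1 in c0.
  have e0 : sg%:C + ii * 0%:C = sg%:C by apply: complexP; rewrite ?Re_line ?Im_line.
  rewrite e0 in c0; rewrite mulrA -c1 -c2.
  have -> : (1 - rp p%:R (- sg)) ^+ 2 = cabs (1 - xp p%:R sg%:C) ^+ 2 by rewrite c0; ring.
  by ring.
rewrite E.
apply: le_trans (_ : \prod_(p < k | prime p) expR (8 * rp p%:R (- sg) ^+ 2) <= _).
  apply: ler_prod => p _; apply/andP; split; last by apply: three_four_one; exact: rp_ge0.
  have h1 := cabs_1xp p sg t; have h2 := cabs_1xp p sg (2 * t).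
  rewrite -[2 * t * _]mulrA in h2; rewrite -h1 -h2.
  by apply: mulr_ge0; [apply: mulr_ge0|]; rewrite ?sqr_ge0 //; apply: exprn_ge0; exact: sqr_ge0.
rewrite -expR_sum ler_expR -mulr_sumr.
have : \sum_(p < k | prime p) rp p%:R (- sg) ^+ 2 <= 2 :> R.
  apply: le_trans (_ : \sum_(0 <= n < k) rp n.+1%:R (- (1 + 1)) <= _); last first.
    by apply: le_trans (sum_rp k ltr01) _; rewrite invr1.
  case: k {E} => [|k]; first by rewrite big_ord0 big_nil.
  rewrite big_mkcond big_ord_recl /= add0r big_mkord big_ord_recr /=.
  apply: le_trans (_ : \sum_(i < k) rp i.+1%:R (- (1 + 1)) <= _); last first.
    by rewrite lerDl rp_ge0.
  apply: ler_sum => i _; case: ifP => _; last exact: rp_ge0.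
  rewrite -rpX; apply: rp_monoe; first by rewrite ler1n.
  by rewrite /bump /=; lra.
lra.
Qed.

Definition zeta s := zetaX s / (s - 1).

(** For large [k] each Euler product times zeta has modulus at least 1/2, which gives the exponent 8
    = 3 + 4 + 1; [eP_341] bounds the Euler products themselves uniformly in [k]. *)
Lemma zeta_341 sg t : 1 < sg ->
  (1 / 2) ^+ 8 <= expR 8 * (cabs (zeta sg%:C) ^+ 3 * cabs (zeta (sg%:C + ii * t%:C)) ^+ 4 * cabs (zeta (sg%:C + ii * (2 * t)%:C))).
Proof.
move=> s1; pose z := zeta; rewrite -/z.
have [K1 h1] := @euler_ev sg%:C s1.
have [|K2 h2] := @euler_ev (sg%:C + ii * t%:C); first by rewrite Re_line.
have [|K3 h3] := @euler_ev (sg%:C + ii * (2 * t)%:C); first by rewrite Re_line.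
set k := (K1 + K2 + K3)%N.
have {}h1 := h1 k (leq_trans (leq_addr _ _) (leq_addr _ _)).
have {}h2 := h2 k (leq_trans (leq_addl _ _) (leq_addr _ _)).
have {}h3 := h3 k (leq_addl _ _).
have h := eP_341 k t s1.
rewrite -/(z _) cabsM in h1; rewrite -/(z _) cabsM in h2; rewrite -/(z _) cabsM in h3.
move: (cabs_ge0 (rough_prod k sg%:C)) (cabs_ge0 (z sg%:C)) (cabs_ge0 (rough_prod k (sg%:C + ii * t%:C))) (cabs_ge0 (z (sg%:C + ii * t%:C)))
  (cabs_ge0 (rough_prod k (sg%:C + ii * (2 * t)%:C))) (cabs_ge0 (z (sg%:C + ii * (2 * t)%:C))).
move: (cabs (rough_prod k sg%:C)) (cabs (z sg%:C)) (cabs (rough_prod k (sg%:C + ii * t%:C))) (cabs (z (sg%:C + ii * t%:C)))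
  (cabs (rough_prod k (sg%:C + ii * (2 * t)%:C))) (cabs (z (sg%:C + ii * (2 * t)%:C))) h h1 h2 h3 => p1 z1 p2 z2 p3 z3 h h1 h2 h3 *.
apply: le_trans (_ : (p1 ^+ 3 * p2 ^+ 4 * p3) * (z1 ^+ 3 * z2 ^+ 4 * z3) <= _); last first.
  by apply: ler_wpM2r => //; rewrite !mulr_ge0 ?exprn_ge0.
have -> : (p1 ^+ 3 * p2 ^+ 4 * p3) * (z1 ^+ 3 * z2 ^+ 4 * z3) = (p1 * z1) ^+ 3 * (p2 * z2) ^+ 4 * (p3 * z3) by ring.
have -> : (1 / 2) ^+ 8 = (1 / 2) ^+ 3 * (1 / 2) ^+ 4 * (1 / 2) :> R by ring.
have q : 0 <= 1 / 2 :> R by lra.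
apply: ler_pM => //.
by apply: ler_pM; rewrite ?exprn_ge0 //; apply: lerXn2r; rewrite ?nnegrE ?mulr_ge0.
Qed.

Lemma line_sub sg t : (sg%:C + ii * t%:C) - 1 = (sg - 1)%:C + ii * t%:C.
Proof. by rewrite rmorphB; ring. Qed.
Lemma abs_line_Im sg t : `|t| <= cabs (sg%:C + ii * t%:C).
Proof. by apply: le_trans (cabs_Im _); rewrite Im_line. Qed.

(** At a zero 1 + it the fourth power in [zeta_341] contributes (1 + e)-values of order e^4, against
    e^(-3) from the pole, so the right-hand side is O(e). At [t = 0] the pole has been removed and
    [zetaX 1 = 1]. *)
Lemma zetaX_neq0_1 t : zetaX (1%:C + ii * t%:C) != 0.
Proof.
have [->|t0] := eqVneq t 0.
  by rewrite (_ : 1%:C + ii * 0%:C = 1) ?zetaX1 ?oner_neq0 //; apply: complexP; rewrite ?Re_line ?Im_line.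
apply/eqP => Z0; have ta : 0 < `|t| by rewrite normr_gt0.
pose T := 2 * `|t|.
have bU := bdd_rect (1 : R) 2 T.
have qZ : qhol (rect 1 2 T) (@zetaX R) (@zetaX' R).
  by apply: (qhol_zetaX bU ltr01) => z [/andP[]].
have [L L0 HL] := qhol_lip bU qZ; have [M M0 HM] := lip_bd bU (qhol_lip bU qZ).
pose Q := expR 8 * (M ^+ 3 * (L / `|t|) ^+ 4 * (M / `|t|)).
have Q0 : 0 <= Q.
  by rewrite mulr_ge0 ?expR_ge0 // !mulr_ge0 ?exprn_ge0 ?divr_ge0.
have inU sg u : 0 <= sg <= 1 -> `|u| <= T -> rect 1 2 T ((1 + sg)%:C + ii * u%:C).
  by move=> h1 h2; rewrite /rect Re_line Im_line; split => //; lra.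
have tT : `|t| <= T by rewrite /T; lra.
have main e : 0 < e -> e <= 1 -> (1 / 2) ^+ 8 <= Q * e.
  move=> e0 e1; have s1 : 1 < 1 + e by lra.
  have := @zeta_341 (1 + e) t s1; rewrite /zeta !line_sub addrAC subrr add0r.
  have -> : (1 + e)%:C - 1 = e%:C :> C by rewrite rmorphD; ring.
  move=> h; apply: le_trans h _; rewrite /Q -[leRHS]mulrA; apply: ler_wpM2l; first exact: expR_ge0.
  have b1 : cabs (zetaX (1 + e)%:C / e%:C) <= M / e.
    rewrite cabsM cabsV cabs_pos ?(ltW e0) //; apply: ler_wpM2r; first by rewrite invr_ge0 ltW.
    apply: HM; have := @inU e 0; rewrite mulr0 addr0; apply; rewrite ?normr0 /T; lra.
  have b2 : cabs (zetaX ((1 + e)%:C + ii * t%:C) / (e%:C + ii * t%:C)) <= L * e / `|t|.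
    rewrite cabsM cabsV; apply: ler_pM; rewrite ?invr_ge0 ?cabs_ge0 //.
      have := HL (1%:C + ii * t%:C) ((1 + e)%:C + ii * t%:C); rewrite Z0 subr0.
      have -> : (1 + e)%:C + ii * t%:C - (1%:C + ii * t%:C) = e%:C :> C by rewrite rmorphD; ring.
      rewrite [cabs e%:C]cabs_pos ?(ltW e0) //; apply; last by apply: inU => //; lra.
      by have := @inU 0 t; rewrite addr0; apply => //; lra.
    rewrite lef_pV2 ?posrE //; first exact: abs_line_Im.
    by apply: lt_le_trans ta _; exact: abs_line_Im.
  have b3 : cabs (zetaX ((1 + e)%:C + ii * (2 * t)%:C) / (e%:C + ii * (2 * t)%:C)) <= M / `|t|.
    have t2 : `|t| <= cabs (e%:C + ii * (2 * t)%:C).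
      by apply: le_trans (abs_line_Im _ _); rewrite normrM normr_nat; lra.
    rewrite cabsM cabsV; apply: ler_pM; rewrite ?invr_ge0 ?cabs_ge0 //.
      by apply: HM; apply: inU; [lra|rewrite normrM normr_nat].
    by rewrite lef_pV2 ?posrE //; apply: lt_le_trans t2.
  apply: le_trans (_ : (M / e) ^+ 3 * (L * e / `|t|) ^+ 4 * (M / `|t|) <= _); last first.
    by apply: le_eqr; field; rewrite !gt_eqF.
  apply: ler_pM; rewrite ?mulr_ge0 ?exprn_ge0 ?cabs_ge0 //.
  by apply: ler_pM; rewrite ?exprn_ge0 ?cabs_ge0 //; apply: lerXn2r; rewrite ?nnegrE ?cabs_ge0 //;
    apply: le_trans (cabs_ge0 _) _; eassumption.
have q0 : (0 : R) < (1 / 2) ^+ 8 by apply: exprn_gt0; lra.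
(* A value of [e] at most 1 for which [Q * e] falls below (1/2)^8. *)
have := main ((1 / 2) ^+ 8 / (Q + 1) / 2) _ _.
have q1 : (1 / 2 : R) ^+ 8 <= 1 by apply: exprn_ile1; lra.
have Q1 : 0 < Q + 1 by lra.
have E : (1 / 2) ^+ 8 / (Q + 1) / 2 <= 1.
  rewrite ler_pdivrMr // ler_pdivrMr //; nra.
have E0 : 0 < (1 / 2) ^+ 8 / (Q + 1) / 2 by rewrite !divr_gt0.
move=> /(_ E0 E); rewrite leNgt => /negP; apply.
rewrite mulrA ltr_pdivrMr // mulrA ltr_pdivrMr //; nra.
Qed.

(** [GRH] settles 1/2 < Re s < 1; the line Re s = 1 and the half-plane of convergence rest on the
    3-4-1 inequality and the Euler product. *)
Lemma zetaX_neq0 (grh : GRH R) s : 1 / 2 < complex.Re s -> zetaX s != 0.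
Proof.
move=> hs; have [s1|s1|s1] := ltgtP (complex.Re s) 1; last 1 first.
- by have := zetaX_neq0_1 (complex.Im s); rewrite -s1 -complexii.
- apply/eqP => Z0.
  have := grh 1%N _ _ isT trivial_character zeta_dirichlet_L s _ s1.
  rewrite Z0 mul0r; have s0 : 0 < complex.Re s by lra.
  move=> /(_ s0 erefl); lra.
- exact: zetaX_neq0_gt1.
Qed.
End NonVanishing.

(** * Bound for 1 / zeta *)

Section LowerBound.
Variable R : realType.
Local Notation C := R[i].
Local Notation ii := (@ii R).
Implicit Types (s z w : C) (x y a b r T M B t A : R) (F G f g : C -> C) (U V : C -> Prop).

(** Composing with the projection [cl] onto [a, b] yields a function continuous on the whole line,
    to which the extreme value theorem applies. *)
Lemma lip_evt (f : R -> R) a b (L : R) : a <= b -> 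
  (forall x y, a <= x <= b -> a <= y <= b -> `|f y - f x| <= L * `|y - x|) ->
  exists2 c, a <= c <= b & forall x, a <= x <= b -> f c <= f x.
Proof.
move=> ab H.
pose cl (x : R) := if x < a then a else if b < x then b else x.
have clin x : a <= cl x <= b.
  by rewrite /cl; case: (ltP x a) => h1; [lra|case: (ltP b x) => h2; lra].
have clid x : a <= x <= b -> cl x = x.
  by move=> h; rewrite /cl; case: (ltP x a) => h1; [lra|case: (ltP b x) => h2; lra].
have cll x y : `|cl y - cl x| <= `|y - x|.
  have h1 := ler_norm (y - x); have h2 := ler_norm (x - y); rewrite (distrC x y) in h2.
  rewrite /cl; case: (ltP y a) => ?; case: (ltP x a) => ?; try case: (ltP b y) => ?; try case: (ltP b x) => ?;
  by rewrite ler_norml; apply/andP; split; lra.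
have [|c] := @EVT_min R (f \o cl) a b ab.
- apply: continuous_subspaceT => x; apply/cvgrPdist_le => e e0.
  near=> y.
  have : `|x - y| < e / (`|L| + 1).
    near: y; apply: cvgr_dist_lt => //; apply: divr_gt0 => //; have := normr_ge0 L; lra.
  rewrite /= ltr_pdivlMr; last by have := normr_ge0 L; lra.
  move=> h; apply: le_trans (H _ _ (clin y) (clin x)) _.
  apply: le_trans (_ : `|L| * `|x - y| <= _); last first.
    by have := normr_ge0 (x - y); nra.
  apply: le_trans (ler_wpM2r (normr_ge0 _) (ler_norm L)) _.
  by apply: ler_wpM2l.
- move=> cin cmin; exists c; first by move: cin; rewrite in_itv.
  move=> x hx; have := cmin x; rewrite /= in_itv /= => /(_ hx).
  by rewrite (clid x) // clid //; move: cin; rewrite in_itv.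
Unshelve. all: by end_near. Qed.

(** Minimisation in one variable at a time: the minimum over the ordinate is Lipschitz in the
    abscissa with the same constant, so it attains its own minimum, at a point where [zetaX] does
    not vanish. *)
Lemma zetaX_min (grh : GRH R) a b T : 1 / 2 < a -> exists2 m, 0 < m & forall z, rect a b T z -> m <= cabs (zetaX z).
Proof.
move=> a2; have [ab|ba] := leP a b; last first.
  by exists 1 => // z [/andP[h1 h2] _]; lra.
have [T0|T0] := leP 0 T; last first.
  by exists 1 => // z [_ h]; have := le_trans (normr_ge0 _) h; lra.
have TT : - T <= T by lra.
have bU := bdd_rect a b T.
have a0 : 0 < a by lra.
have qZ : qhol (rect a b T) (@zetaX R) (@zetaX' R) by apply: (qhol_zetaX bU a0) => z [/andP[]].
have [L L0 HL] := qhol_lip bU qZ.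
pose ph x y := cabs (zetaX (x%:C + ii * y%:C)).
have HL2 x y x' y' : a <= x <= b -> - T <= y <= T -> a <= x' <= b -> - T <= y' <= T ->
   `|ph x' y' - ph x y| <= L * (`|x' - x| + `|y' - y|).
  move=> hx hy hx' hy'.
  have h := HL _ _ (rect_line hx hy) (rect_line hx' hy').
  apply: le_trans (_ : cabs (zetaX (x'%:C + ii * y'%:C) - zetaX (x%:C + ii * y%:C)) <= _).
    exact: cabs_dist.
  apply: le_trans h _; apply: ler_wpM2l => //.
  have -> : x'%:C + ii * y'%:C - (x%:C + ii * y%:C) = (x' - x)%:C + ii * (y' - y)%:C by rewrite !rmorphB; ring.
  by apply: le_trans (cabsD _ _) _; rewrite cabsM cabs_ii mul1r !cabs_real.
have ex x : exists c, a <= x <= b -> (- T <= c <= T) /\ forall y, - T <= y <= T -> ph x c <= ph x y.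
  have [hx|hx] := pselect (is_true (a <= x <= b)); last by exists 0.
  have [|c c1 c2] := @lip_evt (ph x) (- T) T L TT; last by exists c.
  by move=> u v hu hv; have := HL2 x u x v hx hu hx hv; rewrite subrr normr0 add0r.
have [c hc] := choice ex.
have [|x0 hx0 mx0] := @lip_evt (fun x => ph x (c x)) a b L ab.
  move=> x y hx hy; have [cx mx] := hc x hx; have [cy my] := hc y hy.
  have h1 := HL2 x (c y) y (c y) hx cy hy cy; have h2 := HL2 x (c x) y (c x) hx cx hy cx.
  rewrite !subrr normr0 addr0 in h1 h2.
  have h3 := mx _ cy; have h4 := my _ cx.
  move: h1 h2; rewrite !ler_norml => /andP[? ?] /andP[? ?]; apply/andP; split; lra.
exists (ph x0 (c x0)).
  by apply: cabs_gt0; apply: zetaX_neq0 => //; rewrite Re_line; lra.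
move=> z [hz1 hz2]; rewrite [z]complexii.
have hz3 : - T <= complex.Im z <= T by move: hz2; rewrite ler_norml.
apply: le_trans (mx0 _ hz1) _; have [_] := hc _ hz1; exact.
Qed.

Lemma pow_small (q e : R) : 0 <= q -> q < 1 -> 0 < e -> exists n, q ^+ n <= e.
Proof.
move=> q0 q1 e0; apply/not_existsP => H.
suff : e <= 0 by lra.
apply: (@le_add_pow R e 0 1 q) => // n; rewrite add0r mul1r; apply: ltW.
by rewrite ltNge; apply/negP; exact: H.
Qed.

Lemma zeta_upper s : 3 / 2 <= complex.Re s -> cabs (zetaX s) <= 3 * cabs (s - 1).
Proof.
move=> hs; have s1 : 1 < complex.Re s by lra.
have sm : s - 1 != 0.
  by apply/eqP => h; have := congr1 (@complex.Re R) h; rewrite ReB /=; lra.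
suff : cabs (zetaX s / (s - 1)) <= 3.
  by rewrite cabsM cabsV ler_pdivrMr // cabs_gt0.
apply: (@le_add_eps _ _ _ 1) => n.
have e0 : (0 : R) < n.+1%:R^-1 by rewrite invr_gt0 ltr0n.
have [N hN] := zeta_clim s1 e0; have := hN N (leqnn N).
set S := \sum_(_ <= _ < _) _ => h.
have -> : zetaX s / (s - 1) = S - (S - zetaX s / (s - 1)) by ring.
apply: le_trans (cabsB _ _) _; apply: lerD; last by rewrite div1r.
apply: le_trans (cabs_sum _ _ _) _.
apply: le_trans (_ : 1 + (1 / 2)^-1 <= _); last by rewrite invf_div; lra.
apply: le_trans (@sum_rp R (1 / 2) N _); last by lra.
rewrite big_add1 /= !big_nat; apply: ler_sum => i _; rewrite cabs_xp.
by apply: rp_monoe; [rewrite ler1n|lra].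
Qed.

(** The term 1 dominates: 2^(-2) = 1/4 and the sum of n^(-2) over n >= 3 is at most 1/2, which
    leaves 1/4. *)
Lemma zeta_lower t : cabs (1 + ii * t%:C) / 4 <= cabs (zetaX (2%:C + ii * t%:C)).
Proof.
set s := 2%:C + ii * t%:C.
have Rs : complex.Re s = 2 by rewrite Re_line.
have s1 : 1 < complex.Re s by rewrite Rs; lra.
have E : s - 1 = 1 + ii * t%:C by rewrite /s (_ : 2%:C = 1 + 1 :> C) ?rmorph_nat //; ring.
have sm : s - 1 != 0.
  by apply/eqP => h; have := congr1 (@complex.Re R) h; rewrite ReB /=; lra.
suff : 1 / 4 <= cabs (zetaX s / (s - 1)).
  by rewrite cabsM cabsV ler_pdivlMr ?cabs_gt0 // E; lra.
apply: (@le_add_eps _ _ _ 1) => n.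
have e0 : (0 : R) < n.+1%:R^-1 by rewrite invr_gt0 ltr0n.
have [N hN] := zeta_clim s1 e0; have := hN (N + 3)%N (leq_addr _ _).
set S := \sum_(_ <= _ < _) _ => h.
have hS : 1 / 4 <= cabs S.
  rewrite /S big_ltn ?addn3 // xp1 big_ltn //.
  set X := \sum_(_ <= _ < _) _.
  have hX : cabs X <= 1 / 2.
    apply: le_trans (cabs_sum _ _ _) _.
    apply: le_trans (_ : 1^-1 * rp 2%:R (- 1) <= _); last by rewrite rpN1 // invr1 !mul1r.
    apply: le_trans (@tail_rp R 1 2 N.+3 ltr01 isT _); last by [].
    rewrite (big_add1 _ _ 2) /= !big_nat; apply: ler_sum => i _; rewrite cabs_xp Rs.
    by apply: rp_monoe; [rewrite ler1n|lra].
  have h2 : cabs (xp 2%:R s) <= 1 / 4.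
    rewrite cabs_xp Rs (_ : - 2 = -1 + -1); last by ring.
    by rewrite rpD rpN1 //; lra.
  have := cabs_lower 1 (xp 2%:R s + X); have := cabsD (xp 2%:R s) X; rewrite cabs1; lra.
have := cabs_lower S (- (S - zetaX s / (s - 1))); rewrite cabsN opprB subrKC [1 / n.+1%:R]div1r.
move: h hS; move: (cabs _) (cabs _) (cabs _) (n.+1%:R^-1) => x1 x2 x3 x4; clear; lra.
Qed.

Lemma abs_1it t : 1 + `|t| <= 2 * cabs (1 + ii * t%:C) /\ cabs (1 + ii * t%:C) <= 1 + `|t|.
Proof.
have h1 : 1 <= cabs (1 + ii * t%:C).
  by have := cabs_Re (1 + ii * t%:C); rewrite (Re_line 1 t) normr1.
have h2 : `|t| <= cabs (1 + ii * t%:C).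
  by have := cabs_Im (1 + ii * t%:C); rewrite (Im_line 1 t).
split; first by lra.
by apply: le_trans (cabsD _ _) _; rewrite cabs1 cabsM cabs_ii mul1r cabs_real.
Qed.

(** All discs are centred at 2 + it. The outer radius 3/2 - de stays in the zero-free half-plane,
    where the real part of the logarithm is O(log |t|); on the inner radius 1/2 one has Re s >= 3/2
    and it is O(1). [three_circles] then reaches radius 3/2 - 2 de with an arbitrarily small
    multiple of log |t|. *)
Lemma zetaX_lower (grh : GRH R) (de eta : R) : 0 < de -> de <= 1 / 8 -> 0 < eta ->
  exists2 c, 0 < c & forall sg t, 1 / 2 + 2 * de <= sg -> sg <= 2 ->
    c * (1 + `|t|) * rp (2 + `|t|) (- eta) <= cabs (zetaX (sg%:C + ii * t%:C)).
Proof.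
move=> d0 d8 eta0.
pose r2 := 3 / 2 - de; pose rho := 3 / 2 - 2 * de; pose q := rho / r2.
have r20 : 0 < r2 by rewrite /r2; lra.
have rho0 : 0 <= rho by rewrite /rho; lra.
have rr : rho < r2 by rewrite /rho /r2; lra.
have q0 : 0 <= q by rewrite divr_ge0 // ltW.
have q1 : q < 1 by rewrite /q ltr_pdivrMr // mul1r.
have p : 0 < 1 - q by lra.
(* [n0] depends on [de] and [eta] only. It makes the outer circle contribute 2 A eta / 4, which is
   [eta * ln (2 + |t|)] plus a constant. *)
have [|n0 hn0] := @pow_small q (eta / 4 * (1 - q)) q0 q1; first by rewrite !mulr_gt0 ?invr_gt0.
pose S0 := (2 * 36) * \sum_(n < n0) (rho / (1 / 2)) ^+ n.
pose K := S0 + eta / 2 * ln 200.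
exists (expR (- K) / 8); first by rewrite divr_gt0 ?expR_gt0.
move=> sg t hs1 hs2.
have ta := normr_ge0 t.
pose c0 : C := 2%:C + ii * t%:C.
have bD := @bdd_disc R r2.
have a0 : 0 < 1 / 2 + de by lra.
have bR := bdd_rect (1 / 2 + de) (7 / 2) (`|t| + 2).
have inR z : disc r2 z -> rect (1 / 2 + de) (7 / 2) (`|t| + 2) (c0 + z).
  move=> hz; have h1 := le_trans (cabs_Re z) hz; have h2 := le_trans (cabs_Im z) hz.
  rewrite /rect ReD ImD Re_line Im_line; move: h1; rewrite ler_norml /r2 => /andP[h1 h3]; split; first by lra.
  apply: le_trans (ler_normD _ _) _; rewrite lerD2l; apply: le_trans h2 _; rewrite /r2; lra.
have qZ : qhol (rect (1 / 2 + de) (7 / 2) (`|t| + 2)) (@zetaX R) (@zetaX' R).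
  by apply: (qhol_zetaX bR a0) => z [/andP[]].
have qf : qhol (disc r2) (fun z => zetaX (c0 + z)) (fun z => zetaX' (c0 + z)).
  have q2 := qholD (qhol_cst (disc r2) c0) (qhol_id (disc r2)).
  apply: qhol_ext (qhol_comp bD inR (qhol_lip' qZ) qZ bR q2) => z _ //.
  by rewrite add0r mulr1.
have [|m m0 Hm] := @zetaX_min grh (1 / 2 + de) (7 / 2) (`|t| + 2); first by lra.
have [l [l' [ql l0 Hl]]] := disc_log r20 qf m0 (fun z hz => Hm _ (inR z hz)).
rewrite /= addr0 in Hl.
have D0 : disc r2 0 by rewrite /disc cabs0 ltW.
have [i1 i2] := abs_1it t.
have L0 := zeta_lower t; rewrite -/c0 in L0.
have F0 : (1 + `|t|) / 8 <= cabs (zetaX c0) by lra.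
have F0p : 0 < cabs (zetaX c0) by lra.
have eE z : disc r2 z -> cabs (zetaX (c0 + z)) = cabs (zetaX c0) * expR (complex.Re (l z)).
  by move=> /Hl ->; rewrite cabsM cabs_cexp.
(* 36 is the quotient of the upper bound 3 * (3/2)(1 + |t|) by the lower bound (1 + |t|) / 8 at the
   centre. *)
have Lr1 z : cabs z = 1 / 2 -> complex.Re (l z) <= 36.
  move=> hz; have Dz : disc r2 z by rewrite /disc hz /r2; lra.
  have h1 := eE z Dz.
  have hz1 := cabs_Re z; rewrite hz ler_norml in hz1; case/andP: hz1 => hz1 _.
  have Rz : 3 / 2 <= complex.Re (c0 + z) by rewrite ReD Re_line; clear -hz1; lra.
  have h2 := zeta_upper Rz.
  have h3 : cabs (c0 + z - 1) <= 3 / 2 * (1 + `|t|).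
    have -> : c0 + z - 1 = (1 + ii * t%:C) + z.
      by rewrite /c0 (_ : 2%:C = 1 + 1 :> C) ?rmorph_nat //; ring.
    apply: le_trans (cabsD _ _) _; rewrite hz; clear -i2 ta; lra.
  have h4 : cabs (zetaX c0) * expR (complex.Re (l z)) <= cabs (zetaX c0) * 36.
    rewrite -h1; move: h2 h3 F0; move: (cabs _) (cabs _) (cabs _) => u1 u2 u3; clear -ta; lra.
  rewrite ler_pM2l // in h4; have := expR_ge1Dx (complex.Re (l z)); clear -h4; lra.
have t2 : 0 < 2 + `|t| by lra.
(* On the outer circle |zetaX| is at most 25 (2 + |t|)^2, and at the centre it is at least 1/8:
   hence 200 = 25 * 8. *)
pose A := ln 200 + 2 * ln (2 + `|t|).
have A0 : 0 <= A by rewrite addr_ge0 ?mulr_ge0 ?ln_ge0 //; lra.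
have Lr2 z : cabs z = r2 -> complex.Re (l z) <= A.
  move=> hz; have Dz : disc r2 z by rewrite /disc hz.
  have h1 := eE z Dz; have [/andP[hR _] _] := inR z Dz.
  have hh : 1 / 2 <= complex.Re (c0 + z) by lra.
  have h2 := zetaX_le (_ : 0 < 1 / 2) hh.
  have {h2} h2 : cabs (zetaX (c0 + z)) <= 4 * (1 + cabs (c0 + z)) ^+ 2.
    apply: le_trans (h2 _) _; first by lra.
    by have -> : 2 + (1 / 2)^-1 = 4 :> R by rewrite invf_div; clear; lra.
  have h3 : cabs (c0 + z) <= 7 / 2 + `|t|.
    apply: le_trans (cabsD _ _) _; rewrite hz /c0; apply: le_trans (lerD (cabsD _ _) (lexx _)) _.
    by rewrite cabs_pos // cabsM cabs_ii mul1r cabs_real /r2; clear -d0; lra.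
  have h4 : (1 + cabs (c0 + z)) ^+ 2 <= (5 / 2 * (2 + `|t|)) ^+ 2.
    have c00 := cabs_ge0 (c0 + z).
    by apply: lerXn2r; rewrite ?nnegrE; clear -h3 ta c00; lra.
  have h5 : cabs (zetaX c0) * expR (complex.Re (l z)) <= cabs (zetaX c0) * (200 * (2 + `|t|) ^+ 2).
    have X0 : 0 <= (2 + `|t|) ^+ 2 by exact: sqr_ge0.
    apply: le_trans (_ : 25 * (2 + `|t|) ^+ 2 <= _).
      rewrite exprMn in h4; rewrite -h1; apply: le_trans h2 _.
      move: h4; move: (_ ^+ 2) ((2 + _) ^+ 2) => u v; clear; lra.
    rewrite [leRHS]mulrA; apply: ler_wpM2r => //; move: F0; move: (cabs _) => u; clear -ta; lra.
  rewrite ler_pM2l // in h5.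
  rewrite -ler_expR; apply: le_trans h5 _; rewrite /A expRD lnK ?posrE //.
  by rewrite expRM_natl lnK ?posrE.
pose w : C := (sg - 2)%:C.
have hw : cabs w <= rho by rewrite /w cabs_real ler_norml /rho; lra.
have Dw : disc r2 w by apply: le_trans hw _; exact: ltW.
have hl : cabs (l w) <= K + eta * ln (2 + `|t|).
  have h12 : 0 < 1 / 2 :> R by lra.
  have hr12 : 1 / 2 < r2 by rewrite /r2; lra.
  have h36 : 0 <= 36 :> R by [].
  have := three_circles n0 h12 hr12 rho0 rr ql l0 Lr1 Lr2 A0 h36 hw.
  move/le_trans; apply; rewrite -/q -/S0 /K -addrA lerD2l.
  apply: le_trans (_ : 2 * A * (eta / 4) <= _); last by rewrite /A; clear; lra.
  apply: ler_wpM2l; first by rewrite mulr_ge0.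
  by rewrite ler_pdivrMr.
have -> : sg%:C + ii * t%:C = c0 + w by rewrite /c0 /w rmorphB; ring.
rewrite eE //.
have hR : - (K + eta * ln (2 + `|t|)) <= complex.Re (l w).
  have := cabs_Re (l w); rewrite ler_norml => /andP[]; move: hl.
  by move: (cabs _) (complex.Re _) (K + _) => u v k; clear; lra.
have -> : expR (- K) / 8 * (1 + `|t|) * rp (2 + `|t|) (- eta) = (1 + `|t|) / 8 * expR (- (K + eta * ln (2 + `|t|))).
  rewrite (_ : - (K + _) = - K + - eta * ln (2 + `|t|)); last by ring.
  by rewrite expRD /rp; ring.
by apply: ler_pM; rewrite ?expR_ge0 ?ler_expR //; clear -ta; lra.
Qed.

Lemma izeta_bound (grh : GRH R) (de eta : R) : 0 < de -> de <= 1 / 8 -> 0 < eta ->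
  exists2 c, 0 < c & forall sg t, 1 / 2 + 2 * de <= sg -> sg <= 2 ->
    cabs ((sg%:C + ii * t%:C - 1) / zetaX (sg%:C + ii * t%:C)) <= c * rp (2 + `|t|) eta.
Proof.
move=> d0 d8 eta0; have [c c0 Hc] := zetaX_lower grh d0 d8 eta0.
exists c^-1; first by rewrite invr_gt0.
move=> sg t h1 h2; have h := Hc sg t h1 h2.
have ta := normr_ge0 t.
have pz : 0 < c * (1 + `|t|) * rp (2 + `|t|) (- eta) by rewrite !mulr_gt0 ?rp_gt0 //; lra.
have zp : 0 < cabs (zetaX (sg%:C + ii * t%:C)) by exact: lt_le_trans h.
rewrite cabsM cabsV ler_pdivrMr //.
have hs : cabs (sg%:C + ii * t%:C - 1) <= 1 + `|t|.
  have -> : sg%:C + ii * t%:C - 1 = (sg - 1)%:C + ii * t%:C by rewrite rmorphB; ring.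
  apply: le_trans (cabsD _ _) _; rewrite cabsM cabs_ii mul1r !cabs_real; apply: lerD => //.
  by rewrite ler_norml; lra.
apply: le_trans hs _.
apply: le_trans (ler_wpM2l _ h); last by rewrite mulr_ge0 ?rp_ge0 // invr_ge0 ltW.
rewrite rpN; apply: le_eqr; field; rewrite !gt_eqF //; exact: rp_gt0.
Qed.
End LowerBound.

(** * Perron's formula *)

Section Perron.
Variable R : realType.
Local Notation C := R[i].
Local Notation ii := (@ii R).
Implicit Types (s z w : C) (x y a b r T M B t A L : R) (F G f g : C -> C) (U V : C -> Prop).
Local Notation tpi := (pi *+ 2 : R).

Definition vint F x T : C := cint (fun z => F (x%:C + ii * z)) (- T) T.

Lemma lip_vline F F' a b T x : a <= x <= b -> qhol (rect a b T) F F' ->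
  lipon (seg (- T) T) (fun z => F (x%:C + ii * z)).
Proof.
move=> hx qF; have bR := bdd_rect a b T; have bS := bdd_seg (- T) T.
apply: lip_comp (qhol_lip bR qF) (qhol_lip bS (qhol_line x bS)).
by move=> z /segP[t ht ->]; exact: rect_line.
Qed.

(* [Jk] is Perron's kernel; [1 / (s (s + 1)) = 1 / s - 1 / (s + 1)] expresses it
   through [Ek], whose pole at 0 is crossed by comparison with a Poisson kernel. *)
Definition Ek L s := cexp (s * L%:C) / s.
Definition Jk L s := cexp (s * L%:C) / (s * (s + 1)).

Lemma qhol_Ek U L m : bdd U -> 0 < m -> (forall z, U z -> m <= cabs z) -> exists F', qhol U (Ek L) F'.
Proof.
move=> bU m0 hm; have q1 := qhol_cexpc bU (qholM bU (qhol_id U) (qhol_cst U L%:C)).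
have q2 := qholV bU m0 hm (qhol_id U).
by eexists; exact: qholM bU q1 q2.
Qed.
Lemma qhol_Jk U L m : bdd U -> 0 < m -> (forall z, U z -> m <= cabs z) -> (forall z, U z -> m <= cabs (z + 1)) ->
  exists F', qhol U (Jk L) F'.
Proof.
move=> bU m0 hm hm1; have q1 := qhol_cexpc bU (qholM bU (qhol_id U) (qhol_cst U L%:C)).
have q3 := qholM bU (qhol_id U) (qholD (qhol_id U) (qhol_cst U 1)).
have mm : 0 < m * m by rewrite mulr_gt0.
have h z : U z -> m * m <= cabs (z * (z + 1)).
  by move=> Uz; rewrite cabsM; apply: ler_pM; [exact: ltW|exact: ltW|exact: hm|exact: hm1].
by eexists; exact: qholM bU q1 (qholV bU mm h q3).
Qed.

Lemma cabs_cexpL s L : cabs (cexp (s * L%:C)) = expR (complex.Re s * L).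
Proof. by rewrite cabs_cexp ReM /= mulr0 subr0. Qed.

Lemma rect_pos a b T z : 0 < a -> rect a b T z -> a <= cabs z.
Proof. by move=> a0 [/andP[h _] _]; apply: le_trans h (Re_le z). Qed.
Lemma rect_neg a b T z : b < 0 -> rect a b T z -> - b <= cabs z.
Proof.
move=> b0 [/andP[_ h] _]; rewrite -cabsN; apply: le_trans (Re_le _); rewrite ReN; lra.
Qed.
Lemma rectS a b T z : rect a b T z -> rect (a + 1) (b + 1) T (z + 1).
Proof. by move=> [/andP[h1 h2] h]; rewrite /rect ReD ImD /= addr0; split => //; lra. Qed.

Lemma qhol_Ek_rect a b T L : (0 < a) \/ (b < 0) -> exists F', qhol (rect a b T) (Ek L) F'.
Proof.
move=> [h|h].
  by apply: (qhol_Ek L (bdd_rect a b T) h) => z; exact: rect_pos.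
apply: (qhol_Ek (m := - b) L (bdd_rect a b T)); first by lra.
by move=> z; exact: rect_neg.
Qed.
Lemma qhol_Jk_rect a b T L : (0 < a) \/ (-1 < a /\ b < 0) \/ (b < -1) -> exists F', qhol (rect a b T) (Jk L) F'.
Proof.
have W : ((0 < a) \/ (b < 0)) /\ ((0 < a + 1) \/ (b + 1 < 0)) -> exists F', qhol (rect a b T) (Jk L) F'.
  move=> [h1 h2]; have bU := bdd_rect a b T.
  have [m1 p1 H1] : exists2 m, 0 < m & forall z, rect a b T z -> m <= cabs z.
    case: h1 => h; first by exists a => // z; exact: rect_pos.
    by exists (- b); [lra|move=> z; exact: rect_neg].
  have [m2 p2 H2] : exists2 m, 0 < m & forall z, rect a b T z -> m <= cabs (z + 1).
    case: h2 => h; first by exists (a + 1) => // z /rectS; exact: rect_pos.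
    by exists (- (b + 1)); [lra|move=> z /rectS; exact: rect_neg].
  apply: (@qhol_Jk _ L (Num.min m1 m2) bU); first by rewrite lt_min p1.
    by move=> z /H1; apply: le_trans; rewrite ge_min lexx.
  by move=> z /H2; apply: le_trans; rewrite ge_min lexx orbT.
by move=> [h|[[h1 h2]|h]]; apply: W; split; (try by left; lra); (try by right; lra).
Qed.

Lemma cabs_top x T : 0 <= T -> T <= cabs (x%:C + ii * T%:C) /\ T <= cabs (x%:C + ii * (- T)%:C).
Proof.
move=> T0; split; apply: le_trans (cabs_Im _); rewrite Im_line ?normrN; exact: ler_norm.
Qed.

Lemma E_shift a b T L M : a <= b -> 0 < T -> (0 < a) \/ (b < 0) ->
  (forall x, a <= x <= b -> expR (x * L) <= M) ->
  cabs (vint (Ek L) b T - vint (Ek L) a T) <= 2 * M / T * (b - a).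
Proof.
move=> ab T0 hab HM; have [F' qF] := qhol_Ek_rect T L hab.
apply: (contour_shift ab (ltW T0) qF) => x hx.
have b1 (u : C) : complex.Re u = x -> T <= cabs u -> cabs (Ek L u) <= M / T.
  move=> hu hT; rewrite cabsM cabsV cabs_cexpL hu; apply: ler_pM; rewrite ?expR_ge0 ?invr_ge0 ?cabs_ge0 ?HM //.
  by rewrite lef_pV2 ?posrE //; exact: lt_le_trans hT.
have [t1 t2] := cabs_top x (ltW T0).
apply: le_trans (cabsB _ _) _.
have := b1 _ (Re_line x T) t1; have := b1 _ (Re_line x (- T)) t2; lra.
Qed.

Lemma J_shift a b T L M : a <= b -> 0 < T -> (0 < a) \/ (-1 < a /\ b < 0) \/ (b < -1) ->
  (forall x, a <= x <= b -> expR (x * L) <= M) ->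
  cabs (vint (Jk L) b T - vint (Jk L) a T) <= 2 * M / T ^+ 2 * (b - a).
Proof.
move=> ab T0 hab HM; have [F' qF] := qhol_Jk_rect T L hab.
apply: (contour_shift ab (ltW T0) qF) => x hx.
have b1 (u : C) : complex.Re u = x -> T <= cabs u -> T <= cabs (u + 1) -> cabs (Jk L u) <= M / T ^+ 2.
  move=> hu hT hT1; rewrite cabsM cabsV cabs_cexpL hu cabsM; apply: ler_pM; rewrite ?expR_ge0 ?invr_ge0 ?mulr_ge0 ?cabs_ge0 ?HM //.
  have T2 : T ^+ 2 <= cabs u * cabs (u + 1) by rewrite expr2; apply: ler_pM => //; exact: ltW.
  have T20 : 0 < T ^+ 2 by exact: exprn_gt0.
  by rewrite lef_pV2 ?posrE //; exact: lt_le_trans T2.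
have [t1 t2] := cabs_top x (ltW T0); have [t3 t4] := cabs_top (x + 1) (ltW T0).
have e t : (x + 1)%:C + ii * t%:C = x%:C + ii * t%:C + 1 by rewrite rmorphD; ring.
rewrite !e in t3 t4.
apply: le_trans (cabsB _ _) _.
have := b1 _ (Re_line x T) t1 t3; have := b1 _ (Re_line x (- T)) t2 t4; lra.
Qed.

Lemma VI_J a T L : 0 < T -> (0 < a) \/ (-1 < a /\ a < 0) \/ (a < -1) ->
  vint (Jk L) a T = vint (Ek L) a T - (expR (- L))%:C * vint (Ek L) (a + 1) T.
Proof.
move=> T0 ha; have TT : - T <= T by lra.
have a0 : a != 0 by apply/eqP => h; move: ha; rewrite h; case=> [|[[]|]]; lra.
have a1 : a + 1 != 0 by apply/eqP => h; case: ha => [|[[]|]]; lra.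
have aa x : a <= a <= a by rewrite lexx.
have aa1 : a + 1 <= a + 1 <= a + 1 by rewrite lexx.
have sgn x : x != 0 -> 0 < x \/ x < 0 by rewrite neq_lt => /orP[]; [right|left].
have [F1 q1] := qhol_Ek_rect T L (sgn _ a0).
have [F2 q2] := qhol_Ek_rect T L (sgn _ a1).
have l1 := lip_vline (aa 0) q1; have l2 := lip_vline aa1 q2.
rewrite /vint -(cintZ _ TT l2) -(cintB TT l1 (lipZ _ (bdd_seg _ _) l2)).
apply: cint_eq => // z /segP[t _ ->].
rewrite (_ : (a + 1)%:C + ii * t%:C = a%:C + ii * t%:C + 1); last by rewrite rmorphD; ring.
have n1 : a%:C + ii * t%:C != 0.
  by apply: contra a0 => /eqP h; have := congr1 (@complex.Re R) h; rewrite Re_line /= => ->.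
have n2 : a%:C + ii * t%:C + 1 != 0.
  by apply: contra a1 => /eqP h; have := congr1 (@complex.Re R) h; rewrite ReD Re_line /= => ->.
move: (a%:C + ii * t%:C) n1 n2 => s n1 n2.
rewrite /Jk /Ek mulrDl mul1r cexpD.
have -> : cexp L%:C = (expR L)%:C by rewrite /cexp /= cos0 sin0; apply: complexP; rewrite ?ReZ ?ImZ /= ?mulr1 ?mulr0.
have e : (expR (- L))%:C * (expR L)%:C = 1 :> C by rewrite -rmorphM -expRD addNr expR0.
have -> : (expR (- L))%:C * (cexp (s * L%:C) * (expR L)%:C / (s + 1)) = ((expR (- L))%:C * (expR L)%:C) * cexp (s * L%:C) / (s + 1) by ring.
by rewrite e; field; rewrite n2 n1.
Qed.

Lemma atan_quad x y : `|atan y - atan x - (y - x) / (1 + x ^+ 2)| <= (y - x) ^+ 2.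
Proof.
have der (u : R) : is_derive u 1 (@atan R) (1 + u ^+ 2)^-1.
  by apply: DeriveDef; [exact: derivable_atan|rewrite -derive1E derive1_atan].
have cont a b : {within `[a, b], continuous (@atan R)}%classic.
  by apply: continuous_subspaceT => u; exact: continuous_atan.
have [c [hc e]] : exists c, `|c - x| <= `|y - x| /\ atan y - atan x = (1 + c ^+ 2)^-1 * (y - x).
  have [xy|yx|->] := ltgtP x y; last by exists y; rewrite !subrr mulr0.
    have [c hc e] := MVT xy (fun u _ => der u) (cont x y).
    exists c; split => //; move: hc; rewrite in_itv /= => /andP[h1 h2].
    by rewrite !ger0_norm; lra.
  have [c hc e] := MVT yx (fun u _ => der u) (cont y x).
  exists c; split; last by rewrite -opprB e -mulrN opprB.
  by move: hc; rewrite in_itv /= => /andP[h1 h2]; rewrite !ler0_norm; lra.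
rewrite e; have p u : 0 < 1 + u ^+ 2 :> R by have := sqr_ge0 u; lra.
have -> : (1 + c ^+ 2)^-1 * (y - x) - (y - x) / (1 + x ^+ 2) = (y - x) * ((x - c) * ((x + c) / ((1 + c ^+ 2) * (1 + x ^+ 2)))).
  by field; rewrite !gt_eqF.
rewrite !normrM -[leRHS]real_normK ?num_real // expr2; apply: ler_wpM2l => //.
rewrite (distrC x c) -[leRHS]mulr1; apply: ler_pM => //; rewrite ?mulr_ge0 //.
rewrite normfV (ger0_norm (ltW (mulr_gt0 (p c) (p x)))) ler_pdivrMr ?mulr_gt0 // mul1r.
have := sqr_ge0 (1 - c); have := sqr_ge0 (1 + c); have := sqr_ge0 (1 - x); have := sqr_ge0 (1 + x).
have := mulr_ge0 (sqr_ge0 c) (sqr_ge0 x).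
by move=> *; rewrite ler_norml; apply/andP; split; nra.
Qed.

(** On the two lines Re s = eps and Re s = -eps the values of 1 / s differ by the Poisson kernel 2
    eps / (eps^2 + t^2), with primitive 2 atan (t / eps). *)
Lemma cint_poisson T eps : 0 < T -> 0 < eps ->
  vint (fun s => s^-1) eps T - vint (fun s => s^-1) (- eps) T = (4 * atan (T / eps))%:C.
Proof.
move=> T0 e0; have TT : - T <= T by lra.
have bS := bdd_seg (- T) T.
have l1 : lipon (seg (- T) T) (fun z => (eps%:C + ii * z)^-1).
  have [F q] := @qhol_Ek_rect eps eps T 0 (or_introl e0).
  have ee : eps <= eps <= eps by rewrite lexx.
  by apply: lip_ext (lip_vline ee q) => z _; rewrite /Ek mulr0 cexp0 mul1r.
have l2 : lipon (seg (- T) T) (fun z => ((- eps)%:C + ii * z)^-1).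
  have [|F q] := @qhol_Ek_rect (- eps) (- eps) T 0; first by right; lra.
  have ee : - eps <= - eps <= - eps by rewrite lexx.
  by apply: lip_ext (lip_vline ee q) => z _; rewrite /Ek mulr0 cexp0 mul1r.
rewrite /vint -(cintB TT l1 l2).
have q : qhol (seg (- T) T) (fun z => (2 * atan (complex.Re z / eps))%:C) (fun z => (2 * (eps^-1 / (1 + (complex.Re z / eps) ^+ 2)))%:C).
  exists (2 * eps^-1 ^+ 2); first by rewrite mulr_ge0 ?sqr_ge0.
  move=> _ _ /segP[x _ ->] /segP[y _ ->] /=.
  have h := atan_quad (x / eps) (y / eps).
  rewrite -!rmorphB -rmorphM -rmorphB !cabs_real real_normK ?num_real //.
  have -> : 2 * atan (y / eps) - 2 * atan (x / eps) - (y - x) * (2 * (eps^-1 / (1 + (x / eps) ^+ 2))) =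
    2 * (atan (y / eps) - atan (x / eps) - (y / eps - x / eps) / (1 + (x / eps) ^+ 2)) by ring.
  rewrite normrM ger0_norm // -mulrA; apply: ler_wpM2l => //; apply: le_trans h _.
  by apply: le_eqr; ring.
have := cint_FTC TT q; rewrite /= mulNr atanN.
have -> : (2 * atan (T / eps))%:C - (2 * - atan (T / eps))%:C = (4 * atan (T / eps))%:C :> C.
  by rewrite -rmorphB; congr (_%:C); ring.
move=> <-; apply: cint_eq => // z /segP[t _ ->] /=.
have d0 : 0 < eps ^+ 2 + t ^+ 2 by have := sqr_ge0 t; have := exprn_gt0 2 e0; lra.
have n1 : eps%:C + ii * t%:C != 0.
  by apply/eqP => h; have := congr1 (@complex.Re R) h; rewrite Re_line /=; lra.
have n2 : (- eps)%:C + ii * t%:C != 0.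
  by apply/eqP => h; have := congr1 (@complex.Re R) h; rewrite Re_line /=; lra.
apply: (mulfI n1); apply: (mulfI n2).
have -> : 2 * (eps^-1 / (1 + (t / eps) ^+ 2)) = 2 * eps / (eps ^+ 2 + t ^+ 2).
  by field; rewrite !gt_eqF //=; have := sqr_ge0 t; have := exprn_gt0 2 e0; lra.
rewrite mulrBr mulrBr divff // mulrCA divff // !mulr1.
have e2 : ((- eps)%:C + ii * t%:C) * (eps%:C + ii * t%:C) = - (eps ^+ 2 + t ^+ 2)%:C.
  have -> : ((- eps)%:C + ii * t%:C) * (eps%:C + ii * t%:C) = (ii * ii) * t%:C ^+ 2 - eps%:C ^+ 2 by ring.
  by rewrite ii_sqr; ring.
rewrite [RHS]mulrA e2 mulNr -rmorphM.
have -> : (eps ^+ 2 + t ^+ 2) * (2 * eps / (eps ^+ 2 + t ^+ 2)) = 2 * eps by field; rewrite gt_eqF.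
have -> : (- eps)%:C + ii * t%:C - (eps%:C + ii * t%:C) = - (2 * eps)%:C by ring.
by [].
Qed.

(** (exp (s L) - 1) / s is the integral of exp (s x) over 0 <= x <= L, so it has no pole and is
    Lipschitz in [s]. *)
Lemma Ediff_lip L s w : 0 <= L -> s != 0 -> w != 0 -> 
  cabs ((cexp (s * L%:C) - 1) / s - (cexp (w * L%:C) - 1) / w) <=
  expR (cabs w * L) * (cabs (s - w) * L * expR (cabs (s - w) * L)) * L.
Proof.
move=> L0 s0 w0; have bS := bdd_seg 0 L.
have q (u : C) : qhol (seg 0 L) (fun z => cexp (u * z)) (fun z => u * cexp (u * z)).
  apply: qhol_ext (qhol_cexpc bS (qholZ u bS (qhol_id _))) => z _ //.
  by rewrite mulr1 mulrC.
have lq (u : C) : lipon (seg 0 L) (fun z => cexp (u * z)) := qhol_lip bS (q u).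
have I (u : C) : u != 0 -> (cexp (u * L%:C) - 1) / u = cint (fun z => cexp (u * z)) 0 L.
  move=> u0; apply: (mulfI u0); rewrite -(cintZ _ L0 (lq u)) (cint_FTC L0 (q u)) mulr0 cexp0.
  by field.
rewrite !I // -(cintB L0 (lq s) (lq w)).
rewrite -[X in _ <= _ * X]subr0; apply: (cint_bound L0 (lipB bS (lq s) (lq w))) => x /andP[x0 xL].
have -> : cexp (s * x%:C) - cexp (w * x%:C) = cexp (w * x%:C) * (cexp ((s - w) * x%:C) - 1).
  by rewrite mulrBr mulr1 -cexpD; congr (cexp _ - _); ring.
have bx (u : C) : cabs (u * x%:C) <= cabs u * L.
  by rewrite cabsM cabs_pos //; apply: ler_wpM2l => //; exact: cabs_ge0.
rewrite cabsM; apply: ler_pM; rewrite ?cabs_ge0 //.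
  by rewrite cabs_cexp ler_expR; apply: le_trans (Re_le _) (bx _).
apply: le_trans (cexp_lip _) _; apply: ler_pM; rewrite ?cabs_ge0 //.
  by have := emax_ge1 ((s - w) * x%:C); lra.
by apply: le_trans (emax_bound _) _; rewrite ler_expR.
Qed.

(** [Ek] is 1 / s plus a function without pole. Across the imaginary axis the latter changes by
    O(eps), while the former jumps by 4 atan (T / eps), close to 2 pi. *)
Lemma E_jump T L e : 0 < T -> 0 <= L -> 0 < e -> exists eps : R, [/\ 0 < eps, eps <= e, eps <= 1 / 2 &
  cabs (vint (Ek L) eps T - vint (Ek L) (- eps) T - tpi%:C) <= e].
Proof.
move=> T0 L0 e0.
pose D := expR ((1 + T) * L) * (2 * L * expR (2 * L)) * L * (T + T).
have D0 : 0 <= D by rewrite /D !mulr_ge0 ?expR_ge0 //; lra.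
have [X [X0 hX]] : exists X : R, 0 < X /\ forall x, X < x -> `|pi / 2 - atan x| <= e / 8.
  have e8 : 0 < e / 8 by lra.
  have := @cvgy_atan R => /cvgrPdist_le /(_ _ e8) [M [_ HM]].
  exists (`|M| + 1); split; first by have := normr_ge0 M; lra.
  by move=> x hx; apply: HM; have := ler_norm M; lra.
(* The last two terms ensure [eps * D <= e / 2] for the part without pole and [X < T / eps] for the
   arctangent. *)
pose eps := Num.min (Num.min e (1 / 2)) (Num.min (e / 2 / (D + 1)) (T / (X + 1))).
have D1 : 0 < D + 1 by lra. have X1 : 0 < X + 1 by lra.
have ep0 : 0 < eps by rewrite !lt_min e0 !divr_gt0 //; lra.
have [h1 h2 h3 h4] : [/\ eps <= e, eps <= 1 / 2, eps <= e / 2 / (D + 1) & eps <= T / (X + 1)].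
  by split; rewrite !ge_min lexx ?orbT.
clearbody eps; exists eps; split => //.
have TT : - T <= T by lra.
have bS := bdd_seg (- T) T.
have n1 t : eps%:C + ii * t%:C != 0.
  by apply/eqP => h; have := congr1 (@complex.Re R) h; rewrite Re_line /=; lra.
have n2 t : (- eps)%:C + ii * t%:C != 0.
  by apply/eqP => h; have := congr1 (@complex.Re R) h; rewrite Re_line /=; lra.
have lE (M : R) : lipon (seg (- T) T) (fun z => Ek M (eps%:C + ii * z)).
  have [F q] := @qhol_Ek_rect eps eps T M (or_introl ep0).
  have ee : eps <= eps <= eps by rewrite lexx.
  exact: lip_vline ee q.
have lE2 (M : R) : lipon (seg (- T) T) (fun z => Ek M ((- eps)%:C + ii * z)).
  have [|F q] := @qhol_Ek_rect (- eps) (- eps) T M; first by right; lra.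
  have ee : - eps <= - eps <= - eps by rewrite lexx.
  exact: lip_vline ee q.
have l01 : lipon (seg (- T) T) (fun z => (eps%:C + ii * z)^-1).
  by apply: lip_ext (lE 0) => z _; rewrite /Ek mulr0 cexp0 mul1r.
have l02 : lipon (seg (- T) T) (fun z => ((- eps)%:C + ii * z)^-1).
  by apply: lip_ext (lE2 0) => z _; rewrite /Ek mulr0 cexp0 mul1r.
have h5 : cabs (vint (Ek L) eps T - vint (Ek L) (- eps) T - (vint (fun s => s^-1) eps T - vint (fun s => s^-1) (- eps) T)) <= eps * D.
  rewrite /vint -(cintB TT (lE L) (lE2 L)) -(cintB TT l01 l02) -(cintB TT (lipB bS (lE L) (lE2 L)) (lipB bS l01 l02)).
  have -> : eps * D = (expR ((1 + T) * L) * (2 * eps * L * expR (2 * L)) * L) * (T - - T) by rewrite /D; ring.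
  apply: (cint_bound TT (lipB bS (lipB bS (lE L) (lE2 L)) (lipB bS l01 l02))) => t ht.
  have -> : Ek L (eps%:C + ii * t%:C) - Ek L ((- eps)%:C + ii * t%:C) - ((eps%:C + ii * t%:C)^-1 - ((- eps)%:C + ii * t%:C)^-1) =
     (cexp ((eps%:C + ii * t%:C) * L%:C) - 1) / (eps%:C + ii * t%:C) - (cexp (((- eps)%:C + ii * t%:C) * L%:C) - 1) / ((- eps)%:C + ii * t%:C).
    rewrite /Ek; move: (n1 t) (n2 t); move: (eps%:C + ii * t%:C) ((- eps)%:C + ii * t%:C) => s w s0 w0.
    by field; rewrite s0 w0.
  apply: le_trans (Ediff_lip L0 (n1 t) (n2 t)) _.
  have -> : eps%:C + ii * t%:C - ((- eps)%:C + ii * t%:C) = (2 * eps)%:C by ring.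
  have e2 : 0 <= 2 * eps by lra.
  rewrite (cabs_pos e2); apply: ler_wpM2r => //.
  have e2L : 0 <= 2 * eps * L by rewrite mulr_ge0.
  apply: ler_pM; [exact: expR_ge0|by rewrite mulr_ge0 // expR_ge0| |].
    rewrite ler_expR; apply: ler_wpM2r => //; apply: le_trans (cabsD _ _) _.
    rewrite cabsM cabs_ii mul1r !cabs_real normrN (ger0_norm (ltW ep0)).
    have : `|t| <= T by rewrite ler_norml.
    lra.
  apply: ler_wpM2l => //; rewrite ler_expR; apply: ler_wpM2r => //; lra.
rewrite (cint_poisson T0 ep0) in h5.
have h6 : eps * D <= e / 2.
  move: h3; rewrite ler_pdivlMr // => h3; nra.
have h7 : `|pi / 2 - atan (T / eps)| <= e / 8.
  apply: hX; rewrite ltr_pdivlMr //; move: h4; rewrite ler_pdivlMr //; nra.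
set u := vint (Ek L) eps T - _ in h5 *.
have -> : u - tpi%:C = (u - (4 * atan (T / eps))%:C) - (4 * (pi / 2 - atan (T / eps)))%:C.
  have -> : tpi = 4 * (pi / 2) :> R by rewrite -mulr_natr; field.
  by rewrite mulrBr rmorphB; ring.
apply: le_trans (cabsB _ _) _; rewrite cabs_real normrM ger0_norm //.
by clear -h5 h6 h7; lra.
Qed.

(* For [L <= 0] the contour goes to the right, for [L >= 0] to the left. *)
Lemma perron_small T L : 2 <= T -> L <= 0 -> cabs (vint (Jk L) 2 T) <= 4 * expR (2 * L) / T.
Proof.
move=> T2 L0; have T0 : 0 < T by lra. have TT : - T <= T by lra.
have h1 : cabs (vint (Jk L) T T - vint (Jk L) 2 T) <= 2 * expR (2 * L) / T ^+ 2 * (T - 2).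
  apply: J_shift => //; first by left.
  by move=> x /andP[hx _]; rewrite ler_expR; nra.
have ee : T <= T <= T by rewrite lexx.
have [F q] := @qhol_Jk_rect T T T L (or_introl T0).
have h2 : cabs (vint (Jk L) T T) <= (expR (2 * L) / T ^+ 2) * (T - - T).
  apply: (cint_bound TT (lip_vline ee q)) => t ht.
  rewrite cabsM cabsV cabs_cexpL Re_line; apply: ler_pM; rewrite ?expR_ge0 ?invr_ge0 ?cabs_ge0 //.
    by rewrite ler_expR; nra.
  have T20 : 0 < T ^+ 2 by exact: exprn_gt0.
  have hh : T ^+ 2 <= cabs ((T%:C + ii * t%:C) * (T%:C + ii * t%:C + 1)).
    have r1 : T <= cabs (T%:C + ii * t%:C) by apply: le_trans (Re_le _); rewrite Re_line.
    have r2 : T <= cabs (T%:C + ii * t%:C + 1).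
      by apply: le_trans (Re_le _); rewrite ReD Re_line /=; clear; lra.
    by rewrite cabsM expr2; apply: ler_pM => //; exact: ltW.
  by rewrite lef_pV2 ?posrE //; exact: lt_le_trans hh.
have -> : vint (Jk L) 2 T = vint (Jk L) T T - (vint (Jk L) T T - vint (Jk L) 2 T) by ring.
apply: le_trans (cabsB _ _) _; apply: le_trans (lerD h2 h1) _.
have e1 : (expR (2 * L) / T ^+ 2) * (T - - T) = 2 * expR (2 * L) / T by field; rewrite gt_eqF.
have e2 : 2 * expR (2 * L) / T ^+ 2 * (T - 2) <= 2 * expR (2 * L) / T ^+ 2 * T.
  apply: ler_wpM2l; last by clear; lra.
  by apply: divr_ge0; [apply: mulr_ge0 => //; exact: expR_ge0|exact: sqr_ge0].
have e3 : 2 * expR (2 * L) / T ^+ 2 * T = 2 * expR (2 * L) / T by field; rewrite gt_eqF.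
by rewrite e1; clear -e2 e3; lra.
Qed.

Lemma perron_large T L : 2 <= T -> 0 <= L ->
  cabs (vint (Jk L) 2 T - (tpi * (1 - expR (- L)))%:C) <= 12 * expR (2 * L) / T.
Proof.
move=> T2 L0; have T0 : 0 < T by lra. have TT : - T <= T by lra.
have E1 : 1 <= expR (2 * L) by rewrite -[leLHS]expR0 ler_expR; lra.
set Y := expR (2 * L) in E1 *.
pose c := expR (- L); have c0 : 0 < c by exact: expR_gt0.
have c1 : c <= 1 by rewrite expR_le1; lra.
apply: (@le_add_eps _ _ _ (2 + 8 * Y)) => n.
have e0 : (0 : R) < n.+1%:R^-1 by rewrite invr_gt0 ltr0n.
have [eps [p1 p2 p3 p4]] := E_jump T0 L0 e0.
have [e ee] : exists e : R, e = n.+1%:R^-1 by eexists.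
rewrite -ee in e0 p2 p4 *; clear ee.
pose J a := vint (Jk L) a T; pose E a := vint (Ek L) a T.
have iT : 0 < T^-1 by rewrite invr_gt0.
have iT2 : T^-1 <= 1 / 2 by rewrite div1r lef_pV2 ?posrE //; lra.
have T2i : T ^- 2 = T^-1 * T^-1 by rewrite expr2 invfM.
have T2b : T ^- 2 <= T^-1 / 2 by rewrite T2i; clear -iT iT2; nra.
have T2c : 0 <= T ^- 2 by rewrite T2i mulr_ge0 // ltW.
have Y0 : 0 <= Y by clear -E1; lra.
have k1 : Y * T ^- 2 <= Y * (T^-1 / 2) by exact: ler_wpM2l.
have k2 : T^-1 <= Y * T^-1 by clear -E1 iT; nra.
have k3 : Y * eps <= Y * e by exact: ler_wpM2l.
have k4 : e <= Y * e by clear -E1 e0; nra.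
have t1 : cabs (E (eps + 1) - E (- eps + 1)) <= 4 * Y * eps.
  clear p4.
  apply: le_trans (@E_shift (- eps + 1) (eps + 1) T L Y _ T0 _ _) _; first by lra.
  - by left; lra.
  - by move=> x /andP[_ hx]; rewrite ler_expR; nra.
  - have : 0 <= Y * eps by rewrite mulr_ge0 //; lra.
    have -> : 2 * Y / T * (eps + 1 - (- eps + 1)) = 4 * (Y * eps) * T^-1 by ring.
    nra.
have t2 : cabs (E (- 1 + eps) - E (- 1 - eps)) <= 4 * Y * eps.
  clear p4.
  apply: le_trans (@E_shift (- 1 - eps) (- 1 + eps) T L 1 _ T0 _ _) _; first by lra.
  - by right; lra.
  - by move=> x /andP[_ hx]; rewrite expR_le1; nra.
  - have -> : 2 * 1 / T * (- 1 + eps - (- 1 - eps)) = 4 * eps * T^-1 by ring.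
    have : eps <= Y * eps by nra.
    nra.
have s1 : cabs (J 2 - J eps) <= 4 * Y * T ^- 2.
  clear p4 t1 t2.
  apply: le_trans (@J_shift eps 2 T L Y _ T0 (or_introl p1) _) _; first by lra.
    by move=> x /andP[_ hx]; rewrite ler_expR; nra.
  rewrite -!mulrA; have : 0 <= Y * T ^- 2 by rewrite T2i !mulr_ge0 ?ltW //; lra.
  nra.
have s2 : cabs (J (- eps) - J (- 1 + eps)) <= 2 * T ^- 2.
  clear p4 t1 t2 s1.
  apply: le_trans (@J_shift (- 1 + eps) (- eps) T L 1 _ T0 _ _) _; first by lra.
  - by right; left; lra.
  - by move=> x /andP[_ hx]; rewrite expR_le1; nra.
  - rewrite mulr1; have : 0 <= T ^- 2 by rewrite T2i !mulr_ge0 ?ltW.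
    nra.
have s3 : cabs (J (- 1 - eps) - J (- T)) <= 2 * T^-1.
  clear p4 t1 t2 s1 s2.
  apply: le_trans (@J_shift (- T) (- 1 - eps) T L 1 _ T0 _ _) _; first by lra.
  - by right; right; lra.
  - by move=> x /andP[_ hx]; rewrite expR_le1; nra.
  - rewrite mulr1; have -> : 2 * T^-1 = 2 / T ^+ 2 * T by field; rewrite gt_eqF.
    by apply: ler_wpM2l; [rewrite divr_ge0 ?sqr_ge0|lra].
have s4 : cabs (J (- T)) <= 4 * T^-1.
  clear p4 t1 t2 s1 s2 s3.
  have hh : - T < -1 by lra.
  have ee : - T <= - T <= - T by rewrite lexx.
  have [F q] := @qhol_Jk_rect (- T) (- T) T L (or_intror (or_intror hh)).
  apply: le_trans (cint_bound (M := 2 * T ^- 2) TT (lip_vline ee q) _) _; last first.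
    by apply: le_eqr; field; rewrite gt_eqF.
  move=> t ht; rewrite cabsM cabsV cabs_cexpL Re_line -[leRHS]mul1r; apply: ler_pM; rewrite ?expR_ge0 ?invr_ge0 ?cabs_ge0 //.
    by rewrite expR_le1; nra.
  have T20 : 0 < T ^+ 2 / 2 by rewrite divr_gt0 // exprn_gt0.
  have h3 : T ^+ 2 / 2 <= cabs (((- T)%:C + ii * t%:C) * ((- T)%:C + ii * t%:C + 1)).
    rewrite cabsM; apply: le_trans (_ : T * (T / 2) <= _); first by apply: le_eqr; ring.
    have r1 : T <= cabs ((- T)%:C + ii * t%:C).
      by rewrite -cabsN; apply: le_trans (Re_le _); rewrite ReN Re_line opprK.
    have r2 : T / 2 <= cabs ((- T)%:C + ii * t%:C + 1).
      by rewrite -cabsN; apply: le_trans (Re_le _); rewrite ReN ReD Re_line /=; clear -T2; lra.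
    by apply: ler_pM => //; clear -T0; lra.
  have -> : 2 * T ^- 2 = (T ^+ 2 / 2)^-1 by field; rewrite gt_eqF.
  by rewrite lef_pV2 ?posrE //; exact: lt_le_trans h3.
have jE a : (0 < a) \/ (-1 < a /\ a < 0) \/ (a < -1) -> J a = E a - c%:C * E (a + 1) by exact: VI_J.
have j1 : J eps = E eps - c%:C * E (eps + 1) by apply: jE; left.
have j2 : J (- eps) = E (- eps) - c%:C * E (- eps + 1) by clear p4 t1 t2 s1 s2 s3 s4; apply: jE; right; left; lra.
have j3 : J (- 1 + eps) = E (- 1 + eps) - c%:C * E eps.
  by clear p4 t1 t2 s1 s2 s3 s4; rewrite jE; [congr (_ - _ * E _); ring|right; left; lra].
have j4 : J (- 1 - eps) = E (- 1 - eps) - c%:C * E (- eps).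
  by clear p4 t1 t2 s1 s2 s3 s4; rewrite jE; [congr (_ - _ * E _); ring|right; right; lra].
rewrite -/(J 2) -/c; rewrite -/(E eps) -/(E (- eps)) in p4.
have cb (u v : C) : cabs (u - c%:C * v) <= cabs u + cabs v.
  apply: le_trans (cabsB _ _) _; rewrite lerD2l cabsM (cabs_pos (ltW c0)); apply: ler_piMl => //; exact: cabs_ge0.
clear jE; clearbody J E c Y.
(* The path runs from Re s = 2 to Re s = -T through the poles 0 and -1. [VI_J] turns the jumps of
   [J] into jumps of [E]: 2 pi at 0, and -2 pi c at -1 since the second term of [VI_J] is a
   translate. The other differences are shifts without pole. *)
have -> : J 2 - (tpi * (1 - c))%:C =
  (J 2 - J eps) + ((E eps - E (- eps) - tpi%:C) - c%:C * (E (eps + 1) - E (- eps + 1))) + (J (- eps) - J (- 1 + eps))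
   + ((E (- 1 + eps) - E (- 1 - eps)) - c%:C * (E eps - E (- eps) - tpi%:C)) + (J (- 1 - eps) - J (- T)) + J (- T).
  rewrite j1 j2 j3 j4 (_ : (tpi * (1 - c))%:C = tpi%:C - c%:C * tpi%:C); last by rewrite rmorphM rmorphB; ring.
  by clear; move: (tpi%:C) (c%:C) => *; ring.
have b1 := cb (E eps - E (- eps) - tpi%:C) (E (eps + 1) - E (- eps + 1)).
have b2 := cb (E (- 1 + eps) - E (- 1 - eps)) (E eps - E (- eps) - tpi%:C).
apply: le_trans (cabsD _ _) _; apply: le_trans (lerD (cabsD _ _) (lexx _)) _.
apply: le_trans (lerD (lerD (cabsD _ _) (lexx _)) (lexx _)) _.
apply: le_trans (lerD (lerD (lerD (cabsD _ _) (lexx _)) (lexx _)) (lexx _)) _.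
apply: le_trans (lerD (lerD (lerD (lerD (cabsD _ _) (lexx _)) (lexx _)) (lexx _)) (lexx _)) _.
move: iT k1 k2 k3 T2b s1 s2 s3 s4 b1 b2 t1 t2 p4.
move: (cabs _) (cabs _) (cabs _) (cabs _) (cabs _) (cabs _) (cabs _) (cabs _) (cabs _).
move: (T^-1) (T ^- 2) => iT' iT2'; clear => *; lra.
Qed.
End Perron.

(** * Mean values of Dirichlet polynomials *)

Section MeanValue.
Variable R : realType.
Local Notation C := R[i].
Local Notation ii := (@ii R).
Implicit Types (s z w : C) (x y a b r T M B t A : R) (F G f g : C -> C) (U V : C -> Prop).

Lemma conj_cexp z : conjc (cexp z) = cexp (conjc z).
Proof.
by case: z => x y; apply: complexP; rewrite /cexp /= cosN sinN; ring.
Qed.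
Lemma mul_conj z : (cabs z ^+ 2)%:C = z * conjc z.
Proof. by rewrite sqr_cabs; case: z => x y; apply: complexP => /=; ring. Qed.
Lemma conj_sum (I : Type) (r : seq I) (f : I -> C) : conjc (\sum_(i <- r) f i) = \sum_(i <- r) conjc (f i).
Proof.
apply: (big_morph (@conjc R)); last by rewrite /= oppr0.
by move=> [x y] [x' y']; rewrite /= opprD.
Qed.

Lemma cint_osc (l a b : R) : a <= b -> l != 0 -> cabs (cint (fun z => cexp (ii * z * l%:C)) a b) <= 2 / `|l|.
Proof.
move=> ab l0; have bS := bdd_seg a b.
have c0 : ii * l%:C != 0 by rewrite mulf_neq0 ?ii_neq0 //; apply: contra l0 => /eqP [->].
have q : qhol (seg a b) (fun z => (ii * l%:C)^-1 * cexp (ii * z * l%:C)) (fun z => cexp (ii * z * l%:C)).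
  have q1 := qholZ (ii * l%:C)^-1 bS (qhol_cexpc bS (qholZ (ii * l%:C) bS (qhol_id _))).
  apply: qhol_ext q1 => z _ /=; first by congr (_ * cexp _); ring.
  by rewrite mulr1 mulrCA mulVf // mulr1; congr cexp; ring.
have ca (x : R) : cabs ((ii * l%:C)^-1 * cexp (ii * x%:C * l%:C)) = `|l|^-1.
  rewrite cabsM cabsV cabsM cabs_ii mul1r cabs_real cabs_cexp.
  have -> : complex.Re (ii * x%:C * l%:C) = 0 by rewrite -mulrA -rmorphM ReM /=; rewrite !mul0r !mulr0 subr0.
  by rewrite expR0 mulr1.
rewrite (cint_FTC ab q); apply: le_trans (cabsB _ _) _; rewrite !ca.
by apply: le_eqr; rewrite mulrDl mul1r.
Qed.

Lemma ln_sep (m n : nat) (u : R) : (0 < m)%N -> (m < n)%N -> 0 <= u -> u <= 1 ->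
  (n - m)%:R / (2 * n%:R) <= ln (n%:R + u) - ln (m%:R + u).
Proof.
move=> m0 mn u0 u1; have m1 : (1 : R) <= m%:R by rewrite ler1n.
have mn' : (m%:R : R) < n%:R by rewrite ltr_nat.
rewrite natrB; last exact: ltnW.
move: (m%:R : R) (n%:R : R) m1 mn' => x y x1 xy.
have h : ln (x + u) - ln (y + u) <= - ((y - x) / (y + u)).
  rewrite -ln_div ?posrE; [|lra|lra].
  have -> : (x + u) / (y + u) = 1 + - ((y - x) / (y + u)) by field; rewrite gt_eqF //; lra.
  apply: le_ln1Dx; rewrite ltrN2 ltr_pdivrMr; lra.
have h2 : (y - x) / (2 * y) <= (y - x) / (y + u).
  by apply: ler_wpM2l; [lra|rewrite lef_pV2 ?posrE; lra].
lra.
Qed.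

(** Bound for the integral of exp (i t (ln (n + u) - ln (m + u))) over an interval of length [L],
    uniform in 0 <= u <= 1: off the diagonal it majorises 2 divided by the frequency, estimated in
    [ln_sep]. *)
Definition osc_weight (L : R) (m n : nat) : R := if m == n then L else 4 * (maxn m n)%:R / `|m%:R - n%:R|.

Lemma W_pair (u : R) (m n : nat) a b : a <= b -> (0 < m)%N -> (0 < n)%N -> 0 <= u -> u <= 1 ->
  cabs (cint (fun z => cexp (ii * z * (ln (n%:R + u) - ln (m%:R + u))%:C)) a b) <= osc_weight (b - a) m n.
Proof.
move=> ab m0 n0 u0 u1; rewrite /osc_weight; case: eqVneq => [->|mn].
  rewrite subrr; rewrite (@cint_eq _ _ (fun=> 1)) //; last by move=> z _; rewrite mulr0 cexp0.
  by rewrite (cint_cst 1 ab) mulr1 cabs_pos // subr_ge0.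
have W1 (k l : nat) : (0 < k)%N -> (k < l)%N -> 0 < ln (l%:R + u) - ln (k%:R + u) /\ 
     2 / `|ln (l%:R + u) - ln (k%:R + u)| <= 4 * l%:R / (l - k)%:R.
  move=> k0 kl; have := ln_sep k0 kl u0 u1; move: (ln _ - ln _) => x hx.
  have l0 : (0 : R) < l%:R by rewrite ltr0n; lia.
  have d0 : (0 : R) < (l - k)%:R by rewrite ltr0n subn_gt0.
  have p0 : 0 < (l - k)%:R / (2 * l%:R) :> R by rewrite divr_gt0 // mulr_gt0.
  have x0 : 0 < x := lt_le_trans p0 hx.
  split => //; rewrite gtr0_norm //.
  have -> : 4 * l%:R / (l - k)%:R = 2 / ((l - k)%:R / (2 * l%:R)) :> R by field; rewrite !gt_eqF.
  by apply: ler_wpM2l => //; rewrite lef_pV2 ?posrE.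
case: (ltngtP m n) mn => // mn _.
  have [x0 h] := W1 _ _ m0 mn; apply: le_trans (cint_osc ab _) _; first by rewrite gt_eqF.
  by rewrite [X in _ <= _ / X]distrC -natrB ?(ltnW mn) // (@ger0_norm _ (n - m)%:R) ?ler0n.
have [x0 h] := W1 _ _ n0 mn; apply: le_trans (cint_osc ab _) _.
  by rewrite -oppr_eq0 opprB gt_eqF.
by rewrite -natrB ?(ltnW mn) // (@ger0_norm _ (m - n)%:R) ?ler0n // distrC.
Qed.

(** A Dirichlet polynomial on a vertical line, the modulus of n^(-s) being part of [a n]. The shift
    [u] is there for the averages over [d, d + 1] produced by summation by parts. *)
Definition osc_sum (r : seq nat) (a : nat -> C) (u : R) (z : C) : C := \sum_(n <- r) a n * cexp (- (ii * z * (ln (n%:R + u))%:C)).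

Lemma qhol_osc U (l : R) : bdd U -> exists F', qhol U (fun z => cexp (ii * z * l%:C)) F'.
Proof.
move=> bU; have q := qhol_cexpc bU (qholM bU (qholM bU (qhol_cst U ii) (qhol_id U)) (qhol_cst U l%:C)).
by eexists; exact: q.
Qed.
Lemma lip_osc U (l : R) : bdd U -> lipon U (fun z => cexp (ii * z * l%:C)).
Proof. by move=> bU; have [F' q] := qhol_osc l bU; exact: qhol_lip q. Qed.
Lemma lip_Fs U (r : seq nat) (a : nat -> C) (u : R) : bdd U -> lipon U (osc_sum r a u).
Proof.
move=> bU; apply: lip_sum => n; apply: lipZ => //; apply: lip_ext (lip_osc (- ln (n%:R + u)) bU) => z _.
by rewrite rmorphN mulrN.
Qed.
Lemma W_sym (L : R) m n : osc_weight L m n = osc_weight L n m.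
Proof. by rewrite /osc_weight eq_sym maxnC distrC. Qed.

Lemma mean_square (r : seq nat) (a : nat -> C) (b : nat -> R) (u x y : R) : x <= y -> 0 <= u -> u <= 1 ->
  (forall n, n \in r -> (0 < n)%N) -> (forall n, n \in r -> cabs (a n) <= b n) ->
  complex.Re (cint (fun z => ((cabs (osc_sum r a u z)) ^+ 2)%:C) x y) <=
    \sum_(n <- r) \sum_(m <- r) b n * b m * osc_weight (y - x) m n.
Proof.
move=> xy u0 u1 rp ab; have bS := bdd_seg x y.
pose G n m := fun z : C => (a n * conjc (a m)) * cexp (ii * z * (ln (m%:R + u) - ln (n%:R + u))%:C).
have E (z : C) : seg x y z -> ((cabs (osc_sum r a u z)) ^+ 2)%:C = \sum_(n <- r) \sum_(m <- r) G n m z.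
  move=> /segP[t _ ->]; rewrite mul_conj /osc_sum conj_sum mulr_suml; apply: eq_bigr => n _.
  rewrite mulr_sumr; apply: eq_bigr => m _.
  rewrite /G conjM conj_cexp.
  have -> : conjc (- (ii * t%:C * (ln (m%:R + u))%:C)) = ii * t%:C * (ln (m%:R + u))%:C.
    by apply: complexP; rewrite ?ReN ?ImN /=; rewrite ?mul0r ?mulr0 ?subr0 ?addr0 ?oppr0 // ; ring.
  rewrite mulrACA -cexpD; congr (_ * cexp _); rewrite rmorphB; ring.
have lG n m : lipon (seg x y) (G n m) by apply: lipZ => //; exact: lip_osc.
rewrite (cint_eq xy E) (cint_sum _ xy); last by move=> n; apply: lip_sum => m; exact: lG.
apply: le_trans (le_trans (ler_norm _) (cabs_Re _)) _.
apply: le_trans (cabs_sum _ _ _) _; rewrite [leRHS]big_seq big_seq; apply: ler_sum => n nr.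
rewrite (cint_sum _ xy) //; apply: le_trans (cabs_sum _ _ _) _.
rewrite [leRHS]big_seq big_seq; apply: ler_sum => m mr.
rewrite cintZ //; last exact: lip_osc.
rewrite cabsM cabsM cabs_conj; apply: ler_pM; rewrite ?mulr_ge0 ?cabs_ge0 //.
  by apply: ler_pM; rewrite ?cabs_ge0 ?ab.
by rewrite W_sym; exact: W_pair (rp _ nr) (rp _ mr) _ _.
Qed.

(* [2 v <= la + v ^ 2 / la] replaces Cauchy-Schwarz. *)
Lemma mean_abs (r : seq nat) (a : nat -> C) (b : nat -> R) (u x y la : R) : x <= y -> 0 <= u -> u <= 1 -> 0 < la ->
  (forall n, n \in r -> (0 < n)%N) -> (forall n, n \in r -> cabs (a n) <= b n) ->
  complex.Re (cint (fun z => (cabs (osc_sum r a u z))%:C) x y) <=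
    la * (y - x) + la^-1 * \sum_(n <- r) \sum_(m <- r) b n * b m * osc_weight (y - x) m n.
Proof.
move=> xy u0 u1 la0 rp ab; have bS := bdd_seg x y.
have lF := lip_abs (lip_Fs r a u bS).
have lF2 : lipon (seg x y) (fun z => ((cabs (osc_sum r a u z)) ^+ 2)%:C).
  by apply: lip_ext (lipM bS lF lF) => z _; rewrite expr2 rmorphM.
have h := mean_square xy u0 u1 rp ab.
have l2 := lipD (lip_cst (seg x y) la%:C) (lipZ la^-1%:C bS lF2).
apply: le_trans (le_cint_Re (G := fun z => la%:C + la^-1%:C * ((cabs (osc_sum r a u z)) ^+ 2)%:C) xy lF l2 _) _.
  move=> t _; rewrite -rmorphM -rmorphD /=; move: (cabs _) (cabs_ge0 (osc_sum r a u t%:C)) => v v0.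
  have -> : la + la^-1 * v ^+ 2 = (la ^+ 2 + v ^+ 2) / la by field; rewrite gt_eqF.
  by rewrite ler_pdivlMr //; have := sqr_ge0 (v - la); rewrite !expr2; clear -v0 la0; nra.
rewrite cintD //; [|exact: lip_cst|exact: lipZ].
rewrite cint_cst // cintZ // ReD; apply: lerD.
  by rewrite -rmorphM /= mulrC.
by rewrite ReZ; apply: ler_wpM2l => //; rewrite invr_ge0 ltW.
Qed.

Lemma sum_gap (M K m : nat) (de : R) : 0 < de -> (M <= m)%N -> (m < K)%N ->
  \sum_(M <= n < K | n != m) rp `|m%:R - n%:R| (- (1 + de)) <= 2 * (1 + de^-1).
Proof.
move=> d0 Mm mK.
rewrite (big_cat_nat Mm (ltnW mK)) /= [X in _ + X]big_ltn_cond // eqxx /=.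
have -> : \sum_(M <= n < m | n != m) rp `|m%:R - n%:R| (- (1 + de)) = \sum_(M <= n < m) rp (m - n)%:R (- (1 + de)) :> R.
  rewrite [LHS]big_nat_cond [RHS]big_nat_cond; apply: eq_big => [n|n /andP[/andP[_ h] _]].
    by case: (M <= n)%N => //=; case: ltngtP.
  by rewrite -natrB ?(ltnW h) // ger0_norm ?ler0n.
have -> : \sum_(m.+1 <= n < K | n != m) rp `|m%:R - n%:R| (- (1 + de)) = \sum_(m.+1 <= n < K) rp (n - m)%:R (- (1 + de)) :> R.
  rewrite [LHS]big_nat_cond [RHS]big_nat_cond; apply: eq_big => [n|n /andP[/andP[h _] _]].
    by case: (ltngtP m n).
  by rewrite distrC -natrB ?(ltnW h) // ger0_norm ?ler0n.
have -> : \sum_(M <= n < m) rp (m - n)%:R (- (1 + de)) = \sum_(0 <= n < m - M) rp n.+1%:R (- (1 + de)) :> R.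
  rewrite big_nat_rev /= -{1}(add0n M) big_addn big_nat [RHS]big_nat; apply: eq_bigr => n /andP[_ h].
  rewrite (_ : (m - (M + m - (n + M).+1) = n.+1)%N) //; by move: h; clear; lia.
have -> : \sum_(m.+1 <= n < K) rp (n - m)%:R (- (1 + de)) = \sum_(0 <= n < K - m.+1) rp n.+1%:R (- (1 + de)) :> R.
  by rewrite -{1}(add0n m.+1) big_addn; apply: eq_bigr => n _; rewrite addnS -addSn addnK.
by have := sum_rp (m - M) d0; have := sum_rp (K - m.+1) d0; lra.
Qed.

(** Each off-diagonal term is charged to its two indices with the weight |m - n|^(-1 - de), summable
    in either one; [h] records what an index pays. *)
Lemma sum_W (M K : nat) (b h : nat -> R) (L de : R) : 0 < de -> 
  (forall m, 0 <= h m) ->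
  (forall m n, (M <= m < K)%N -> (M <= n < K)%N -> m != n ->
     b n * b m * osc_weight L m n <= (h m + h n) * rp `|m%:R - n%:R| (- (1 + de))) ->
  \sum_(M <= n < K) \sum_(M <= m < K) b n * b m * osc_weight L m n <=
    L * (\sum_(M <= n < K) b n ^+ 2) + 4 * (1 + de^-1) * \sum_(M <= n < K) h n.
Proof.
move=> d0 h0 H.
have k0 x : 0 <= rp x (- (1 + de)) by exact: rp_ge0.
pose k m n := rp (R := R) `|m%:R - n%:R| (- (1 + de)).
apply: le_trans (_ : \sum_(M <= n < K) (L * b n ^+ 2 + \sum_(M <= m < K | m != n) (h m * k m n + h n * k m n)) <= _).
  rewrite !big_nat; apply: ler_sum => n nI.
  rewrite (bigD1_seq n) /= ?mem_index_iota ?iota_uniq //; apply: lerD.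
    by rewrite /osc_weight eqxx expr2 mulrC.
  rewrite big_nat_cond [leRHS]big_nat_cond; apply: ler_sum => m /andP[mI mn].
  by rewrite -mulrDl; exact: H.
rewrite big_split /= -mulr_sumr lerD2l.
have S1 : \sum_(M <= n < K) \sum_(M <= m < K | m != n) h n * k m n <= 2 * (1 + de^-1) * \sum_(M <= n < K) h n.
  rewrite mulr_sumr !big_nat; apply: ler_sum => n /andP[n1 n2].
  rewrite -mulr_sumr mulrC; apply: ler_wpM2r => //; apply: le_trans (sum_gap d0 n1 n2).
  by apply: le_eqr; apply: eq_bigr => m _; rewrite /k distrC.
have -> : \sum_(M <= n < K) \sum_(M <= m < K | m != n) (h m * k m n + h n * k m n) =
   \sum_(M <= n < K) \sum_(M <= m < K | m != n) h n * k m n + \sum_(M <= n < K) \sum_(M <= m < K | m != n) h n * k m n.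
  under eq_bigr do rewrite big_split /=.
  rewrite big_split /=; congr (_ + _).
  under eq_bigr do rewrite big_mkcond /=.
  rewrite exchange_big /=; apply: eq_bigr => n _; rewrite [RHS]big_mkcond; apply: eq_bigr => m _.
  by rewrite eq_sym /k distrC.
by lra.
Qed.

(** In place of a logarithm from the sum of 1 / |m - n|, a factor K^de is paid and the exponent
    becomes summable. *)
Lemma rp_dist (m n K : nat) (de : R) : m != n -> (m <= K)%N -> (n <= K)%N -> 0 <= de ->
  `|m%:R - n%:R|^-1 <= rp K%:R de * rp `|m%:R - n%:R| (- (1 + de)).
Proof.
move=> mn mK nK d0.
have [x1 xK] : 1 <= `|m%:R - n%:R| :> R /\ `|m%:R - n%:R| <= K%:R :> R.
  wlog lt : m n mn mK nK / (m < n)%N.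
    move=> H; case: (ltngtP m n) => h; [exact: H|rewrite distrC; apply: H => //; by rewrite eq_sym|by rewrite h eqxx in mn].
  by rewrite distrC -natrB ?(ltnW lt) // ger0_norm ?ler0n // ler1n ler_nat; move: lt nK; clear; lia.
move: (`|_|) x1 xK => x x1 xK; have x0 : 0 < x by lra.
have -> : x^-1 = rp x de * rp x (- (1 + de)) by rewrite -rpD -rpN1 //; congr rp; ring.
by apply: ler_wpM2r; [exact: rp_ge0|exact: rp_monob].
Qed.

Lemma sum_rp1 (al : R) (k : nat) : 0 < al -> \sum_(1 <= n < k.+1) rp n%:R (- (1 + al)) <= 1 + al^-1.
Proof. by move=> a0; rewrite big_add1 /=; exact: sum_rp. Qed.

Lemma short_sum (sg de L S : R) (b : nat -> R) (K : nat) : 1 / 2 < sg -> 0 < de -> 0 <= L -> (0 < K)%N ->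
  S = 1 + (2 * sg - 1)^-1 -> (forall n, b n = 2 * rp n%:R (- sg)) ->
  \sum_(1 <= n < K.+1) \sum_(1 <= m < K.+1) b n * b m * osc_weight L m n <=
    L * (4 * S) + 64 * (1 + de^-1) * S * rp K%:R (1 + de).
Proof.
move=> s1 d0 L0 K0 hS hb.
have al0 : 0 < 2 * sg - 1 by lra.
have K0' : (0 : R) < K%:R by rewrite ltr0n.
have bb n : b n ^+ 2 = 4 * rp n%:R (- (1 + (2 * sg - 1))).
  rewrite hb exprMn -rpX; congr (_ * rp _ _); ring.
pose h n := 16 * rp K%:R (1 + de) * rp n%:R (- (1 + (2 * sg - 1))).
apply: le_trans (sum_W (h := h) d0 _ _) _.
- by move=> m; rewrite /h !mulr_ge0 ?rp_ge0.
- move=> m n /andP[m1 mK] /andP[n1 nK] mn; rewrite /osc_weight (negPf mn).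
  have mM : ((maxn m n)%:R : R) <= K%:R by rewrite ler_nat; move: mK nK; clear; lia.
  have dd := rp_dist mn mK nK (ltW d0).
  have h1 : (maxn m n)%:R / `|m%:R - n%:R| <= rp K%:R (1 + de) * rp `|m%:R - n%:R| (- (1 + de)) :> R.
    rewrite rpD rp1 // -mulrA; apply: ler_pM => //; by rewrite ?ler0n ?invr_ge0.
  have h2 : b n * b m <= 4 * (rp n%:R (- (1 + (2 * sg - 1))) + rp m%:R (- (1 + (2 * sg - 1)))).
    have := bb n; have := bb m; move: (rp _ _) (rp _ _) (b n) (b m) => u v x y hx hy.
    have := sqr_ge0 (x - y); have := sqr_ge0 (x + y); rewrite !expr2 in hx hy *; nra.
  rewrite -!mulrA (mulrA (b n)); apply: le_trans (ler_pM _ _ h2 (ler_wpM2l _ h1)) _ => //.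
  - by rewrite !hb !mulr_ge0 ?rp_ge0.
  - by rewrite /h; apply: le_eqr; ring.
have A := sum_rp1 K al0.
under eq_bigr do rewrite bb.
rewrite -mulr_sumr -mulr_sumr; rewrite -hS in A; apply: lerD.
  by apply: ler_wpM2l => //; apply: ler_wpM2l.
have := ler_wpM2l (_ : 0 <= 64 * (1 + de^-1) * rp K%:R (1 + de)) A => H.
apply: le_trans (le_trans _ (H _)) _.
- by apply: le_eqr; ring.
- by rewrite !mulr_ge0 ?rp_ge0 // addr_ge0 // invr_ge0 ltW.
- by apply: le_eqr; ring.
Qed.

Lemma tail_sum (q : nat) (de L : R) (b : nat -> R) (X K : nat) : 0 < de -> de <= 1 / 2 -> 0 <= L -> L <= 2 * X%:R -> (0 < X)%N -> (X < K)%N ->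
  (forall n, b n = 2 * q%:R * rp n%:R (- (3 / 2))) ->
  \sum_(X.+1 <= n < K) \sum_(X.+1 <= m < K) b n * b m * osc_weight L m n <=
    (16 + 128 * (1 + de^-1)) * q%:R ^+ 2 * rp X%:R (- (1 - de)).
Proof.
move=> d0 d1 L0 LX X0 XK hb.
have X0' : (0 : R) < X%:R by rewrite ltr0n.
have q0 : 0 <= q%:R ^+ 2 :> R by exact: sqr_ge0.
pose h n := 16 * q%:R ^+ 2 * rp n%:R (- (1 + (1 - de))).
(* The whole term is charged to the smaller index: [n] occurs with exponent -3/2 + 1 + de <= 0, so
   it may be replaced by [m]. *)
have ws (m n : nat) : (0 < m)%N -> (m < n)%N -> b n * b m * osc_weight L m n <= h m * rp `|m%:R - n%:R| (- (1 + de)).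
  move=> m0 mn; have mn0 : m != n by rewrite lt_eqF.
  have m0' : (0 : R) < m%:R by rewrite ltr0n.
  have n0' : (0 : R) < n%:R by rewrite ltr0n (ltn_trans m0).
  have mn' : (m%:R : R) <= n%:R by rewrite ler_nat ltnW.
  rewrite /osc_weight (negPf mn0) (maxn_idPr (ltnW mn)).
  have dd := rp_dist mn0 (ltnW mn) (leqnn n) (ltW d0).
  have h1 : rp n%:R (- (3 / 2)) * rp m%:R (- (3 / 2)) * (n%:R * rp n%:R de) <= rp m%:R (- (1 + (1 - de))).
    rewrite (_ : n%:R * rp n%:R de = rp n%:R (1 + de)); last by rewrite rpD rp1.
    rewrite mulrAC -rpD.
    have -> : - (1 + (1 - de)) = (- (3 / 2) + (1 + de)) + - (3 / 2) :> R by lra.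
    rewrite [leRHS]rpD; apply: ler_wpM2r; first exact: rp_ge0.
    by apply: rp_antib => //; lra.
  have -> : b n * b m * (4 * n%:R / `|m%:R - n%:R|) = 16 * q%:R ^+ 2 * (rp n%:R (- (3 / 2)) * rp m%:R (- (3 / 2)) * n%:R) * `|m%:R - n%:R|^-1.
    by rewrite !hb; ring.
  apply: le_trans (ler_wpM2l _ dd) _; first by rewrite !mulr_ge0 ?rp_ge0 // ltW.
  rewrite [leLHS]mulrA; apply: ler_wpM2r; first exact: rp_ge0.
  have h2 := ler_wpM2l (mulr_ge0 (_ : 0 <= 16) q0) h1.
  by rewrite /h; apply: le_trans (h2 _) => //; apply: le_eqr; ring.
have h0 m : 0 <= h m by rewrite /h !mulr_ge0 ?rp_ge0.
apply: le_trans (sum_W (h := h) d0 h0 _) _.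
  move=> m n /andP[m1 mK] /andP[n1 nK] mn.
  have k0 : 0 <= rp `|m%:R - n%:R| (- (1 + de)) :> R := rp_ge0 _ _.
  rewrite mulrDl; have [lt|lt|/eqP] := ltngtP m n; last by rewrite (negPf mn).
    by apply: le_trans (ws m n _ lt) _; [lia|rewrite lerDl mulr_ge0].
  rewrite (mulrC (b n)) W_sym distrC; apply: le_trans (ws n m _ lt) _; [lia|rewrite lerDr mulr_ge0 //].
  by rewrite distrC.
have T1 : \sum_(X.+1 <= n < K) rp n%:R (- (1 + (1 - de))) <= 2 * rp X%:R (- (1 - de)).
  case: K XK {ws h0} => // K XK; rewrite big_add1 /=.
  apply: le_trans (tail_rp (_ : 0 < 1 - de) X0 _) _; [lra|by []|].
  apply: ler_wpM2r; first exact: rp_ge0.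
  by rewrite -[leRHS]invrK lef_pV2 ?posrE; lra.
have T2 : \sum_(X.+1 <= n < K) b n ^+ 2 <= 4 * q%:R ^+ 2 * X%:R^-1 * \sum_(X.+1 <= n < K) rp n%:R (- (1 + (1 - de))).
  rewrite mulr_sumr !big_nat; apply: ler_sum => n /andP[n1 _].
  have Xn : (X%:R : R) <= n%:R by rewrite ler_nat; lia.
  have -> : b n ^+ 2 = 4 * q%:R ^+ 2 * rp n%:R (- (3 / 2) * 2%:R) by rewrite hb rpX; ring.
  rewrite -[leRHS]mulrA; apply: ler_wpM2l; first by rewrite mulr_ge0.
  have -> : - (3 / 2) * 2%:R = (- (1 + de)) + (- (1 + (1 - de))) :> R by lra.
  rewrite rpD; apply: ler_wpM2r; first exact: rp_ge0.
  apply: le_trans (rp_antib X0' Xn _) _; first by lra.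
  rewrite -(rpN1 X0'); apply: rp_monoe; last by lra.
  by rewrite ler1n.
have L1 : L * X%:R^-1 <= 2 by rewrite ler_pdivrMr.
rewrite -mulr_sumr.
have Y0 := rp_ge0 (X%:R : R) (- (1 - de)).
have A0 : 0 <= \sum_(X.+1 <= n < K) rp n%:R (- (1 + (1 - de))) :> R by apply: sumr_ge0 => n _; exact: rp_ge0.
move: A0 T1 T2; move: (\sum_(X.+1 <= n < K) rp n%:R (- (1 + (1 - de)))) (\sum_(X.+1 <= n < K) b n ^+ 2).
move: (rp X%:R (- (1 - de)) : R) Y0 => Y Y0 A B A0 T1 T2.
have t1 : L * B <= 16 * q%:R ^+ 2 * Y.
  apply: le_trans (ler_wpM2l L0 T2) _.
  have -> : L * (4 * q%:R ^+ 2 / X%:R * A) = (4 * q%:R ^+ 2 * A) * (L / X%:R) by ring.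
  apply: le_trans (ler_wpM2l _ L1) _; first by rewrite !mulr_ge0.
  have := ler_wpM2l q0 T1; clear; lra.
have e0 : 0 <= 1 + de^-1 by rewrite addr_ge0 // invr_ge0 ltW.
have t2 : 4 * (1 + de^-1) * (16 * q%:R ^+ 2 * A) <= 128 * (1 + de^-1) * q%:R ^+ 2 * Y.
  by have := ler_wpM2l (mulr_ge0 e0 q0) T1; clear; move: (1 + de^-1) (q%:R ^+ 2) => u v; lra.
by apply: le_trans (lerD t1 t2) _; apply: le_eqr; ring.
Qed.

End MeanValue.

(** * Summation by parts and the mean of a Dirichlet polynomial with bounded coefficient sums *)

Section MeanValue2.
Variable R : realType.
Local Notation C := R[i].
Local Notation ii := (@ii R).
Implicit Types (s z w : C) (x y sg : R) (g : nat -> R).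

Lemma xp_line x sg z : xp x (sg%:C + ii * z) = xp x sg%:C * cexp (- (ii * z * (ln x)%:C)).
Proof. by rewrite xpD. Qed.

Lemma xp_step (x h : R) s : 1 <= x -> 0 <= h -> 0 <= complex.Re s ->
  cabs (xp (x + h) s - xp x s + s * h%:C * xp x (s + 1)) <= (cabs s + cabs s ^+ 2) * h ^+ 2.
Proof.
move=> x1 h0 s0; have x0 : 0 < x by lra.
pose l := ln (x + h) - ln x; pose w := - (s * l%:C).
have lq : `|l - h / x| <= h ^+ 2.
  have xh1 : 1 <= x + h by lra.
  by have := ln_quad x1 xh1; rewrite (_ : x + h - x = h) //; ring.
have l0 : 0 <= l by rewrite /l subr_ge0 ler_ln ?posrE; lra.
have lh : l <= h.
  rewrite /l -ln_div ?posrE //; last by lra.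
  have -> : (x + h) / x = 1 + h / x by field; rewrite gt_eqF.
  apply: le_trans (le_ln1Dx _) _.
    by apply: lt_le_trans (_ : 0 <= _); [lra|rewrite divr_ge0 // ltW].
  by rewrite ler_pdivrMr //; nra.
have e1 : xp (x + h) s = xp x s * cexp w by rewrite /xp -cexpD /w /l; congr cexp; rewrite rmorphB; ring.
have -> : xp (x + h) s - xp x s + s * h%:C * xp x (s + 1) = xp x s * ((cexp w - 1 - w) - s * (l - h / x)%:C).
  have -> : (l - h / x)%:C = l%:C - h%:C * (x^-1)%:C :> C by rewrite -rmorphM -rmorphB.
  by rewrite e1 xpD xpp1 // /w; ring.
have n1 : cabs (xp x s) <= 1 by rewrite cabs_xp; apply: rp_le1 => //; lra.
have cs := cabs_ge0 s.
have cw : cabs w <= cabs s * h by rewrite cabsN cabsM cabs_pos //; apply: ler_wpM2l.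
have em : emax w <= 1.
  by rewrite ge_max lexx expR_le1 ReN ReM /= mulr0 subr0 oppr_le0 mulr_ge0.
have n2 : cabs (cexp w - 1 - w) <= cabs s ^+ 2 * h ^+ 2.
  apply: le_trans (cexp_quad _) _; rewrite -[leRHS]mulr1 -exprMn.
  apply: ler_pM => //; [exact: exprn_ge0 (cabs_ge0 _)|by have := emax_ge1 w; lra|].
  by apply: lerXn2r; rewrite ?nnegrE ?cabs_ge0 // mulr_ge0.
have n3 : cabs (s * (l - h / x)%:C) <= cabs s * h ^+ 2 by rewrite cabsM cabs_real; exact: ler_wpM2l.
rewrite cabsM -[leRHS]mul1r; apply: ler_pM; rewrite ?cabs_ge0 //.
by apply: le_trans (cabsB _ _) _; rewrite mulrDl addrC; exact: lerD.
Qed.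

(** The average over [d, d + 1] is a finite sum over [m] nodes, so that mean values can be taken
    node by node; [m] is chosen afterwards to make the error negligible. *)
Lemma xp_riemann (d m : nat) s : (0 < d)%N -> (0 < m)%N -> 0 <= complex.Re s ->
  cabs (xp d%:R s - xp d.+1%:R s - s * (m%:R^-1)%:C * \sum_(0 <= i < m) xp (d%:R + i%:R / m%:R) (s + 1)) <= (cabs s + cabs s ^+ 2) / m%:R.
Proof.
move=> d0 m0 s0; have m0' : (0 : R) < m%:R by rewrite ltr0n.
have d1 : (1 : R) <= d%:R by rewrite ler1n.
pose f i := xp (d%:R + i%:R / m%:R) s.
have -> : xp d%:R s - xp d.+1%:R s = - \sum_(0 <= i < m) (f i.+1 - f i).
  rewrite telescope_sumr // /f mul0r addr0 divff ?gt_eqF // natr1 opprB //.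
rewrite mulr_sumr -opprD -big_split /= cabsN.
apply: le_trans (cabs_sum _ _ _) _.
have -> : (cabs s + cabs s ^+ 2) / m%:R = \sum_(0 <= i < m) (cabs s + cabs s ^+ 2) * (m%:R^-1) ^+ 2 :> R.
  by rewrite sumr_const_nat subn0 -mulr_natr; field; rewrite gt_eqF.
apply: ler_sum => i _.
have i0 : 0 <= i%:R / m%:R :> R by rewrite divr_ge0.
have -> : f i.+1 = xp (d%:R + i%:R / m%:R + m%:R^-1) s.
  by rewrite /f -natr1 mulrDl mul1r addrA.
by apply: xp_step => //; lra.
Qed.

Lemma abel (g : nat -> R) (f : nat -> C) (X D : nat) : (X <= D)%N ->
  let G n := \sum_(1 <= j < n.+1) g j in
  \sum_(X.+1 <= d < D.+1) (g d)%:C * f d =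
  \sum_(X.+1 <= d < D.+1) (G d)%:C * (f d - f d.+1) + (G D)%:C * f D.+1 - (G X)%:C * f X.+1.
Proof.
move=> XD G; rewrite -(subnK XD); elim: (D - X)%N => [|k IH].
  by rewrite add0n !big_geq // add0r subrr.
rewrite addSn big_nat_recr ?ltnS ?leq_addl //= IH [in RHS]big_nat_recr ?ltnS ?leq_addl //=.
have -> : G (k + X).+1 = G (k + X)%N + g (k + X).+1 by rewrite /G big_nat_recr.
by rewrite rmorphD; ring.
Qed.

Definition dpoly (g : nat -> R) (D : nat) s : C := \sum_(1 <= d < D.+1) (g d)%:C * xp d%:R s.

(* Summation by parts in the tail produces differences [d ^ (- s) - (d + 1) ^ (- s)],
   which are averages of [s (d + u) ^ (- s - 1)] over [u] in [[0, 1]]. *)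
Definition ftail (g : nat -> R) (X D : nat) (u : R) s : C :=
  \sum_(X.+1 <= d < D.+1) (\sum_(1 <= j < d.+1) g j)%:C * xp (d%:R + u) (s + 1).

Lemma dpoly_tail (g : nat -> R) (q X D m : nat) s : (X <= D)%N -> (0 < m)%N -> 0 <= complex.Re s ->
  (forall n, `|\sum_(1 <= j < n.+1) g j| <= 2 * q%:R) ->
  cabs (dpoly g D s) <= cabs (dpoly g X s) + 4 * q%:R
    + cabs s / m%:R * \sum_(0 <= i < m) cabs (ftail g X D (i%:R / m%:R) s)
    + 2 * q%:R * D%:R * (cabs s + cabs s ^+ 2) / m%:R.
Proof.
move=> XD m0 s0 hG.
rewrite {1}/dpoly (big_cat_nat (n := X.+1)) //= -/(dpoly g X s) (abel g _ XD).
set G := fun n => \sum_(1 <= j < n.+1) g j.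
have m0' : (0 : R) <= m%:R^-1 by rewrite invr_ge0.
have xp1' (n : nat) : cabs (xp n.+1%:R s) <= 1.
  by rewrite cabs_xp; apply: rp_le1; rewrite ?ler1n //; lra.
have gb (n k : nat) : cabs ((G n)%:C * xp k.+1%:R s) <= 2 * q%:R.
  by rewrite cabsM cabs_real -[leRHS]mulr1; apply: ler_pM; rewrite ?normr_ge0 ?cabs_ge0 ?hG ?xp1'.
pose E d := xp d%:R s - xp d.+1%:R s - s * (m%:R^-1)%:C * \sum_(0 <= i < m) xp (d%:R + i%:R / m%:R) (s + 1).
have -> : \sum_(X.+1 <= d < D.+1) (G d)%:C * (xp d%:R s - xp d.+1%:R s) =
   s * (m%:R^-1)%:C * \sum_(0 <= i < m) ftail g X D (i%:R / m%:R) s + \sum_(X.+1 <= d < D.+1) (G d)%:C * E d.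
  rewrite /ftail exchange_big mulr_sumr -big_split /=; apply: eq_bigr => d _.
  by rewrite -mulr_sumr /E; ring.
have b1 : cabs (s * (m%:R^-1)%:C * \sum_(0 <= i < m) ftail g X D (i%:R / m%:R) s) <=
   cabs s / m%:R * \sum_(0 <= i < m) cabs (ftail g X D (i%:R / m%:R) s).
  rewrite !cabsM cabs_pos //; apply: ler_wpM2l; [exact: mulr_ge0 (cabs_ge0 _) _|exact: cabs_sum].
have b2 : cabs (\sum_(X.+1 <= d < D.+1) (G d)%:C * E d) <= 2 * q%:R * D%:R * (cabs s + cabs s ^+ 2) / m%:R.
  apply: le_trans (cabs_sum _ _ _) _.
  apply: le_trans (_ : \sum_(X.+1 <= d < D.+1) 2 * q%:R * ((cabs s + cabs s ^+ 2) / m%:R) <= _).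
    rewrite !big_nat; apply: ler_sum => d /andP[d1 _].
    rewrite cabsM cabs_real; apply: ler_pM; rewrite ?normr_ge0 ?cabs_ge0 ?hG //.
    by apply: xp_riemann => //; lia.
  have k0 : 0 <= (cabs s + cabs s ^+ 2) / m%:R by rewrite mulr_ge0 // addr_ge0 ?exprn_ge0 ?cabs_ge0.
  rewrite sumr_const_nat subSS -[leLHS]mulr_natr.
  apply: le_trans (ler_wpM2l _ (_ : _ <= D%:R)) _.
  - by apply: mulr_ge0 => //; exact: mulr_ge0.
  - by rewrite ler_nat leq_subr.
  - by apply: le_eqr; ring.
have := gb D D; have := gb X X; move: b1 b2.
rewrite -!addrA; move: (_ / m%:R * _) (2 * q%:R * _) => B1 B2 b1 b2 g1 g2.
apply: le_trans (cabsD _ _) _; rewrite lerD2l.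
apply: le_trans (cabsD _ _) _.
have := cabsD (\sum_(X.+1 <= d < D.+1) (G d)%:C * E d) ((G D)%:C * xp D.+1%:R s - (G X)%:C * xp X.+1%:R s).
have := cabsB ((G D)%:C * xp D.+1%:R s) ((G X)%:C * xp X.+1%:R s).
by move: (q%:R : R) b1 b2 g1 g2 => Q; move: (cabs _) (cabs _) (cabs _) (cabs _) (cabs _) (cabs _); clear; move=> *; lra.
Qed.

Lemma dpoly_line g (D : nat) sg z : dpoly g D (sg%:C + ii * z) = osc_sum (index_iota 1 D.+1) (fun d => (g d)%:C * xp d%:R sg%:C) 0 z.
Proof. by rewrite /dpoly /osc_sum; apply: eq_bigr => d _; rewrite xp_line addr0 mulrA. Qed.

Lemma ftail_line g (X D : nat) (u : R) sg z : ftail g X D u (sg%:C + ii * z) =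
  osc_sum (index_iota X.+1 D.+1) (fun d => (\sum_(1 <= j < d.+1) g j)%:C * xp (d%:R + u) (sg + 1)%:C) u z.
Proof.
rewrite /ftail /osc_sum; apply: eq_bigr => d _.
by rewrite (_ : sg%:C + ii * z + 1 = (sg + 1)%:C + ii * z) ?xp_line ?mulrA // rmorphD; ring.
Qed.

Lemma rp2 x : 0 < x -> rp x 2 = x ^+ 2.
Proof. by move=> x0; rewrite -[2]mul1r rpX rp1. Qed.

Lemma short_int g (q K : nat) (sg de T x y : R) : 1 / 2 < sg -> 0 < de -> de <= 1 / 2 -> (forall n, `|g n| <= 2) -> (0 < q)%N ->
  1 <= T -> - T <= x -> x <= y -> y <= T -> (0 < K)%N -> K%:R <= 2 * (q%:R * T) ->
  complex.Re (cint (fun z => (cabs (dpoly g K (sg%:C + ii * z)))%:C) x y) <=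
   (2 + 8 * (1 + (2 * sg - 1)^-1) + 256 * (1 + de^-1) * (1 + (2 * sg - 1)^-1)) * (q%:R * rp T (1 + de)).
Proof.
move=> s1 d0 d1 g2 q0 T1 hx xy hy K0 KX.
have q0' : (1 : R) <= q%:R by rewrite ler1n.
have qp : (0 : R) < q%:R by rewrite ltr0n.
have K0' : (0 : R) < K%:R by rewrite ltr0n.
have T0 : 0 < T by lra.
pose a d := (g d)%:C * xp d%:R sg%:C.
pose b d := 2 * rp d%:R (- sg) : R.
rewrite (@cint_eq _ _ (fun z => (cabs (osc_sum (index_iota 1 K.+1) a 0 z))%:C)) //; last by move=> z _; rewrite dpoly_line.
(* The weight [q] balances the two parts: [q] times the length is O(q T), and K^(1 + de) <= 4 q^2
   T^(1 + de) divided by [q] is of the same order. *)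
have h := @mean_abs R (index_iota 1 K.+1) a b 0 x y q%:R xy (lexx _) ler01 qp _ _.
apply: le_trans (h _ _) _.
- by move=> n; rewrite mem_index_iota => /andP[].
- by move=> n _; rewrite /a /b cabsM cabs_real cabs_xp /=; apply: ler_wpM2r; [exact: rp_ge0|exact: g2].
have L0 : 0 <= y - x by lra.
have S0 := @short_sum R sg de (y - x) _ b K s1 d0 L0 K0 erefl (fun n => erefl).
set S := 1 + (2 * sg - 1)^-1 in S0 *. set E := 1 + de^-1 in S0 *.
have Sp : 0 <= S by rewrite addr_ge0 // invr_ge0; lra.
have Ep : 0 <= E by rewrite addr_ge0 // invr_ge0; lra.
set Y := rp T (1 + de).
have TY : T <= Y by rewrite -{1}(rp1 T0); apply: rp_monoe => //; lra.
have KY : rp K%:R (1 + de) <= 4 * q%:R ^+ 2 * Y.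
  apply: le_trans (rp_monob K0' KX _) _; first by lra.
  rewrite !rpM // ?mulr_gt0 // mulrA; apply: ler_wpM2r; first exact: rp_ge0.
  apply: ler_pM; rewrite ?rp_ge0 //.
    have -> : 4 = 2 ^+ 2 :> R by ring.
    by rewrite -rp2 //; apply: rp_monoe; lra.
  by rewrite -rp2 //; apply: rp_monoe => //; lra.
have q1 : q%:R^-1 * q%:R = 1 :> R by rewrite mulVf // gt_eqF.
have qi0 : 0 <= q%:R^-1 :> R by rewrite invr_ge0 ltW.
have qi1 : q%:R^-1 <= q%:R :> R by apply: (le_trans _ q0'); rewrite invf_le1.
have Y0 : 0 <= Y by exact: rp_ge0.
apply: le_trans (lerD (lexx _) (ler_wpM2l qi0 S0)) _.
have LY : y - x <= 2 * Y by lra.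
have c1 : q%:R * (y - x) <= 2 * (q%:R * Y) by have := ler_wpM2l (ltW qp) LY; clear; lra.
have c2 : q%:R^-1 * ((y - x) * (4 * S)) <= 8 * S * (q%:R * Y).
  have -> : 8 * S * (q%:R * Y) = q%:R * ((2 * Y) * (4 * S)) by ring.
  by apply: ler_pM => //; [rewrite !mulr_ge0|apply: ler_wpM2r => //; rewrite mulr_ge0].
have c3 : q%:R^-1 * (64 * E * S * rp K%:R (1 + de)) <= 256 * E * S * (q%:R * Y).
  have -> : 256 * E * S * (q%:R * Y) = q%:R^-1 * (64 * E * S * (4 * q%:R ^+ 2 * Y)).
    by field; rewrite gt_eqF.
  by apply: ler_wpM2l => //; apply: ler_wpM2l => //; rewrite !mulr_ge0.
by rewrite [_^-1 * (_ + _)]mulrDr; apply: le_trans (lerD c1 (lerD c2 c3)) _; apply: le_eqr; ring.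
Qed.

Lemma tail_int g (q X D : nat) (sg de T x y u : R) : 1 / 2 < sg -> 0 < de -> de <= 1 / 2 ->
  (forall n, `|\sum_(1 <= j < n.+1) g j| <= 2 * q%:R) -> (0 < q)%N -> 0 <= u -> u <= 1 ->
  1 <= T -> - T <= x -> x <= y -> y <= T -> (X <= D)%N -> q%:R * T <= X%:R -> X%:R <= 2 * (q%:R * T) ->
  complex.Re (cint (fun z => (cabs (ftail g X D u (sg%:C + ii * z)))%:C) x y) <=
   (34 + 256 * (1 + de^-1)) * (q%:R * rp T de).
Proof.
move=> s1 d0 d1 hG q0 u0 u1 T1 hx xy hy XD qX Xq.
have q0' : (1 : R) <= q%:R by rewrite ler1n.
have qp : (0 : R) < q%:R by rewrite ltr0n.
have T0 : 0 < T by lra.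
have TX : T <= X%:R by nra.
have X0' : (0 : R) < X%:R by lra.
have X0 : (0 < X)%N by rewrite -(ltr0n R).
pose a d := (\sum_(1 <= j < d.+1) g j)%:C * xp (d%:R + u) (sg + 1)%:C.
pose b d := 2 * q%:R * rp d%:R (- (3 / 2)) : R.
rewrite (@cint_eq _ _ (fun z => (cabs (osc_sum (index_iota X.+1 D.+1) a u z))%:C)) //; last by move=> z _; rewrite ftail_line.
(* The weight q / T: times the length it gives O(q), and its inverse times q^2 X^(de - 1) is
   O(X^de), since X >= q T. The factor |s| <= 3 T in front of the tail leaves room for no more. *)
have la0 : 0 < q%:R / T by rewrite divr_gt0.
apply: le_trans (mean_abs (b := b) xy u0 u1 la0 _ _) _.
- by move=> n; rewrite mem_index_iota => /andP[n1 _]; exact: leq_trans n1.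
- move=> n; rewrite mem_index_iota => /andP[n1 _].
  have n1' : (1 : R) <= n%:R by rewrite ler1n; exact: leq_trans n1.
  rewrite /a /b cabsM cabs_real cabs_xp /=; apply: ler_pM => //; first exact: rp_ge0.
  apply: le_trans (rp_antib (_ : 0 < n%:R) (_ : _ <= n%:R + u) _) _; [lra|lra|lra|].
  by apply: rp_monoe => //; lra.
have L0 : 0 <= y - x by lra.
have LX : y - x <= 2 * X%:R by lra.
have S0 := @tail_sum R q de (y - x) b X D.+1 d0 d1 L0 LX X0 XD (fun n => erefl).
set E := 1 + de^-1 in S0 *.
have Ep : 0 <= E by rewrite addr_ge0 // invr_ge0; lra.
have li0 : 0 <= (q%:R / T)^-1 by rewrite invr_ge0 ltW.
apply: le_trans (lerD (lexx _) (ler_wpM2l li0 S0)) _.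
set Y := rp T de.
have Y1 : 1 <= Y by apply: rp_ge1 => //; lra.
have c1 : q%:R / T * (y - x) <= 2 * q%:R.
  have -> : 2 * q%:R = q%:R / T * (2 * T) by field; rewrite gt_eqF.
  by apply: ler_wpM2l; [exact: ltW|lra].
have c2 : X%:R * rp X%:R (- (1 - de)) <= 2 * q%:R * Y.
  rewrite -{1}(rp1 X0') -rpD (_ : 1 + - (1 - de) = de); last by ring.
  apply: le_trans (rp_monob X0' Xq (ltW d0)) _.
  rewrite !rpM // ?mulr_gt0 // mulrA; apply: ler_wpM2r; first exact: rp_ge0.
  apply: ler_pM; rewrite ?rp_ge0 //.
    have h2 : (0 : R) < 2 by []. by rewrite -{2}(rp1 h2); apply: rp_monoe; lra.
  by rewrite -{2}(rp1 qp); apply: rp_monoe => //; lra.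
have c3 : (q%:R / T)^-1 * ((16 + 128 * E) * q%:R ^+ 2 * rp X%:R (- (1 - de))) <= (16 + 128 * E) * (2 * q%:R * Y).
  have -> : (q%:R / T)^-1 * ((16 + 128 * E) * q%:R ^+ 2 * rp X%:R (- (1 - de))) = (16 + 128 * E) * ((q%:R * T) * rp X%:R (- (1 - de))).
    by field; rewrite !gt_eqF.
  apply: ler_wpM2l; first by lra.
  by apply: le_trans c2; apply: ler_wpM2r => //; exact: rp_ge0.
have c4 : q%:R <= q%:R * Y by nra.
by apply: le_trans (lerD c1 c3) _; move: c4; clear; lra.
Qed.

(** The threshold [X] is about q T because summation by parts replaces coefficients of size d^(-1/2)
    by ones of size q T d^(-3/2), which is a gain exactly beyond q T. *)
Lemma dpoly_mean (sg de : R) : 1 / 2 < sg -> sg <= 2 -> 0 < de -> de <= 1 / 2 ->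
  exists2 c : R, 0 < c & forall (g : nat -> R) (q D : nat) (T x y : R),
    (forall n, `|g n| <= 2) -> (forall n, `|\sum_(1 <= j < n.+1) g j| <= 2 * q%:R) -> (0 < q)%N -> (0 < D)%N ->
    1 <= T -> - T <= x -> x <= y -> y <= T ->
    complex.Re (cint (fun z => (cabs (dpoly g D (sg%:C + ii * z)))%:C) x y) <= c * (q%:R * rp T (1 + de)).
Proof.
move=> s1 s2 d0 d1.
pose S := 1 + (2 * sg - 1)^-1; pose E := 1 + de^-1.
have Sp : 0 <= S by rewrite addr_ge0 // invr_ge0; lra.
have Ep : 0 <= E by rewrite addr_ge0 // invr_ge0; lra.
pose C1 := 2 + 8 * S + 256 * E * S; pose C2 := 34 + 256 * E.
have C10 : 0 < C1 by rewrite /C1; have := mulr_ge0 Ep Sp; lra.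
have C20 : 0 < C2 by rewrite /C2; lra.
exists (C1 + 3 * C2 + 10) => [|g q D T x y g2 hG q0 D0 T1 hx xy hy]; first by lra.
have q0' : (1 : R) <= q%:R by rewrite ler1n.
have T0 : 0 < T by lra.
have bS := bdd_seg x y.
pose Y := rp T (1 + de).
have Ed : Y = T * rp T de by rewrite /Y rpD rp1.
have Y0 : 0 <= Y by exact: rp_ge0.
have TY : T <= Y by rewrite -{1}(rp1 T0); apply: rp_monoe => //; lra.
have qT0 : 0 <= q%:R * T by nra.
have qY0 : 0 <= q%:R * Y by nra.
pose X := (Num.truncn (q%:R * T)).+1.
have qX : q%:R * T <= X%:R by apply: ltW; exact: truncnS_gt.
have Xq : X%:R <= 2 * (q%:R * T).
  rewrite /X -natr1; have : (Num.truncn (q%:R * T))%:R <= q%:R * T by rewrite truncn_le.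
  have q1T : 1 <= q%:R * T by nra.
  by clear -q1T; lra.
have [DX|XD] := leqP D X.
  have DX' : D%:R <= 2 * (q%:R * T) by apply: le_trans Xq; rewrite ler_nat.
  apply: le_trans (short_int s1 d0 d1 g2 q0 T1 hx xy hy D0 DX') _; apply: ler_wpM2r => //.
  by rewrite -/S -/E -/C1; lra.
have {}XD := ltnW XD.
(* With |s| <= 3 T this [m] brings the discretisation error of [dpoly_tail] below [q]; together with
   the boundary terms 4 q this makes the 5 q used below. *)
pose m := (Num.truncn (2 * D%:R * (3 * T + (3 * T) ^+ 2))).+1.
have mB : 2 * D%:R * (3 * T + (3 * T) ^+ 2) <= m%:R by apply: ltW; exact: truncnS_gt.
have m0 : (0 : R) < m%:R by rewrite ltr0n.
pose A z := cabs (dpoly g X (sg%:C + ii * z)).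
pose B i z := cabs (ftail g X D (i%:R / m%:R) (sg%:C + ii * z)).
have lA : lipon (seg x y) (fun z => (A z)%:C).
  by apply: lip_abs; apply: lip_ext (lip_Fs _ _ _ bS) => z _; rewrite dpoly_line.
have lB i : lipon (seg x y) (fun z => (B i z)%:C).
  by apply: lip_abs; apply: lip_ext (lip_Fs _ _ _ bS) => z _; rewrite ftail_line.
have lP : lipon (seg x y) (fun z => (cabs (dpoly g D (sg%:C + ii * z)))%:C).
  by apply: lip_abs; apply: lip_ext (lip_Fs _ _ _ bS) => z _; rewrite dpoly_line.
have lS : lipon (seg x y) (fun z => \sum_(0 <= i < m) (B i z)%:C) by apply: lip_sum.
have lZ := lipZ (3 * T / m%:R)%:C bS lS.
have lC := lip_cst (seg x y) (5 * q%:R)%:C.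
have h := le_cint_Re (G := fun z => (A z)%:C + ((5 * q%:R)%:C + (3 * T / m%:R)%:C * \sum_(0 <= i < m) (B i z)%:C)) xy lP (lipD lA (lipD lC lZ)).
apply: le_trans (h _) _ => {h}.
  move=> t /andP[t1 t2]; set s := sg%:C + ii * t%:C.
  have s0 : 0 <= complex.Re s by rewrite Re_line; clear -s1; lra.
  have cs : cabs s <= 3 * T.
    apply: le_trans (cabsD _ _) _; rewrite cabsM cabs_ii mul1r !cabs_real.
    have : `|sg| <= 2 by rewrite ger0_norm; clear -s1 s2; lra.
    have : `|t| <= T by rewrite ler_norml; clear -hx hy t1 t2; lra.
    by clear -T1; lra.
  have b := dpoly_tail XD (ltn0Sn _ : (0 < m)%N) s0 hG.
  rewrite !ReD ReZ Re_sum /=; apply: le_trans b _.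
  rewrite -/(A t%:C) -!addrA lerD2l.
  have e1 : 2 * q%:R * D%:R * (cabs s + cabs s ^+ 2) / m%:R <= q%:R.
    rewrite ler_pdivrMr //.
    have -> : 2 * q%:R * D%:R * (cabs s + cabs s ^+ 2) = q%:R * (2 * D%:R * (cabs s + cabs s ^+ 2)) by ring.
    apply: ler_wpM2l; first by clear -q0'; lra.
    apply: le_trans mB; apply: ler_wpM2l; first by rewrite mulr_ge0.
    apply: lerD => //; apply: lerXn2r; rewrite ?nnegrE ?cabs_ge0 //; clear -T0; lra.
  have e2 : cabs s / m%:R * \sum_(0 <= i < m) cabs (ftail g X D (i%:R / m%:R) s) <= 3 * T / m%:R * \sum_(0 <= i < m) B i t%:C.
    apply: ler_wpM2r; first by apply: sumr_ge0 => i _; exact: cabs_ge0.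
    by apply: ler_wpM2r => //; rewrite invr_ge0 ltW.
  by move: e1 e2; clear; move: (_ / m%:R) (_ * \sum_(_ <= _ < _) _) (_ * \sum_(_ <= _ < _) _) => *; lra.
rewrite (cintD xy lA (lipD lC lZ)) (cintD xy lC lZ) (cintZ _ xy lS) (cint_cst _ xy) (cint_sum _ xy lB) !ReD !ReZ Re_sum /=.
have X0 : (0 < X)%N by [].
have i1 := short_int s1 d0 d1 g2 q0 T1 hx xy hy X0 Xq.
have i2 : (y - x) * (5 * q%:R) <= 10 * (q%:R * Y).
  have : y - x <= 2 * Y by clear -hx hy TY; lra.
  have qn : 0 <= q%:R :> R by clear -q0'; lra.
  by move=> hh; have := ler_wpM2r qn hh; clear; lra.
have i3 : 3 * T / m%:R * \sum_(0 <= i < m) complex.Re (cint (fun z => (B i z)%:C) x y) <= 3 * C2 * (q%:R * Y).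
  apply: le_trans (_ : 3 * T / m%:R * \sum_(0 <= i < m) C2 * (q%:R * rp T de) <= _).
    apply: ler_wpM2l; first by apply: divr_ge0; [clear -T0; lra|exact: ltW].
    rewrite !big_nat; apply: ler_sum => i /andP[_ im].
    have u0 : 0 <= i%:R / m%:R :> R by rewrite divr_ge0.
    have u1 : i%:R / m%:R <= 1 :> R by rewrite ler_pdivrMr // mul1r ler_nat ltnW.
    exact: (tail_int s1 d0 d1 hG q0 u0 u1 T1 hx xy hy XD qX Xq).
  rewrite sumr_const_nat subn0 -mulr_natr Ed; apply: le_eqr; field; by rewrite gt_eqF.
apply: le_trans (lerD i1 (lerD i2 i3)) _; rewrite -/S -/E -/C1; apply: le_eqr; rewrite -/Y; ring.
Qed.
End MeanValue2.

(** * Arithmetic reduction *)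

Lemma mobius_mul_prime p m : prime p -> (0 < m)%N -> ~~ (p %| m)%N -> mobius (p * m) = - mobius m.
Proof.
move=> pp m0 pm; have p0 := prime_gt0 pp.
have pe : perm_eq (primes (p * m)) (p :: primes m).
  apply: uniq_perm; rewrite ?primes_uniq //= ?primes_uniq ?mem_primes ?(negPf pm) ?andbF //.
  by move=> x; rewrite primesM // primes_prime // !inE.
rewrite /mobius muln_gt0 p0 m0 /= (perm_size pe) (perm_all _ pe) /=.
have lp : logn p (p * m) = 1%N by rewrite lognM // lognE pp p0 dvdnn divnn p0 logn1 logn_coprime // prime_coprime.
rewrite lp eqxx /=.
have -> : all (fun q => logn q (p * m) == 1%N) (primes m) = all (fun q => logn q m == 1%N) (primes m).
  apply: eq_in_all => q; rewrite mem_primes => /and3P[pq _ qm].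
  rewrite lognM // [logn q p]lognE pq p0 dvdn_prime2 //; case: (eqVneq q p) => [qp|_] //.
  by rewrite qp (negPf pm) in qm.
by case: (all _ _); rewrite ?oppr0 // exprS mulN1r.
Qed.

Lemma mobius_sq_prime p m : prime p -> (0 < m)%N -> (p %| m)%N -> mobius (p * m) = 0.
Proof.
move=> pp m0 pm; have p0 := prime_gt0 pp; rewrite /mobius muln_gt0 p0 m0 /=.
case: allP => // /(_ p); rewrite mem_primes pp muln_gt0 p0 m0 dvdn_mulr // => /(_ isT).
rewrite lognM // [logn p p]lognE pp p0 dvdnn divnn p0 logn1.
have : (0 < logn p m)%N by rewrite logn_gt0 mem_primes pp m0.
by case: (logn p m).
Qed.

Lemma mobius_abs n : `|mobius n| <= 1.
Proof. by rewrite /mobius; case: ifP => _; rewrite ?normr0 // normrX normrN1 expr1n. Qed.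

Lemma dvd_sum_range (V : nmodType) (F : nat -> V) (n N : nat) : (0 < n)%N -> (n <= N)%N ->
  \sum_(1 <= d < N.+1 | (d %| n)%N) F d = \sum_(1 <= d < n.+1 | (d %| n)%N) F d.
Proof.
move=> n0 nN; rewrite (big_cat_nat (n := n.+1)) //= [X in _ + X]big_nat_cond [X in _ + X]big_pred0 ?addr0 // => d.
case: (boolP (d %| n)%N) => [/(dvdn_leq n0) h|_]; last by rewrite andbF.
by rewrite ltnNge h.
Qed.

(** With [p] the least prime factor of [n], each divisor [d] prime to [p] cancels against [p * d],
    and a divisor divisible by p^2 contributes 0. *)
Lemma sum_mobius n : (0 < n)%N -> \sum_(1 <= d < n.+1 | (d %| n)%N) mobius d = (n == 1%N)%:R.
Proof.
move=> n0; case: (ltnP 1 n) => [n1|n1]; last first.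
  have -> : n = 1%N by apply/eqP; rewrite eqn_leq n1 n0.
  by rewrite big_mkcond big_nat1.
rewrite gtn_eqF //=; pose p := pdiv n; have pp : prime p by exact: pdiv_prime.
have p0 := prime_gt0 pp; have pn : (p %| n)%N := pdiv_dvd n.
have np0 : (0 < n %/ p)%N by rewrite divn_gt0 // dvdn_leq.
have dvp d : ~~ (p %| d)%N -> (d %| n)%N = (d %| n %/ p)%N.
  move=> h; rewrite -{1}(divnK pn) Gauss_dvdl //; first by rewrite coprime_sym prime_coprime.
rewrite (bigID (fun d => (p %| d)%N)) /=.
rewrite (eq_bigl (fun d => (p %| d)%N && (d %| n)%N)); last by move=> d; rewrite andbC.
rewrite big_mkcondr sum_dvd_reindex //=.
have -> : \sum_(1 <= d < n.+1 | (d %| n)%N && ~~ (p %| d)%N) mobius d =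
          \sum_(1 <= d < (n %/ p).+1 | (d %| n %/ p)%N && ~~ (p %| d)%N) mobius d.
  rewrite (eq_bigl (fun d => (d %| n %/ p)%N && ~~ (p %| d)%N)); last first.
    by move=> d; case: (boolP (p %| d)%N) => [|h]; rewrite ?andbF // dvp.
  by rewrite !big_mkcondr dvd_sum_range // leq_div.
rewrite [X in _ + X]big_mkcond /= -big_split /= big_nat big1 // => d /andP[d0 _].
have -> : (p * d %| n)%N = (d %| n %/ p)%N by rewrite -{1}(divnK pn) mulnC dvdn_pmul2r.
case: (d %| n %/ p)%N => /=; last by rewrite addr0.
case: (boolP (p %| d)%N) => h /=; first by rewrite mobius_sq_prime ?addr0.
by rewrite mobius_mul_prime // addNr.
Qed.

Lemma dvd_double (V : nmodType) (F : nat -> nat -> V) (N : nat) :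
  \sum_(1 <= n < N.+1) \sum_(1 <= d < N.+1 | (d %| n)%N) F d n =
  \sum_(1 <= d < N.+1) \sum_(1 <= m < (N %/ d).+1) F d (d * m)%N.
Proof.
under eq_bigr do rewrite big_mkcond.
rewrite exchange_big /= !big_nat; apply: eq_bigr => d /andP[d0 _].
by rewrite -big_mkcond -sum_dvd_reindex.
Qed.

Lemma sum_divn (V : nmodType) (F : nat -> V) (d N Q : nat) : (0 < d)%N -> (N <= Q)%N ->
  \sum_(1 <= m < (N %/ d).+1) F m = \sum_(1 <= m < Q.+1 | (d * m <= N)%N) F m.
Proof.
move=> d0 NQ; have dQ : (N %/ d <= Q)%N by apply: leq_trans NQ; exact: leq_div.
have e m : (d * m <= N)%N = (m <= N %/ d)%N by rewrite mulnC -leq_divRL.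
rewrite [RHS](big_cat_nat (n := (N %/ d).+1)) ?ltnS //=.
rewrite [X in _ = _ + X]big_nat_cond [X in _ = _ + X]big_pred0 ?addr0; last first.
  by move=> m; rewrite e [(m <= _)%N]leqNgt; case: (_ < m)%N; case: (m < Q.+1)%N.
rewrite big_nat [RHS]big_nat_cond; apply: eq_bigl => m.
by rewrite e ltnS; case: (m <= _)%N; rewrite ?andbF ?andbT.
Qed.

Lemma hyper_exch (V : nmodType) (F : nat -> nat -> V) (N : nat) :
  \sum_(1 <= d < N.+1) \sum_(1 <= m < (N %/ d).+1) F d m = \sum_(1 <= m < N.+1) \sum_(1 <= d < (N %/ m).+1) F d m.
Proof.
transitivity (\sum_(1 <= d < N.+1) \sum_(1 <= m < N.+1) (if (d * m <= N)%N then F d m else 0)).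
  by rewrite !big_nat; apply: eq_bigr => d /andP[d0 _]; rewrite (sum_divn _ d0 (leqnn N)) big_mkcond.
rewrite exchange_big /= !big_nat; apply: eq_bigr => m /andP[m0 _]; rewrite (sum_divn _ m0 (leqnn N)) [RHS]big_mkcond.
by apply: eq_bigr => d _; rewrite mulnC.
Qed.

Section Arith.
Variable R : realType.
Local Notation C := R[i].
Local Notation ii := (@ii R).
Implicit Types (s z w : C) (x y sg : R).

Definition mu (n : nat) : R := (mobius n)%:~R.
Lemma mu_le n : `|mu n| <= 1.
Proof. by rewrite /mu -intr_norm -[leRHS]/(1%:~R) ler_int mobius_abs. Qed.
Lemma sum_mu n N : (0 < n)%N -> (n <= N)%N -> \sum_(1 <= d < N.+1 | (d %| n)%N) mu d = (n == 1%N)%:R.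
Proof.
move=> n0 nN; rewrite dvd_sum_range // -(rmorph_sum (@intmul R 1)) sum_mobius //.
by case: (n == 1%N).
Qed.

Definition Mmu (n : nat) : R := \sum_(1 <= m < n.+1) mu m.

(** This is what allows the mean of a periodic function to be subtracted: a constant summed against
    M(N / d) contributes just itself. *)
Lemma sum_Mmu (N : nat) : (0 < N)%N -> \sum_(1 <= d < N.+1) Mmu (N %/ d) = 1.
Proof.
move=> N0; rewrite /Mmu hyper_exch -(dvd_double (fun m _ => mu m)).
rewrite big_ltn // sum_mu // big_nat big1 ?addr0 // => n /andP[n1 nN].
by rewrite sum_mu ?gtn_eqF //; exact: ltnW.
Qed.

Definition gfun (a1 a2 d : nat) : R := 1 - (lin_res a1 a2 d)%:R / a1%:R
       - fracpart ((d%:R - a2%:R * (lin_res a1 a2 d)%:R) / (a1%:R * a2%:R)).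

Lemma sum_Eerr a1 a2 N : \sum_(1 <= n < N.+1) Eerr R a1 a2 n = \sum_(1 <= d < N.+1) gfun a1 a2 d * Mmu (N %/ d).
Proof.
transitivity (\sum_(1 <= n < N.+1) \sum_(1 <= d < N.+1 | (d %| n)%N) mu (n %/ d) * gfun a1 a2 d).
  rewrite !big_nat; apply: eq_bigr => n /andP[n0 nN].
  rewrite /Eerr dvd_sum_range // -[RHS]big_filter; apply: perm_big; apply: uniq_perm.
  - exact: divisors_uniq.
  - by rewrite filter_uniq // iota_uniq.
  - move=> d; rewrite mem_filter mem_index_iota -dvdn_divisors //.
    case: (boolP (d %| n)%N) => // dn; rewrite ltnS (dvdn_leq n0 dn) andbT /=.
    by rewrite (dvdn_gt0 n0 dn).
rewrite (dvd_double (fun d n => mu (n %/ d) * gfun a1 a2 d)) !big_nat; apply: eq_bigr => d /andP[d0 _].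
by rewrite /Mmu mulr_sumr; apply: eq_bigr => m _; rewrite mulKn // mulrC.
Qed.

Lemma fracpart_itv x : 0 <= fracpart x /\ fracpart x < 1.
Proof.
have /andP[h1 h2] := floor_itv x; rewrite /fracpart; split; first by rewrite subr_ge0.
by move: h2; rewrite intrD; lra.
Qed.

Lemma fracpartD1 x : fracpart (x + 1) = fracpart x.
Proof. by rewrite /fracpart floorDrz ?rpred1 // floor1 intrD; ring. Qed.

Lemma gfun_le a1 a2 d : (0 < a1)%N -> coprime a1 a2 -> `|gfun a1 a2 d| <= 1.
Proof.
move=> a0 cop; have [r1 _] := lin_resP d a0 cop.
have a0' : (0 : R) < a1%:R by rewrite ltr0n.
have [f0 f1] := fracpart_itv ((d%:R - a2%:R * (lin_res a1 a2 d)%:R) / (a1%:R * a2%:R)).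
rewrite /gfun; move: (fracpart _) f0 f1 => f f0 f1.
have h1 : (lin_res a1 a2 d)%:R / a1%:R <= 1 :> R by rewrite ler_pdivrMr // mul1r ler_nat ltnW.
have h0 : 0 <= (lin_res a1 a2 d)%:R / a1%:R :> R by rewrite divr_ge0 // ltW.
by rewrite ler_norml; move: (_ / a1%:R) h0 h1 => u h0 h1; apply/andP; split; lra.
Qed.

(** Adding [a1 * a2] keeps the residue modulo [a1], hence [lin_res], and raises the argument of the
    fractional part by exactly 1. *)
Lemma gfun_per a1 a2 d : (0 < a1)%N -> (0 < a2)%N -> coprime a1 a2 -> gfun a1 a2 (d + a1 * a2) = gfun a1 a2 d.
Proof.
move=> a0 b0 cop.
have e : lin_res a1 a2 (d + a1 * a2) = lin_res a1 a2 d.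
  have [r1 r2] := lin_resP d a0 cop.
  by apply/esym/lin_res_unique => //; rewrite r2 [(a1 * a2)%N]mulnC addnC modnMDl.
rewrite /gfun e; congr (_ - _ - _).
rewrite -[RHS]fracpartD1; congr fracpart; rewrite natrD natrM; field.
by rewrite !pnatr_eq0 -!lt0n a0 b0.
Qed.

(** [c] is the mean over one period. The partial sums of [f - c] are then periodic themselves, and
    over less than a period each term adds at most 2. *)
Lemma mean_zero (f : nat -> R) (q : nat) : (0 < q)%N -> (forall d, f (d + q)%N = f d) -> (forall d, `|f d| <= 1) ->
  exists c : R, [/\ `|c| <= 1, forall d, `|f d - c| <= 2 & forall n, `|\sum_(1 <= j < n.+1) (f j - c)| <= 2 * q%:R].
Proof.
move=> q0 per f1; have q0' : (0 : R) < q%:R by rewrite ltr0n.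
pose c := (\sum_(1 <= j < q.+1) f j) / q%:R.
have c1 : `|c| <= 1.
  rewrite normrM normfV [X in _ / X]gtr0_norm // ler_pdivrMr // mul1r.
  apply: le_trans (ler_norm_sum _ _ _) _.
  apply: le_trans (_ : \sum_(1 <= j < q.+1) (1 : R) <= _); first by apply: ler_sum.
  by rewrite sumr_const_nat subSS subn0.
have c2 d : `|f d - c| <= 2 by apply: le_trans (ler_normB _ _) _; have := f1 d; lra.
exists c; split => //.
pose G n := \sum_(1 <= j < n.+1) (f j - c).
have Gq : G q = 0.
  rewrite /G sumrB sumr_const_nat subSS subn0 -[c *+ q]mulr_natr /c divfK ?subrr //.
  by rewrite gt_eqF.
have GS n : G n.+1 = G n + (f n.+1 - c) by rewrite /G big_nat_recr.
have Gper n : G (n + q)%N = G n.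
  elim: n => [|n IH]; first by rewrite add0n Gq /G big_nil.
  by rewrite addSn !GS IH -addSn per.
have Gb n : `|G n| <= 2 * n%:R.
  elim: n => [|n IH]; first by rewrite /G big_nil normr0 mulr0.
  by rewrite GS; apply: le_trans (ler_normD _ _) _; have := c2 n.+1; rewrite -natr1; lra.
move=> n; rewrite -/(G n) (divn_eq n q) addnC.
have -> : G (n %% q + n %/ q * q)%N = G (n %% q)%N.
  by elim: (n %/ q)%N => [|k IH]; rewrite ?mul0n ?addn0 // mulSn addnCA addnC Gper.
by apply: le_trans (Gb _) _; rewrite ler_pM2l // ler_nat ltnW // ltn_pmod.
Qed.

Lemma hyperbola (g : nat -> R) (q N D : nat) : (forall n, `|\sum_(1 <= j < n.+1) g j| <= 2 * q%:R) ->
  (N < D.+1 * D.+1)%N -> (D <= N)%N ->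
  `|\sum_(1 <= d < N.+1) g d * Mmu (N %/ d) - \sum_(1 <= d < D.+1) g d * Mmu (N %/ d)| <= 4 * q%:R * D%:R.
Proof.
move=> hG ND DN; rewrite [X in `|X - _|](big_cat_nat (n := D.+1)) //= [X in `|X|]addrC addKr.
have -> : \sum_(D.+1 <= d < N.+1) g d * Mmu (N %/ d) =
   \sum_(1 <= d < N.+1) \sum_(1 <= m < (N %/ d).+1) (if (D < d)%N then g d * mu m else 0).
  rewrite [RHS](big_cat_nat (n := D.+1)) //= [X in _ = X + _](_ : _ = 0) ?add0r; last first.
    by rewrite big_nat big1 // => d /andP[_ dD]; rewrite big1 // => m _; rewrite ltnNge -ltnS dD.
  by rewrite !big_nat; apply: eq_bigr => d /andP[Dd _]; rewrite Dd /Mmu mulr_sumr.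
rewrite hyper_exch; apply: le_trans (ler_norm_sum _ _ _) _.
apply: le_trans (_ : \sum_(1 <= m < N.+1) (if (m <= D)%N then 4 * q%:R else 0) <= _); last first.
  rewrite (big_cat_nat (n := D.+1)) //= [X in _ + X]big_nat [X in _ + X]big1 ?addr0; last first.
    by move=> m /andP[Dm _]; rewrite leqNgt Dm.
  rewrite big_nat (eq_bigr (fun=> 4 * q%:R)); last by move=> m /andP[_]; rewrite ltnS => ->.
  by rewrite -big_nat sumr_const_nat subSS subn0 -[leLHS]mulr_natr.
rewrite !big_nat; apply: ler_sum => m /andP[m0 mN].
have q4 : 0 <= 4 * q%:R :> R by rewrite mulr_ge0.
have [h|h] := leqP (N %/ m) D.
  rewrite big_nat big1 ?normr0; first by case: ifP.
  by move=> d /andP[_ dm]; rewrite ltnNge (leq_trans _ h).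
(* [N %/ m > D] together with N < (D + 1)^2 forces m <= D. For each such [m] the sum over [d] is a
   difference of two partial sums of [g], at most 4 q. *)
have -> : (m <= D)%N.
  rewrite leqNgt; apply/negP => Dm; move: h; rewrite ltnNge => /negP; apply.
  by rewrite -ltnS ltn_divLR //; apply: leq_trans ND _; rewrite leq_mul2l.
have -> : \sum_(1 <= d < (N %/ m).+1) (if (D < d)%N then g d * mu m else 0) =
   (\sum_(1 <= d < (N %/ m).+1) g d - \sum_(1 <= d < D.+1) g d) * mu m.
  rewrite (big_cat_nat (n := D.+1)) ?ltnS ?(ltnW h) //= big_nat big1 ?add0r; last first.
    by move=> d /andP[_ dD]; rewrite ltnNge -ltnS dD.
  rewrite [in RHS](big_cat_nat (n := D.+1)) ?ltnS ?(ltnW h) //= [X in X - _]addrC addrK mulr_suml.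
  by rewrite !big_nat; apply: eq_bigr => d /andP[-> _].
rewrite normrM -[leRHS]mulr1; apply: ler_pM; rewrite ?normr_ge0 ?mu_le //.
by apply: le_trans (ler_normB _ _) _; have := hG (N %/ m)%N; have := hG D; lra.
Qed.

Definition wt (N H n : nat) : R := if (n <= N)%N then 1 else if (n <= N + H)%N then (N + H - n)%:R / H%:R else 0.

Lemma wt_dist (N H n : nat) : (0 < H)%N -> `|wt N H n - (n <= N)%:R| <= (n <= N + H)%:R - (n <= N)%:R.
Proof.
move=> H0; have H0' : (0 : R) < H%:R by rewrite ltr0n.
rewrite /wt; case: (leqP n N) => h; first by rewrite (leq_trans h) ?leq_addr // !subrr normr0.
rewrite !subr0; case: (leqP n (N + H)) => h2; last by rewrite normr0.
rewrite ger0_norm ?divr_ge0 // ler_pdivrMr // mul1r ler_nat.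
by rewrite leq_subLR leq_add2r ltnW.
Qed.

(** The two sums differ only at those [m] with N < d m <= N + H, at most H / d + 1 in number. *)
Lemma smooth_Mmu (N H Q d : nat) : (0 < H)%N -> (0 < d)%N -> (N + H <= Q)%N ->
  `|\sum_(1 <= m < Q.+1) mu m * wt N H (d * m) - Mmu (N %/ d)| <= H%:R / d%:R + 1.
Proof.
move=> H0 d0 NQ; have d0' : (0 : R) < d%:R by rewrite ltr0n.
rewrite /Mmu (sum_divn _ d0 (leq_trans (leq_addr H N) NQ)) [X in _ - X]big_mkcond -sumrB.
apply: le_trans (ler_norm_sum _ _ _) _.
apply: le_trans (_ : \sum_(1 <= m < Q.+1) ((d * m <= N + H)%N%:R - (d * m <= N)%N%:R) <= _).
  apply: ler_sum => m _.
  have -> : (if (d * m <= N)%N then mu m else 0) = mu m * (d * m <= N)%N%:R by case: ifP; rewrite ?mulr1 ?mulr0.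
  by rewrite -mulrBr normrM -[leRHS]mul1r; apply: ler_pM; rewrite ?normr_ge0 ?mu_le ?wt_dist.
have cnt A : (A <= Q)%N -> \sum_(1 <= m < Q.+1) (d * m <= A)%N%:R = (A %/ d)%:R :> R.
  move=> AQ; have := @sum_divn R (fun=> 1) d A Q d0 AQ; rewrite sumr_const_nat subSS subn0 => ->.
  by rewrite [RHS]big_mkcond; apply: eq_bigr => m _; case: ifP.
rewrite sumrB !cnt //; last exact: leq_trans (leq_addr H N) NQ.
rewrite lerBlDl; apply: le_trans (_ : ((N %/ d)%:R + (H %/ d)%:R + 1) <= _).
  by rewrite -natrD natr1 ler_nat -addn1 leq_divDl.
rewrite -addrA lerD2l lerD2r ler_pdivlMr // -natrM ler_nat; exact: leq_trunc_div.
Qed.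

Lemma reduction (g : nat -> R) (q N D Q : nat) (e : R) : 0 < e -> (forall n, `|g n| <= 2) ->
  (forall n, `|\sum_(1 <= j < n.+1) g j| <= 2 * q%:R) -> (0 < D)%N ->
  (N < D.+1 * D.+1)%N -> (D <= N)%N -> (N + D <= Q)%N ->
  `|\sum_(1 <= d < N.+1) g d * Mmu (N %/ d)| <= 4 * q%:R * D%:R + 2 * D%:R * ((1 + e^-1) * rp D%:R e + 1) +
    `|\sum_(1 <= d < D.+1) g d * \sum_(1 <= m < Q.+1) mu m * wt N D (d * m)|.
Proof.
move=> e0 g2 hG D0 ND DN NQ; have h1 := hyperbola hG ND DN.
have D0' : (0 : R) < D%:R by rewrite ltr0n.
have h2 : `|\sum_(1 <= d < D.+1) g d * Mmu (N %/ d) - \sum_(1 <= d < D.+1) g d * \sum_(1 <= m < Q.+1) mu m * wt N D (d * m)|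
   <= 2 * D%:R * ((1 + e^-1) * rp D%:R e + 1).
  rewrite -sumrB; apply: le_trans (ler_norm_sum _ _ _) _.
  apply: le_trans (_ : \sum_(1 <= d < D.+1) (2 * D%:R * rp D%:R e * rp d%:R (- (1 + e)) + 2) <= _).
    rewrite !big_nat; apply: ler_sum => d /andP[d0 dD].
    have d0' : (0 : R) < d%:R by rewrite ltr0n.
    rewrite -mulrBr normrM distrC.
    apply: le_trans (ler_pM (normr_ge0 _) (normr_ge0 _) (g2 d) (smooth_Mmu D0 d0 NQ)) _.
    (* For d <= D this replaces the harmonic sum by a convergent series, at the price of D^e. *)
    have h : d%:R^-1 <= rp D%:R e * rp d%:R (- (1 + e)) :> R.
      have -> : d%:R^-1 = rp d%:R e * rp d%:R (- (1 + e)) :> R by rewrite -rpD -rpN1 //; congr rp; ring.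
      apply: ler_wpM2r; first exact: rp_ge0.
      by apply: rp_monob => //; [rewrite ler_nat -ltnS|exact: ltW].
    by have := ler_wpM2l (ltW D0') h; lra.
  rewrite big_split /= -mulr_sumr sumr_const_nat subSS subn0.
  have s1 : \sum_(1 <= d < D.+1) rp d%:R (- (1 + e)) <= 1 + e^-1 by rewrite big_add1; exact: sum_rp.
  have := ler_wpM2l (_ : 0 <= 2 * D%:R * rp D%:R e) s1.
  rewrite -[2 *+ D]mulr_natr => h; apply: le_trans (lerD (h _) (lexx _)) _.
    by rewrite !mulr_ge0 ?rp_ge0 ?ltW.
  by apply: le_eqr; ring.
move: h1 h2; move: (\sum_(_ <= _ < _) _) (\sum_(_ <= _ < _) _) (\sum_(_ <= _ < _) _) => u v w h1 h2.
have := ler_normD (w - v) (v - u); have := ler_normD (w - v + (v - u)) u.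
rewrite (_ : w - v + (v - u) + u = w); last by ring.
move: (4 * q%:R * _) (2 * D%:R * _) h1 h2 => A B h1 h2; lra.
Qed.
End Arith.

(** * The smoothed sum as a contour integral *)

Section PerronSum.
Variable R : realType.
Local Notation C := R[i].
Local Notation ii := (@ii R).
Local Notation tpi := (pi *+ 2 : R).
Implicit Types (s z w : C) (x y sg T : R) (g : nat -> R).

Definition mu_dpoly (Q : nat) s : C := \sum_(1 <= m < Q.+1) (mu R m)%:C * xp m%:R s.
Definition inv_zeta s : C := (s - 1) / zetaX s.

(** The truncated convolution of [mu] with partial sums of zeta equals 1 exactly ([T1]). Replacing
    the partial sum up to [Q %/ m] by zeta costs at most 4 m / Q, and the weights m^(-2) make the
    total O(Q^(-1/2)), with 12 = 4 * 3. *)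
Lemma inv_zeta_sum s (Q : nat) : complex.Re s = 2 -> (0 < Q)%N ->
  cabs (inv_zeta s - mu_dpoly Q s) <= cabs (inv_zeta s) * (12 * rp Q%:R (- (1 / 2))).
Proof.
move=> s2 Q0; have s1 : 1 < complex.Re s by rewrite s2; lra.
have Q0' : (0 : R) < Q%:R by rewrite ltr0n.
have Z0 := zetaX_neq0_gt1 s1.
have sm : s - 1 != 0.
  by apply/eqP => h; have := congr1 (@complex.Re R) h; rewrite ReB /= s2; lra.
pose A n : C := \sum_(1 <= k < n.+1) xp k%:R s.
have T1 : \sum_(1 <= m < Q.+1) (mu R m)%:C * xp m%:R s * A (Q %/ m)%N = 1.
  transitivity (\sum_(1 <= m < Q.+1) \sum_(1 <= k < (Q %/ m).+1) (mu R m)%:C * xp (m * k)%:R s).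
    rewrite !big_nat; apply: eq_bigr => m /andP[m0 _]; rewrite /A mulr_sumr !big_nat; apply: eq_bigr => k /andP[k0 _].
    by rewrite natrM xpM ?ltr0n // mulrA.
  rewrite -(dvd_double (fun m n => (mu R m)%:C * xp n%:R s)).
  transitivity (\sum_(1 <= n < Q.+1) (n == 1%N)%:R * xp n%:R s); last first.
    rewrite big_ltn // mul1r xp1 big_nat big1 ?addr0 // => n /andP[n1 _].
    by rewrite gtn_eqF // mul0r.
  rewrite !big_nat; apply: eq_bigr => n /andP[n0 nQ].
  by rewrite -mulr_suml -rmorph_sum sum_mu //; case: (n == 1%N).
pose z := zetaX s / (s - 1).
have e1 : inv_zeta s * z = 1 by rewrite /inv_zeta /z; field; rewrite Z0 sm.
have -> : inv_zeta s - mu_dpoly Q s = inv_zeta s * \sum_(1 <= m < Q.+1) (mu R m)%:C * xp m%:R s * (A (Q %/ m)%N - z).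
  under eq_bigr do rewrite mulrBr.
  by rewrite sumrB T1 -mulr_suml mulrBr mulr1 mulrCA e1 mulr1.
rewrite cabsM; apply: ler_wpM2l; first exact: cabs_ge0.
apply: le_trans (cabs_sum _ _ _) _.
apply: le_trans (_ : \sum_(1 <= m < Q.+1) 4 * rp Q%:R (- (1 / 2)) * rp m%:R (- (1 + 1 / 2)) <= _).
  rewrite !big_nat; apply: ler_sum => m /andP[m0 mQ].
  have m0' : (0 : R) < m%:R by rewrite ltr0n.
  have n0 : (0 < Q %/ m)%N by rewrite divn_gt0.
  have n0' : (0 : R) < (Q %/ m)%:R by rewrite ltr0n.
  have h := zeta_sum s1 n0; rewrite s2 (_ : 2 - 1 = 1) in h; last by ring.
  rewrite divr1 rpN1 // in h.
  have hm : Q%:R <= 2 * m%:R * (Q %/ m)%:R :> R.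
    rewrite -!natrM ler_nat {1}(divn_eq Q m).
    have := ltn_pmod Q m0; nia.
  have h2 : (Q %/ m)%:R^-1 <= 2 * m%:R / Q%:R :> R.
    by rewrite ler_pdivlMr // ler_pdivrMl //; move: hm; lra.
  have h3 : cabs ((mu R m)%:C * xp m%:R s) <= rp m%:R (- 2).
    rewrite cabsM cabs_real cabs_xp s2 -[leRHS]mul1r; apply: ler_wpM2r; [exact: rp_ge0|exact: mu_le].
  rewrite cabsM; apply: le_trans (ler_pM (cabs_ge0 _) (cabs_ge0 _) h3 (_ : _ <= 4 * (m%:R / Q%:R))) _.
    by apply: le_trans h _; move: h2; clear; lra.
  have h4 : rp m%:R (- 2) * (m%:R / Q%:R) <= rp Q%:R (- (1 / 2)) * rp m%:R (- (1 + 1 / 2)) :> R.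
    rewrite -{2}(rp1 m0') -(rpN1 Q0') mulrA -rpD.
    have -> : rp Q%:R (-1) = rp Q%:R (- (1 / 2)) * rp Q%:R (- (1 / 2)) :> R by rewrite -rpD; congr rp; lra.
    rewrite mulrCA; apply: ler_wpM2l; first exact: rp_ge0.
    have -> : - (1 + 1 / 2) = (- 2 + 1) + (- (1 / 2)) :> R by lra.
    rewrite [leRHS]rpD; apply: ler_wpM2l; first exact: rp_ge0.
    by apply: rp_antib => //; rewrite ler_nat -ltnS.
  by move: h4; clear; lra.
rewrite -mulr_sumr.
have h := @sum_rp1 R (1 / 2) Q; have {}h : \sum_(1 <= n < Q.+1) rp n%:R (- (1 + 1 / 2)) <= 3 :> R.
  apply: le_trans (h _) _; first by lra.
  by rewrite div1r invrK; lra.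
have := ler_wpM2l (_ : 0 <= 4 * rp Q%:R (- (1 / 2))) h => /(_ _) h'; apply: le_trans (h' _) _.
  by rewrite mulr_ge0 ?rp_ge0.
by apply: le_eqr; ring.
Qed.

(* Mellin transform of the cut-off [wt], which is linear on [[N, N + H]]. *)
Definition kappa (N H : nat) s : C :=
  ((N + H)%:R * xp (N + H)%:R (- s) - N%:R * xp N%:R (- s)) / (H%:R * (s * (s + 1))).

Lemma kappa_xp (N H n : nat) s : (0 < n)%N -> (0 < N)%N -> (0 < H)%N ->
  kappa N H s * xp n%:R s = ((N + H)%:R / H%:R) * Jk (ln (N + H)%:R - ln n%:R) s - (N%:R / H%:R) * Jk (ln N%:R - ln n%:R) s.
Proof.
move=> n0 N0 H0; have e (x : R) : cexp (s * (ln x - ln n%:R)%:C) = xp x (- s) * xp n%:R s.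
  by rewrite /xp -cexpD; congr cexp; rewrite rmorphB; ring.
by rewrite /kappa /Jk !e invfM; ring.
Qed.

Lemma perron_both x y T : 0 < x -> 0 < y -> 2 <= T ->
  cabs (vint (Jk (ln x - ln y)) 2 T - (tpi * Num.max 0 (1 - y / x))%:C) <= 12 * (x / y) ^+ 2 / T.
Proof.
move=> x0 y0 T2.
have e2 : expR (2 * (ln x - ln y)) = (x / y) ^+ 2.
  by rewrite -ln_div ?posrE // -rp2 ?divr_gt0.
have [h|h] := leP x y.
  have -> : Num.max 0 (1 - y / x) = 0.
    by apply/max_idPl; rewrite subr_le0 ler_pdivlMr // mul1r.
  rewrite mulr0 subr0; apply: le_trans (perron_small T2 _) _.
    by rewrite subr_le0 ler_ln ?posrE.
  by rewrite e2; apply: ler_wpM2r; [rewrite invr_ge0; lra|have := sqr_ge0 (x / y); lra].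
have -> : Num.max 0 (1 - y / x) = 1 - expR (- (ln x - ln y)).
  rewrite opprB -ln_div ?posrE // lnK ?posrE ?divr_gt0 //; apply/max_idPr.
  by rewrite subr_ge0 ler_pdivrMr // mul1r ltW.
apply: le_trans (perron_large T2 _) _; last by rewrite e2.
by rewrite subr_ge0 ler_ln ?posrE // ltW.
Qed.

(** The trapezoidal cut-off is a difference of two hinges max (0, 1 - n / x), the functions that
    [perron_both] obtains from the kernel [Jk]. *)
Lemma wtE (N H n : nat) : (0 < N)%N -> (0 < H)%N ->
  wt R N H n = (N + H)%:R / H%:R * Num.max 0 (1 - n%:R / (N + H)%:R) - N%:R / H%:R * Num.max 0 (1 - n%:R / N%:R).
Proof.
move=> N0 H0; have N0' : (0 : R) < N%:R by rewrite ltr0n.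
have H0' : (0 : R) < H%:R by rewrite ltr0n.
have NH0 : (0 : R) < (N + H)%:R by rewrite ltr0n addn_gt0 N0.
have pos (A : nat) : (0 : R) < A%:R -> (n <= A)%N -> Num.max 0 (1 - n%:R / A%:R) = 1 - n%:R / A%:R :> R.
  by move=> A0 h; apply/max_idPr; rewrite subr_ge0 ler_pdivrMr // mul1r ler_nat.
have neg (A : nat) : (0 : R) < A%:R -> (A < n)%N -> Num.max 0 (1 - n%:R / A%:R) = 0 :> R.
  by move=> A0 h; apply/max_idPl; rewrite subr_le0 ler_pdivlMr // mul1r ler_nat ltnW.
rewrite /wt; case: (leqP n N) => h.
  rewrite !pos //; last by rewrite (leq_trans h) ?leq_addr.
  by rewrite natrD; field; rewrite -natrD !gt_eqF.
rewrite (neg N) // mulr0 subr0; case: (leqP n (N + H)) => h2; last by rewrite neg ?mulr0.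
by rewrite pos // natrB //; field; rewrite -natrD !gt_eqF.
Qed.

Lemma lip_VI F F' sg T : qhol (rect sg sg T) F F' -> lipon (seg (- T) T) (fun z => F (sg%:C + ii * z)).
Proof.
have ss : sg <= sg <= sg by rewrite lexx.
by move=> q; exact: lip_vline ss q.
Qed.

Lemma Jk_lip (L T : R) : lipon (seg (- T) T) (fun z => Jk L (2%:C + ii * z)).
Proof.
have p2 : (0 : R) < 2 by [].
have [F q] := @qhol_Jk_rect R 2 2 T L (or_introl p2).
exact: lip_VI q.
Qed.

Lemma VI_lin (F G : C -> C) (a b : C) x T : 0 <= T -> lipon (seg (- T) T) (fun z => F (x%:C + ii * z)) ->
  lipon (seg (- T) T) (fun z => G (x%:C + ii * z)) ->
  vint (fun s => a * F s - b * G s) x T = a * vint F x T - b * vint G x T.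
Proof.
move=> T0 lF lG; have TT : - T <= T by lra.
have bS := bdd_seg (- T) T.
by rewrite /vint -(cintZ a TT lF) -(cintZ b TT lG) -cintB //; exact: lipZ.
Qed.

Lemma perron_wt (N H n : nat) T : (0 < n)%N -> (0 < N)%N -> (0 < H)%N -> 2 <= T ->
  cabs (vint (fun s => kappa N H s * xp n%:R s) 2 T - (tpi * wt R N H n)%:C) <=
    24 * (N + H)%:R ^+ 3 / T * rp n%:R (- (1 + 1)).
Proof.
move=> n0 N0 H0 T2; have T0 : 0 <= T by lra. have TT : - T <= T by lra.
have n0' : (0 : R) < n%:R by rewrite ltr0n.
have N0' : (0 : R) < N%:R by rewrite ltr0n.
have H0' : (0 : R) < H%:R by rewrite ltr0n.
have NH0 : (0 : R) < (N + H)%:R by rewrite ltr0n addn_gt0 N0.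
have -> : vint (fun s => kappa N H s * xp n%:R s) 2 T =
  (N + H)%:R / H%:R * vint (Jk (ln (N + H)%:R - ln n%:R)) 2 T - N%:R / H%:R * vint (Jk (ln N%:R - ln n%:R)) 2 T.
  by rewrite -(VI_lin _ _ T0 (Jk_lip _ T) (Jk_lip _ T)); apply: cint_eq => // z _; rewrite kappa_xp.
rewrite wtE //.
have p1 := perron_both NH0 n0' T2; have p2 := perron_both N0' n0' T2.
set u := vint _ 2 T in p1 *; set v := vint _ 2 T in p2 *.
set u' := Num.max _ _ in p1 *; set v' := Num.max _ _ in p2 *.
have -> : (N + H)%:R / H%:R * u - N%:R / H%:R * v - (tpi * ((N + H)%:R / H%:R * u' - N%:R / H%:R * v'))%:C =
  ((N + H)%:R / H%:R)%:C * (u - (tpi * u')%:C) - (N%:R / H%:R)%:C * (v - (tpi * v')%:C).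
  have e (k : nat) : (k%:R / H%:R)%:C = k%:R / H%:R :> C by rewrite rmorphM fmorphV !rmorph_nat.
  by rewrite -!e !rmorphM rmorphB !rmorphM; ring.
clearbody u v u' v'.
apply: le_trans (cabsB _ _) _; rewrite !cabsM !cabs_pos ?divr_ge0 //.
have H1 : H%:R^-1 <= 1 :> R by rewrite invf_le1 // ler1n.
have Hi0 : 0 <= H%:R^-1 :> R by rewrite invr_ge0 ltW.
have iT : 0 <= T^-1 by rewrite invr_ge0.
have rn : rp n%:R (- (1 + 1)) = n%:R ^- 2 :> R by rewrite rpN (_ : 1 + 1 = 2) ?rp2 //; ring.
have k0 : 0 <= T^-1 * n%:R ^- 2 by rewrite mulr_ge0 // invr_ge0 exprn_ge0 // ltW.
have q1 : (N + H)%:R / H%:R * cabs (u - (tpi * u')%:C) <= 12 * (N + H)%:R ^+ 3 * (T^-1 * n%:R ^- 2).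
  apply: le_trans (ler_pM _ _ (_ : _ <= (N + H)%:R) p1) _; rewrite ?cabs_ge0 ?divr_ge0 //.
    by rewrite -[leRHS]mulr1; apply: ler_wpM2l => //; exact: ltW.
  by apply: le_eqr; field; rewrite !gt_eqF //; lra.
have q2 : N%:R / H%:R * cabs (v - (tpi * v')%:C) <= 12 * (N + H)%:R ^+ 3 * (T^-1 * n%:R ^- 2).
  apply: le_trans (ler_pM _ _ (_ : _ <= N%:R) p2) _; rewrite ?cabs_ge0 ?divr_ge0 //.
    by rewrite -[leRHS]mulr1; apply: ler_wpM2l => //; exact: ltW.
  apply: le_trans (_ : 12 * N%:R ^+ 3 * (T^-1 * n%:R ^- 2) <= _).
    by apply: le_eqr; field; rewrite !gt_eqF //; lra.
  apply: ler_wpM2r => //; apply: ler_wpM2l => //; apply: lerXn2r; rewrite ?nnegrE // ler_nat leq_addr //.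
by rewrite rn; move: q1 q2; rewrite -!mulrA; move: (T^-1 * _) => k; clear; lra.
Qed.

Lemma qhol_xps U x : bdd U -> qhol U (xp x) (fun s => xp x s * - (ln x)%:C).
Proof.
move=> bU; apply: qhol_ext (qhol_cexpc bU (qholZ (- (ln x)%:C) bU (qhol_id U))) => z _.
  by rewrite /xp; congr cexp; ring.
by rewrite /xp mulr1; congr (cexp _ * _); ring.
Qed.

Lemma qhol_dpoly U g (D : nat) : bdd U -> exists F', qhol U (dpoly g D) F'.
Proof.
move=> bU; eexists; apply: qhol_sum => d; apply: qholZ => //; exact: qhol_xps.
Qed.

Lemma qhol_kappa U (N H : nat) (a : R) : bdd U -> 0 < a -> (0 < H)%N -> (forall z, U z -> a <= complex.Re z) ->
  exists F', qhol U (kappa N H) F'.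
Proof.
move=> bU a0 H0 hU.
have H0' : (0 : R) < H%:R by rewrite ltr0n.
have q (x : R) : exists F', qhol U (fun s => xp x (- s)) F'.
  exists (fun s => xp x (- s) * (ln x)%:C).
  apply: qhol_ext (qhol_cexpc bU (qholZ (ln x)%:C bU (qhol_id U))) => z _.
    by rewrite /xp; congr cexp; ring.
  by rewrite /xp mulr1; congr (cexp _ * _); ring.
have [F1 p1] := q (N + H)%:R; have [F2 p2] := q N%:R.
have p3 := qholD (qholZ (N + H)%:R bU p1) (qholZ (- N%:R) bU p2).
have m0 : 0 < H%:R * (a * a) by rewrite !mulr_gt0.
have hm z : U z -> H%:R * (a * a) <= cabs (H%:R * (z * (z + 1))).
  move=> /hU hz; rewrite !cabsM cabs_nat; apply: ler_wpM2l; first exact: ltW.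
  apply: ler_pM; [exact: ltW|exact: ltW|exact: le_trans hz (Re_le _)|].
  by apply: le_trans (Re_le _); rewrite ReD /=; lra.
have p4 := qholV bU m0 hm (qholZ H%:R bU (qholM bU (qhol_id U) (qholD (qhol_id U) (qhol_cst U 1)))).
eexists; apply: qhol_ext (qholM bU p3 p4) => z _; last reflexivity.
by rewrite /kappa mulNr.
Qed.

Lemma qhol_Smu U (Q : nat) : bdd U -> exists F', qhol U (mu_dpoly Q) F'.
Proof.
move=> bU; eexists; apply: qhol_sum => d; apply: qholZ => //; exact: qhol_xps.
Qed.

Lemma qhol_Iz (grh : GRH R) a b T : 1 / 2 < a -> exists F', qhol (rect a b T) inv_zeta F'.
Proof.
move=> a2; have bU := bdd_rect a b T; have [m m0 hm] := zetaX_min grh b T a2.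
have a0 : 0 < a by lra.
have qz := qholV bU m0 hm (qhol_zetaX bU a0 (fun z (h : rect a b T z) => let: conj h1 _ := h in proj1 (andP h1))).
have q := qholM bU (qholD (qhol_id _) (qhol_cst _ (- 1))) qz.
by eexists; exact: q.
Qed.

Definition smoothed_sum g (N D Q : nat) : R := \sum_(1 <= d < D.+1) g d * \sum_(1 <= m < Q.+1) mu R m * wt R N D (d * m).

Lemma Vsum_perron g (N D Q : nat) T : (forall n, `|g n| <= 2) -> (0 < N)%N -> (0 < D)%N -> 2 <= T ->
  cabs (vint (fun s => kappa N D s * (dpoly g D s * mu_dpoly Q s)) 2 T - (tpi * smoothed_sum g N D Q)%:C) <=
   192 * (N + D)%:R ^+ 3 / T.
Proof.
move=> g2 N0 D0 T2; have T0 : 0 <= T by lra. have TT : - T <= T by lra.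
have bR := bdd_rect 2 2 T; have bS := bdd_seg (- T) T.
have r2 z : rect 2 2 T z -> 2 <= complex.Re z by case=> /andP[].
have [Fk qk] := qhol_kappa N bR (ltr0Sn R 1) D0 r2.
have lX (n : nat) : lipon (seg (- T) T) (fun z => kappa N D (2%:C + ii * z) * xp n%:R (2%:C + ii * z)).
  exact: lip_VI (qholM bR qk (qhol_xps n%:R bR)).
pose c d m : C := (g d * mu R m)%:C.
have E1 : vint (fun s => kappa N D s * (dpoly g D s * mu_dpoly Q s)) 2 T =
   \sum_(1 <= d < D.+1) \sum_(1 <= m < Q.+1) c d m * vint (fun s => kappa N D s * xp (d * m)%:R s) 2 T.
  rewrite /vint (@cint_eq _ _ (fun z => \sum_(1 <= d < D.+1) \sum_(1 <= m < Q.+1)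
     c d m * (if (0 < d)%N && (0 < m)%N then kappa N D (2%:C + ii * z) * xp (d * m)%:R (2%:C + ii * z) else 0))) //; last first.
    move=> z _; rewrite /dpoly /mu_dpoly mulr_suml mulr_sumr !big_nat; apply: eq_bigr => d /andP[d0 _].
    rewrite !mulr_sumr !big_nat; apply: eq_bigr => m /andP[m0 _]; rewrite d0 m0 /= natrM xpM ?ltr0n // /c rmorphM; ring.
  have l d m : lipon (seg (- T) T) (fun z => c d m * (if (0 < d)%N && (0 < m)%N then kappa N D (2%:C + ii * z) * xp (d * m)%:R (2%:C + ii * z) else 0)).
    apply: lipZ => //; case: (_ && _); [exact: lX|exact: lip_cst].
  rewrite (cint_sum _ TT); last by move=> d; exact: lip_sum.
  rewrite !big_nat; apply: eq_bigr => d /andP[d0 _]; rewrite (cint_sum _ TT) // !big_nat; apply: eq_bigr => m /andP[m0 _].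
  by rewrite d0 m0 /= (cintZ _ TT).
have E2 : (tpi * smoothed_sum g N D Q)%:C = \sum_(1 <= d < D.+1) \sum_(1 <= m < Q.+1) c d m * (tpi * wt R N D (d * m))%:C.
  rewrite /smoothed_sum mulr_sumr rmorph_sum; apply: eq_bigr => d _; rewrite !mulr_sumr rmorph_sum; apply: eq_bigr => m _.
  by rewrite /c -rmorphM; congr (_%:C); ring.
rewrite E1 E2 -sumrB; apply: le_trans (cabs_sum _ _ _) _.
set K := 24 * (N + D)%:R ^+ 3 / T.
have K0 : 0 <= K by rewrite /K !mulr_ge0 ?exprn_ge0 ?invr_ge0.
apply: le_trans (_ : \sum_(1 <= d < D.+1) 2 * K * rp d%:R (- (1 + 1)) * 2 <= _).
  rewrite !big_nat; apply: ler_sum => d /andP[d0 _].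
  rewrite -sumrB; apply: le_trans (cabs_sum _ _ _) _.
  apply: le_trans (_ : \sum_(1 <= m < Q.+1) 2 * K * rp d%:R (- (1 + 1)) * rp m%:R (- (1 + 1)) <= _).
    rewrite !big_nat; apply: ler_sum => m /andP[m0 _].
    rewrite -mulrBr cabsM cabs_real normrM.
    have p := perron_wt (_ : 0 < d * m)%N N0 D0 T2; 
    have rm : rp (d * m)%:R (- (1 + 1)) = rp d%:R (- (1 + 1)) * rp m%:R (- (1 + 1)) :> R by rewrite natrM rpM ?ltr0n.
    have dm : (0 < d * m)%N by rewrite muln_gt0 d0.
    have {}p := p dm; rewrite rm -/K in p.
    have h : `|g d| * `|mu R m| <= 2 by rewrite -[leRHS]mulr1; apply: ler_pM; rewrite ?normr_ge0 ?mu_le.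
    apply: le_trans (ler_pM _ (cabs_ge0 _) h p) _; first by rewrite mulr_ge0 ?normr_ge0.
    by apply: le_eqr; ring.
  rewrite -mulr_sumr; apply: ler_wpM2l; first by apply: mulr_ge0; [exact: mulr_ge0|exact: rp_ge0].
  by apply: le_trans (sum_rp1 Q ltr01) _; rewrite invr1; lra.
rewrite -mulr_suml -mulr_sumr.
have h : \sum_(1 <= d < D.+1) rp d%:R (- (1 + 1)) <= 2 :> R by apply: le_trans (sum_rp1 D ltr01) _; rewrite invr1; lra.
have := ler_wpM2l K0 h; move: (\sum_(_ <= _ < _) _) => S hS.
have -> : 192 * (N + D)%:R ^+ 3 / T = 8 * K by rewrite /K; ring.
by move: hS; clear; lra.
Qed.

(** The cut-off vanishes beyond N + D, so [Q] may grow freely; this is how [mu_dpoly Q] is replaced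
    by 1 / zeta in [Vsum_line]. *)
Lemma Vsum_indep g (N D Q : nat) : (N + D <= Q)%N -> smoothed_sum g N D Q = smoothed_sum g N D (N + D).
Proof.
move=> NQ; rewrite /smoothed_sum !big_nat; apply: eq_bigr => d /andP[d0 _]; congr (_ * _).
rewrite (big_cat_nat (n := (N + D).+1)) //= [X in _ + X]big_nat [X in _ + X]big1 ?addr0 // => m /andP[m1 _].
have h : (N + D < d * m)%N by apply: leq_trans m1 _; exact: leq_pmull.
have h1 : (d * m <= N + D)%N = false by rewrite leqNgt h.
have h2 : (d * m <= N)%N = false by rewrite leqNgt (leq_ltn_trans (leq_addr _ _) h).
by rewrite /wt h1 h2 mulr0.
Qed.
End PerronSum.

(** * Shift to the line Re s = 1/2 + 2 de and the dyadic estimate there *)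

Section Shift.
Variable R : realType.
Local Notation C := R[i].
Local Notation ii := (@ii R).
Local Notation tpi := (pi *+ 2 : R).
Implicit Types (s z w : C) (x y sg T : R) (g : nat -> R).

Definition Fker g (N D : nat) s : C := kappa N D s * (dpoly g D s * inv_zeta s).

Lemma cabs_mul3 (u v w : C) : cabs (u * (v * w)) = cabs u * (cabs v * cabs w).
Proof. by rewrite !cabsM. Qed.

Lemma qhol_Fker (grh : GRH R) g (N D : nat) a b T : 1 / 2 < a -> (0 < D)%N -> exists F', qhol (rect a b T) (Fker g N D) F'.
Proof.
move=> a2 D0; have bU := bdd_rect a b T; have a0 : 0 < a by lra.
have [F1 q1] := qhol_kappa N bU a0 D0 (fun z (h : rect a b T z) => let: conj h1 _ := h in proj1 (andP h1)).
have [F2 q2] := qhol_dpoly g D bU.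
have [F3 q3] := qhol_Iz grh b T a2.
by eexists; exact: qholM bU q1 (qholM bU q2 q3).
Qed.

Lemma Vsum_line (grh : GRH R) g (N D : nat) T : (forall n, `|g n| <= 2) -> (0 < N)%N -> (0 < D)%N -> 2 <= T ->
  cabs (vint (Fker g N D) 2 T - (tpi * smoothed_sum g N D (N + D))%:C) <= 192 * (N + D)%:R ^+ 3 / T.
Proof.
move=> g2 N0 D0 T2; have T0 : 0 <= T by lra. have TT : - T <= T by lra.
have bR := bdd_rect 2 2 T; have bS := bdd_seg (- T) T.
have h2 : 1 / 2 < 2 :> R by lra.
have [F' q] := qhol_Fker grh g N 2 T h2 D0.
have lF := lip_VI q.
have [M M0 hM] := lip_bd bS lF.
apply: (@le_add_eps _ _ _ (M * 12 * (T - - T))) => n.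
(* [T] is fixed while [Q] grows; the square makes Q^(-1/2) at most 1 / (n + 1). *)
pose Q := (N + D + n.+1 * n.+1)%N.
have Q0 : (0 < Q)%N by rewrite /Q; lia.
have Q0' : (0 : R) < Q%:R by rewrite ltr0n.
have NQ : (N + D <= Q)%N by rewrite leq_addr.
have P := Vsum_perron Q g2 N0 D0 T2.
rewrite (Vsum_indep g NQ) in P.
have rQ : rp Q%:R (- (1 / 2)) <= n.+1%:R^-1 :> R.
  have n0 : (0 : R) < n.+1%:R by [].
  have -> : n.+1%:R^-1 = rp (n.+1 * n.+1)%:R (- (1 / 2)) :> R.
    by rewrite natrM rpM // -rpD -(rpN1 n0); congr rp; lra.
  by apply: rp_antib; [rewrite ltr0n muln_gt0|rewrite ler_nat leq_addl|lra].
pose G s := kappa N D s * (dpoly g D s * mu_dpoly Q s).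
have [Fk qk] : exists F', qhol (rect 2 2 T) (kappa N D) F'.
  apply: (@qhol_kappa R _ N D 2 bR) => //; by move=> z [/andP[]].
have [Fd qd] := qhol_dpoly g D bR; have [osc_sum qs] := @qhol_Smu R _ Q bR.
have lG : lipon (seg (- T) T) (fun z => G (2%:C + ii * z)) := lip_VI (qholM bR qk (qholM bR qd qs)).
have dist : cabs (vint (Fker g N D) 2 T - vint G 2 T) <= M * 12 * (T - - T) / n.+1%:R.
  rewrite /vint -(cintB TT lF lG).
  have -> : M * 12 * (T - - T) / n.+1%:R = M * (12 / n.+1%:R) * (T - - T) by ring.
  apply: (cint_bound TT (lipB bS lF lG)) => t ht; set s := 2%:C + ii * t%:C.
  have s2 : complex.Re s = 2 by rewrite Re_line.
  have hs := hM t%:C (proj2 (seg_real _ _ _) ht); rewrite -/s in hs.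
  have -> : Fker g N D s - G s = kappa N D s * (dpoly g D s * (inv_zeta s - mu_dpoly Q s)) by rewrite /Fker /G; ring.
  rewrite cabs_mul3; apply: le_trans (_ : cabs (Fker g N D s) * (12 * rp Q%:R (- (1 / 2))) <= _).
    rewrite /Fker cabs_mul3 -!mulrA; apply: ler_wpM2l; first exact: cabs_ge0.
    by apply: ler_wpM2l; [exact: cabs_ge0|exact: inv_zeta_sum].
  by apply: ler_pM => //; [exact: cabs_ge0|rewrite mulr_ge0 ?rp_ge0|apply: ler_wpM2l].
have -> : vint (Fker g N D) 2 T - (tpi * smoothed_sum g N D (N + D))%:C =
  (vint G 2 T - (tpi * smoothed_sum g N D (N + D))%:C) + (vint (Fker g N D) 2 T - vint G 2 T) by ring.
by apply: le_trans (cabsD _ _) _; exact: lerD.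
Qed.

Lemma cabs_dpoly g (D : nat) s : (forall n, `|g n| <= 2) -> 0 <= complex.Re s -> cabs (dpoly g D s) <= 2 * D%:R.
Proof.
move=> g2 s0; apply: le_trans (cabs_sum _ _ _) _.
apply: le_trans (_ : \sum_(1 <= d < D.+1) (2 : R) <= _).
  rewrite !big_nat; apply: ler_sum => d /andP[d0 _].
  rewrite cabsM cabs_real -[leRHS]mulr1; apply: ler_pM; rewrite ?normr_ge0 ?cabs_ge0 ?g2 //.
  by rewrite cabs_xp; apply: rp_le1; [rewrite ler1n|lra].
by rewrite sumr_const_nat subSS subn0 -[leLHS]mulr_natr.
Qed.

Lemma cabs_kappa_top (N D : nat) s T : (0 < N)%N -> (0 < D)%N -> 0 <= complex.Re s -> complex.Re s <= 2 -> 0 < T ->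
  T <= `|complex.Im s| -> cabs (kappa N D s) <= 2 * (N + D)%:R ^+ 3 / T ^+ 2.
Proof.
move=> N0 D0 s0 s2 T0 sT.
have N0' : (1 : R) <= N%:R by rewrite ler1n.
have D0' : (1 : R) <= D%:R by rewrite ler1n.
have ND0 : (1 : R) <= (N + D)%:R by rewrite natrD; lra.
rewrite cabsM cabsV; apply: ler_pM; rewrite ?cabs_ge0 ?invr_ge0 ?cabs_ge0 //.
  have b (k : nat) : (0 < k)%N -> (k <= N + D)%N -> cabs (k%:R * xp k%:R (- s)) <= (N + D)%:R ^+ 3.
    move=> k0 kN; have k0' : (1 : R) <= k%:R by rewrite ler1n.
    have kk : k%:R <= (N + D)%:R :> R by rewrite ler_nat.
    rewrite cabsM cabs_nat cabs_xp ReN opprK exprS; apply: ler_pM; rewrite ?rp_ge0 //.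
    apply: le_trans (_ : rp k%:R 2 <= _); first exact: rp_monoe.
    by rewrite rp2; [apply: lerXn2r; rewrite ?nnegrE; lra|lra].
  apply: le_trans (cabsB _ _) _.
  have := b (N + D)%N; have := b N; rewrite addn_gt0 N0 leq_addr leqnn => /(_ isT isT) h1 /(_ isT isT) h2.
  by move: h1 h2; clear; lra.
have T20 : 0 < T ^+ 2 by exact: exprn_gt0.
have hs : T ^+ 2 <= cabs (D%:R * (s * (s + 1))).
  rewrite !cabsM cabs_nat -[leLHS]mul1r; apply: ler_pM => //; first exact: ltW.
  rewrite expr2; apply: ler_pM; rewrite ?(ltW T0) //; first exact: le_trans sT (cabs_Im _).
  by apply: le_trans (cabs_Im _); rewrite ImD /= addr0.
by rewrite lef_pV2 ?posrE //; exact: lt_le_trans hs.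
Qed.

(** The horizontal sides are O(1 / T): [kappa] is O(T^(-2)) and [inv_zeta] is O(T). As [K] is
    independent of [T], trivial bounds for everything else suffice. *)
Lemma Vsum_shift (grh : GRH R) g (N D : nat) (de : R) : (forall n, `|g n| <= 2) -> (0 < N)%N -> (0 < D)%N ->
  0 < de -> de <= 1 / 8 -> exists K : R, forall T, 2 <= T ->
  tpi * `|smoothed_sum g N D (N + D)| <= cabs (vint (Fker g N D) (1 / 2 + 2 * de) T) + K / T.
Proof.
move=> g2 N0 D0 de0 de1.
have [c c0 hc] := izeta_bound grh de0 de1 (ltr01 : (0 : R) < 1).
pose P3 := (N + D)%:R ^+ 3 : R.
have P30 : 0 <= P3 by rewrite exprn_ge0.
pose M := 2 * P3 * (2 * D%:R) * (2 * c).
have M0 : 0 <= M by rewrite /M !mulr_ge0 // ltW.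
exists (192 * P3 + 4 * M) => T T2.
set sg := 1 / 2 + 2 * de.
have T0 : 0 < T by lra.
have sg2 : sg <= 2 by rewrite /sg; lra.
have sg1 : 1 / 2 < sg by rewrite /sg; lra.
have [F' q] := qhol_Fker grh g N 2 T sg1 D0.
have iT0 : 0 < T^-1 by rewrite invr_gt0.
have h : cabs (vint (Fker g N D) 2 T - vint (Fker g N D) sg T) <= 2 * (M / T) * (2 - sg).
  apply: (contour_shift sg2 (ltW T0) q) => x /andP[x1 x2].
  have b (t : R) : `|t| = T -> cabs (Fker g N D (x%:C + ii * t%:C)) <= M / T.
    move=> tT; set s := x%:C + ii * t%:C.
    have sx : complex.Re s = x by rewrite Re_line.
    have sy : complex.Im s = t by rewrite Im_line.
    have k1 : cabs (kappa N D s) <= 2 * P3 / T ^+ 2.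
      by apply: cabs_kappa_top => //; rewrite ?sx ?sy ?tT //; lra.
    have k2 : cabs (dpoly g D s) <= 2 * D%:R by apply: cabs_dpoly => //; rewrite sx; lra.
    have k3 : cabs (inv_zeta s) <= 2 * c * T.
      apply: le_trans (hc x t _ x2) _; first exact: x1.
      rewrite tT rp1; last by lra.
      by have := ler_wpM2l (ltW c0) T2; lra.
    rewrite /Fker cabs_mul3.
    apply: le_trans (ler_pM (cabs_ge0 _) _ k1 (ler_pM (cabs_ge0 _) (cabs_ge0 _) k2 k3)) _.
      by rewrite mulr_ge0 ?cabs_ge0.
    by rewrite /M; apply: le_eqr; field; rewrite gt_eqF.
  apply: le_trans (cabsB _ _) _.
  have := b T (gtr0_norm T0); have := b (- T); rewrite normrN => /(_ (gtr0_norm T0)).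
  by clear; lra.
have l := Vsum_line grh g2 N0 D0 T2; rewrite -/P3 in l.
have -> : tpi * `|smoothed_sum g N D (N + D)| = cabs ((tpi * smoothed_sum g N D (N + D))%:C).
  by rewrite cabs_real normrM (ger0_norm (tpi_ge0 R)).
set u := vint _ 2 T in h l; set v := vint _ sg T in h *; set a := (tpi * _)%:C in l *.
have -> : a = v + (u - v) - (u - a) by ring.
apply: le_trans (cabsB _ _) _; apply: le_trans (lerD (cabsD _ _) (lexx _)) _.
have MT : 0 <= M / T by rewrite mulr_ge0 // ltW.
have h' : cabs (u - v) <= 4 * (M / T) by apply: le_trans h _; nra.
by move: h' l; clear; lra.
Qed.

(** Interpolation between the exponents 0 and 1: it turns the two bounds for [kappa] into a single
    power of |s|. *)
Lemma min_rp x (th : R) : 0 < x -> 0 <= th -> th <= 1 -> Num.min 1 x <= rp x th.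
Proof.
move=> x0 t0 t1; have [h|h] := leP 1 x.
  by apply: rp_ge1.
by rewrite -{1}(rp1 x0) /rp ler_expR; have := ln_lt0 (_ : 0 < x < 1); rewrite x0 h => /(_ isT) l; nra.
Qed.

Lemma rp_inv x (a : R) : 0 < x -> rp x^-1 a = rp x (- a).
Proof. by move=> x0; rewrite -(rpN1 x0) rprp mulN1r. Qed.

(** The numerator is x^(s + 1) between N and N + D: the mean value estimate ([n1]) cancels the
    length [D] and gives decay 1 / |s|, the trivial estimate ([n2]) keeps (N + D) / D and gives 1 /
    |s|^2. The factor 2 of [n1] is (N + D) / N <= 2. *)
Lemma cabs_kappa (N D : nat) s (th : R) : (0 < D)%N -> (D <= N)%N -> 0 < complex.Re s -> 0 <= th -> th <= 1 ->
  cabs (kappa N D s) <= 2 * rp (N + D)%:R (complex.Re s) * rp ((N + D)%:R / D%:R) th * rp (cabs s) (- (1 + th)).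
Proof.
move=> D0 DN s0 t0 t1; have N0 := leq_trans D0 DN.
have N0' : (0 : R) < N%:R by rewrite ltr0n.
have D0' : (0 : R) < D%:R by rewrite ltr0n.
pose x := (N + D)%:R : R; have x0 : 0 < x by rewrite ltr0n addn_gt0 N0.
have Nx : N%:R <= x by rewrite ler_nat leq_addr.
have cs0 : 0 < cabs s by apply: lt_le_trans s0 (Re_le _).
have cs1 : cabs s <= cabs (s + 1).
  rewrite -(@ler_pXn2r _ 2) ?nnegrE ?cabs_ge0 // !sqr_cabs ReD ImD /= addr0.
  by rewrite lerD2r !expr2; nra.
pose A := rp x (complex.Re s); have A0 : 0 <= A by exact: rp_ge0.
pose num := x%:C * xp x (- s) - N%:R%:C * xp N%:R (- s).
have kE : cabs (kappa N D s) = cabs num / (D%:R * (cabs s * cabs (s + 1))).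
  by rewrite /kappa cabsM cabsV !cabsM cabs_nat /num !rmorph_nat.
have xpE (y : R) : 0 < y -> y%:C * xp y (- s) = xp y (- (s + 1)).
  by move=> y0; rewrite -xpB1 // opprD.
have n1 : cabs num <= cabs (s + 1) * (2 * A * D%:R).
  rewrite /num !xpE //.
  pose l := ln x - ln N%:R.
  have l0 : 0 <= l by rewrite subr_ge0 ler_ln ?posrE.
  have lD : l <= D%:R / N%:R.
    rewrite /l -ln_div ?posrE //.
    have -> : x / N%:R = 1 + D%:R / N%:R by rewrite /x natrD; field; rewrite gt_eqF.
    by apply: le_ln1Dx; apply: lt_le_trans (_ : 0 <= _); [lra|rewrite divr_ge0 // ltW].
  pose w := (s + 1) * l%:C.
  have -> : xp N%:R (- (s + 1)) = xp x (- (s + 1)) * cexp (- w).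
    by rewrite /xp -cexpD /w /l rmorphB; congr cexp; ring.
  have -> : xp x (- (s + 1)) - xp x (- (s + 1)) * cexp (- w) = - (xp x (- (s + 1)) * (cexp (- w) - 1)) by ring.
  rewrite cabsN cabsM cabs_xp ReN opprK ReD /= rpD rp1 // -/A.
  have em : emax (- w) <= 1.
    rewrite ge_max lexx expR_le1 ReN ReM ReD /= mulr0 subr0 oppr_le0 mulr_ge0 //; lra.
  have h1 : cabs (cexp (- w) - 1) <= cabs (s + 1) * (D%:R / N%:R).
    apply: le_trans (cexp_lip _) _; rewrite cabsN cabsM cabs_pos // -[leRHS]mulr1.
    by apply: ler_pM => //; rewrite ?mulr_ge0 ?cabs_ge0 //; [have := emax_ge1 (- w); lra|apply: ler_wpM2l => //; exact: cabs_ge0].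
  apply: le_trans (ler_wpM2l _ h1) _; first by rewrite mulr_ge0 // ltW.
  have x2 : x <= 2 * N%:R.
    have DN' : D%:R <= N%:R :> R by rewrite ler_nat.
    by rewrite /x natrD; clear -DN'; lra.
  have -> : A * x * (cabs (s + 1) * (D%:R / N%:R)) = cabs (s + 1) * (A * D%:R) * (x / N%:R) by ring.
  have -> : cabs (s + 1) * (2 * A * D%:R) = cabs (s + 1) * (A * D%:R) * 2 by ring.
  by apply: ler_wpM2l; [rewrite !mulr_ge0 ?cabs_ge0 // ltW|rewrite ler_pdivrMr].
have n2 : cabs num <= 2 * A * x.
  have b (y : R) : 0 < y -> y <= x -> cabs (y%:C * xp y (- s)) <= A * x.
    move=> y0 yx; rewrite cabsM (cabs_pos (ltW y0)) cabs_xp ReN opprK mulrC.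
    by apply: ler_pM => //; rewrite ?rp_ge0 ?(ltW y0) //; apply: rp_monob => //; exact: ltW.
  apply: le_trans (cabsB _ _) _; have := b x x0 (lexx _); have := b N%:R N0' Nx; clear; lra.
have k1 : cabs (kappa N D s) <= 2 * A / cabs s.
  rewrite kE ler_pdivrMr ?mulr_gt0 //; last exact: lt_le_trans cs1.
  by apply: le_trans n1 _; apply: le_eqr; field; rewrite gt_eqF.
have k2 : cabs (kappa N D s) <= 2 * A / cabs s * (x / D%:R / cabs s).
  rewrite kE ler_pdivrMr ?mulr_gt0 //; last exact: lt_le_trans cs1.
  apply: le_trans n2 _.
  have -> : 2 * A / cabs s * (x / D%:R / cabs s) * (D%:R * (cabs s * cabs (s + 1))) = 2 * A * x * (cabs (s + 1) / cabs s).
    by field; rewrite !gt_eqF.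
  rewrite -[leLHS]mulr1; apply: ler_wpM2l; first by rewrite !mulr_ge0 // ltW.
  by rewrite ler_pdivlMr // mul1r.
have v0 : 0 < x / D%:R / cabs s by rewrite !divr_gt0.
have k3 : cabs (kappa N D s) <= 2 * A / cabs s * Num.min 1 (x / D%:R / cabs s).
  by rewrite minEle; case: ifP; rewrite ?mulr1.
apply: le_trans k3 _; apply: le_trans (ler_wpM2l _ (min_rp v0 t0 t1)) _.
  by rewrite divr_ge0 ?cabs_ge0 // mulr_ge0.
rewrite rpM ?invr_gt0 ?divr_gt0 // (rp_inv _ cs0) -/A opprD rpD (rpN1 cs0); apply: le_eqr; ring.
Qed.

(** Asking for |s| >= T / 2 rather than |t| >= T / 2 covers the central block with [T = 1] as well
    as the blocks T / 2 <= |t| <= T. *)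
Lemma piece (grh : GRH R) (de eta : R) : 0 < de -> de <= 1 / 8 -> 0 < eta -> eta <= 1 / 3 ->
  exists2 c, 0 < c & forall g (q N D : nat) T x y, (forall n, `|g n| <= 2) ->
    (forall n, `|\sum_(1 <= j < n.+1) g j| <= 2 * q%:R) -> (0 < q)%N -> (0 < D)%N -> (D <= N)%N ->
    1 <= T -> - T <= x -> x <= y -> y <= T ->
    (forall t, x <= t <= y -> T / 2 <= cabs ((1 / 2 + 2 * de)%:C + ii * t%:C)) ->
    cabs (cint (fun z => Fker g N D ((1 / 2 + 2 * de)%:C + ii * z)) x y) <=
      c * (q%:R * rp (N + D)%:R (1 / 2 + 2 * de) * rp ((N + D)%:R / D%:R) (3 * eta)) * rp T (- eta).
Proof.
move=> de0 de1 e0 e1; set sg := 1 / 2 + 2 * de.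
have sg1 : 1 / 2 < sg by rewrite /sg; lra.
have sg2 : sg <= 2 by rewrite /sg; lra.
have [c c0 hc] := izeta_bound grh de0 de1 e0.
have eh : eta <= 1 / 2 by lra.
have [b b0 hb] := dpoly_mean sg1 sg2 e0 eh.
exists (24 * c * b) => [|g q N D T x y g2 hG q0 D0 DN T1 hx xy hy ht]; first by rewrite !mulr_gt0.
set A := rp (N + D)%:R sg; set B := rp _ (3 * eta).
have A0 : 0 <= A by exact: rp_ge0. have B0 : 0 <= B by exact: rp_ge0.
have T0 : 0 < T by lra.
have [F' qF] := qhol_Fker grh g N sg T sg1 D0.
have sub z : seg x y z -> seg (- T) T z.
  by move=> /segP[t /andP[t1 t2] ->]; apply/seg_real; lra.
have lF := lip_sub sub (lip_VI qF).
have bS := bdd_seg x y.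
have bR := bdd_rect sg sg T.
have [Fd qd] := qhol_dpoly g D bR.
have lD := lip_abs (lip_sub sub (lip_VI qd)).
(* 4 majorises 2^(1 + 3 eta), lost in |s| >= T / 2, and 3 majorises 3^eta, from 2 + |t| <= 3 T; both
   by [eta <= 1 / 3]. *)
pose K := (2 * A * B * (4 * rp T (- (1 + 3 * eta)))) * (c * (3 * rp T eta)).
have K0 : 0 <= K by rewrite /K !mulr_ge0 ?rp_ge0 // ltW.
apply: le_trans (cint_dom (G := fun z => K%:C * (cabs (dpoly g D (sg%:C + ii * z)))%:C) xy lF (lipZ _ bS lD) _) _.
  move=> t htt; set s := sg%:C + ii * t%:C.
  have st : T / 2 <= cabs s by apply: ht.
  have tT : `|t| <= T by rewrite ler_norml; case/andP: htt; clear -hx hy => *; lra.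
  have k1 : cabs (kappa N D s) <= 2 * A * B * (4 * rp T (- (1 + 3 * eta))).
    have := @cabs_kappa N D s (3 * eta) D0 DN; rewrite Re_line -/A -/B => h.
    apply: le_trans (h _ _ _) _; [clear -sg1; lra|clear -e0; lra|clear -e1; lra|].
    apply: ler_wpM2l; first by rewrite !mulr_ge0.
    have T20 : 0 < T / 2 by clear -T0; lra.
    apply: le_trans (rp_antib T20 st _) _; first by clear -e0; lra.
    rewrite rpM ?invr_gt0 // mulrC; apply: ler_wpM2r; first exact: rp_ge0.
    rewrite rp_inv // opprK; have -> : 4 = 2 ^+ 2 :> R by ring.
    by rewrite -rp2 //; apply: rp_monoe; [rewrite ler1n|clear -e1; lra].
  have k3 : cabs (inv_zeta s) <= c * (3 * rp T eta).
    apply: le_trans (hc sg t (lexx _) sg2) _; apply: ler_wpM2l; first exact: ltW.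
    apply: le_trans (_ : rp (3 * T) eta <= _).
      by apply: rp_monob; [have := normr_ge0 t; clear; lra|clear -tT T1; lra|exact: ltW].
    rewrite rpM //; apply: ler_wpM2r; first exact: rp_ge0.
    have h3 : (0 : R) < 3 by [].
    by rewrite -{2}(rp1 h3); apply: rp_monoe; [rewrite ler1n|clear -e1; lra].
  rewrite /Fker cabs_mul3 -rmorphM /= mulrCA [leRHS]mulrC; apply: ler_wpM2l; first exact: cabs_ge0.
  by apply: ler_pM; rewrite ?cabs_ge0.
rewrite cintZ // ReZ.
apply: le_trans (ler_wpM2l K0 (hb g q D T x y g2 hG q0 D0 T1 hx xy hy)) _.
rewrite /K; have e : rp T (- (1 + 3 * eta)) * rp T eta * rp T (1 + eta) = rp T (- eta).
  by rewrite -!rpD; congr rp; ring.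
by rewrite -e; apply: le_eqr; ring.
Qed.

(* On [[2 ^ k, 2 ^ k.+1]] the kernel contributes [2 ^ (- k (1 + 3 eta))], 1 / zeta
   contributes [2 ^ (k eta)] and the mean of [dpoly] [2 ^ (k (1 + eta))]. *)
Lemma dyadic (grh : GRH R) (de eta : R) : 0 < de -> de <= 1 / 8 -> 0 < eta -> eta <= 1 / 3 ->
  exists2 c, 0 < c & forall g (q N D : nat), (forall n, `|g n| <= 2) ->
    (forall n, `|\sum_(1 <= j < n.+1) g j| <= 2 * q%:R) -> (0 < q)%N -> (0 < D)%N -> (D <= N)%N ->
    `|smoothed_sum g N D (N + D)| <=
      c * (q%:R * rp (N + D)%:R (1 / 2 + 2 * de) * rp ((N + D)%:R / D%:R) (3 * eta)).
Proof.
move=> de0 de1 e0 e1; set sg := 1 / 2 + 2 * de.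
have sg1 : 1 / 2 < sg by rewrite /sg; lra.
have [c c0 hc] := piece grh de0 de1 e0 e1.
have h2 : (0 : R) < 2 by [].
pose r := rp (2 : R) (- eta).
have r0 : 0 < r by exact: rp_gt0.
have r1 : r < 1.
  rewrite /r /rp -[ltRHS]expR0 ltr_expR mulNr oppr_lt0; apply: mulr_gt0 => //.
  by apply: ln_gt0; rewrite ltr1n.
have r1' : 0 < 1 - r by lra.
exists (2 * c / (1 - r)) => [|g q N D g2 hG q0 D0 DN]; first by rewrite divr_gt0 // mulr_gt0.
have N0 : (0 < N)%N by exact: leq_trans DN.
set A := q%:R * _ * _.
have A0 : 0 <= A by rewrite /A !mulr_ge0 ?rp_ge0.
pose F z := Fker g N D (sg%:C + ii * z).
have lF T x y : - T <= x -> y <= T -> lipon (seg x y) F.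
  move=> hx hy; have [F' qF] := qhol_Fker grh g N sg T sg1 D0.
  by apply: lip_sub (lip_VI qF) => z /segP[t /andP[t1 t2] ->]; apply/seg_real; lra.
pose p n : R := 2 ^+ n.
have p1 n : 1 <= p n by apply: exprn_ege1; rewrite ler1n.
have pS n : p n.+1 = 2 * p n by rewrite /p exprS.
have rpp n : rp (p n) (- eta) = r ^+ n.
  by have -> : p n = rp 2 n%:R; [rewrite -[n%:R]mul1r rpX rp1|rewrite rprp mulrC rpX].
have pE n : p n = 2 ^+ n by [].
clearbody p.
have abs_s (t : R) : `|t| <= cabs (sg%:C + ii * t%:C) by apply: le_trans (cabs_Im _); rewrite Im_line.
have geo n : cabs (cint F 0 (p n)) <= c * A * \sum_(0 <= k < n.+1) r ^+ k /\
             cabs (cint F (- p n) 0) <= c * A * \sum_(0 <= k < n.+1) r ^+ k.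
  (* Since Re s > 1/2, the central block |t| <= 1 satisfies the hypothesis of [piece] with
     [T = 1]. *)
  have base t : 1 / 2 <= cabs (sg%:C + ii * t%:C).
    by apply: le_trans (Re_le _); rewrite Re_line; lra.
  elim: n => [|n [IH1 IH2]].
    rewrite big_nat1 expr0 mulr1 pE expr0.
    have b x y : -1 <= x -> x <= y -> y <= 1 -> cabs (cint F x y) <= c * A.
      move=> hx xy hy; have := hc g q N D 1 x y g2 hG q0 D0 DN (lexx _) hx xy hy (fun t _ => base t).
      by rewrite rp_1 mulr1.
    by split; apply: b; clear; lra.
  have Pn := p1 n; have P1 := pS n; have P2 := p1 n.+1.
  rewrite [\sum_(0 <= k < n.+2) _]big_nat_recr //= mulrDr.
  have b x y : - p n.+1 <= x -> x <= y -> y <= p n.+1 -> (forall t, x <= t <= y -> p n <= `|t|) ->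
     cabs (cint F x y) <= c * A * r ^+ n.+1.
    move=> hx xy hy ht; rewrite -rpp.
    apply: (hc g q N D (p n.+1) x y g2 hG q0 D0 DN P2 hx xy hy) => t /ht h.
    by apply: le_trans (abs_s t); rewrite P1 mulrC mulKf.
  split.
    have l0 : 0 <= p n.+1 by clear -P2; lra.
    have ll : lipon (seg 0 (p n.+1)) F by apply: (lF (p n.+1)); clear -P2; lra.
    (* As [p n.+1 / 2 = p n], cutting in the middle detaches exactly the block from [p n] to
       [p n.+1]. *)
    have := cint_split l0 ll; rewrite /= add0r.
    have -> : p n.+1 / 2 = p n by rewrite P1 mulrC mulKf.
    move=> ->; apply: le_trans (cabsD _ _) _; apply: lerD => //.
    apply: b; [clear -Pn P1; lra|clear -Pn P1; lra|clear -Pn P1; lra|] => t /andP[t1 _].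
    by apply: le_trans t1 (ler_norm _).
  have l0 : - p n.+1 <= 0 by clear -P2; lra.
  have ll : lipon (seg (- p n.+1) 0) F by apply: (lF (p n.+1)); clear -P2; lra.
  have := cint_split l0 ll; rewrite /= addr0.
  have -> : - p n.+1 / 2 = - p n by rewrite P1; field.
  move=> ->; rewrite addrC; apply: le_trans (cabsD _ _) _; apply: lerD => //.
  apply: b; [clear -Pn P1; lra|clear -Pn P1; lra|clear -Pn P1; lra|] => t /andP[_ t1].
  by rewrite -normrN; apply: le_trans (ler_norm _); clear -t1; lra.
have gsum n : \sum_(0 <= k < n.+1) r ^+ k <= (1 - r)^-1.
  rewrite -[leRHS]mul1r ler_pdivlMr // mulrC.
  have -> : (1 - r) * \sum_(0 <= k < n.+1) r ^+ k = 1 - r ^+ n.+1.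
    elim: n => [|n IH]; first by rewrite big_nat1 expr0 mulr1 expr1.
    by rewrite big_nat_recr //= mulrDr IH !exprS; ring.
  by have := exprn_ge0 n.+1 (ltW r0); lra.
have cA0 : 0 <= c * A by rewrite mulr_ge0 // ltW.
have vb n : cabs (vint (Fker g N D) sg (p n)) <= 2 * c / (1 - r) * A.
  have Pn := p1 n.
  have l0 : - p n <= p n by clear -Pn; lra.
  have ll : lipon (seg (- p n) (p n)) F by apply: (lF (p n)); clear; lra.
  rewrite /vint -/F; have := cint_split l0 ll; rewrite /= addNr mul0r => ->.
  apply: le_trans (cabsD _ _) _; have [g1 g2'] := geo n.
  have := ler_wpM2l cA0 (gsum n) => h.
  have -> : 2 * c / (1 - r) * A = c * A * (1 - r)^-1 + c * A * (1 - r)^-1 by ring.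
  by apply: lerD; [exact: le_trans g2' h|exact: le_trans g1 h].
have [K hK] := Vsum_shift grh g2 N0 D0 de0 de1.
have tp : 1 <= tpi by have := pi_ge2 R; rewrite mulr2n; lra.
apply: le_trans (_ : tpi * `|smoothed_sum g N D (N + D)| <= _).
  by rewrite -[leLHS]mul1r; apply: ler_wpM2r.
(* The bound [vb] is uniform in the height [T = 2 ^ n.+1]; only [K / T] depends on it, and it
   disappears in the limit. *)
apply: (@le_add_geo _ _ _ `|K|) => n.
have T2 : 2 <= p n.+1 by rewrite pS; have := p1 n; lra.
apply: le_trans (hK _ T2) _; apply: lerD; first exact: vb.
apply: le_trans (_ : `|K| / p n.+1 <= _).
  by apply: ler_wpM2r; [rewrite invr_ge0; lra|exact: ler_norm].
apply: ler_wpM2l => //; rewrite lef_pV2 ?posrE; [|lra|exact: exprn_gt0].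
by rewrite pS -pE; have := p1 n; clear; lra.
Qed.
End Shift.

(** * Choice of the parameters and conclusion *)

Lemma nat_sqrt (N : nat) : exists D, (D * D <= N)%N /\ (N < D.+1 * D.+1)%N.
Proof.
elim: N => [|N [D [h1 h2]]]; first by exists 0%N.
have [h|h] := ltnP N.+1 (D.+1 * D.+1); first by exists D; split=> //; exact: leq_trans (leqnSn N).
exists D.+1; split => //; apply: leq_ltn_trans h2 _.
by rewrite ltn_mul.
Qed.

Lemma powR_rp (R : realType) (x a : R) : 0 < x -> x `^ a = rp x a.
Proof. by move=> x0; rewrite /powR gt_eqF. Qed.

Theorem theorem3 (R : realType) (grh : GRH R) :
  forall eps : R, 0 < eps ->
  exists C : R, 0 < C /\
    forall a1 a2 : nat, (1 < a1)%N -> (a1 < a2)%N -> coprime a1 a2 ->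
    forall N : nat, (0 < N)%N ->
      `| \sum_(1 <= n < N.+1) Eerr R a1 a2 n |
        <= C * (a1%:R * a2%:R * N%:R `^ (2^-1 + eps)).
Proof.
(* The cap keeps [e / 8], taken below for both [de] and [eta], within the ranges 1/8 and 1/3 of
   [dyadic]; a smaller exponent is harmless since N >= 1. *)
move=> eps eps0; pose e := Num.min eps (1 / 4).
have e0 : 0 < e by rewrite lt_min eps0; lra.
have e4 : e <= 1 / 4 by rewrite ge_min lexx orbT.
have ee : e <= eps by rewrite ge_min lexx.
have de0 : 0 < e / 8 by lra.
have de1 : e / 8 <= 1 / 8 by lra.
have et1 : e / 8 <= 1 / 3 by lra.
have [c c0 hc] := dyadic grh de0 de1 de0 et1.
have ei : 0 < e^-1 by rewrite invr_gt0.
(* 9 = 4 + 4 + 1: the hyperbola error [b1], the constant part of the smoothing error [b7], and the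
   mean [k]. The rest of [b7] gives 2 / e, and [b6] gives 16 c. *)
exists (9 + 2 * e^-1 + 16 * c); split => [|a1 a2 a1g a12 cop N N0]; first by lra.
have a10 : (0 < a1)%N by exact: ltnW.
have a20 : (0 < a2)%N by exact: ltn_trans a12.
have N0' : (0 : R) < N%:R by rewrite ltr0n.
have N1 : (1 : R) <= N%:R by rewrite ler1n.
rewrite -natrM powR_rp //; pose q := (a1 * a2)%N; rewrite -/q.
have q0 : (0 < q)%N by rewrite muln_gt0 a10.
have q1 : (1 : R) <= q%:R by rewrite ler1n.
have [k [k1 g2 hG]] := mean_zero q0 (fun d => gfun_per R d a10 a20 cop) (fun d => gfun_le R d a10 cop).
pose g d := gfun R a1 a2 d - k.
have [D [DN ND]] := nat_sqrt N.
have D0 : (0 < D)%N by case: (D) ND => //; rewrite ltnNge N0.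
have DN' : (D <= N)%N by apply: leq_trans DN; exact: leq_pmull.
have D0' : (0 : R) < D%:R by rewrite ltr0n.
have ND2 : (N + D)%:R <= 2 * N%:R :> R by rewrite -natrM ler_nat mul2n -addnn leq_add2l.
(* By [sum_Mmu], removing the mean [k] from [gfun] changes the sum by [k] alone. *)
have -> : \sum_(1 <= n < N.+1) Eerr R a1 a2 n = \sum_(1 <= d < N.+1) g d * Mmu R (N %/ d) + k.
  rewrite sum_Eerr -[X in _ + X]mulr1 -(sum_Mmu R N0) mulr_sumr -big_split /=; apply: eq_bigr => d _.
  by rewrite /g; ring.
pose X := rp (N%:R : R) (1 / 2); have X0 : 0 < X by exact: rp_gt0.
have XX : X * X = N%:R by rewrite -rpD (_ : 1 / 2 + 1 / 2 = 1) ?rp1 //; lra.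
have DX : D%:R <= X.
  by rewrite -(@ler_pXn2r _ 2) ?nnegrE ?(ltW X0) ?(ltW D0') // !expr2 XX -natrM ler_nat.
have XD : X <= 2 * D%:R.
  rewrite -(@ler_pXn2r _ 2) ?nnegrE ?mulr_ge0 ?(ltW X0) ?(ltW D0') // !expr2 XX -!natrM ler_nat.
  by apply: leq_trans (ltnW ND) _; apply: leq_mul; rewrite mul2n -addnn -addn1 leq_add2l.
pose Z := rp (N%:R : R) (2^-1 + eps).
have mono a b : a <= b -> rp (N%:R : R) a <= rp N%:R b by exact: rp_monoe.
have XZ : X <= Z by apply: mono; lra.
have Z1 : 1 <= Z by apply: rp_ge1 => //; lra.
have b1 : 4 * q%:R * D%:R <= 4 * (q%:R * Z).
  by rewrite -mulrA; apply: ler_wpM2l => //; apply: ler_wpM2l => //; exact: le_trans XZ.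
have b2 : D%:R * rp D%:R e <= Z.
  apply: le_trans (_ : X * rp N%:R e <= _).
    apply: ler_pM; rewrite ?rp_ge0 //; apply: rp_monob; rewrite ?ler_nat //; exact: ltW.
  by rewrite -rpD; apply: mono; lra.
have b3 : rp (N + D)%:R (1 / 2 + 2 * (e / 8)) <= 4 * rp N%:R (1 / 2 + 2 * (e / 8)) :> R.
  apply: le_trans (_ : rp (2 * N%:R) (1 / 2 + 2 * (e / 8)) <= _).
    apply: rp_monob; [by rewrite ltr0n addn_gt0 N0| |lra].
    exact: ND2.
  rewrite rpM //; apply: ler_wpM2r; first exact: rp_ge0.
  have -> : 4 = 2 ^+ 2 :> R by ring.
  by rewrite -rp2 //; apply: rp_monoe; lra.
have b4 : rp ((N + D)%:R / D%:R) (3 * (e / 8)) <= 4 * rp N%:R (1 / 2 * (3 * (e / 8))) :> R.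
  apply: le_trans (_ : rp (4 * X) (3 * (e / 8)) <= _).
    apply: rp_monob; [by rewrite divr_gt0 // ltr0n addn_gt0 N0| |lra].
    rewrite ler_pdivrMr //; apply: le_trans (_ : 2 * N%:R <= _).
      exact: ND2.
    by rewrite -XX; have := ler_wpM2l (ltW X0) XD; lra.
  have h4 : (0 : R) < 4 by [].
  rewrite rpM // rprp; apply: ler_wpM2r; first exact: rp_ge0.
  by rewrite -{2}(rp1 h4); apply: rp_monoe; lra.
have b5 : rp (N + D)%:R (1 / 2 + 2 * (e / 8)) * rp ((N + D)%:R / D%:R) (3 * (e / 8)) <= 16 * Z.
  apply: le_trans (ler_pM (rp_ge0 _ _) (rp_ge0 _ _) b3 b4) _.
  rewrite mulrACA -rpD; have -> : 4 * 4 = 16 :> R by ring.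
  (* The exponents add up to 1/2 + e/4 + 3e/16, below 1/2 + eps. *)
  by apply: ler_wpM2l => //; apply: mono; lra.
have b6 : `|smoothed_sum g N D (N + D)| <= 16 * c * (q%:R * Z).
  apply: le_trans (hc g q N D g2 hG q0 D0 DN') _; rewrite -mulrA; apply: le_trans (ler_wpM2l (ltW c0) (ler_wpM2l (ler0n _ q) b5)) _.
  by apply: le_eqr; ring.
have qZ : Z <= q%:R * Z by rewrite ler_peMl //; lra.
have b7 : 2 * D%:R * ((1 + e^-1) * rp D%:R e + 1) <= (4 + 2 * e^-1) * (q%:R * Z).
  have -> : 2 * D%:R * ((1 + e^-1) * rp D%:R e + 1) = 2 * (1 + e^-1) * (D%:R * rp D%:R e) + 2 * D%:R by ring.
  have e1 : 0 <= 2 * (1 + e^-1) by lra.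
  have := ler_wpM2l e1 (le_trans b2 qZ); have := le_trans DX (le_trans XZ qZ).
  by clear; lra.
apply: le_trans (ler_normD _ _) _; rewrite -/Z.
apply: le_trans (lerD (le_trans (reduction e0 g2 hG D0 ND DN' (leqnn (N + D))) (lerD (lerD b1 b7) b6)) k1) _.
by move: Z1 qZ; clear; lra.
Qed.
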